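(* Let $M$ be a compact smooth real manifold, $\mathfrak{Z}(M)$ a distribution of complex vector fields on $M$, $E\xrightarrow{\pi}M$ a smooth complex vector bundle of finite rank and $\nabla$ a $\mathbb{C}$-linear connection on $E$. Assume that $\mathfrak{Z}(M)$ is subelliptic at all points $p\in M$. Then: (1) The space $\mathcal{O}_{\mathfrak{Z}}(M)=\{\sigma\in\mathcal{C}^\infty(M,E)\mid\nabla_Z(\sigma)=0\ \forall Z\in\mathfrak{Z}(M)\}$ is finite dimensional. (2) The map $\mathcal{C}^\infty(M,E)\times\mathfrak{Z}(M)\ni(\sigma,Z)\mapsto(\nabla_Z(\sigma),Z)\in\mathcal{C}^\infty(M,E)\times\mathfrak{Z}(M)$ has closed range, in the following sense: if $\{\sigma_\nu\}$ is a sequence in $\mathcal{C}^\infty(M,E)$ and for each $Z\in\mathfrak{Z}(M)$ there is $f_Z\in\mathcal{C}^\infty(M,E)$ such that $\nabla_Z(\sigma_\nu)$ converges uniformly to $f_Z$ in $M$, then there exists a section $\sigma\in\mathcal{C}^\infty(M,E)$ with $\nabla_Z(\sigma)=f_Z$ for all $Z\in\mathfrak{Z}(M)$.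
   Context: $\mathcal{C}^\infty(M)$ denotes complex valued smooth functions, $\mathcal{C}^\infty_0(U)$ those with compact support in the open set $U$, $\mathfrak{X}^{\mathbb{C}}(M)$ the smooth complex vector fields. A distribution of complex vector fields is a $\mathcal{C}^\infty(M)$-submodule $\mathfrak{Z}(M)\subset\mathfrak{X}^{\mathbb{C}}(M)$ (rank not necessarily constant). $\|\cdot\|_s$ is the Sobolev norm of order $s$ and $\|\cdot\|_0$ the $L^2$ norm with respect to a Riemannian metric on $M$. $\mathfrak{Z}(M)$ is subelliptic at $p$ if there are an open neighborhood $U$ of $p$, constants $\epsilon>0$, $C>0$ and $L_1,\dots,L_n\in\mathfrak{Z}(M)$ with $\|u\|_\epsilon^2\le C(\|u\|_0^2+\sum_{j=1}^n\|L_j(u)\|_0^2)$ for all $u\in\mathcal{C}^\infty_0(U)$. For a complex vector field $Z$, $\nabla_Z=\nabla_{\mathrm{Re}Z}+i\nabla_{\mathrm{Im}Z}$ acts on smooth sections of $E$. *)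

(* Defs.v *)
From HB Require Import structures.
From mathcomp Require Import all_boot all_order all_algebra.
From mathcomp Require Import complex.
From mathcomp Require Import all_classical all_reals all_analysis.
Set Implicit Arguments.
Unset Strict Implicit.
Unset Printing Implicit Defensive.
Import Order.TTheory GRing.Theory Num.Theory.
Import numFieldNormedType.Exports.
Local Open Scope classical_set_scope.
Local Open Scope ring_scope.
Local Open Scope complex_scope.

(** * Calculus on R^n *)

Definition partial (R : realType) (n : nat) (a : 'I_n)
    (f : 'rV[R]_n -> R) (y : 'rV[R]_n) : R :=
  'D_(delta_mx 0 a) f y.

(* [Ck k W f] is only meaningful for [W] open. *)
Fixpoint Ck (R : realType) (n k : nat) (W : set 'rV[R]_n)
    (f : 'rV[R]_n -> R) : Prop :=
  (forall y, W y -> {for y, continuous f}) /\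
  (if k is k'.+1 then
     forall a : 'I_n, (forall y, W y -> derivable f y (delta_mx 0 a)) /\
                      Ck k' W (partial a f)
   else True).

Definition Cinfty (R : realType) (n : nat) (W : set 'rV[R]_n)
    (f : 'rV[R]_n -> R) : Prop :=
  forall k, Ck k W f.

Definition cpartial (R : realType) (n : nat) (a : 'I_n)
    (f : 'rV[R]_n -> R[i]) (y : 'rV[R]_n) : R[i] :=
  partial a (fun z => complex.Re (f z)) y
    +i* partial a (fun z => complex.Im (f z)) y.

(* Lebesgue integral over R^n as an iterated one-dimensional integral. It is
   only applied below to functions that are Borel and either nonnegative or
   integrable with integrable slices, where Tonelli and Fubini identify it with
   the integral against n-dimensional Lebesgue measure. *)
Fixpoint iint (R : realType) (n : nat) : ('rV[R]_n -> \bar R) -> \bar R :=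
  match n return ('rV[R]_n -> \bar R) -> \bar R with
  | 0 => fun f => f 0
  | n'.+1 => fun f =>
      (\int[lebesgue_measure]_(t in [set: R])
         iint (fun v : 'rV[R]_n' => f (row_mx (t%:M : 'rV[R]_1) v)))%E
  end.

Definition ciint (R : realType) (n : nat) (f : 'rV[R]_n -> R[i]) : R[i] :=
  fine (iint (fun y => (complex.Re (f y))%:E))
    +i* fine (iint (fun y => (complex.Im (f y))%:E)).

Definition csq (R : realType) (z : R[i]) : R :=
  complex.Re z ^+ 2 + complex.Im z ^+ 2.

Definition dotp (R : realType) (n : nat) (x y : 'rV[R]_n) : R :=
  \sum_(a < n) x 0 a * y 0 a.

Definition fourier (R : realType) (n : nat) (f : 'rV[R]_n -> R[i])
    (xi : 'rV[R]_n) : R[i] :=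
  ((Num.sqrt (2 * pi)) ^- n)%:C *
    ciint (fun y => f y * (cos (dotp y xi) -i* sin (dotp y xi))).

(* the squared norm of H^s(R^n) *)
Definition hs_sq (R : realType) (n : nat) (s : R) (f : 'rV[R]_n -> R[i])
    : \bar R :=
  iint (fun xi => ((1 + dotp xi xi) `^ s * csq (fourier f xi))%:E).

(** * Smooth manifolds *)

Record chart (R : realType) (n : nat) (M : topologicalType) := Chart {
  src : set M;
  tgt : set 'rV[R]_n;
  to : M -> 'rV[R]_n;
  inv : 'rV[R]_n -> M;
  src_open : open src;
  tgt_open : open tgt;
  to_tgt : forall x, src x -> tgt (to x);
  inv_src : forall y, tgt y -> src (inv y);
  toK : forall x, src x -> inv (to x) = x;
  invK : forall y, tgt y -> to (inv y) = y;
  to_continuous : forall x, src x -> {for x, continuous to};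
  inv_continuous : forall y, tgt y -> {for y, continuous inv}
}.

(* A smooth structure of dimension n on M, given by an atlas that need not be
   maximal. Second countability is not required: it follows from compactness,
   and M is always assumed compact below. [at_pt x] is a preferred chart around
   x, whose only role is to identify the tangent space of M at x with R^n. *)
Record manifold (R : realType) (n : nat) (M : topologicalType) := Manifold {
  idx : Type;
  ch : idx -> chart R n M;
  at_pt : M -> idx;
  at_ptP : forall x, src (ch (at_pt x)) x;
  transition_smooth : forall (i j : idx) (b : 'I_n),
    Cinfty (tgt (ch i) `&` inv (ch i) @^-1` src (ch j))
           (fun y => to (ch j) (inv (ch i) y) 0 b);
  manifold_hausdorff : hausdorff_space M
}.

Definition rsmooth_on (R : realType) (n : nat) (M : topologicalType)
    (A : manifold R n M) (U : set M) (f : M -> R) : Prop :=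
  forall i : idx A,
    Cinfty (tgt (ch i) `&` inv (ch i) @^-1` U) (f \o inv (ch i)).

Definition csmooth_on (R : realType) (n : nat) (M : topologicalType)
    (A : manifold R n M) (U : set M) (f : M -> R[i]) : Prop :=
  rsmooth_on A U (fun x => complex.Re (f x)) /\
  rsmooth_on A U (fun x => complex.Im (f x)).

Definition tsupport (M : topologicalType) (V : zmodType) (f : M -> V)
    : set M :=
  closure [set x | f x != 0].

(* C^oo_0(U) *)
Definition test_function (R : realType) (n : nat) (M : topologicalType)
    (A : manifold R n M) (U : set M) (u : M -> R[i]) : Prop :=
  [/\ csmooth_on A setT u, compact (tsupport u) & tsupport u `<=` U].

(* Row a holds the components in chart j of the a-th coordinate field of
   chart i: a tangent vector at x with components v in chart i has components
   [v *m jac A i j x] in chart j. *)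
Definition jac (R : realType) (n : nat) (M : topologicalType)
    (A : manifold R n M) (i j : idx A) (x : M) : 'M[R]_n :=
  \matrix_(a, b) partial a (fun y => to (ch j) (inv (ch i) y) 0 b)
                           (to (ch i) x).

(** * Vector fields and distributions *)

(* A vector field is given at x by its components in the preferred chart
   around x; it is smooth when its components in every chart are. *)
Definition rvf (R : realType) (n : nat) (M : topologicalType) :=
  M -> 'rV[R]_n.
Definition cvf (R : realType) (n : nat) (M : topologicalType) :=
  M -> 'rV[R[i]]_n.

Definition rvf_smooth (R : realType) (n : nat) (M : topologicalType)
    (A : manifold R n M) (X : rvf R n M) : Prop :=
  forall (i : idx A) (b : 'I_n),
    rsmooth_on A (src (ch i)) (fun x => (X x *m jac (at_pt A x) i x) 0 b).

Definition re_vf (R : realType) (n : nat) (M : topologicalType)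
    (Z : cvf R n M) : rvf R n M := fun x => map_mx (@complex.Re R) (Z x).
Definition im_vf (R : realType) (n : nat) (M : topologicalType)
    (Z : cvf R n M) : rvf R n M := fun x => map_mx (@complex.Im R) (Z x).
Definition of_rvf (R : realType) (n : nat) (M : topologicalType)
    (X : rvf R n M) : cvf R n M := fun x => map_mx (fun t => t%:C) (X x).

Definition cvf_smooth (R : realType) (n : nat) (M : topologicalType)
    (A : manifold R n M) (Z : cvf R n M) : Prop :=
  rvf_smooth A (re_vf Z) /\ rvf_smooth A (im_vf Z).

Definition vf_app (R : realType) (n : nat) (M : topologicalType)
    (A : manifold R n M) (Z : cvf R n M) (u : M -> R[i]) : M -> R[i] :=
  fun x => let c := ch (at_pt A x) in
    \sum_(a < n) Z x 0 a * cpartial a (u \o inv c) (to c x).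

Record cvf_distribution (R : realType) (n : nat) (M : topologicalType)
    (A : manifold R n M) := CvfDistribution {
  dist_set :> cvf R n M -> Prop;
  dist_smooth : forall Z, dist_set Z -> cvf_smooth A Z;
  dist0 : dist_set (fun=> 0);
  distD : forall Y Z, dist_set Y -> dist_set Z ->
    dist_set (fun x => Y x + Z x);
  distZ : forall (f : M -> R[i]) Z, csmooth_on A setT f -> dist_set Z ->
    dist_set (fun x => f x *: Z x)
}.

(** * L^2 and Sobolev norms, subellipticity *)

Definition metric_coef (R : realType) (n : nat) (M : topologicalType)
    (A : manifold R n M) (g : M -> 'M[R]_n) (i : idx A) (x : M) : 'M[R]_n :=
  let J := jac i (at_pt A x) x in J *m g x *m J^T.

Record riemannian_metric (R : realType) (n : nat) (M : topologicalType)
    (A : manifold R n M) := RiemannianMetric {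
  rmetric :> M -> 'M[R]_n;
  rmetric_sym : forall x, (rmetric x)^T = rmetric x;
  rmetric_pos : forall x (v : 'rV[R]_n), v != 0 ->
    0 < (v *m rmetric x *m v^T) 0 0;
  rmetric_smooth : forall (i : idx A) (a b : 'I_n),
    rsmooth_on A (src (ch i)) (fun x => metric_coef rmetric i x a b)
}.

(* finite partition of unity whose k-th member is supported in the domain of
   the chart [pou_chart k] *)
Record partition_of_unity (R : realType) (n : nat) (M : topologicalType)
    (A : manifold R n M) := PartitionOfUnity {
  pou_size : nat;
  pou_chart : 'I_pou_size -> idx A;
  pou :> 'I_pou_size -> M -> R;
  pou_smooth : forall k, rsmooth_on A setT (pou k);
  pou_ge0 : forall k x, 0 <= pou k x;
  pou_sum : forall x, \sum_(k < pou_size) pou k x = 1;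
  pou_supp : forall k, tsupport (pou k) `<=` src (ch (pou_chart k))
}.

Definition push (R : realType) (n : nat) (M : topologicalType) (V : zmodType)
    (c : chart R n M) (f : M -> V) : 'rV[R]_n -> V :=
  patch (fun=> 0) (tgt c) (f \o inv c).

(* integral against the Riemannian volume measure *)
Definition mint (R : realType) (n : nat) (M : topologicalType)
    (A : manifold R n M) (g : riemannian_metric A) (P : partition_of_unity A)
    (f : M -> R) : \bar R :=
  (\sum_(k < pou_size P)
     let i := pou_chart k in
     iint (fun y => (push (ch i) (fun x =>
       P k x * f x * Num.sqrt (\det (metric_coef g i x))) y)%:E))%E.

Definition l2_sq (R : realType) (n : nat) (M : topologicalType)
    (A : manifold R n M) (g : riemannian_metric A) (P : partition_of_unity A)
    (u : M -> R[i]) : \bar R :=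
  mint g P (fun x => csq (u x)).

Definition sobolev_sq (R : realType) (n : nat) (M : topologicalType)
    (A : manifold R n M) (P : partition_of_unity A) (s : R) (u : M -> R[i])
    : \bar R :=
  (\sum_(k < pou_size P)
     hs_sq s (push (ch (pou_chart k)) (fun x => (P k x)%:C * u x)%R))%E.

Definition subelliptic_at (R : realType) (n : nat) (M : topologicalType)
    (A : manifold R n M) (g : riemannian_metric A) (P : partition_of_unity A)
    (D : cvf_distribution A) (p : M) : Prop :=
  exists (U : set M) (eps C : R) (m : nat) (L : 'I_m -> cvf R n M),
    [/\ open U /\ U p, 0 < eps, 0 < C, (forall j, D (L j)) &
        forall u, test_function A U u ->
          (sobolev_sq P eps u <=
             C%:E * (l2_sq g P u + \sum_(j < m) l2_sq g P (vf_app A (L j) u)))%E].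

(** * Vector bundles and connections *)

(* A smooth complex vector bundle of rank r, as a family of complex vector
   spaces with local trivializations whose transition maps are smooth. *)
Record vbundle (R : realType) (n : nat) (M : topologicalType)
    (A : manifold R n M) (r : nat) := VBundle {
  fiber :> M -> lmodType R[i];
  tidx : Type;
  tdom : tidx -> set M;
  triv : forall (i : tidx) (x : M), fiber x -> 'rV[R[i]]_r;
  tdom_open : forall i, open (tdom i);
  tdom_cover : forall x, exists i, tdom i x;
  triv_linear : forall i x, tdom i x -> linear (triv i (x := x));
  triv_bij : forall i x, tdom i x -> bijective (triv i (x := x));
  triv_smooth : forall i j, exists T : M -> 'M[R[i]]_r,
    (forall a b, csmooth_on A (tdom i `&` tdom j) (fun x => T x a b)) /\
    (forall x, tdom i x -> tdom j x ->
       forall v : fiber x, triv j v = triv i v *m T x)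
}.

Definition section (R : realType) (n : nat) (M : topologicalType)
    (A : manifold R n M) (r : nat) (E : vbundle A r) := forall x : M, E x.

Definition section_smooth (R : realType) (n : nat) (M : topologicalType)
    (A : manifold R n M) (r : nat) (E : vbundle A r) (s : section E) : Prop :=
  forall (i : tidx E) (b : 'I_r),
    csmooth_on A (tdom i) (fun x => triv i (s x) 0 b).

(* The values of [nab] on non-smooth arguments are irrelevant. *)
Record connection (R : realType) (n : nat) (M : topologicalType)
    (A : manifold R n M) (r : nat) (E : vbundle A r) := Connection {
  nab :> rvf R n M -> section E -> section E;
  nab_smooth : forall X s, rvf_smooth A X -> section_smooth s ->
    section_smooth (nab X s);
  nab_addl : forall X Y s, rvf_smooth A X -> rvf_smooth A Y ->
    section_smooth s -> forall x,
    nab (fun z => X z + Y z) s x = nab X s x + nab Y s x;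
  nab_scalel : forall (f : M -> R) X s, rsmooth_on A setT f ->
    rvf_smooth A X -> section_smooth s -> forall x,
    nab (fun z => f z *: X z) s x = (f x)%:C *: nab X s x;
  nab_linear : forall (c : R[i]) X s t, rvf_smooth A X ->
    section_smooth s -> section_smooth t -> forall x,
    nab X (fun z => c *: s z + t z) x = c *: nab X s x + nab X t x;
  nab_leibniz : forall (f : M -> R[i]) X s, csmooth_on A setT f ->
    rvf_smooth A X -> section_smooth s -> forall x,
    nab X (fun z => f z *: s z) x =
      vf_app A (of_rvf X) f x *: s x + f x *: nab X s x
}.

Definition cnab (R : realType) (n : nat) (M : topologicalType)
    (A : manifold R n M) (r : nat) (E : vbundle A r) (nabla : connection E)
    (Z : cvf R n M) (s : section E) : section E :=
  fun x => nabla (re_vf Z) s x + (0 +i* 1) *: nabla (im_vf Z) s x.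

Definition parallel_sections (R : realType) (n : nat) (M : topologicalType)
    (A : manifold R n M) (r : nat) (E : vbundle A r) (nabla : connection E)
    (D : cvf_distribution A) : set (section E) :=
  [set s | section_smooth s /\ forall Z, D Z -> forall x, cnab nabla Z s x = 0].

Definition finite_dimensional (R : realType) (n : nat) (M : topologicalType)
    (A : manifold R n M) (r : nat) (E : vbundle A r)
    (S : set (section E)) : Prop :=
  exists (d : nat) (e : 'I_d -> section E), (forall k, S (e k)) /\
    forall s, S s -> exists c : 'I_d -> R[i],
      forall x, s x = \sum_(k < d) c k *: e k x.

Record hermitian_metric (R : realType) (n : nat) (M : topologicalType)
    (A : manifold R n M) (r : nat) (E : vbundle A r) := HermitianMetric {
  hform :> forall x : M, E x -> E x -> R[i];
  hform_linear : forall x (c : R[i]) (u v w : E x),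
    hform (c *: u + v) w = c * hform u w + hform v w;
  hform_conj : forall x (u v : E x), hform v u = conjc (hform u v);
  hform_pos : forall x (v : E x), v != 0 -> 0 < hform v v;
  hform_smooth : forall s t : section E, section_smooth s ->
    section_smooth t -> csmooth_on A setT (fun x => hform (s x) (t x))
}.

(* On a compact manifold this does not depend on the choice of h. *)
Definition uniform_cvg (R : realType) (n : nat) (M : topologicalType)
    (A : manifold R n M) (r : nat) (E : vbundle A r) (h : hermitian_metric E)
    (s : nat -> section E) (f : section E) : Prop :=
  forall e : R, 0 < e -> exists N : nat, forall nu : nat, (N <= nu)%N ->
    forall x, Num.sqrt (complex.Re (h x (s nu x - f x) (s nu x - f x))) < e.

(* Main.v *)
Require Import Defs.
From mathcomp Require Import all_boot all_order all_algebra.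
From mathcomp Require Import complex.
From mathcomp Require Import all_classical all_reals all_analysis.
From mathcomp Require Import ring lra.
Set Implicit Arguments.
Unset Strict Implicit.
Unset Printing Implicit Defensive.
Import Order.TTheory GRing.Theory Num.Theory.
Import numFieldNormedType.Exports.
Local Open Scope classical_set_scope.
Local Open Scope ring_scope.

(* Read through the Fourier transform in a coordinate ball, subellipticity says that a test vector v
   differs from its mollification at scale 2^-k by O(lam^k) (|v| + |Lv|), with lam < 1. This replaces
   Sobolev spaces. It makes an L^2-bounded weak solution T of the local system smooth: the decay of T
   against mean zero mollifiers improves by the factor lam at each step, and the derivatives of T solve
   a system of the same kind. It also bounds the L^2 norm of a parallel section by finitely many
   functionals, whence (1). For (2), subtract from sigma_nu its projection to the parallel sections.
   If the L^2 norms stay bounded along an ultrafilter, the weak limit is smooth, it solves the system,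
   and the convergence is strong in L^2; if not, normalising produces a parallel section of norm one
   with zero projection, a contradiction. *)

(** All integrals below are of continuous functions with compact support, and L^2 objects appear
    only as functionals on test functions. Where identities would cost integrability or Jacobians,
    inequalities serve: Plancherel is a lower bound tested against a compactly supported frequency
    cut-off, and a change of variables holds up to a constant. The obstacle in the regularity step
    is that the estimate speaks of test vectors and of their derivatives, whereas T is no function.
    It is applied to mean zero mollifications of T, whose images under the operator are again made
    of such mollifications, up to O(2^-k). To return to T one needs approximations whose increments
    are (1 - A) v + (1 - A') v with v such a mollification, A and A' being the averages at two
    consecutive scales: [1 - (1 - A)^2] has this property, A has not. The errors O(2^-k) keep the
    rate mu above 1/2, but [lam * mu < 1/2] can be reached, and then the factor 2^k of one
    differentiation is absorbed. A complex equation is treated as a real system of twice the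
    size. *)

Section ContinuityRules.
Variables (R : realType) (T : topologicalType).
Implicit Types (f g : T -> R) (x : T).

Lemma forD f g x : {for x, continuous f} -> {for x, continuous g} ->
  {for x, continuous (fun z => f z + g z)}.
Proof. exact: continuousD. Qed.

Lemma forN f x : {for x, continuous f} -> {for x, continuous (fun z => - f z)}.
Proof. exact: continuousN. Qed.

Lemma forB f g x : {for x, continuous f} -> {for x, continuous g} ->
  {for x, continuous (fun z => f z - g z)}.
Proof. exact: continuousB. Qed.

Lemma forM f g x : {for x, continuous f} -> {for x, continuous g} ->
  {for x, continuous (fun z => f z * g z)}.
Proof. exact: continuousM. Qed.

Lemma forV f x : f x != 0 -> {for x, continuous f} ->
  {for x, continuous (fun z => (f z)^-1)}.
Proof. exact: continuousV. Qed.

Lemma for_abs f x : {for x, continuous f} -> {for x, continuous (fun z => `|f z|)}.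
Proof. move=> cf; apply: cvg_comp cf _; exact: norm_continuous. Qed.

Lemma for_sum (I : Type) (s : seq I) (F : I -> T -> R) x :
  (forall i, {for x, continuous (F i)}) ->
  {for x, continuous (fun z => \sum_(i <- s) F i z)}.
Proof.
move=> H; elim: s => [|i s IH].
  have -> : (fun z => \sum_(i <- [::]) F i z) = cst 0.
    by apply/funext => z; rewrite big_nil.
  exact: cst_continuous.
have -> : (fun z => \sum_(j <- i :: s) F j z) = (fun z => F i z + \sum_(j <- s) F j z).
  by apply/funext => z; rewrite big_cons.
exact: forD.
Qed.

End ContinuityRules.

(** * Derivatives along lines and functions of class C^k on R^n *)

Section Line.
Variables (R : realType) (V : normedModType R).

(** The two difference quotients are the same function of h. Mean value theorems and explicit affine
    derivatives are thereby carried over from one variable to directional derivatives. *)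
Lemma is_derive_line (f : V -> R) (x v : V) (s : R) (d : R) :
  is_derive (x + s *: v) v f d <-> is_derive s 1 (fun r => f (x + r *: v)) d.
Proof.
have E : (fun h : R => h^-1 *: ((f \o shift (x + s *: v)) (h *: v) - f (x + s *: v)))
  = (fun h : R => h^-1 *: (((fun r => f (x + r *: v)) \o shift s) (h *: (1 : R)) - f (x + s *: v))).
  apply/funext => h /=; congr (_ *: (f _ - _)).
  by rewrite [h *: 1]mulr1 scalerDl addrCA.
split=> -[D1 D2]; split; rewrite ?/derivable ?/derive in D1 D2 *.
- by rewrite -E.
- by rewrite -E.
- by rewrite E.
- by rewrite E.
Qed.

Lemma mvt_le (f df : R -> R) (a b m : R) :
  (forall s : R, a <= s <= b -> is_derive s 1 f (df s)) ->
  (forall s : R, a <= s <= b -> `|df s| <= m) -> a <= b ->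
  `|f b - f a| <= m * (b - a).
Proof.
move=> Hd Hm ab.
have cf : {within `[a, b], continuous f}.
  apply: derivable_within_continuous => x; rewrite in_itv /= => /Hd H.
  exact: ex_derive.
have [|c cab ->] := @MVT_segment R f df a b ab _ cf.
  by move=> x; rewrite in_itv /= => /andP[h1 h2]; apply: Hd; rewrite !ltW.
rewrite normrM (ger0_norm (_ : 0 <= b - a)) ?subr_ge0//.
by apply: ler_wpM2r; [rewrite subr_ge0|apply: Hm; rewrite in_itv in cab].
Qed.

Lemma mvt_le_sym (f df : R -> R) (a b m : R) :
  (forall s : R, Num.min a b <= s <= Num.max a b -> is_derive s 1 f (df s)) ->
  (forall s : R, Num.min a b <= s <= Num.max a b -> `|df s| <= m) ->
  `|f b - f a| <= m * `|b - a|.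
Proof.
case: (leP a b) => ab Hd Hm.
  by rewrite [X in _ * X]ger0_norm ?subr_ge0//; apply: (mvt_le Hd Hm).
by rewrite distrC [X in _ * X]distrC [X in _ * X]ger0_norm ?subr_ge0 ?(ltW ab)//;
  apply: (mvt_le Hd Hm); rewrite ltW.
Qed.

Lemma mvt_ex (f df : R -> R) (h : R) :
  (forall s : R, `|s| <= `|h| -> is_derive s 1 f (df s)) ->
  exists2 s : R, `|s| <= `|h| & f h - f 0 = df s * h.
Proof.
move=> Hd.
have [h0|h0] := leP 0 h.
  have Hd' s : 0 <= s <= h -> is_derive s 1 f (df s).
    by case/andP => s0 sh; apply: Hd; rewrite !ger0_norm.
  have cf : {within `[0, h], continuous f}.
    apply: derivable_within_continuous => x; rewrite in_itv /= => /Hd' H.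
    exact: ex_derive.
  have [|c cab E] := @MVT_segment R f df 0 h h0 _ cf.
    by move=> x; rewrite in_itv /= => /andP[h1 h2]; apply: Hd'; rewrite !ltW.
  exists c; last by rewrite E subr0.
  by move: cab; rewrite in_itv /= => /andP[c0 ch]; rewrite !ger0_norm.
have Hd' s : h <= s <= 0 -> is_derive s 1 f (df s).
  by case/andP => s0 sh; apply: Hd; rewrite !ler0_norm ?lerN2// ltW.
have cf : {within `[h, 0], continuous f}.
  apply: derivable_within_continuous => x; rewrite in_itv /= => /Hd' H.
  exact: ex_derive.
have [|c cab E] := @MVT_segment R f df h 0 (ltW h0) _ cf.
  by move=> x; rewrite in_itv /= => /andP[h1 h2]; apply: Hd'; rewrite !ltW.
exists c.
  by move: cab; rewrite in_itv /= => /andP[c0 ch]; rewrite !ler0_norm ?lerN2// ltW.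
by rewrite -opprB E; ring.
Qed.

Lemma is_derive_affine (c d s : R) : is_derive s 1 (fun r => c + r * d) d.
Proof.
by apply: is_derive_eq; rewrite add0r mul1r scaler0 add0r /GRing.scale /= mulr1.
Qed.

End Line.

Section Calculus.
Variables (R : realType) (n : nat).
Local Notation V := 'rV[R]_n.
Implicit Types (W : set V) (f g : V -> R) (y : V).

Definition unitv (a : 'I_n) : V := delta_mx 0 a.

Lemma unitvE a b : unitv a 0 b = (a == b)%:R.
Proof. by rewrite /unitv mxE eqxx /= eq_sym. Qed.

Lemma norm_coord (x : V) a : `|x 0 a| <= `|x|.
Proof.
rewrite [leRHS]mx_normrE.
exact: (@le_bigmax _ _ _ 0 (fun i : 'I_1 * 'I_n => `|x i.1 i.2|) (0, a)).
Qed.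

Lemma norm_le_coord (x : V) (m : R) :
  0 <= m -> (forall a, `|x 0 a| <= m) -> `|x| <= m.
Proof.
move=> m0 H; rewrite [leLHS]mx_normrE; apply: bigmax_le => //= -[i j] _ /=.
by rewrite ord1.
Qed.

Lemma norm_lt_coord (x : V) (m : R) :
  0 < m -> (forall a, `|x 0 a| < m) -> `|x| < m.
Proof.
move=> m0 H; rewrite [ltLHS]mx_normrE; apply: bigmax_lt => //= -[i j] _ /=.
by rewrite ord1.
Qed.

Lemma norm_unitv a : `|unitv a| <= 1.
Proof.
apply: norm_le_coord => // b; rewrite unitvE; case: eqP => _ /=; rewrite ?normr1 ?normr0//.
Qed.

Lemma Ck_cont k W f y : Ck k W f -> W y -> {for y, continuous f}.
Proof. by case: k => [|k] [] H _; apply: H. Qed.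

Lemma CkS_partial k W f a : Ck k.+1 W f -> Ck k W (partial a f).
Proof. by case=> _ /(_ a)[]. Qed.

Lemma CkS_derive k W f a y : Ck k.+1 W f -> W y ->
  is_derive y (unitv a) f (partial a f y).
Proof. by case=> _ /(_ a)[H _] Wy; apply: derivableP; apply: H. Qed.

Lemma is_derive_partial a f y d : is_derive y (unitv a) f d -> partial a f y = d.
Proof. by case. Qed.

Lemma Ck_sub k W W' f : W' `<=` W -> Ck k W f -> Ck k W' f.
Proof.
move=> sW; elim: k f => [|k IH] f [H1 H2]; split=> //.
- by move=> y /sW; apply: H1.
- by move=> y /sW; apply: H1.
- move=> a; have [H3 H4] := H2 a; split; last exact: IH.
  by move=> y /sW; apply: H3.
Qed.

Lemma partial_near f g a y : (\near y, f y = g y) -> partial a f y = partial a g y.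
Proof. exact: near_eq_derive. Qed.

Lemma open_near W y (P : V -> Prop) : open W -> W y -> (forall z, W z -> P z) ->
  \near y, P y.
Proof.
move=> oW Wy H; apply: (@filterS _ (nbhs y) _ W) => //.
exact: open_nbhs_nbhs.
Qed.

Lemma near_continuous f g y : (\near y, f y = g y) ->
  {for y, continuous f} -> {for y, continuous g}.
Proof.
move=> fg fc; rewrite /prop_for /continuous_at -(nbhs_singleton fg).
exact: cvg_trans (@near_eq_cvg _ _ (nbhs y) (nbhs_filter y) f g fg) fc.
Qed.

Lemma Ck_ext k W f g : open W -> (forall y, W y -> f y = g y) ->
  Ck k W f -> Ck k W g.
Proof.
move=> oW; elim: k f g => [|k IH] f g fg [H1 H2].
  split=> // y Wy; move: (H1 y Wy) => fc.
  have nfg : \near y, f y = g y by apply: open_near Wy _.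
  exact: near_continuous fc.
split=> [y Wy|a].
  move: (H1 y Wy) => fc.
  have nfg : \near y, f y = g y by apply: open_near Wy _.
  exact: near_continuous fc.
have [H3 H4] := H2 a; split.
  move=> y Wy; apply: near_eq_derivable (H3 y Wy).
  by apply: open_near Wy _.
apply: IH H4 => y Wy; apply: partial_near.
by apply: open_near Wy _.
Qed.

(** Lets an explicit formula stand for [partial a f], with which it is only known to agree on W. *)
Lemma CkS k W f (df : 'I_n -> V -> R) : open W ->
  (forall y, W y -> {for y, continuous f}) ->
  (forall a y, W y -> is_derive y (unitv a) f (df a y)) ->
  (forall a, Ck k W (df a)) -> Ck k.+1 W f.
Proof.
move=> oW fc fd dfC; split=> // a; split.
  by move=> y Wy; have := fd a y Wy => -[].
apply: Ck_ext (dfC a) => // y Wy.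
by rewrite (is_derive_partial (fd a y Wy)).
Qed.

Lemma Ck_pred k W f : Ck k.+1 W f -> Ck k W f.
Proof.
elim: k f => [|k IH] f; first by move=> [H1 _]; split.
case=> H1 H2; split=> // a; have [H3 H4] := H2 a; split=> //.
exact: IH.
Qed.

Lemma Ck_local k W f : open W ->
  (forall y, W y -> exists W', [/\ open W', W' y & Ck k W' f]) -> Ck k W f.
Proof.
move=> oW; elim: k f => [|k IH] f H.
  by split=> // y /H[W' [_ W'y [H1 _]]]; apply: H1.
split=> [y /H[W' [_ W'y [H1 _]]]|a]; first exact: H1.
split; first by move=> y /H[W' [_ W'y [_ H1]]]; apply: (H1 a).1.
apply: IH => y /H[W' [oW' W'y [_ H1]]]; exists W'; split=> //.
exact: (H1 a).2.
Qed.

Lemma Ck_cst k W (c : R) : open W -> Ck k W (cst c).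
Proof.
move=> oW; elim: k c => [|k IH] c; first by split=> // y _; apply: cst_continuous.
apply: (CkS (df := fun _ => cst 0)) => // y _; exact: cst_continuous.
Qed.

Lemma Ck_add k W f g : open W -> Ck k W f -> Ck k W g -> Ck k W (fun y => f y + g y).
Proof.
move=> oW; elim: k f g => [|k IH] f g Cf Cg.
  split=> // y Wy; apply: forD; [exact: Ck_cont Cf Wy|exact: Ck_cont Cg Wy].
apply: (CkS (df := fun a y => partial a f y + partial a g y)) => [//|y Wy|a y Wy|a].
- by apply: forD; [exact: Ck_cont Cf Wy|exact: Ck_cont Cg Wy].
- have := CkS_derive a Cf Wy; have := CkS_derive a Cg Wy => ? ?.
  exact: is_deriveD.
- by apply: IH; apply: CkS_partial.
Qed.

Lemma Ck_mul k W f g : open W -> Ck k W f -> Ck k W g -> Ck k W (fun y => f y * g y).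
Proof.
move=> oW; elim: k f g => [|k IH] f g Cf Cg.
  split=> // y Wy; apply: forM; [exact: Ck_cont Cf Wy|exact: Ck_cont Cg Wy].
apply: (CkS (df := fun a y => f y * partial a g y + g y * partial a f y)) => [//|y Wy|a y Wy|a].
- by apply: forM; [exact: Ck_cont Cf Wy|exact: Ck_cont Cg Wy].
- have := CkS_derive a Cf Wy; have := CkS_derive a Cg Wy => ? ?.
  exact: is_deriveM.
- apply: Ck_add => //; apply: IH; do ?[exact: CkS_partial|exact: Ck_pred].
Qed.

Lemma Ck_inv k W f : open W -> (forall y, W y -> f y != 0) ->
  Ck k W f -> Ck k W (fun y => (f y)^-1).
Proof.
move=> oW f0; elim: k f f0 => [|k IH] f f0 Cf.
  by split=> // y Wy; apply: forV; [exact: f0|exact: Ck_cont Cf Wy].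
apply: (CkS (df := fun a y => - 1 * ((f y)^-1 * (f y)^-1) * partial a f y)) => [//|y Wy|a y Wy|a].
- by apply: forV; [exact: f0|exact: Ck_cont Cf Wy].
- have [h1 h2] := CkS_derive a Cf Wy.
  split; first exact: derivableV (f0 _ Wy) h1.
  rewrite deriveV// ?f0// h2 /GRing.scale /=.
  by rewrite -exprVn expr2 mulN1r.
- have H := IH f f0 (Ck_pred Cf).
  apply: Ck_mul => //; last exact: CkS_partial.
  apply: Ck_mul => //; first exact: Ck_cst.
  exact: Ck_mul.
Qed.

Lemma Ck_coord k W a : open W -> Ck k W (fun y : V => y 0 a).
Proof.
move=> oW; case: k => [|k].
  by split=> // y _; apply: coord_continuous.
apply: (CkS (df := fun b => cst ((unitv b) 0 a))) => [//|y _|b y _|b].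
- exact: coord_continuous.
- rewrite -[y]addr0 -(scale0r (unitv b)); apply/is_derive_line.
  have -> : (fun r : R => (y + r *: unitv b) 0 a) = (fun r => y 0 a + r * unitv b 0 a).
    by apply/funext => r; rewrite !mxE.
  by rewrite /cst; exact: is_derive_affine.
- exact: Ck_cst.
Qed.

(* Increments along the coordinate axes, one after the other. *)
Lemma increment_le f y (r m : R) (h : V) :
  0 <= m ->
  (forall z a, `|z - y| < r -> derivable f z (unitv a) /\ `|partial a f z| <= m) ->
  `|h| < r -> `|f (y + h) - f y| <= n%:R * m * `|h|.
Proof.
move=> m0 H hr.
pose tr k : V := \row_j (if (j < k)%N then h 0 j else 0).
have tr0 : tr 0 = 0 by apply/rowP => j; rewrite !mxE ltn0.
have trn : tr n = h by apply/rowP => j; rewrite !mxE ltn_ord.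
have trS k (kn : (k < n)%N) : tr k.+1 = tr k + h 0 (Ordinal kn) *: unitv (Ordinal kn).
  apply/rowP => j; rewrite !mxE eqxx /= ltnS leq_eqVlt.
  have [jk|jk] := eqVneq (j : nat) k.
    have -> : j = Ordinal kn by apply/val_inj.
    by rewrite eqxx ltnn mulr1 add0r.
  rewrite /=; have -> : (j == Ordinal kn) = false.
    by apply/negbTE/eqP => E; move: jk; rewrite E eqxx.
  by rewrite mulr0 addr0.
have step k : (k < n)%N -> `|f (y + tr k.+1) - f (y + tr k)| <= m * `|h|.
  move=> kn; set a := Ordinal kn.
  pose p := y + tr k.
  have near_y s : `|s| <= `|h 0 a| -> `|p + s *: unitv a - y| < r.
    move=> sh; apply: le_lt_trans hr.
    rewrite addrAC /p [y + _]addrC addrK; apply: norm_le_coord => // j.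
    rewrite !mxE eqxx /=; have [->|ja] := eqVneq j a.
      by rewrite ltnn add0r mulr1 (le_trans sh)// norm_coord.
    by rewrite mulr0 addr0; case: ifP => _; rewrite ?norm_coord// normr0.
  have [s sh E] := @mvt_ex R (fun s => f (p + s *: unitv a))
     (fun s => partial a f (p + s *: unitv a)) (h 0 a)
     (fun s sh => (is_derive_line f p (unitv a) s _).1
       (derivableP (H _ a (near_y s sh)).1)).
  rewrite trS addrA -/p -/a.
  move: E; rewrite scale0r addr0 => ->.
  rewrite normrM; apply: ler_pM => //; last exact: norm_coord.
  exact: (H _ a (near_y s sh)).2.
have main k : (k <= n)%N -> `|f (y + tr k) - f y| <= k%:R * (m * `|h|).
  elim: k => [|k IH] kn; first by rewrite tr0 addr0 subrr normr0 mul0r.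
  rewrite -(subrK (f (y + tr k)) (f (y + tr k.+1))) -addrA.
  apply: (le_trans (ler_normD _ _)).
  by rewrite -natr1 mulrDl mul1r [leRHS]addrC; apply: lerD; [apply: step|apply: IH; apply: ltnW].
by have := main n (leqnn n); rewrite trn mulrA.
Qed.

Definition grad_app f y (v : V) : R := \sum_(a < n) v 0 a * partial a f y.

(** Subtracting the linear part at y leaves a function whose partial derivatives are small near y,
    to which [increment_le] applies. *)
Lemma C1_increment W f y (e : R) : open W -> Ck 1 W f -> W y -> 0 < e ->
  exists2 r, 0 < r & forall h, `|h| < r ->
    `|f (y + h) - f y - grad_app f y h| <= e * `|h|.
Proof.
move=> oW Cf Wy e0.
(* The n coordinate increments each cost e'; the [+ 1] covers n = 0. *)
pose e' := e / (n%:R + 1).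
have e'0 : 0 < e' by rewrite divr_gt0// ltr_wpDl.
have [r r0 Hr] : exists2 r, 0 < r & forall z, `|z - y| < r ->
    W z /\ forall a, `|partial a f z - partial a f y| <= e'.
  have near1 : \forall z \near y, W z /\ forall a, `|partial a f z - partial a f y| <= e'.
    apply: filterI; first exact: open_nbhs_nbhs.
    have : \forall z \near y, forall a : 'I_n, (a \in enum 'I_n) -> `|partial a f z - partial a f y| <= e'.
      elim: (enum 'I_n) => [|a s IH]; first exact: filterE.
      have ca : \forall z \near y, `|partial a f z - partial a f y| <= e'.
        have c := Ck_cont (CkS_partial a Cf) Wy.
        move/cvgr_dist_le: c => /(_ _ e'0); apply: filterS => z.
        by rewrite distrC.
      apply: filterS2 ca IH => z h1 h2 b; rewrite inE => /orP[/eqP->//|]; exact: h2.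
    by apply: filterS => z H a; apply: H; rewrite mem_enum.
  have /nbhs_ballP[r /= r0 Hr] := near1.
  by exists r => // z zr; apply: Hr; rewrite -ball_normE /= distrC.
exists r => // h hr.
pose g z := f z - grad_app f y z.
have Hg z a : `|z - y| < r -> derivable g z (unitv a) /\ `|partial a g z| <= e'.
  move=> /Hr[Wz Hz].
  have D : is_derive z (unitv a) g (partial a f z - partial a f y).
    apply: is_deriveB; first exact: CkS_derive Cf Wz.
    rewrite -[z]addr0 -(scale0r (unitv a)); apply/is_derive_line.
    have -> : (fun r : R => grad_app f y (z + r *: unitv a))
        = (fun r => grad_app f y z + r * partial a f y).
      apply/funext => s; rewrite /grad_app.
      under eq_bigr => b _ do rewrite !mxE mulrDl.
      rewrite big_split /=; congr (_ + _).
      rewrite (bigD1 a) //= big1 ?addr0 => [|b ba].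
        by rewrite !eqxx mulr1.
      by rewrite (negbTE ba) /= mulr0 mul0r.
    exact: is_derive_affine.
  by split; [case: D|rewrite (is_derive_partial D)].
have := increment_le (ltW e'0) Hg hr.
have -> : g (y + h) - g y = f (y + h) - f y - grad_app f y h.
  rewrite /g /grad_app; under eq_bigr => b _ do rewrite mxE mulrDl.
  by rewrite big_split /=; ring.
move=> /le_trans; apply; apply: ler_wpM2r; first exact: normr_ge0.
rewrite /e' mulrCA ger_pMr// ler_pdivrMr ?mul1r ?lerDl// ltr_wpDl.
Qed.

End Calculus.

Section Chain.
Variables (R : realType).

Lemma is_derive_dist (f : R -> R) (x d : R) :
  (forall e : R, 0 < e -> exists2 r, 0 < r & forall h, `|h| < r ->
    `|f (x + h) - f x - h * d| <= e * `|h|) ->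
  is_derive x 1 f d.
Proof.
move=> H.
have L : h^-1 *: ((f \o shift x) (h *: (1 : R)) - f x) @[h --> 0^'] --> d.
  apply/cvgrPdist_le => e e0; have [r r0 Hr] := H e e0.
  near=> h.
  have h0 : h != 0 by near: h; exact: nbhs_dnbhs_neq.
  have hr : `|h| < r.
    near: h; apply: dnbhs0_lt => //.
  have -> : d - h^-1 *: ((f \o shift x) (h *: (1 : R)) - f x)
     = - (h^-1 * (f (x + h) - f x - h * d)).
    rewrite /= [h *: 1]mulr1 [h + x]addrC /GRing.scale /=.
    by field.
  rewrite normrN normrM normfV mulrC ler_pdivrMr ?normr_gt0//.
  exact: Hr.
split; first by apply/cvg_ex; exists d.
exact/cvg_lim.
Unshelve. all: by end_near. Qed.

Lemma is_derive_distP (f : R -> R) (x d : R) : is_derive x 1 f d ->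
  forall e : R, 0 < e -> exists2 r, 0 < r & forall h, `|h| < r ->
    `|f (x + h) - f x - h * d| <= e * `|h|.
Proof.
move=> [D1 D2] e e0.
have L : h^-1 *: ((f \o shift x) (h *: (1 : R)) - f x) @[h --> 0^'] --> d.
  by rewrite -D2; exact: D1.
move/cvgrPdist_le: L => /(_ e e0).
rewrite near_withinE => /nbhs_ballP[r /= r0 Hr].
exists r => // h hr.
have [->|h0] := eqVneq h 0; first by rewrite addr0 subrr mul0r subr0 normr0 mulr0.
have := Hr h; rewrite /= -ball_normE /= sub0r normrN => /(_ hr h0).
have -> : d - h^-1 *: ((f \o shift x) (h *: (1 : R)) - f x)
     = - (h^-1 * (f (x + h) - f x - h * d)).
  rewrite /= [h *: 1]mulr1 [h + x]addrC /GRing.scale /=.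
  by field.
by rewrite normrN normrM normfV mulrC ler_pdivrMr ?normr_gt0//.
Qed.

Variables (n m : nat).

Lemma chain_rule (W : set 'rV[R]_n) (f : 'rV[R]_n -> R)
    (G : 'rV[R]_m -> 'rV[R]_n) (y v : 'rV[R]_m) (dG : 'rV[R]_n) :
  open W -> Ck 1 W f -> W (G y) ->
  (forall b, is_derive y v (fun z => G z 0 b) (dG 0 b)) ->
  is_derive y v (f \o G) (grad_app f (G y) dG).
Proof.
move=> oW Cf WG HG.
rewrite -[y]addr0 -(scale0r v); apply/is_derive_line.
rewrite scale0r addr0.
apply: is_derive_dist => e e0.
have lin (h : R) : grad_app f (G y) (h *: dG) = h * grad_app f (G y) dG.
  rewrite /grad_app mulr_sumr; apply: eq_bigr => b _.
  by rewrite mxE mulrA.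
have linD (u w : 'rV[R]_n) : grad_app f (G y) (u + w) = grad_app f (G y) u + grad_app f (G y) w.
  rewrite /grad_app -big_split; apply: eq_bigr => b _.
  by rewrite mxE mulrDl.
pose S := \sum_(b < n) `|partial b f (G y)|.
have S0 : 0 <= S by apply: sumr_ge0.
have bnd (u : 'rV[R]_n) (c : R) : 0 <= c -> (forall b, `|u 0 b| <= c) ->
    `|grad_app f (G y) u| <= c * S.
  move=> c0 Hc; rewrite /grad_app /S mulr_sumr.
  apply: (le_trans (ler_norm_sum _ _ _)); apply: ler_sum => b _.
  by rewrite normrM ler_wpM2r.
pose K := `|dG| + 1.
have K0 : 0 < K by rewrite ltr_wpDl.
(* Half of e pays for the linearisation of f, over an increment of G of size at most [K * |h|], and
   half for that of G itself, through e2. The minimum with 1 in e2 is what gives the bound by K. *)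
pose e1 := e / (2 * K); have e10 : 0 < e1 by rewrite divr_gt0// mulr_gt0.
have [r1 r10 Hr1] := C1_increment oW Cf WG e10.
pose e2 := Num.min 1 (e / (2 * (S + 1))).
have e20 : 0 < e2.
  by rewrite lt_min ltr01 divr_gt0// mulr_gt0// ltr_wpDl.
have [r2 r20 Hr2] : exists2 r, 0 < r & forall h : R, `|h| < r -> forall b,
    `|G (y + h *: v) 0 b - G y 0 b - h * dG 0 b| <= e2 * `|h|.
  have : forall s : seq 'I_n, exists2 r, 0 < r & forall h : R, `|h| < r -> forall b,
    b \in s -> `|G (y + h *: v) 0 b - G y 0 b - h * dG 0 b| <= e2 * `|h|.
    elim=> [|b s [r r0 Hr]]; first by exists 1.
    have HGb := HG b.
    rewrite -[y]addr0 -(scale0r v) in HGb; move/is_derive_line in HGb.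
    have [r' r'0 Hr'] := is_derive_distP HGb e20.
    exists (Num.min r r'); first by rewrite lt_min r0.
    move=> h; rewrite lt_min => /andP[hr hr'] c; rewrite inE => /orP[/eqP->|]; last exact: Hr.
    by have := Hr' _ hr'; rewrite !add0r scale0r addr0.
  move=> /(_ (enum 'I_n))[r r0 Hr]; exists r => // h /Hr H b.
  by apply: H; rewrite mem_enum.
exists (Num.min r2 (r1 / K)); first by rewrite lt_min r20 divr_gt0.
move=> h; rewrite lt_min => /andP[/Hr2 hr2 hr1] /=.
rewrite add0r.
set k := G (y + h *: v) - G y.
have kb b : `|k 0 b - h * dG 0 b| <= e2 * `|h| by rewrite !mxE; apply: hr2.
have kK : `|k| <= `|h| * K.
  apply: norm_le_coord => [|b]; first by rewrite mulr_ge0// ltW.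
  have -> : k 0 b = (k 0 b - h * dG 0 b) + h * dG 0 b by rewrite subrK.
  apply: (le_trans (ler_normD _ _)).
  rewrite /K mulrDr mulr1 [leRHS]addrC; apply: lerD.
    by apply: (le_trans (kb b)); rewrite ler_piMl// ge_min lexx.
  by rewrite normrM ler_wpM2l// norm_coord.
have kr : `|k| < r1.
  by apply: (le_lt_trans kK); rewrite -ltr_pdivlMr.
have H1 := Hr1 k kr.
have Gk : G y + k = G (y + h *: v) by rewrite /k addrC subrK.
rewrite Gk in H1.
have E : k = h *: dG + (k - h *: dG) by rewrite addrC subrK.
have H2 : `|grad_app f (G y) (k - h *: dG)| <= e2 * `|h| * S.
  apply: bnd => [|b]; first by rewrite mulr_ge0// ltW.
  by have := kb b; rewrite !mxE.
rewrite scale0r addr0.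
rewrite -(subrK (grad_app f (G y) k) (f (G (y + h *: v)) - f (G y))) -addrA.
apply: (le_trans (ler_normD _ _)).
apply: (@le_trans _ _ (e1 * `|k| + e2 * `|h| * S)).
  apply: lerD => //.
  by rewrite {1}E linD lin addrC addKr.
have -> : e * `|h| = (e / 2) * `|h| + (e / 2) * `|h| by field.
apply: lerD.
  apply: (@le_trans _ _ (e1 * (`|h| * K))); first by rewrite ler_wpM2l// ltW.
  by rewrite /e1 le_eqVlt; apply/orP; left; apply/eqP; field; rewrite gt_eqF.
rewrite mulrAC ler_wpM2r//.
apply: (@le_trans _ _ (e / (2 * (S + 1)) * S)); first by rewrite ler_wpM2r// ge_min lexx orbT.
rewrite invfM mulrA -mulrA ler_piMr ?divr_ge0 ?(ltW e0)//.
by rewrite mulrC ler_pdivrMr ?mul1r ?lerDl// ltr_wpDl.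
Qed.

Lemma for_row (T : topologicalType) (G : T -> 'rV[R]_n) (x : T) :
  (forall b, {for x, continuous (fun z => G z 0 b)}) -> {for x, continuous G}.
Proof.
move=> H; apply/cvgrPdist_le => e e0.
have : \forall t \near x, forall b : 'I_n, b \in enum 'I_n -> `|(G x - G t) 0 b| <= e.
  elim: (enum 'I_n) => [|a s IH]; first exact: filterE.
  have ca : \forall z \near x, `|(G x - G z) 0 a| <= e.
    have /cvgrPdist_le := H a; move=> /(_ _ e0); apply: filterS => z.
    by rewrite !mxE.
  apply: filterS2 ca IH => z h1 h2 b; rewrite inE => /orP[/eqP->//|]; exact: h2.
apply: filterS => t Ht; apply: norm_le_coord; first exact: ltW.
by move=> b; apply: Ht; rewrite mem_enum.
Qed.

Lemma for_comp (T : topologicalType) (U : topologicalType) (G : T -> U) (f : U -> R) (x : T) :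
  {for x, continuous G} -> {for G x, continuous f} -> {for x, continuous (f \o G)}.
Proof. move=> cG cf; exact: continuous_comp. Qed.

Lemma Ck_sum k (W : set 'rV[R]_n) (I : Type) (s : seq I) (P : pred I) (F : I -> 'rV[R]_n -> R) :
  open W -> (forall i, P i -> Ck k W (F i)) ->
  Ck k W (fun y => \sum_(i <- s | P i) F i y).
Proof.
move=> oW H; elim: s => [|i s IH].
  apply: (@Ck_ext _ _ _ _ (cst 0)) => // [y _|]; first by rewrite big_nil.
  exact: Ck_cst.
case Pi : (P i).
  apply: (@Ck_ext _ _ _ _ (fun y => F i y + \sum_(i <- s | P i) F i y)) => //.
    by move=> y _; rewrite big_cons Pi.
  by apply: Ck_add => //; apply: H.
by apply: Ck_ext IH => // y _; rewrite big_cons Pi.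
Qed.

End Chain.

Lemma Ck_comp (R : realType) (n m k : nat) (W : set 'rV[R]_n) (U : set 'rV[R]_m)
    (f : 'rV[R]_n -> R) (G : 'rV[R]_m -> 'rV[R]_n) :
  open W -> open U -> (forall y, U y -> W (G y)) ->
  Ck k W f -> (forall b, Ck k U (fun y => G y 0 b)) -> Ck k U (f \o G).
Proof.
move=> oW oU UW; elim: k f => [|k IH] f Cf CG.
  split=> // y Uy; apply: for_comp; last exact: Ck_cont Cf (UW _ Uy).
  by apply: for_row => b; exact: Ck_cont (CG b) Uy.
apply: (@CkS _ _ _ _ _ (fun a y => \sum_(b < n) partial a (fun z => G z 0 b) y * partial b f (G y))) => [//|y Uy|a y Uy|a].
- apply: for_comp; last exact: Ck_cont Cf (UW _ Uy).
  by apply: for_row => b; exact: Ck_cont (CG b) Uy.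
- have := @chain_rule R n m W f G y (unitv R a) (\row_b partial a (fun z => G z 0 b) y) oW.
  have C1 : Ck 1 W f.
    by elim: k Cf {IH CG} => // k IH /Ck_pred.
  move=> /(_ C1 (UW _ Uy)) H.
  apply: is_derive_eq; first by apply: H => b; rewrite mxE; exact: CkS_derive (CG b) Uy.
  by rewrite /grad_app; apply: eq_bigr => b _; rewrite mxE.
- apply: Ck_sum => // b _; apply: Ck_mul => //; first exact: CkS_partial.
  by apply: IH; [exact: CkS_partial|move=> c; exact: Ck_pred].
Qed.

Local Opaque partial.

Section Smooth.
Variables (R : realType) (n : nat).
Local Notation V := 'rV[R]_n.
Implicit Types (f g : V -> R) (y : V) (W : set V).

Definition smooth f := Cinfty setT f.

Lemma smooth_Cinfty W f : smooth f -> Cinfty W f.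
Proof. by move=> H k; apply: Ck_sub (H k). Qed.

Lemma Cinfty_partial W f a : Cinfty W f -> Cinfty W (partial a f).
Proof. by move=> H k; apply: CkS_partial (H k.+1). Qed.

Lemma Cinfty_derive W f a y : Cinfty W f -> W y ->
  is_derive y (unitv R a) f (partial a f y).
Proof. by move=> H; apply: (CkS_derive _ (H 1%N)). Qed.

Lemma Cinfty_for W f y : Cinfty W f -> W y -> {for y, continuous f}.
Proof. by move=> H; apply: Ck_cont (H 0%N). Qed.

Lemma sm_partial f a : smooth f -> smooth (partial a f).
Proof. exact: Cinfty_partial. Qed.

Lemma sm_derive f a y : smooth f -> is_derive y (unitv R a) f (partial a f y).
Proof. by move=> H; apply: Cinfty_derive H _. Qed.

Lemma sm_cont f : smooth f -> continuous f.
Proof. by move=> H y; apply: (Cinfty_for H). Qed.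

Lemma sm_cst (c : R) : smooth (fun=> c).
Proof. by move=> k; apply: Ck_cst; apply: openT. Qed.

Lemma sm_add f g : smooth f -> smooth g -> smooth (fun y => f y + g y).
Proof. by move=> H1 H2 k; apply: Ck_add; [exact: openT|exact: H1|exact: H2]. Qed.

Lemma sm_mul f g : smooth f -> smooth g -> smooth (fun y => f y * g y).
Proof. by move=> H1 H2 k; apply: Ck_mul; [exact: openT|exact: H1|exact: H2]. Qed.

Lemma sm_scal (c : R) f : smooth f -> smooth (fun y => c * f y).
Proof. by move=> H; apply: sm_mul => //; exact: sm_cst. Qed.

Lemma sm_opp f : smooth f -> smooth (fun y => - f y).
Proof.
move=> H; have -> : (fun y => - f y) = (fun y => -1 * f y).
  by apply/funext => y; rewrite mulN1r.
exact: sm_scal.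
Qed.

Lemma sm_sub f g : smooth f -> smooth g -> smooth (fun y => f y - g y).
Proof. by move=> H1 H2; apply: sm_add => //; apply: sm_opp. Qed.

Lemma sm_inv f : smooth f -> (forall y, f y != 0) -> smooth (fun y => (f y)^-1).
Proof. by move=> H H0 k; apply: Ck_inv => //; exact: openT. Qed.

Lemma sm_coord a : smooth (fun y : V => y 0 a).
Proof. by move=> k; apply: Ck_coord; exact: openT. Qed.

Lemma sm_sum (I : Type) (s : seq I) (P : pred I) (F : I -> V -> R) :
  (forall i, P i -> smooth (F i)) -> smooth (fun y => \sum_(i <- s | P i) F i y).
Proof. by move=> H k; apply: Ck_sum => [|i Pi]; [exact: openT|exact: H]. Qed.

Lemma sm_prod (I : Type) (s : seq I) (P : pred I) (F : I -> V -> R) :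
  (forall i, P i -> smooth (F i)) -> smooth (fun y => \prod_(i <- s | P i) F i y).
Proof.
move=> H; elim: s => [|i s IH].
  have -> : (fun y => \prod_(i <- [::] | P i) F i y) = cst 1 by apply/funext=> y; rewrite big_nil.
  exact: sm_cst.
case Pi : (P i).
  have -> : (fun y => \prod_(i <- i :: s | P i) F i y)
      = (fun y => F i y * \prod_(i <- s | P i) F i y).
    by apply/funext => y; rewrite big_cons Pi.
  by apply: sm_mul => //; apply: H.
have -> // : (fun y => \prod_(i <- i :: s | P i) F i y)
      = (fun y => \prod_(i <- s | P i) F i y).
by apply/funext => y; rewrite big_cons Pi.
Qed.

Lemma partialD f g a y : smooth f -> smooth g ->
  partial a (fun z => f z + g z) y = partial a f y + partial a g y.
Proof.
move=> /(sm_derive a y) ? /(sm_derive a y) ?.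
by apply: is_derive_partial; apply: is_deriveD.
Qed.

Lemma partialZ (c : R) f a y : smooth f ->
  partial a (fun z => c * f z) y = c * partial a f y.
Proof.
move=> /(sm_derive a y) ?.
by apply: is_derive_partial; apply: is_deriveZ.
Qed.

Lemma partialN f a y : smooth f -> partial a (fun z => - f z) y = - partial a f y.
Proof.
move=> /(sm_derive a y) ?.
by apply: is_derive_partial; apply: is_deriveN.
Qed.

Lemma partialB f g a y : smooth f -> smooth g ->
  partial a (fun z => f z - g z) y = partial a f y - partial a g y.
Proof. by move=> Hf Hg; rewrite partialD ?partialN//; exact: sm_opp. Qed.

Lemma partialM f g a y : smooth f -> smooth g ->
  partial a (fun z => f z * g z) y = partial a f y * g y + f y * partial a g y.
Proof.
move=> /(sm_derive a y) Df /(sm_derive a y) Dg.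
rewrite (is_derive_partial (is_deriveM Df Dg)).
by rewrite addrC /GRing.scale /= [g y * _]mulrC.
Qed.

Lemma partial_sum (I : Type) (s : seq I) (F : I -> V -> R) a y :
  (forall i, smooth (F i)) ->
  partial a (fun z => \sum_(i <- s) F i z) y = \sum_(i <- s) partial a (F i) y.
Proof.
move=> H; elim: s => [|i s IH].
  rewrite big_nil; apply: is_derive_partial.
  have -> : (fun z => \sum_(i <- [::]) F i z) = cst 0 by apply/funext=> z; rewrite big_nil.
  exact: is_derive_cst.
have -> : (fun z => \sum_(j <- i :: s) F j z) = (fun z => F i z + \sum_(j <- s) F j z).
  by apply/funext => z; rewrite big_cons.
by rewrite big_cons partialD ?IH//; exact: sm_sum.
Qed.

Lemma partial_cst (c : R) a y : partial a (fun=> c) y = 0.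
Proof. by apply: is_derive_partial; apply: is_derive_cst. Qed.

Lemma partial_coord a b y : partial a (fun z : V => z 0 b) y = (a == b)%:R.
Proof.
apply: is_derive_partial.
rewrite -[y]addr0 -(scale0r (unitv R a)); apply/is_derive_line.
have -> : (fun r : R => (y + r *: unitv R a) 0 b) = (fun r => y 0 b + r * (a == b)%:R).
  by apply/funext => r; rewrite !mxE !eqxx eq_sym.
exact: is_derive_affine.
Qed.

Lemma line_derive f a y (s : R) : smooth f ->
  is_derive s 1 (fun r => f (y + r *: unitv R a)) (partial a f (y + s *: unitv R a)).
Proof. by move=> H; exact: (is_derive_line f y (unitv R a) s _).1 (sm_derive _ _ H). Qed.

Lemma near_norm (P : V -> Prop) y : (\forall z \near y, P z) ->
  exists2 r, 0 < r & forall z, `|z - y| < r -> P z.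
Proof.
move=> /nbhs_ballP[r /= r0 Hr]; exists r => // z zr.
by apply: Hr; rewrite -ball_normE /= distrC.
Qed.

Lemma continuous_dist f y (e : R) : {for y, continuous f} -> 0 < e ->
  exists2 r, 0 < r & forall z, `|z - y| < r -> `|f z - f y| <= e.
Proof.
move=> cf e0; apply: near_norm.
move/cvgr_dist_le : cf => /(_ _ e0); apply: filterS => z.
by rewrite distrC.
Qed.

Lemma mixed_difference f a b y (h : R) : smooth f -> exists2 z : V,
  `|z - y| <= 2 * `|h| &
  f (y + h *: unitv R a + h *: unitv R b) - f (y + h *: unitv R a)
   - f (y + h *: unitv R b) + f y = partial b (partial a f) z * h * h.
Proof.
move=> sf.
pose phi s := f (y + h *: unitv R b + s *: unitv R a) - f (y + s *: unitv R a).
have [s sh E] := @mvt_ex R phi (fun s => partial a f (y + h *: unitv R b + s *: unitv R a)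
  - partial a f (y + s *: unitv R a)) h
  (fun s _ => is_deriveB (line_derive _ _ _ sf) (line_derive _ _ _ sf)).
have [t th E2] := @mvt_ex R (fun t => partial a f (y + s *: unitv R a + t *: unitv R b))
  (fun t => partial b (partial a f) (y + s *: unitv R a + t *: unitv R b)) h
  (fun t _ => line_derive _ _ _ (sm_partial a sf)).
exists (y + s *: unitv R a + t *: unitv R b).
  have -> : y + s *: unitv R a + t *: unitv R b - y = s *: unitv R a + t *: unitv R b.
    by rewrite -[y + _ + _]addrA [y + _]addrC addrK.
  rewrite mulrDl !mul1r; apply: (le_trans (ler_normD _ _)).
  rewrite !normrZ; apply: lerD.
    by rewrite (le_trans _ sh)// ler_piMr// norm_unitv.
  by rewrite (le_trans _ th)// ler_piMr// norm_unitv.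
rewrite -E2 scale0r addr0 [y + s *: _ + _]addrAC -E /phi !scale0r !addr0.
by rewrite [y + h *: unitv R b + _]addrAC; ring.
Qed.

Lemma common_approx (u v : R) :
  (forall e : R, 0 < e -> exists2 x, `|x - u| <= e & `|x - v| <= e) -> u = v.
Proof.
move=> H; apply/eqP; rewrite -subr_eq0 -normr_le0; apply/ler_addgt0Pr => e e0.
have [x xu xv] := H (e / 2) (divr_gt0 e0 (ltr0n _ 2)).
rewrite add0r (le_trans (ler_distD x u v))// distrC [e]splitr.
exact: lerD.
Qed.

(** The second difference of f is symmetric in a and b, and [mixed_difference] evaluates it in
    either order at a point near y. *)
Lemma partial_comm f a b y : smooth f ->
  partial a (partial b f) y = partial b (partial a f) y.
Proof.
move=> sf; apply: common_approx => e e0.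
have [r1 r10 H1] := continuous_dist (sm_cont (sm_partial a (sm_partial b sf)) (x := y)) e0.
have [r2 r20 H2] := continuous_dist (sm_cont (sm_partial b (sm_partial a sf)) (x := y)) e0.
(* The points supplied by [mixed_difference] lie within 2|h| of y, hence inside both radii of
   continuity. *)
pose h := Num.min r1 r2 / 4.
have m0 : 0 < Num.min r1 r2 by rewrite lt_min r10.
have h0 : 0 < h by rewrite divr_gt0.
have hlt : 2 * `|h| < Num.min r1 r2 by rewrite gtr0_norm// /h; lra.
have [z1 z1n E1] := mixed_difference a b y h sf.
have [z2 z2n E2] := mixed_difference b a y h sf.
have E : partial b (partial a f) z1 = partial a (partial b f) z2.
  apply: (mulIf (lt0r_neq0 h0)); apply: (mulIf (lt0r_neq0 h0)).
  apply: etrans (esym E1) (etrans _ E2).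
  have -> : y + h *: unitv R a + h *: unitv R b = y + h *: unitv R b + h *: unitv R a.
    by rewrite addrAC.
  by congr (_ + _); rewrite addrAC.
have l1 : Num.min r1 r2 <= r1 by rewrite ge_min lexx.
have l2 : Num.min r1 r2 <= r2 by rewrite ge_min lexx orbT.
have A1 := H1 z2 (le_lt_trans z2n (lt_le_trans hlt l1)).
have A2 := H2 z1 (le_lt_trans z1n (lt_le_trans hlt l2)).
exists (partial a (partial b f) z2); first exact: A1.
by rewrite -E; exact: A2.
Qed.

(** A smooth function of one variable, given together with all its derivatives; [flat] and the sine
    enter compositions in this form. *)
Definition smooth1 (F : nat -> R -> R) := forall k (x : R), is_derive x 1 (F k) (F k.+1 x).

End Smooth.

Section Compose1.
Variables (R : realType) (n : nat).

Lemma is_derive_comp1 (F : R -> R) (f : 'rV[R]_n -> R) (y v : 'rV[R]_n) (d d' : R) :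
  is_derive (f y) 1 F d' -> is_derive y v f d -> is_derive y v (F \o f) (d' * d).
Proof.
move=> HF Hf.
rewrite -[y]addr0 -(scale0r v); apply/is_derive_line.
apply: (@is_derive1_comp R F (fun r => f (y + r *: v)) 0 d' d).
  by rewrite scale0r addr0.
by apply: (is_derive_line f y v 0 d).1; rewrite scale0r addr0.
Qed.

Lemma Ck_comp1 (F : nat -> R -> R) k j W (f : 'rV[R]_n -> R) : open W -> smooth1 F ->
  Ck k W f -> Ck k W (F j \o f).
Proof.
move=> oW sF; elim: k j => [|k IH] j Cf.
  split=> // y Wy; apply: for_comp; first exact: Ck_cont Cf Wy.
  apply: differentiable_continuous; apply/derivable1_diffP.
  by have := sF j (f y) => -[].
apply: (CkS (df := fun a y => F j.+1 (f y) * partial a f y)) => [//|y Wy|a y Wy|a].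
- apply: for_comp; first exact: Ck_cont Cf Wy.
  apply: differentiable_continuous; apply/derivable1_diffP.
  by have := sF j (f y) => -[].
- by apply: is_derive_comp1; [exact: sF|exact: CkS_derive Cf Wy].
- by apply: Ck_mul => //; [apply: IH; exact: Ck_pred|exact: CkS_partial].
Qed.

Lemma sm_comp1 (F : nat -> R -> R) j (f : 'rV[R]_n -> R) : smooth1 F ->
  smooth f -> smooth (F j \o f).
Proof. by move=> sF sf k; apply: Ck_comp1 => //; exact: openT. Qed.

End Compose1.

(** * Flat functions, bumps and plateaus *)

Section FlatExp.
Variable R : realType.

(** For x > 0 the k-th derivative of exp(-1/x) is P_k(1/x) exp(-1/x); differentiating once more
    gives P_(k+1) = X^2 (P_k - P_k'). *)
Fixpoint flat_poly k : {poly R} :=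
  if k is k'.+1 then 'X^2 * (flat_poly k' - (flat_poly k')^`()) else 1.

Definition flat k (x : R) : R :=
  if 0 < x then (flat_poly k).[x^-1] * expR (- x^-1) else 0.

(** With N = [size p] and M = N + 1, raising exp(u / M) >= u / M to the power M gives exp(-u) <= M^M
    / u^(N + 1), one power of u below the bound of p by u^N. *)
Lemma horner_exp_bound (p : {poly R}) : exists2 C, 0 <= C &
  forall u : R, 1 <= u -> `|p.[u]| * expR (- u) <= C / u.
Proof.
pose N := size p; pose M := N.+1%:R : R.
pose C := (\sum_(i < N) `|p`_i|) * M ^+ N.+1.
have M0 : 0 < M by rewrite ltr0n.
exists C; first by rewrite mulr_ge0 ?sumr_ge0// exprn_ge0// ltW.
move=> u u1; have u0 : 0 < u by exact: lt_le_trans u1.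
have Hp : `|p.[u]| <= (\sum_(i < N) `|p`_i|) * u ^+ N.
  rewrite horner_coef mulr_suml; apply: (le_trans (ler_norm_sum _ _ _)).
  apply: ler_sum => i _; rewrite normrM ler_wpM2l// normrX gtr0_norm//.
  by apply: ler_weXn2l => //; apply: ltnW.
have He : expR (- u) <= M ^+ N.+1 / u ^+ N.+1.
  rewrite expRN -[_ / _]invrK invf_div lef_pV2 ?posrE ?expR_gt0 ?divr_gt0 ?exprn_gt0//.
  rewrite -expr_div_n.
  have {2}-> : u = M * (u / M) by rewrite mulrC divfK ?gt_eqF.
  rewrite /M expRM_natl -/M; apply: lerXn2r; rewrite ?nnegrE ?divr_ge0 ?expR_ge0 ?(ltW u0) ?(ltW M0)//.
  by apply: le_trans (expR_ge1Dx _); rewrite lerDr.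
apply: (le_trans (ler_pM _ _ Hp He)); rewrite ?expR_ge0//.
rewrite /C le_eqVlt; apply/orP; left; apply/eqP.
rewrite [u ^+ N.+1]exprS.
by field; rewrite expf_neq0 ?gt_eqF.
Qed.

Lemma smooth1_flat : smooth1 flat.
Proof.
move=> k x.
have [x0|x0|x0] := ltgtP x 0.
- have N : \forall z \near x, (cst 0 : R -> R) z = flat k z.
    have : \forall z \near x, z < 0 by apply: lt_nbhsl.
    by apply: filterS => z z0; rewrite /flat ltNge ltW.
  apply: near_eq_is_derive N _.
  have -> : flat k.+1 x = 0 by rewrite /flat ltNge ltW.
  exact: is_derive_cst.
- have N : \forall z \near x, (flat_poly k).[z^-1] * expR (- z^-1) = flat k z.
    have : \forall z \near x, 0 < z by apply: lt_nbhsr.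
    by apply: filterS => z z0; rewrite /flat z0.
  apply: near_eq_is_derive N _.
  have D1 : is_derive x 1 (fun z : R => z^-1) (- x ^- 2).
    split; first by apply: derivableV; [rewrite gt_eqF|exact: derivable_id].
    rewrite (@deriveV _ _ id) ?gt_eqF//.
    by rewrite derive_id /GRing.scale /= mulr1.
  have D2 : is_derive x 1 (fun z : R => (flat_poly k).[z^-1]) ((flat_poly k)^`().[x^-1] * (- x ^- 2)).
    exact: (@is_derive1_comp R (horner (flat_poly k)) (fun z => z^-1) x _ _ (is_derive_poly _ _) D1).
  have D3 : is_derive x 1 (fun z : R => - z^-1) (x ^- 2).
    by apply: is_derive_eq; rewrite opprK.
  have D4 : is_derive x 1 (fun z : R => expR (- z^-1)) (expR (- x^-1) * x ^- 2).
    exact: (@is_derive1_comp R expR (fun z => - z^-1) x _ _ (is_derive_expR _) D3).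
  apply: is_derive_eq (is_deriveM D2 D4) _.
  rewrite /flat x0 /= hornerM hornerXn !hornerE /GRing.scale /= exprVn.
  ring.
- rewrite x0; have -> : flat k.+1 0 = 0 by rewrite /flat ltxx.
  (* At u = 1/h the extra factor X absorbs the division by h, so the difference quotient at 0 is at
     most C h. *)
  have [C C0 HC] := horner_exp_bound ('X * flat_poly k).
  apply: is_derive_dist => e e0.
  exists (Num.min 1 (e / (C + 1))).
    by rewrite lt_min ltr01 divr_gt0// ltr_wpDl.
  move=> h; rewrite lt_min => /andP[h1 h2].
  rewrite add0r mulr0 subr0 {2}/flat ltxx subr0 /flat.
  case: ifP => h0; last by rewrite normr0 mulr_ge0// ltW.
  rewrite gtr0_norm// in h1 h2 *.
  have := HC h^-1 _; rewrite invr_ge1 ?unitfE ?gt_eqF// (ltW h1) => /(_ isT).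
  rewrite hornerM hornerX normrM gtr0_norm ?invr_gt0// invrK => H.
  rewrite normrM [X in _ * X]ger0_norm ?expR_ge0//.
  have : `|(flat_poly k).[h^-1]| * expR (- h^-1) <= C * h * h.
    by rewrite -ler_pdivrMr// mulrC mulrA; exact: H.
  move=> /le_trans; apply; rewrite ler_pM2r//.
  rewrite ltr_pdivlMr ?ltr_wpDl// in h2.
  by rewrite mulrC (le_trans _ (ltW h2))// ler_wpM2l ?lerDl// ltW.
Qed.

Lemma flat_gt0 (x : R) : 0 < x -> 0 < flat 0 x.
Proof. by move=> x0; rewrite /flat x0 hornerE mul1r expR_gt0. Qed.

Lemma flat_eq0 (x : R) : x <= 0 -> flat 0 x = 0.
Proof. by move=> x0; rewrite /flat ltNge x0. Qed.

Lemma flat_ge0 (x : R) : 0 <= flat 0 x.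
Proof. by case: (ltP 0 x) => [/flat_gt0/ltW//|/flat_eq0 ->]. Qed.

Section Bump.
Variable n : nat.
Local Notation V := 'rV[R]_n.

Definition cbump (y : V) : R := \prod_(a < n) (flat 0 (1 - y 0 a) * flat 0 (1 + y 0 a)).

Lemma sm_flat (f : V -> R) : smooth f -> smooth (fun y => flat 0 (f y)).
Proof. by move=> sf; apply: (sm_comp1 (F := flat)) => //; exact: smooth1_flat. Qed.

Lemma sm_cbump : smooth cbump.
Proof.
apply: sm_prod => a _; apply: sm_mul; apply: sm_flat.
  by apply: sm_sub; [exact: sm_cst|exact: sm_coord].
by apply: sm_add; [exact: sm_cst|exact: sm_coord].
Qed.

Lemma cbump_ge0 y : 0 <= cbump y.
Proof. by apply: prodr_ge0 => a _; rewrite mulr_ge0 ?flat_ge0. Qed.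

Lemma cbump_gt0 y : `|y| < 1 -> 0 < cbump y.
Proof.
move=> y1; apply: prodr_gt0 => a _.
have := le_lt_trans (norm_coord y a) y1; rewrite ltr_norml => /andP[h1 h2].
by rewrite mulr_gt0// flat_gt0//; lra.
Qed.

Lemma cbump_supp y : 1 <= `|y| -> cbump y = 0.
Proof.
move=> y1; have [a Ha] : exists a, 1 <= `|y 0 a|.
  apply/not_existsP => H; move: y1; rewrite leNgt => /negP; apply.
  by apply: norm_lt_coord => // a; rewrite ltNge; apply/negP/H.
rewrite /cbump (bigD1 a)//=.
have -> : flat 0 (1 - y 0 a) * flat 0 (1 + y 0 a) = 0; last by rewrite mul0r.
move: Ha; rewrite ler_normr => /orP[H|H].
  by rewrite [flat 0 (1 - _)]flat_eq0 ?mul0r//; lra.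
by rewrite (@flat_eq0 (1 + y 0 a)) ?mulr0//; lra.
Qed.

Lemma cbump_even y : cbump (- y) = cbump y.
Proof. by apply: eq_bigr => a _; rewrite mxE opprK mulrC. Qed.

(** A quotient A / (A + B), where A > 0 exactly for |s - c| < r2 and B > 0 exactly for |s - c| > r1.
    When r1 < r2 the denominator never vanishes. *)
Definition plateau1 (c r1 r2 s : R) : R :=
  let A := flat 0 (r2 - (s - c)) * flat 0 (r2 + (s - c)) in
  A / (A + (flat 0 ((s - c) - r1) + flat 0 (- (s - c) - r1))).

Definition plateau (c : V) (r1 r2 : R) (y : V) : R :=
  \prod_(a < n) plateau1 (c 0 a) r1 r2 (y 0 a).

Lemma plateau_den (c r1 r2 s : R) : r1 < r2 ->
  0 < flat 0 (r2 - (s - c)) * flat 0 (r2 + (s - c)) +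
   (flat 0 ((s - c) - r1) + flat 0 (- (s - c) - r1)).
Proof.
move=> r12; have p := @flat_ge0.
have [h1|h1] := ltP r1 (s - c).
  by rewrite ltr_wpDl ?mulr_ge0// ltr_pwDl// flat_gt0// subr_gt0.
have [h2|h2] := ltP r1 (- (s - c)).
  by rewrite ltr_wpDl ?mulr_ge0// ltr_wpDl// flat_gt0// subr_gt0.
by rewrite ltr_pwDl ?addr_ge0// mulr_gt0// flat_gt0//; lra.
Qed.

Lemma sm_plateau c r1 r2 : r1 < r2 -> smooth (plateau c r1 r2).
Proof.
move=> r12; apply: sm_prod => a _.
have S : smooth (fun y : V => y 0 a - c 0 a) by apply: sm_sub; [exact: sm_coord|exact: sm_cst].
have A : smooth (fun y : V => flat 0 (r2 - (y 0 a - c 0 a)) * flat 0 (r2 + (y 0 a - c 0 a))).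
  by apply: sm_mul; apply: sm_flat; [apply: sm_sub|apply: sm_add] => //; exact: sm_cst.
apply: sm_mul => //; apply: sm_inv.
  apply: sm_add => //; apply: sm_add; apply: sm_flat; apply: sm_sub => //; try exact: sm_cst.
  exact: sm_opp.
by move=> y; rewrite gt_eqF// plateau_den.
Qed.

Lemma plateau1_01 (c r1 r2 s : R) : r1 < r2 -> 0 <= plateau1 c r1 r2 s <= 1.
Proof.
move=> r12; have p := @flat_ge0; rewrite /plateau1 divr_ge0 ?mulr_ge0 ?(ltW (plateau_den _ _ _))//=.
by rewrite ler_pdivrMr ?plateau_den// mul1r lerDl addr_ge0.
Qed.

Lemma plateau_01 c r1 r2 y : r1 < r2 -> 0 <= plateau c r1 r2 y <= 1.
Proof.
move=> r12; apply/andP; split.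
  by apply: prodr_ge0 => a _; case/andP: (plateau1_01 (c 0 a) (y 0 a) r12).
have -> : 1 = \prod_(a < n) (1 : R) by rewrite big1.
by apply: ler_prod => a _; exact: plateau1_01.
Qed.

Lemma plateau_in c r1 r2 y : r1 < r2 -> `|y - c| <= r1 -> plateau c r1 r2 y = 1.
Proof.
move=> r12 yc; apply: big1 => a _; rewrite /plateau1.
have := le_trans (norm_coord (y - c) a) yc; rewrite !mxE ler_norml => /andP[h1 h2].
rewrite [flat 0 (_ - r1)]flat_eq0 ?subr_le0// [flat 0 (- _ - r1)]flat_eq0; last lra.
by rewrite !addr0 divff// mulf_neq0// gt_eqF// flat_gt0//; lra.
Qed.

Lemma plateau_out c r1 r2 y : 0 < r2 -> r2 <= `|y - c| -> plateau c r1 r2 y = 0.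
Proof.
move=> r20 yc.
have [a Ha] : exists a, r2 <= `|(y - c) 0 a|.
  apply/not_existsP => H; move: yc; rewrite leNgt => /negP; apply.
  by apply: norm_lt_coord => // a; rewrite ltNge; apply/negP/H.
rewrite /plateau (bigD1 a)//= /plateau1.
have -> : flat 0 (r2 - (y 0 a - c 0 a)) * flat 0 (r2 + (y 0 a - c 0 a)) = 0; last by rewrite !mul0r.
move: Ha; rewrite !mxE ler_normr => /orP[H|H].
  by rewrite [flat 0 (r2 - _)]flat_eq0 ?mul0r//; lra.
by rewrite (@flat_eq0 (r2 + (y 0 a - c 0 a))) ?mulr0//; lra.
Qed.
End Bump.
End FlatExp.

Section GlobalContinuity.
Variables (R : realType) (T : topologicalType).
Implicit Types f g : T -> R.

Lemma for_dist f x :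
  (forall e : R, 0 < e -> \forall z \near x, `|f z - f x| <= e) -> {for x, continuous f}.
Proof.
by move=> H; apply/cvgrPdist_le => e /H; apply: filterS => z; rewrite distrC.
Qed.

Lemma contD f g : continuous f -> continuous g -> continuous (fun x => f x + g x).
Proof. by move=> cf cg x; exact: (forD (cf x) (cg x)). Qed.

Lemma contB f g : continuous f -> continuous g -> continuous (fun x => f x - g x).
Proof. by move=> cf cg x; exact: (forB (cf x) (cg x)). Qed.

Lemma contN f : continuous f -> continuous (fun x => - f x).
Proof. by move=> cf x; exact: (forN (cf x)). Qed.

Lemma contM f g : continuous f -> continuous g -> continuous (fun x => f x * g x).
Proof. by move=> cf cg x; exact: (forM (cf x) (cg x)). Qed.

Lemma cont_cst (c : R) : continuous (fun _ : T => c).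
Proof. exact: cst_continuous. Qed.

Lemma contZ (c : R) f : continuous f -> continuous (fun x => c * f x).
Proof. by move=> cf; apply: contM cf; exact: cont_cst. Qed.

Lemma cont_abs f : continuous f -> continuous (fun x => `|f x|).
Proof. by move=> cf x; exact: (for_abs (cf x)). Qed.

Lemma cont_sum (I : Type) (s : seq I) (F : I -> T -> R) :
  (forall i, continuous (F i)) -> continuous (fun z => \sum_(i <- s) F i z).
Proof. by move=> H x; apply: (@for_sum R T I s F x) => i; exact: (H i x). Qed.

Lemma cont_comp (U : topologicalType) (G : U -> T) f :
  continuous G -> continuous f -> continuous (fun x => f (G x)).
Proof. by move=> cG cf x; exact: (continuous_comp (cG x) (cf (G x))). Qed.

End GlobalContinuity.

(** * Integrals over intervals and boxes, and their dependence on parameters *)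

Section OneDim.
Variable R : realType.
Local Notation mu := (@lebesgue_measure R).
Implicit Types (f g F : R -> R) (a b : R).

Lemma continuous_integrable f a b : continuous f ->
  mu.-integrable `[a, b] (EFin \o f).
Proof.
move=> cf; apply: continuous_compact_integrable; first exact: segment_compact.
exact: continuous_subspaceT.
Qed.

Lemma antiderivative f : continuous f -> forall a,
  exists F, forall x : R, a <= x -> is_derive x 1 F (f x).
Proof.
move=> cf a.
(* Starting at a - 1 makes a itself an interior point, so that the derivative there is two-sided. *)
exists (fun x => \int[mu]_(t in `[a - 1, x]) f t)%R => x ax.
have [] := @continuous_FTC1_closed R f (a - 1) x (x + 1).
- by rewrite ltrDl.
- exact: continuous_integrable.
- by rewrite (lt_le_trans _ ax)// ltrBlDr ltrDl.
- exact: cf.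
move=> d1 d2; apply: DeriveDef; first exact: d1.
by rewrite -derive1E; exact: d2.
Qed.

Lemma is_derive_within F a b f :
  (forall x : R, a <= x <= b -> is_derive x 1 F (f x)) ->
  {within `[a, b], continuous F}.
Proof.
move=> Hd; apply: derivable_within_continuous => x; rewrite in_itv /= => /Hd H.
exact: ex_derive.
Qed.

Lemma integral_FTC f F a b : continuous f -> a <= b ->
  (forall x : R, a <= x <= b -> is_derive x 1 F (f x)) ->
  (\int[mu]_(x in `[a, b]) (f x)%:E = (F b - F a)%:E)%E.
Proof.
move=> cf; rewrite le_eqVlt => /orP[/eqP <- _|ab Hd].
  by rewrite set_itv1 integral_set1// subrr.
rewrite (@continuous_FTC2 R f F)//.
- exact: continuous_subspaceT.
- have cF x : a <= x <= b -> {for x, continuous F}.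
    move=> /Hd[h _]; apply: differentiable_continuous; exact/derivable1_diffP.
  split.
  + by move=> x; rewrite in_itv /= => /andP[h1 h2]; have [] := Hd x; rewrite ?ltW.
  + by apply: cvg_at_right_filter; apply: cF; rewrite lexx ltW.
  + by apply: cvg_at_left_filter; apply: cF; rewrite lexx ltW.
- move=> x; rewrite in_itv /= => /andP[h1 h2].
  rewrite derive1E; have [|_ ->//] := Hd x; by rewrite !ltW.
Qed.

Definition J1 (A : R) f : R := (\int[mu]_(x in `[(- A)%R, A]) f x)%R.

Lemma J1E A f F : continuous f -> 0 <= A ->
  (forall x : R, - A <= x <= A -> is_derive x 1 F (f x)) ->
  J1 A f = F A - F (- A).
Proof.
move=> cf A0 Hd; rewrite /J1 /Rintegral (integral_FTC (F := F))//.
by rewrite (le_trans _ A0)// oppr_le0.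
Qed.

Lemma J1_ex A f : continuous f -> exists2 F,
  (forall x : R, - A <= x -> is_derive x 1 F (f x)) & (0 <= A -> J1 A f = F A - F (- A)).
Proof.
move=> cf; have [F HF] := antiderivative cf (- A).
exists F => // A0; apply: J1E => // x /andP[h _]; exact: HF.
Qed.

Lemma J1_EFin A f : continuous f ->
  (\int[mu]_(x in `[(- A)%R, A]) (f x)%:E = (J1 A f)%:E)%E.
Proof.
move=> cf; rewrite /J1 /Rintegral fineK//.
apply: integrable_fin_num => //; exact: continuous_integrable.
Qed.

Lemma J1_le A f g : continuous f -> continuous g -> 0 <= A ->
  (forall x, - A <= x <= A -> f x <= g x) -> J1 A f <= J1 A g.
Proof.
move=> cf cg A0 fg; apply: le_Rintegral => //; try exact: continuous_integrable.
Qed.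

Lemma J1_lin A (c : R) f g : continuous f -> continuous g -> 0 <= A ->
  J1 A (fun x => c * f x + g x) = c * J1 A f + J1 A g.
Proof.
move=> cf cg A0.
have [F HF ->//] := J1_ex A cf; have [G HG ->//] := J1_ex A cg.
have cfg : continuous (fun x => c * f x + g x).
  by apply: contD => //; exact: contZ.
have Hd x : - A <= x <= A -> is_derive x 1 (fun x => c * F x + G x) (c * f x + g x).
  move=> /andP[h _]; have hF := HF x h; have hG := HG x h.
  exact: (is_deriveD (is_deriveZ c hF) hG).
by rewrite (J1E cfg A0 Hd); ring.
Qed.

Lemma J1_cst A (c : R) : 0 <= A -> J1 A (fun=> c) = c * (2 * A).
Proof.
move=> A0; have cc : continuous (fun _ : R => c) by move=> x; apply: cst_continuous.
have Hd x : - A <= x <= A -> is_derive x 1 (fun x => 0 + x * c) c.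
  by move=> _; apply: is_derive_affine.
by rewrite (J1E cc A0 Hd); ring.
Qed.

Lemma integral_support A f : (forall x, A < `|x| -> f x = 0) ->
  (\int[mu]_x (f x)%:E = \int[mu]_(x in `[(- A)%R, A]) (f x)%:E)%E.
Proof.
move=> H; rewrite [RHS]integral_mkcond; apply: eq_integral => x _.
rewrite /patch; case: ifPn => // /negP xA; rewrite H//.
rewrite ltNge ler_norml; apply/negP => h; apply: xA.
by rewrite mem_setE in_itv.
Qed.

End OneDim.

Section UniformParameter.
Variables (R : realType) (X T : topologicalType).

Lemma cont_pairr (G : T * X -> R) t : continuous G -> continuous (fun x => G (t, x)).
Proof.
move=> cG; apply: (@cont_comp R _ X (fun x => (t, x)) G) => // x.
by apply: cvg_pair; [exact: cvg_cst|exact: cvg_id].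
Qed.

Lemma cont_pairl (G : T * X -> R) x : continuous G -> continuous (fun t => G (t, x)).
Proof.
move=> cG; apply: (@cont_comp R _ T (fun t => (t, x)) G) => // t.
by apply: cvg_pair; [exact: cvg_id|exact: cvg_cst].
Qed.

Lemma cont_swap (G : T * X -> R) : continuous G -> continuous (fun p : X * T => G (p.2, p.1)).
Proof.
move=> cG; apply: (@cont_comp R _ (X * T)%type (fun p => (p.2, p.1)) G) => // p.
by apply: cvg_pair; [exact: cvg_snd|exact: cvg_fst].
Qed.

(** The tube lemma: over a compact K, continuity in the parameter is uniform in x. *)
Lemma uniform_param (K : set X) (G : T * X -> R) (t : T) (e : R) :
  compact K -> continuous G -> 0 < e ->
  \forall t' \near t, forall x, K x -> `|G (t', x) - G (t, x)| <= e.
Proof.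
move=> /compact_near_coveringP cK cG e0.
have H : \forall t' \near t, K `<=` [set x | `|G (t', x) - G (t, x)| <= e].
  apply: cK => x Kx.
  have e2 : 0 < e / 2 by rewrite divr_gt0.
  have /cvgr_dist_le := cG (t, x); move=> /(_ _ e2) [[B1 B2] /= [n1 n2] HB].
  exists (B2, B1) => /=; first by split.
  move=> [x' t'] /= [b2 b1].
  have h1 := HB (t', x') (conj b1 b2).
  have h2 := HB (t, x') (conj (nbhs_singleton n1) b2).
  rewrite (le_trans (ler_distD (G (t, x)) _ _))// [leRHS]splitr.
  by apply: lerD; rewrite // distrC.
exact: H.
Qed.

End UniformParameter.

Section Functionals.
Variables (R : realType) (n : nat).
Local Notation V := 'rV[R]_n.

Definition linear_functional (w : (V -> R) -> R) :=
  forall (c : R) f g, continuous f -> continuous g ->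
    w (fun y => c * f y + g y) = c * w f + w g.

(** With linearity this describes measures of compact support. Box integrals, integration against a
    function of compact support and the cut-off solution [cutf T chi] are all of this kind, so that
    parameters, Fubini and convolution are treated once for all of them. *)
Definition sup_bounded (w : (V -> R) -> R) (A C : R) :=
  forall f m, continuous f -> 0 <= m -> (forall y, `|y| <= A -> `|f y| <= m) ->
    `|w f| <= C * m.

Lemma compact_box (A : R) : compact [set y : V | `|y| <= A].
Proof.
apply: bounded_closed_compact.
  by exists A; split; [exact: num_real|move=> x Ax y /= /le_trans; apply; exact: ltW].
apply: (@closed_comp _ _ (fun y : V => `|y|) [set x : R | x <= A]).
  by move=> x _; exact: norm_continuous.
exact: closed_le.
Qed.

Lemma lfun0 w : linear_functional w -> w (fun=> 0) = 0.
Proof.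
move=> /(_ 1 (fun=> 0) (fun=> 0) (@cont_cst _ _ _) (@cont_cst _ _ _)).
under eq_fun do rewrite mulr0 addr0.
by rewrite mul1r => /esym/eqP; rewrite -subr_eq0 addrK => /eqP.
Qed.

Lemma lfunZ w (c : R) f : linear_functional w -> continuous f -> w (fun y => c * f y) = c * w f.
Proof.
move=> wl cf; have := wl c f (fun=> 0) cf (@cont_cst _ _ _).
rewrite lfun0// addr0 => <-; congr w; apply/funext => y; by rewrite addr0.
Qed.

Lemma lfunB w f g : linear_functional w -> continuous f -> continuous g ->
  w (fun y => f y - g y) = w f - w g.
Proof.
move=> wl cf cg; have := wl (-1) g f cg cf.
by rewrite mulN1r addrC => <-; congr w; apply/funext => y; rewrite mulN1r addrC.
Qed.

Lemma sup_bounded_ge0 w A C : linear_functional w -> sup_bounded w A C -> 0 <= C.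
Proof.
move=> wl wb.
have z (y : V) : `|y| <= A -> `|(fun _ : V => 0 : R) y| <= 1 by rewrite normr0.
have := wb _ _ (@cont_cst R V 0) ler01 z.
by rewrite lfun0// normr0 mulr1.
Qed.

Lemma functional_param (T : topologicalType) w A C (G : T * V -> R) :
  linear_functional w -> sup_bounded w A C -> continuous G ->
  continuous (fun t => w (fun y => G (t, y))).
Proof.
move=> wl wb cG t.
have C0 := sup_bounded_ge0 wl wb.
have cGt t' : continuous (fun y => G (t', y)) by exact: cont_pairr.
apply/cvgrPdist_le => e e0.
(* C may be 0, hence the [C + 1]; the same device recurs in all later epsilon arguments. *)
have e1 : 0 < e / (C + 1) by rewrite divr_gt0// ltr_wpDl.
have := @uniform_param R V T _ G t _ (@compact_box A) cG e1.
apply: filterS => t' Ht'.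
rewrite distrC -lfunB//.
apply: (le_trans (wb _ (e / (C + 1)) _ _ _)) => //.
- exact: contB.
- exact: ltW.
- by rewrite mulrA ler_pdivrMr ?ltr_wpDl// mulrC ler_wpM2l ?lerDl// ltW.
Qed.

(** Fubini from the fundamental theorem of calculus. If [P s] is the integral of H over [-B, s],
    then [w (P s)] has derivative [w (H (s, .))], because w is continuous for the supremum norm, and
    it vanishes at s = -B. *)
Lemma functional_J1 w A C B (H : R * V -> R) :
  linear_functional w -> sup_bounded w A C -> continuous H -> 0 <= B ->
  J1 B (fun t => w (fun y => H (t, y))) = w (fun y => J1 B (fun t => H (t, y))).
Proof.
move=> wl wb cH B0.
have C0 := sup_bounded_ge0 wl wb.
have cHt t : continuous (fun y => H (t, y)).
  exact: cont_pairr.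
have cHy y : continuous (fun t => H (t, y)).
  exact: cont_pairl.
(* The margin 1 below -B keeps s + h in the domain of the antiderivative for |h| < 1. *)
have /choice[F HF] : forall y : V, exists F : R -> R,
    forall x : R, - (B + 1) <= x -> is_derive x 1 F (H (x, y)).
  by move=> y; have [F HF] := antiderivative (cHy y) (- (B + 1)); exists F.
pose P s y := F y s - F y (- B).
have incr y s t (c m : R) : - (B + 1) <= s -> - (B + 1) <= t ->
   (forall u, Num.min s t <= u <= Num.max s t -> `|H (u, y) - c| <= m) ->
   `|F y t - F y s - (t - s) * c| <= m * `|t - s|.
  move=> hs ht Hm.
  have -> : F y t - F y s - (t - s) * c = (F y t - (0 + t * c)) - (F y s - (0 + s * c)) by ring.
  apply: (@mvt_le_sym R (fun u => F y u - (0 + u * c)) (fun u => H (u, y) - c)) => // u /andP[u1 u2].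
  apply: is_deriveB; first by apply: HF; apply: le_trans u1; rewrite le_min hs.
  exact: is_derive_affine.
have PJ y : P B y = J1 B (fun t => H (t, y)).
  rewrite /P; apply/esym; apply: (J1E (cHy y) B0) => x /andP[h _]; apply: HF.
  by apply: le_trans h; rewrite lerN2 lerDl.
have cP s : - (B + 1) <= s -> continuous (P s).
  move=> hs y; apply: for_dist => e e0.
  have e1 : 0 < e / (`|s + B| + 1) by rewrite divr_gt0// ltr_wpDl.
  pose H' (p : V * R) := H (p.2, p.1).
  have cH' : continuous H' by exact: cont_swap.
  have := @uniform_param R R V _ H' y _ (@segment_compact _ (Num.min (- B) s) (Num.max (- B) s)) cH' e1.
  apply: filterS => y' Hy'.
  have -> : P s y' - P s y = (F y' s - F y s) - (F y' (- B) - F y (- B)).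
    by rewrite /P; ring.
  have hB : - (B + 1) <= - B by rewrite lerN2 lerDl.
  apply: (le_trans (@mvt_le_sym R (fun u => F y' u - F y u) (fun u => H (u, y') - H (u, y)) (- B) s
    (e / (`|s + B| + 1)) _ _)) => [u /andP[u1 u2]|u u12|].
  - have hu : - (B + 1) <= u by apply: le_trans u1; rewrite le_min hB.
    by apply: is_deriveB; apply: HF.
  - by apply: (Hy' u); rewrite /= in_itv.
  - rewrite opprK mulrAC ler_pdivrMr ?ltr_wpDl//.
    by rewrite ler_wpM2l ?lerDl// ltW.
have cw : continuous (fun t => w (fun y => H (t, y))) by exact: functional_param wb cH.
have D (s : R) : - B <= s <= B -> is_derive s 1 (fun s => w (P s)) (w (fun y => H (s, y))).
  move=> /andP[s1 s2]; apply: is_derive_dist => e e0.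
  have e1 : 0 < e / (C + 1) by rewrite divr_gt0// ltr_wpDl.
  have := @uniform_param R V R _ H s _ (@compact_box A) cH e1.
  move=> /nbhs_ballP[r /= r0 Hr].
  exists (Num.min 1 r); first by rewrite lt_min ltr01.
  move=> h; rewrite lt_min => /andP[h1 hr].
  have hs : - (B + 1) <= s by rewrite (le_trans _ s1)// lerN2 lerDl.
  have hsh : - (B + 1) <= s + h.
    by rewrite opprD lerD//; move: h1; rewrite ltr_norml => /andP[/ltW].
  have -> : w (P (s + h)) - w (P s) - h * w (fun y => H (s, y))
     = w (fun y => P (s + h) y - P s y - h * H (s, y)).
    have c1 : continuous (fun y => P (s + h) y - P s y) by apply: contB; exact: cP.
    rewrite (@lfunB w (fun y => P (s + h) y - P s y) (fun y => h * H (s, y)))//; last exact: contZ.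
    by rewrite (@lfunB w (P (s + h)) (P s)) ?lfunZ//; exact: cP.
  apply: (le_trans (wb _ (e / (C + 1) * `|h|) _ _ _)).
  - by apply: contB; [apply: contB; exact: cP|exact: contZ].
  - by rewrite mulr_ge0// ltW.
  - move=> y yA; have -> : P (s + h) y - P s y - h * H (s, y)
      = F y (s + h) - F y s - (s + h - s) * H (s, y) by rewrite /P; ring.
    have E : s + h - s = h by ring.
    rewrite -[X in _ <= _ * `|X|]E; apply: incr => // u u12; apply: Hr => //=.
    rewrite -ball_normE /=; apply: le_lt_trans hr.
    move: u12; case: (leP s (s + h)) => hh /andP[u1 u2].
      rewrite distrC ger0_norm ?subr_ge0// lerBlDl (le_trans u2)// lerD2l ler_norm//.
    rewrite ger0_norm ?subr_ge0//; have := ler_norm (- h); rewrite normrN; lra.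
  - rewrite mulrA ler_wpM2r// mulrA ler_pdivrMr ?ltr_wpDl// mulrC.
    by rewrite ler_wpM2l ?lerDl// ltW.
rewrite (J1E cw B0 D).
have -> : P (- B) = (fun=> 0) by apply/funext => y; rewrite /P subrr.
by rewrite lfun0// subr0; congr w; apply/funext => y; exact: PJ.
Qed.

End Functionals.

Section BoxIntegral.
Variable R : realType.

(** The same term as in the slices of [iint], so that box integrals and [iint] unfold alike. *)
Definition cns n (t : R) (v : 'rV[R]_n) : 'rV[R]_n.+1 := row_mx (t%:M : 'rV[R]_1) v.

Lemma cns0 n t (v : 'rV[R]_n) : cns t v 0 ord0 = t.
Proof.
rewrite /cns (_ : ord0 = lshift n (ord0 : 'I_1)); last by apply/val_inj.
by rewrite (row_mxEl (t%:M : 'rV[R]_1) v) mxE eqxx mulr1n.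
Qed.

Lemma cnsS n t (v : 'rV[R]_n) j : cns t v 0 (lift ord0 j) = v 0 j.
Proof.
rewrite /cns (_ : lift ord0 j = rshift 1 j); last by apply/val_inj.
by rewrite (row_mxEr (t%:M : 'rV[R]_1) v).
Qed.

Lemma cnsP n (y : 'rV[R]_n.+1) : exists t v, y = cns t v.
Proof.
exists (y 0 ord0), (\row_j y 0 (lift ord0 j)); apply/rowP => j.
by case: (unliftP ord0 j) => [k|] ->; rewrite ?cnsS ?cns0 ?mxE.
Qed.

Lemma norm_cns n t (v : 'rV[R]_n) : `|cns t v| = Num.max `|t| `|v|.
Proof.
apply/eqP; rewrite eq_le; apply/andP; split.
  apply: norm_le_coord; first by rewrite le_max normr_ge0.
  move=> a; case: (unliftP ord0 a) => [k|] ->; rewrite ?cnsS ?cns0 le_max ?lexx//.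
  by rewrite norm_coord orbT.
rewrite ge_max; apply/andP; split.
  by have := norm_coord (cns t v) ord0; rewrite cns0.
by apply: norm_le_coord => // a; have := norm_coord (cns t v) (lift ord0 a); rewrite cnsS.
Qed.

Lemma cont_pair (T U W : topologicalType) (f : T -> U) (g : T -> W) :
  continuous f -> continuous g -> continuous (fun x => (f x, g x)).
Proof. by move=> cf cg x; apply: cvg_pair; [exact: cf|exact: cg]. Qed.

Lemma cont_cns n (T : topologicalType) (a : T -> R) (b : T -> 'rV[R]_n) :
  continuous a -> continuous b -> continuous (fun x => cns (a x) (b x)).
Proof.
move=> ca cb x; apply: (@for_row R _ _ (fun x => cns (a x) (b x))) => j.
case: (unliftP ord0 j) => [k|] ->.
  have -> : (fun x => cns (a x) (b x) 0 (lift ord0 k)) = (fun x => b x 0 k).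
    by apply/funext => q; rewrite cnsS.
  exact: (cont_comp cb (@coord_continuous R 1 n 0 k)).
have -> : (fun x => cns (a x) (b x) 0 ord0) = a by apply/funext => q; rewrite cns0.
exact: ca.
Qed.

Lemma cont_fst (T U : topologicalType) : continuous (@fst T U).
Proof. by move=> p; exact: cvg_fst. Qed.

Lemma cont_snd (T U : topologicalType) : continuous (@snd T U).
Proof. by move=> p; exact: cvg_snd. Qed.

Fixpoint BI (A : R) n : ('rV[R]_n -> R) -> R :=
  match n return ('rV[R]_n -> R) -> R with
  | 0 => fun f => f 0
  | n'.+1 => fun f => J1 A (fun t => BI A (fun v : 'rV[R]_n' => f (cns t v)))
  end.

Lemma cont_slice n (f : 'rV[R]_n.+1 -> R) : continuous f ->
  continuous (fun p : R * 'rV[R]_n => f (cns p.1 p.2)).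
Proof.
move=> cf; apply: (cont_comp (G := fun p : R * 'rV[R]_n => cns p.1 p.2)) cf.
by apply: cont_cns; [exact: cont_fst|exact: cont_snd].
Qed.

Lemma cont_slice1 n (f : 'rV[R]_n.+1 -> R) t : continuous f -> continuous (fun v => f (cns t v)).
Proof. by move=> /cont_slice cf; exact: (cont_pairr (G := fun p : R * 'rV[R]_n => f (cns p.1 p.2))). Qed.

Lemma BI_functional A n : 0 <= A ->
  linear_functional (@BI A n) /\ sup_bounded (@BI A n) A ((2 * A) ^+ n).
Proof.
move=> A0; elim: n => [|n [IHl IHb]].
  split=> // f m _ m0 Hm; rewrite expr0 mul1r; apply: Hm; by rewrite normr0.
have cp f : continuous f -> continuous (fun t => BI A (fun v : 'rV[R]_n => f (cns t v))).
  move=> cf; apply: (functional_param IHl IHb (G := fun p => f (cns p.1 p.2))).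
  exact: cont_slice.
split.
  move=> c f g cf cg /=.
  rewrite -J1_lin//; try exact: cp.
  congr (J1 A _); apply/funext => t; apply: IHl; exact: cont_slice1.
move=> f m cf m0 Hm /=.
have M0 : 0 <= (2 * A) ^+ n * m by rewrite mulr_ge0// exprn_ge0// mulr_ge0.
have bnd t : - A <= t <= A -> `|BI A (fun v : 'rV[R]_n => f (cns t v))| <= (2 * A) ^+ n * m.
  move=> tA; apply: IHb => //; first exact: cont_slice1.
  move=> v vA; apply: Hm; rewrite norm_cns ge_max vA andbT ler_norml; exact: tA.
rewrite ler_norml; apply/andP; split.
  have := @J1_le R A (fun=> - ((2 * A) ^+ n * m)) _ (@cont_cst R R _) (cp f cf) A0.
  rewrite J1_cst// exprS => H.
  apply: le_trans (H _) => [|t /bnd]; last by rewrite ler_norml => /andP[].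
  by rewrite le_eqVlt; apply/orP; left; apply/eqP; ring.
have := @J1_le R A _ (fun=> ((2 * A) ^+ n * m)) (cp f cf) (@cont_cst R R _) A0.
rewrite J1_cst// exprS => H.
apply: le_trans (H _) _ => [t /bnd|]; first by rewrite ler_norml => /andP[].
by rewrite le_eqVlt; apply/orP; left; apply/eqP; ring.
Qed.

Lemma BI_param A n (T : topologicalType) (G : T * 'rV[R]_n -> R) : 0 <= A ->
  continuous G -> continuous (fun t => BI A (fun y => G (t, y))).
Proof. by move=> /(BI_functional n)[h1 h2]; exact: functional_param h2. Qed.

Lemma functional_BI m n (w : ('rV[R]_n -> R) -> R) A C B (G : 'rV[R]_m * 'rV[R]_n -> R) :
  linear_functional w -> sup_bounded w A C -> continuous G -> 0 <= B ->
  BI B (fun x => w (fun y => G (x, y))) = w (fun y => BI B (fun x => G (x, y))).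
Proof.
move=> wl wb cG B0; elim: m G cG => [//|m IH] G cG.
have cG1 t : continuous (fun p : 'rV[R]_m * 'rV[R]_n => G (cns t p.1, p.2)).
  apply: (@cont_comp R _ _ (fun p : 'rV[R]_m * 'rV[R]_n => (cns t p.1, p.2)) G) => //.
  apply: cont_pair; last exact: cont_snd.
  by apply: cont_cns; [exact: cont_cst|exact: cont_fst].
rewrite /=.
have -> : (fun t => BI B (fun v : 'rV[R]_m => w (fun y => G (cns t v, y)))) =
    (fun t => w (fun y => BI B (fun v => G (cns t v, y)))).
  by apply/funext => t; apply: (IH (fun p => G (cns t p.1, p.2))).
apply: (functional_J1 (H := fun p => BI B (fun v => G (cns p.1 v, p.2))) wl wb) => //.
apply: (BI_param (G := fun q : (R * 'rV[R]_n) * 'rV[R]_m => G (cns q.1.1 q.2, q.1.2))) => //.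
apply: (cont_comp (G := fun q : (R * 'rV[R]_n) * 'rV[R]_m => (cns q.1.1 q.2, q.1.2))) cG.
have c1 : continuous (fun q : (R * 'rV[R]_n) * 'rV[R]_m => q.1) by exact: cont_fst.
apply: cont_pair; last by move=> q; apply: (continuous_comp (f := fst) (g := snd)); [exact: cont_fst|exact: cont_snd].
apply: cont_cns; last exact: cont_snd.
by move=> q; apply: (continuous_comp (f := fst) (g := fst)); [exact: cont_fst|exact: cont_fst].
Qed.

Lemma BI_ge0 A n (f : 'rV[R]_n -> R) : 0 <= A -> continuous f ->
  (forall y, `|y| <= A -> 0 <= f y) -> 0 <= BI A f.
Proof.
move=> A0; elim: n f => [|n IH] f cf f0; first by apply: f0; rewrite normr0.
rewrite -(mul0r (2 * A)) -(J1_cst 0 A0) /=; apply: J1_le => //; first exact: cont_cst.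
  apply: (BI_param (G := fun p => f (cns p.1 p.2))) => //; exact: cont_slice.
move=> t tA; apply: IH; first exact: cont_slice1.
move=> v vA; apply: f0; rewrite norm_cns ge_max vA andbT ler_norml; exact: tA.
Qed.

Lemma iint_BI A n (f : 'rV[R]_n -> R) : 0 <= A -> continuous f ->
  (forall y, A < `|y| -> f y = 0) -> iint (fun y => (f y)%:E) = (BI A f)%:E.
Proof.
move=> A0; elim: n f => [//|n IH] f cf f0 /=.
have E t : iint (fun v : 'rV[R]_n => (f (cns t v))%:E) = (BI A (fun v => f (cns t v)))%:E.
  apply: IH; first exact: cont_slice1.
  by move=> v vA; apply: f0; rewrite norm_cns lt_max vA orbT.
under eq_integral => t _ do rewrite E.
rewrite (@integral_support R A (fun t => BI A (fun v : 'rV[R]_n => f (cns t v)))).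
  apply: J1_EFin; apply: (BI_param (G := fun p => f (cns p.1 p.2))) => //; exact: cont_slice.
move=> t tA; have -> : (fun v : 'rV[R]_n => f (cns t v)) = (fun=> 0).
  by apply/funext => v; apply: f0; rewrite norm_cns lt_max tA.
exact: lfun0 (BI_functional n A0).1.
Qed.

End BoxIntegral.

Section OneDimMore.
Variable R : realType.
Implicit Types f k : R -> R.

(** An antiderivative of k is constant on either side of the support, so the end points produced by
    the substitution may be moved out to those of one larger interval. *)
Lemma J1_affine A D (c h : R) k : c != 0 -> 0 <= D ->
  continuous k -> (forall x, A < `|x| -> k x = 0) ->
  A <= D -> A <= `|c| * D - `|h| -> 0 <= A ->
  J1 D (fun t => k (c * t + h)) = `|c|^-1 * J1 D k.
Proof.
move=> c0 D0 ck sk AD ADc A0.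
have [F HF] := antiderivative ck (- (`|c| * D + `|h| + D)).
have B0 : 0 <= `|c| * D + `|h| by rewrite addr_ge0// mulr_ge0.
have flat s t : - (`|c| * D + `|h| + D) <= s -> s <= t ->
    (forall u, s <= u <= t -> A <= `|u|) -> F s = F t.
  move=> hs st Hu.
  (* The support only settles |u| > A; at |u| = A the value is 0 by continuity. *)
  have k0 u : s <= u <= t -> k u = 0.
    move=> /Hu; rewrite le_eqVlt => /orP[/eqP E|/sk//].
    have ck0 : {for u, continuous k} by exact: ck.
    apply/eqP; rewrite -normr_le0; apply/ler_addgt0Pr => e e0; rewrite add0r.
    move/cvgr_dist_le: ck0 => /(_ _ e0) /nbhs_ballP[r /= r0 Hr].
    pose u' := if 0 <= u then u + r / 2 else u - r / 2.
    have /Hr : ball u r u'.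
      rewrite -ball_normE /= /u'; case: ifP => _; rewrite opprD ?opprK addrA subrr add0r ?normrN gtr0_norm; lra.
    have -> : k u' = 0; last by rewrite subr0.
    apply: sk; rewrite E /u'; case: ifPn => [u0|].
      by rewrite (ger0_norm u0) ger0_norm; lra.
    by rewrite -ltNge => u0; rewrite (ltr0_norm u0) ltr0_norm; lra.
  apply/esym/eqP; rewrite -subr_eq0 -normr_le0.
  have := @mvt_le R F k s t 0 _ _ st; rewrite mul0r; apply.
    by move=> u /andP[u1 _]; apply: HF; apply: le_trans u1.
  by move=> u /k0 ->; rewrite normr0.
have cc : continuous (fun t => k (c * t + h)).
  apply: (cont_comp (G := fun t => c * t + h)) => //.
  by apply: contD; [apply: contZ => x; exact: cvg_id|exact: cont_cst].
have Dc : forall x : R, - D <= x <= D -> is_derive x 1 (fun t => c^-1 * F (c * t + h)) (k (c * x + h)).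
  move=> x /andP[x1 x2].
  have hx : - (`|c| * D + `|h| + D) <= c * x + h.
    have : `|c * x| <= `|c| * D by rewrite normrM ler_wpM2l// ler_norml x1.
    rewrite ler_norml => /andP[h1 _]; have := ler_norm (- h); rewrite normrN; lra.
  have d1 : is_derive x 1 (fun t => c * t + h) c.
    have := is_derive_affine h c x; rewrite (_ : (fun r => h + r * c) = (fun t => c * t + h))//.
    by apply/funext => t; rewrite addrC mulrC.
  have d2 := @is_derive1_comp R F (fun t => c * t + h) x _ _ (HF _ hx) d1.
  apply: is_derive_eq (is_deriveZ c^-1 d2) _.
  by rewrite /GRing.scale /= mulrCA mulVf// mulr1.
have Dk : forall x : R, - D <= x <= D -> is_derive x 1 F (k x).
  move=> x /andP[x1 x2]; apply: HF; apply: le_trans x1; rewrite lerN2; lra.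
rewrite (J1E cc D0 Dc) (J1E ck D0 Dk).
have pD : F D = F (`|c| * D + `|h| + D).
  by apply: flat => [||u /andP[u1 u2]]; rewrite ?(le_trans _ (ler_norm u))//; lra.
have nD : F (- D) = F (- (`|c| * D + `|h| + D)).
  apply/esym; apply: flat => [//||u /andP[u1 u2]]; first lra.
  by have := ler_norm (- u); rewrite normrN; lra.
have hh := ler_norm h; have hn : - `|h| <= h by rewrite lerNl -normrN ler_norm.
have [cp|cn] := ltP 0 c.
  rewrite gtr0_norm// in B0 HF flat pD nD hh hn ADc Dk Dc *.
  have -> : F (c * D + h) = F (c * D + `|h| + D).
    by apply: flat => [||u /andP[u1 u2]]; rewrite ?(le_trans _ (ler_norm u))//; lra.
  have -> : F (c * - D + h) = F (- (c * D + `|h| + D)).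
    apply/esym; apply: flat => [//||u /andP[u1 u2]]; first lra.
    by have := ler_norm (- u); rewrite normrN; lra.
  by rewrite pD nD; ring.
have cn' : c < 0 by rewrite lt_neqAle c0.
rewrite ltr0_norm// in B0 HF flat pD nD hh hn ADc Dk Dc *.
have -> : F (c * D + h) = F (- (- c * D + `|h| + D)).
  apply/esym; apply: flat => [//||u /andP[u1 u2]]; first lra.
  by have := ler_norm (- u); rewrite normrN; lra.
have -> : F (c * - D + h) = F (- c * D + `|h| + D).
  by apply: flat => [||u /andP[u1 u2]]; rewrite ?(le_trans _ (ler_norm u))//; lra.
by rewrite pD nD invrN; ring.
Qed.

(** The antiderivative is nondecreasing with equal end values, hence constant, and k is its
    derivative. *)
Lemma J1_eq0 A k (s : R) : continuous k -> (forall x, - A <= x <= A -> 0 <= k x) ->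
  J1 A k = 0 -> `|s| < A -> k s = 0.
Proof.
move=> ck k0 J0; rewrite ltr_norml => /andP[s1 s2].
have A0 : 0 <= A by lra.
have [F HF JF] := J1_ex A ck.
have mono x y : - A <= x -> x <= y -> y <= A -> F x <= F y.
  move=> x1 xy y1.
  have HFx z : x <= z <= y -> is_derive z 1 F (k z).
    by case/andP => z1 z2; apply: HF; apply: le_trans z1.
  have [|c /[!in_itv]/= /andP[c1 c2] E] := @MVT_segment R F k x y xy _ (is_derive_within HFx).
    by move=> z /[!in_itv]/= /andP[z1 z2]; apply: HFx; rewrite !ltW.
  rewrite -subr_ge0 E mulr_ge0 ?subr_ge0// k0// (le_trans x1 c1)//=; lra.
have FA : F A = F (- A) by apply/eqP; rewrite -subr_eq0 -JF// J0.
have cF x : - A <= x -> x <= A -> F x = F A.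
  move=> x1 x2; apply/eqP; rewrite eq_le; apply/andP; split; first exact: mono.
  by rewrite FA; apply: mono.
have near_cst : \forall z \near s, (cst (F A)) z = F z.
  apply/nbhs_ballP; exists (Num.min (s + A) (A - s)).
    by rewrite /= lt_min; apply/andP; split; lra.
  move=> z; rewrite -ball_normE /= lt_min !ltr_norml => /andP[/andP[z1 z2] /andP[z3 z4]].
  by rewrite [RHS]cF//; lra.
have D1 : is_derive s 1 F 0.
  by apply: near_eq_is_derive near_cst _; exact: is_derive_cst.
have [_ <-] := HF s (ltW s1).
by case: D1.
Qed.

End OneDimMore.

(** * The integral of compactly supported continuous functions *)

Section Integral.
Variables (R : realType).

Definition supp n (A : R) (f : 'rV[R]_n -> R) := forall y, A < `|y| -> f y = 0.
Definition Cc n (f : 'rV[R]_n -> R) := continuous f /\ exists A, supp A f.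
Definition I n (f : 'rV[R]_n -> R) : R := fine (iint (fun y => (f y)%:E)).

Section Basic.
Variable n : nat.
Local Notation V := 'rV[R]_n.
Implicit Types f g : V -> R.

Lemma Cc_cont f : Cc f -> continuous f. Proof. by case. Qed.

Lemma supp_le A B f : A <= B -> supp A f -> supp B f.
Proof. by move=> AB sf y /(le_lt_trans AB) /sf. Qed.

Lemma Cc_supp f : Cc f -> exists2 A, 0 <= A & supp A f.
Proof.
move=> [_ [A sA]]; exists (Num.max 0 A); first by rewrite le_max lexx.
by apply: supp_le sA; rewrite le_max lexx orbT.
Qed.

Lemma Cc_supp2 f g : Cc f -> Cc g -> exists A, [/\ 0 <= A, supp A f & supp A g].
Proof.
move=> /Cc_supp[A A0 sA] /Cc_supp[B B0 sB]; exists (Num.max A B); split.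
- by rewrite le_max A0.
- by apply: supp_le sA; rewrite le_max lexx.
- by apply: supp_le sB; rewrite le_max lexx orbT.
Qed.

Lemma CcD f g : Cc f -> Cc g -> Cc (fun y => f y + g y).
Proof.
move=> Cf Cg; have [A [A0 sf sg]] := Cc_supp2 Cf Cg.
split; first by apply: contD; exact: Cc_cont.
by exists A => y Ay; rewrite sf// sg// addr0.
Qed.

Lemma CcMl f g : continuous f -> Cc g -> Cc (fun y => f y * g y).
Proof.
move=> cf [cg [A sA]]; split; first exact: contM.
by exists A => y /sA ->; rewrite mulr0.
Qed.

Lemma CcMr f g : Cc f -> continuous g -> Cc (fun y => f y * g y).
Proof.
move=> [cf [A sA]] cg; split; first exact: contM.
by exists A => y /sA ->; rewrite mul0r.
Qed.

Lemma CcZ (c : R) f : Cc f -> Cc (fun y => c * f y).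
Proof. by apply: CcMl; exact: cont_cst. Qed.

Lemma CcN f : Cc f -> Cc (fun y => - f y).
Proof. by move=> [cf [A sA]]; split; [exact: contN|exists A => y /sA ->; rewrite oppr0]. Qed.

Lemma CcB f g : Cc f -> Cc g -> Cc (fun y => f y - g y).
Proof. by move=> Cf Cg; apply: CcD => //; exact: CcN. Qed.

Lemma Cc0 : Cc (fun _ : V => 0).
Proof. by split; [exact: cont_cst|exists 0]. Qed.

Lemma Cc_sum (T : Type) (s : seq T) (F : T -> V -> R) :
  (forall i, Cc (F i)) -> Cc (fun y => \sum_(i <- s) F i y).
Proof.
move=> H; elim: s => [|i s IH].
  by under eq_fun do rewrite big_nil; exact: Cc0.
by under eq_fun do rewrite big_cons; exact: CcD.
Qed.

Lemma Cc_sq f : Cc f -> Cc (fun y => f y ^+ 2).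
Proof. by move=> Cf; apply: CcMr => //; exact: Cc_cont. Qed.

Lemma Cc_abs f : Cc f -> Cc (fun y => `|f y|).
Proof. by move=> [cf [A sA]]; split; [exact: cont_abs|exists A => y /sA ->; rewrite normr0]. Qed.

Lemma I_BI A f : 0 <= A -> continuous f -> supp A f -> I f = BI A f.
Proof. by move=> A0 cf sA; rewrite /I (iint_BI A0 cf sA). Qed.

Lemma iint_I f : Cc f -> iint (fun y => (f y)%:E) = (I f)%:E.
Proof.
move=> Cf; have [A A0 sA] := Cc_supp Cf.
by rewrite (I_BI A0 (Cc_cont Cf) sA) (iint_BI A0 (Cc_cont Cf) sA).
Qed.

Lemma I_lin (c : R) f g : Cc f -> Cc g -> I (fun y => c * f y + g y) = c * I f + I g.
Proof.
move=> Cf Cg; have [A [A0 sf sg]] := Cc_supp2 Cf Cg.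
rewrite !(I_BI A0)//; try exact: Cc_cont.
- by apply: (BI_functional n A0).1; exact: Cc_cont.
- by apply: contD; [apply: contZ|]; exact: Cc_cont.
- by move=> y Ay; rewrite sf// sg// mulr0 addr0.
Qed.

Lemma I0 : I (fun _ : V => 0) = 0.
Proof.
have := I_lin 1 Cc0 Cc0.
under eq_fun do rewrite mulr0 addr0.
by rewrite mul1r => /esym/eqP; rewrite -subr_eq0 addrK => /eqP.
Qed.

Lemma I_scal (c : R) f : Cc f -> I (fun y => c * f y) = c * I f.
Proof.
by move=> Cf; have := I_lin c Cf Cc0; under eq_fun do rewrite addr0; rewrite I0 addr0.
Qed.

Lemma I_add f g : Cc f -> Cc g -> I (fun y => f y + g y) = I f + I g.
Proof.
by move=> Cf Cg; have := I_lin 1 Cf Cg; under eq_fun do rewrite mul1r; rewrite mul1r.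
Qed.

Lemma I_opp f : Cc f -> I (fun y => - f y) = - I f.
Proof. by move=> Cf; have := I_scal (-1) Cf; under eq_fun do rewrite mulN1r; rewrite mulN1r. Qed.

Lemma I_sub f g : Cc f -> Cc g -> I (fun y => f y - g y) = I f - I g.
Proof. by move=> Cf Cg; rewrite I_add ?I_opp//; exact: CcN. Qed.

Lemma I_sum (T : Type) (s : seq T) (F : T -> V -> R) : (forall i, Cc (F i)) ->
  I (fun y => \sum_(i <- s) F i y) = \sum_(i <- s) I (F i).
Proof.
move=> H; elim: s => [|i s IH].
  by under eq_fun do rewrite big_nil; rewrite I0 big_nil.
under eq_fun do rewrite big_cons.
by rewrite big_cons I_add ?IH//; exact: Cc_sum.
Qed.

Lemma I_ge0 f : Cc f -> (forall y, 0 <= f y) -> 0 <= I f.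
Proof.
move=> Cf f0; have [A A0 sA] := Cc_supp Cf.
by rewrite (I_BI A0 (Cc_cont Cf) sA); apply: BI_ge0 => //; exact: Cc_cont.
Qed.

Lemma I_le f g : Cc f -> Cc g -> (forall y, f y <= g y) -> I f <= I g.
Proof.
move=> Cf Cg fg; rewrite -subr_ge0 -I_sub//; apply: I_ge0; first exact: CcB.
by move=> y; rewrite subr_ge0.
Qed.

Lemma I_abs f : Cc f -> `|I f| <= I (fun y => `|f y|).
Proof.
move=> Cf; rewrite ler_norml; apply/andP; split; last first.
  by apply: I_le => // [|y]; [exact: Cc_abs|exact: ler_norm].
rewrite -I_opp; last exact: Cc_abs.
apply: I_le => // [|y]; first by apply: CcN; exact: Cc_abs.
by rewrite lerNl -normrN ler_norm.
Qed.

Lemma I_bound A m f : 0 <= A -> 0 <= m -> continuous f -> supp A f ->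
  (forall y, `|y| <= A -> `|f y| <= m) -> `|I f| <= (2 * A) ^+ n * m.
Proof.
by move=> A0 m0 cf sf Hm; rewrite (I_BI A0 cf sf); apply: (BI_functional n A0).2.
Qed.

End Basic.

Lemma BI_eq0 A n (f : 'rV[R]_n -> R) : 0 < A -> continuous f -> (forall y, `|y| <= A -> 0 <= f y) ->
  BI A f = 0 -> forall y, `|y| < A -> f y = 0.
Proof.
move=> A0; elim: n f => [|n IH] f cf f0 If y yA.
  by rewrite (_ : y = 0)//; apply/rowP => -[].
have [t [v E]] := cnsP y; move: yA; rewrite E norm_cns gt_max => /andP[tA vA].
have cp : continuous (fun t => BI A (fun v : 'rV[R]_n => f (cns t v))).
  apply: (BI_param (G := fun p => f (cns p.1 p.2))); first exact: ltW.
  exact: cont_slice.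
apply: (IH (fun v => f (cns t v))) => //; first exact: cont_slice1.
  by move=> u uA; apply: f0; rewrite norm_cns ge_max uA ltW.
apply: (J1_eq0 cp _ If tA) => s sA.
apply: BI_ge0; [exact: ltW|exact: cont_slice1|move=> u uA].
by apply: f0; rewrite norm_cns ge_max uA andbT ler_norml.
Qed.

Lemma I_eq0 n (f : 'rV[R]_n -> R) : Cc f -> (forall y, 0 <= f y) -> I f = 0 -> forall y, f y = 0.
Proof.
move=> Cf f0 If y; have [A A0 sA] := Cc_supp Cf.
have B0 : 0 < A + `|y| + 1 by rewrite ltr_wpDl// addr_ge0.
apply: (@BI_eq0 (A + `|y| + 1) n f B0 (Cc_cont Cf)) => [//||]; last by lra.
rewrite -(I_BI (ltW B0) (Cc_cont Cf)) => //.
by apply: supp_le sA; rewrite -addrA lerDl addr_ge0.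
Qed.

Lemma I_gt0 n (f : 'rV[R]_n -> R) y : Cc f -> (forall y, 0 <= f y) -> 0 < f y -> 0 < I f.
Proof.
move=> Cf f0 fy; rewrite lt_neqAle I_ge0// andbT; apply/eqP => /esym If.
by move: fy; rewrite (I_eq0 Cf f0 If) ltxx.
Qed.

Lemma cont_affine n (c : R) (h : 'rV[R]_n) : continuous (fun y : 'rV[R]_n => c *: y + h).
Proof.
move=> y; apply: (@for_row R _ _ (fun y : 'rV[R]_n => c *: y + h)) => a.
have -> : (fun z : 'rV[R]_n => (c *: z + h) 0 a) = (fun z => c * z 0 a + h 0 a).
  by apply/funext => z; rewrite !mxE.
have : continuous (fun z : 'rV[R]_n => c * z 0 a + h 0 a).
  by apply: contD; [apply: contZ; exact: coord_continuous|exact: cont_cst].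
exact.
Qed.

Lemma BI_affine n A D (c : R) (h : 'rV[R]_n) f : c != 0 -> continuous f -> supp A f ->
  0 <= A -> A <= D -> A <= `|c| * D - `|h| ->
  BI D (fun y => f (c *: y + h)) = `|c| ^- n * BI D f.
Proof.
move=> c0 + + A0 AD; have D0 := le_trans A0 AD.
elim: n h f => [|n IH] h f cf sf ADc.
  by rewrite /= expr0 invr1 mul1r (_ : _ + _ = 0)//; apply/rowP => -[].
have [h0 [h' E]] := cnsP h; have : `|h| = Num.max `|h0| `|h'| by rewrite E norm_cns.
move=> hm; have hh0 : `|h0| <= `|h| by rewrite hm le_max lexx.
have hh' : `|h'| <= `|h| by rewrite hm le_max lexx orbT.
have Ec t (v : 'rV[R]_n) : c *: cns t v + h = cns (c * t + h0) (c *: v + h').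
  rewrite E; apply/rowP => j; case: (unliftP ord0 j) => [k|] ->.
    by rewrite mxE mxE !cnsS !mxE.
  by rewrite mxE mxE !cns0.
rewrite /=.
have -> : (fun t => BI D (fun v : 'rV[R]_n => f (c *: cns t v + h))) =
   (fun t => `|c| ^- n * BI D (fun v => f (cns (c * t + h0) v))).
  apply/funext => t; under eq_fun do rewrite Ec.
  apply: (IH h' (fun v => f (cns (c * t + h0) v))).
  - exact: cont_slice1.
  - by move=> v vA; apply: sf; rewrite norm_cns lt_max vA orbT.
  - lra.
pose k t := BI D (fun v : 'rV[R]_n => f (cns t v)).
have ck : continuous k.
  apply: (BI_param (G := fun p => f (cns p.1 p.2))) => //; exact: cont_slice.
have sk t : A < `|t| -> k t = 0.
  move=> tA; rewrite /k (_ : (fun v => _) = (fun=> 0)).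
    exact: lfun0 (BI_functional n D0).1.
  by apply/funext => v; apply: sf; rewrite norm_cns lt_max tA.
have -> : (fun t => `|c| ^- n * BI D (fun v : 'rV[R]_n => f (cns (c * t + h0) v)))
   = (fun t => `|c| ^- n * k (c * t + h0) + 0) by apply/funext => t; rewrite addr0.
have ckc : continuous (fun t => k (c * t + h0)).
  apply: (cont_comp (G := fun t => c * t + h0)) => //.
  by apply: contD; [apply: contZ => x; exact: cvg_id|exact: cont_cst].
rewrite J1_lin//; last exact: cont_cst.
rewrite J1_cst// mul0r addr0 (J1_affine c0 D0 ck sk) //; last lra.
by rewrite mulrA exprSr invfM [_^-1 * _]mulrC.
Qed.

Section Invariance.
Variable n : nat.
Local Notation V := 'rV[R]_n.
Implicit Types f g : V -> R.

Lemma Cc_affine (c : R) (h : V) f : c != 0 -> Cc f -> Cc (fun y => f (c *: y + h)).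
Proof.
move=> c0 Cf; have [A A0 sA] := Cc_supp Cf.
split; first exact: (@cont_comp R _ _ (fun y : V => c *: y + h) f (@cont_affine _ c h) (Cc_cont Cf)).
exists ((A + `|h|) / `|c|) => y; rewrite ltr_pdivrMr ?normr_gt0// => H; apply: sA.
have := ler_normB (c *: y + h) h; rewrite addrK normrZ mulrC => H2.
by rewrite -(ltrD2r `|h|); apply: lt_le_trans H H2.
Qed.

Lemma I_affine (c : R) (h : V) f : c != 0 -> Cc f ->
  I (fun y => f (c *: y + h)) = `|c| ^- n * I f.
Proof.
move=> c0 Cf; have Cf' := Cc_affine h c0 Cf.
have [A A0 sA] := Cc_supp Cf; have [B [B0 sf sf']] := Cc_supp2 Cf Cf'.
have cp : 0 < `|c| by rewrite normr_gt0.
pose D := Num.max B ((B + `|h|) / `|c|).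
have D0 : 0 <= D by rewrite le_max B0.
have BD : B <= D by rewrite le_max lexx.
rewrite !(I_BI D0)//; try exact: Cc_cont; try exact: supp_le BD _.
apply: (BI_affine c0 (Cc_cont Cf) sf) => //.
have : (B + `|h|) / `|c| <= D by rewrite le_max lexx orbT.
rewrite ler_pdivrMr// mulrC; lra.
Qed.

Lemma I_shift (h : V) f : Cc f -> I (fun y => f (y + h)) = I f.
Proof.
move=> Cf; have := I_affine h (oner_neq0 R) Cf.
by under eq_fun do rewrite scale1r; rewrite normr1 expr1n invr1 mul1r.
Qed.

Lemma Cc_shift (h : V) f : Cc f -> Cc (fun y => f (y + h)).
Proof. by move=> Cf; have := Cc_affine h (oner_neq0 R) Cf; under eq_fun do rewrite scale1r. Qed.

Lemma N1_neq0 : (-1 : R) != 0. Proof. by rewrite oppr_eq0 oner_eq0. Qed.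

Lemma I_reflect (h : V) f : Cc f -> I (fun y => f (h - y)) = I f.
Proof.
move=> Cf; have := I_affine h N1_neq0 Cf.
by under eq_fun do rewrite scaleN1r addrC; rewrite normrN1 expr1n invr1 mul1r.
Qed.

Lemma Cc_reflect (h : V) f : Cc f -> Cc (fun y => f (h - y)).
Proof. by move=> Cf; have := Cc_affine h N1_neq0 Cf; under eq_fun do rewrite scaleN1r addrC. Qed.

End Invariance.
End Integral.

Section Fubini.
Variables (R : realType) (m n : nat).
Local Notation U := 'rV[R]_m.
Local Notation V := 'rV[R]_n.
Implicit Types F : U * V -> R.

Definition supp2 A F := forall x y, A < `|x| \/ A < `|y| -> F (x, y) = 0.

Lemma supp2_le A B F : A <= B -> supp2 A F -> supp2 B F.
Proof. by move=> AB sF x y [h|h]; apply: sF; [left|right]; exact: le_lt_trans h. Qed.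

Lemma I_sliceE A F : 0 <= A -> continuous F -> supp2 A F ->
  (fun x => I (fun y => F (x, y))) = (fun x => BI A (fun y => F (x, y))).
Proof.
move=> A0 cF sF; apply/funext => x; apply: I_BI => //; first exact: cont_pairr.
by move=> y yA; apply: sF; right.
Qed.

Lemma Cc_I A F : continuous F -> supp2 A F -> Cc (fun x => I (fun y => F (x, y))).
Proof.
move=> cF /(supp2_le (B := Num.max 0 A)) sF.
have {}sF : supp2 (Num.max 0 A) F by apply: sF; rewrite le_max lexx orbT.
have A0 : 0 <= Num.max 0 A by rewrite le_max lexx.
rewrite (I_sliceE A0)//; split; first exact: BI_param.
exists (Num.max 0 A) => x xA; rewrite (_ : (fun y => _) = (fun=> 0)).
  exact: lfun0 (BI_functional n A0).1.
by apply/funext => y; apply: sF; left.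
Qed.

End Fubini.

Lemma I_swap (R : realType) (m n : nat) (A : R) (F : 'rV[R]_m * 'rV[R]_n -> R) :
  continuous F -> supp2 A F ->
  I (fun x => I (fun y => F (x, y))) = I (fun y => I (fun x => F (x, y))).
Proof.
move=> cF /(supp2_le (B := Num.max 0 A)) sF.
have {}sF : supp2 (Num.max 0 A) F by apply: sF; rewrite le_max lexx orbT.
have A0 : 0 <= Num.max 0 A by rewrite le_max lexx.
set B := Num.max 0 A in A0 sF.
have sF' : supp2 B (fun p => F (p.2, p.1)) by move=> x y /= H; apply: sF; case: H; [right|left].
have cF' := cont_swap cF.
have c1 := Cc_cont (Cc_I cF sF); have c2 := Cc_cont (Cc_I cF' sF').
have s1 : supp B (fun x => I (fun y => F (x, y))).
  move=> x xB; rewrite (_ : (fun y => _) = (fun=> 0)) ?I0//.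
  by apply/funext => y; apply: sF; left.
have s2 : supp B (fun y => I (fun x => F (x, y))).
  move=> y yB; rewrite (_ : (fun x => _) = (fun=> 0)) ?I0//.
  by apply/funext => x; apply: sF; right.
rewrite (I_BI A0 c1 s1) (I_BI A0 c2 s2).
rewrite (I_sliceE A0 cF sF) (I_sliceE A0 cF' sF') /=.
have [wl wb] := BI_functional n A0.
exact: (functional_BI wl wb cF A0).
Qed.

Section FunctionalDerivative.
Variables (R : realType) (n : nat).
Local Notation V := 'rV[R]_n.

Lemma functional_derive (w : (V -> R) -> R) A C (G G' : R * V -> R) :
  linear_functional w -> sup_bounded w A C -> continuous G -> continuous G' ->
  (forall (s : R) y, is_derive s 1 (fun t => G (t, y)) (G' (s, y))) ->
  forall s : R, is_derive s 1 (fun t => w (fun y => G (t, y))) (w (fun y => G' (s, y))).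
Proof.
move=> wl wb cG cG' HG s; have C0 := sup_bounded_ge0 wl wb.
apply: is_derive_dist => e e0.
have e1 : 0 < e / (C + 1) by rewrite divr_gt0// ltr_wpDl.
have := @uniform_param R V R _ G' s _ (@compact_box R n A) cG' e1.
move=> /nbhs_ballP[r /= r0 Hr].
exists r => // h hr.
have c1 t : continuous (fun y => G (t, y)) by exact: cont_pairr.
have c2 t : continuous (fun y => G' (t, y)) by exact: cont_pairr.
have c3 : continuous (fun y => G (s + h, y) - G (s, y)) by exact: contB.
have -> : w (fun y => G (s + h, y)) - w (fun y => G (s, y)) - h * w (fun y => G' (s, y))
   = w (fun y => G (s + h, y) - G (s, y) - h * G' (s, y)).
  rewrite (@lfunB _ _ w (fun y => G (s + h, y) - G (s, y)) (fun y => h * G' (s, y)))//; last exact: contZ.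
  by rewrite (@lfunB _ _ w (fun y => G (s + h, y)))// lfunZ.
apply: (le_trans (wb _ (e / (C + 1) * `|h|) _ _ _)).
- by apply: contB => //; exact: contZ.
- by rewrite mulr_ge0// ltW.
- move=> y yA.
  have -> : G (s + h, y) - G (s, y) - h * G' (s, y)
      = (G (s + h, y) - (0 + (s + h) * G' (s, y))) - (G (s, y) - (0 + s * G' (s, y))) by ring.
  have E : s + h - s = h by ring.
  rewrite -[X in _ <= _ * `|X|]E.
  apply: (@mvt_le_sym R (fun t => G (t, y) - (0 + t * G' (s, y))) (fun t => G' (t, y) - G' (s, y))).
    by move=> t _; apply: is_deriveB; exact: is_derive_affine.
  move=> u u12; apply: Hr => //=.
  rewrite -ball_normE /=; apply: le_lt_trans hr.
  move: u12; case: (leP s (s + h)) => hh /andP[u1 u2].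
    rewrite distrC ger0_norm ?subr_ge0// lerBlDl (le_trans u2)// lerD2l ler_norm//.
  rewrite ger0_norm ?subr_ge0//; have := ler_norm (- h); rewrite normrN; lra.
- rewrite mulrA ler_wpM2r// mulrA ler_pdivrMr ?ltr_wpDl// mulrC.
  by rewrite ler_wpM2l ?lerDl// ltW.
Qed.

Lemma cont_line (f : V -> R) (v : V) : continuous f ->
  continuous (fun p : R * V => f (p.2 + p.1 *: v)).
Proof.
move=> cf; apply: (@cont_comp R _ _ (fun p : R * V => p.2 + p.1 *: v) f) => // p.
apply: (@for_row R _ _ (fun p : R * V => p.2 + p.1 *: v)) => a.
have -> : (fun q : R * V => (q.2 + q.1 *: v) 0 a) = (fun q => q.2 0 a + q.1 * v 0 a).
  by apply/funext => q; rewrite !mxE.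
have : continuous (fun q : R * V => q.2 0 a + q.1 * v 0 a).
  apply: contD.
    exact: (@cont_comp R _ _ (fun q : R * V => q.2) (fun v : V => v 0 a) (@cont_snd _ _) (@coord_continuous R 1 n 0 a)).
  by apply: contM; [exact: cont_fst|exact: cont_cst].
exact.
Qed.

Lemma supp_partial A f a : supp A f -> supp A (@partial R n a f).
Proof.
move=> sf y yA; rewrite (@partial_near R n f (fun=> 0)) ?partial_cst//.
have : \forall z \near y, A < `|z|.
  have := @norm_continuous R V y; move/cvgr_gt => /(_ _ yA); exact.
by apply: filterS => z; apply: sf.
Qed.

Lemma Cc_partial f a : smooth f -> Cc f -> Cc (@partial R n a f).
Proof.
move=> sf [_ [A sA]]; split; first by apply: sm_cont; exact: sm_partial.
by exists A; exact: supp_partial.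
Qed.

(** Translation invariance of the integral, differentiated at t = 0 under the integral sign. *)
Lemma I_partial f a : smooth f -> Cc f -> I (@partial R n a f) = 0.
Proof.
move=> sf Cf; have [A A0 sA] := Cc_supp Cf.
(* The margin 1 keeps the translates with |t| < 1 inside one fixed box. *)
pose B := A + 1; have B0 : 0 <= B by rewrite addr_ge0.
have AB : A <= B by rewrite lerDl.
have [wl wb] := BI_functional (R := R) n B0.
have cf := sm_cont sf; have cf' := sm_cont (sm_partial a sf).
have D := functional_derive (G := fun p => f (p.2 + p.1 *: unitv R a))
  (G' := fun p => partial a f (p.2 + p.1 *: unitv R a)) wl wb (@cont_line f (unitv R a) cf)
  (@cont_line _ (unitv R a) cf') (fun s y => line_derive a y s sf) 0.
have E : (fun y => partial a f (y + 0 *: unitv R a)) = partial a f.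
  by apply/funext => y; rewrite scale0r addr0.
rewrite /= E in D.
rewrite (I_BI B0 cf'); last by apply: supp_partial; exact: supp_le AB sA.
have N : \forall t \near (0 : R), cst (I f) t = BI B (fun y => f (y + t *: unitv R a)).
  apply/nbhs_ballP; exists 1 => //= t; rewrite -ball_normE /= sub0r normrN => t1.
  rewrite -(I_shift (t *: unitv R a) Cf); apply: I_BI => //; first exact: Cc_cont (Cc_shift _ Cf).
  move=> y yB; apply: sA.
  have : `|t *: unitv R a| <= 1.
    by rewrite normrZ mulr_ile1// ?norm_unitv// ltW.
  have := ler_normB (y + t *: unitv R a) (t *: unitv R a); rewrite addrK /B in yB *; lra.
have := near_eq_is_derive N (is_derive_cst (I f) (0 : R) 1).
by move=> [_ <-]; case: D.
Qed.

Lemma I_parts (f g : V -> R) (a : 'I_n) : smooth f -> smooth g -> Cc g ->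
  I (fun y => f y * partial a g y) = - I (fun y => partial a f y * g y).
Proof.
move=> sf sg Cg.
have := I_partial a (sm_mul sf sg) (CcMl (sm_cont sf) Cg).
have -> : partial a (fun y => f y * g y) = (fun y => partial a f y * g y + f y * partial a g y).
  by apply/funext => y; rewrite partialM.
rewrite I_add; last 2 first.
- by apply: CcMl => //; apply: sm_cont; exact: sm_partial.
- by apply: CcMl; [exact: sm_cont|exact: Cc_partial].
by move/eqP; rewrite addrC addr_eq0 => /eqP.
Qed.

End FunctionalDerivative.

(** * Cauchy-Schwarz and the Schur test *)

Section L2.
Variables (R : realType).

Lemma quadratic_disc (a b c : R) : 0 <= c -> (forall t : R, 0 <= a + 2 * t * b + t ^+ 2 * c) -> b ^+ 2 <= a * c.
Proof.
move=> c0 H; move: c0; rewrite le_eqVlt => /orP[/eqP c0|c0].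
  have a0 : 0 <= a by have := H 0; rewrite mulr0 mul0r expr0n /= mul0r !addr0.
  rewrite -c0 mulr0; have [->|b0] := eqVneq b 0; first by rewrite expr0n.
  have := H (- (a + 1) / (2 * b)).
  have -> : a + 2 * (- (a + 1) / (2 * b)) * b + (- (a + 1) / (2 * b)) ^+ 2 * c = -1.
    by rewrite -c0; field.
  by rewrite lerNr oppr0 ler10.
have := H (- b / c).
have -> : a + 2 * (- b / c) * b + (- b / c) ^+ 2 * c = (a * c - b ^+ 2) / c.
  by field; rewrite gt_eqF.
by rewrite pmulr_lge0 ?invr_gt0// subr_ge0.
Qed.

Variable n : nat.
Local Notation V := 'rV[R]_n.
Implicit Types (f g rho : V -> R).

(** The weight serves twice: a plateau equal to 1 on the supports gives the plain inequality, a
    convolution kernel gives the Schur test. *)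
Lemma weighted_CS rho f g : Cc rho -> (forall y, 0 <= rho y) -> continuous f -> continuous g ->
  (I (fun y => rho y * (f y * g y))) ^+ 2 <=
  I (fun y => rho y * f y ^+ 2) * I (fun y => rho y * g y ^+ 2).
Proof.
move=> Cr r0 cf cg.
have C1 : Cc (fun y => rho y * f y ^+ 2) by apply: CcMr => //; apply: contM.
have C2 : Cc (fun y => rho y * g y ^+ 2) by apply: CcMr => //; apply: contM.
have C3 : Cc (fun y => rho y * (f y * g y)) by apply: CcMr => //; apply: contM.
apply: quadratic_disc.
  by apply: I_ge0 => // y; rewrite mulr_ge0// sqr_ge0.
move=> t; rewrite -!I_scal// -!I_add//; try exact: CcZ; last by apply: CcD => //; exact: CcZ.
apply: I_ge0; first by apply: CcD; [apply: CcD|]; rewrite //; exact: CcZ.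
move=> y; rewrite (_ : _ + _ = rho y * (f y + t * g y) ^+ 2); first by rewrite mulr_ge0// sqr_ge0.
ring.
Qed.

Definition nrm f := Num.sqrt (I (fun y => f y ^+ 2)).

Lemma nrm_ge0 f : 0 <= nrm f. Proof. exact: sqrtr_ge0. Qed.

Lemma I_sq_ge0 f : Cc f -> 0 <= I (fun y => f y ^+ 2).
Proof. by move=> Cf; apply: I_ge0 => [|y]; [exact: Cc_sq|exact: sqr_ge0]. Qed.

Lemma nrm_sq f : Cc f -> nrm f ^+ 2 = I (fun y => f y ^+ 2).
Proof. by move=> Cf; rewrite sqr_sqrtr// I_sq_ge0. Qed.

Lemma plateau_Cc A : exists rho : V -> R, [/\ Cc rho, smooth rho,
  (forall y, 0 <= rho y <= 1) & forall y, `|y| <= A -> rho y = 1].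
Proof.
have AB : Num.max 0 A < Num.max 0 A + 1 by rewrite ltrDl.
have p : 0 < Num.max 0 A + 1 by rewrite ltr_wpDl// le_max lexx.
exists (plateau 0 (Num.max 0 A) (Num.max 0 A + 1)); split.
- split; first exact: sm_cont (sm_plateau _ AB).
  by exists (Num.max 0 A + 1) => y yA; rewrite plateau_out// subr0 ltW.
- exact: sm_plateau.
- by move=> y; exact: plateau_01.
- by move=> y yA; rewrite plateau_in// subr0 le_max yA orbT.
Qed.

Lemma cauchy_schwarz_I f g : Cc f -> Cc g -> `|I (fun y => f y * g y)| <= nrm f * nrm g.
Proof.
move=> Cf Cg; have [A [A0 sf sg]] := Cc_supp2 Cf Cg.
have [rho [Cr _ r01 r1]] := plateau_Cc A.
have E h : supp A h -> (fun y => rho y * h y) = h.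
  move=> sh; apply/funext => y; case: (leP `|y| A) => [/r1 ->|/sh ->]; by rewrite ?mul1r ?mulr0.
have := weighted_CS Cr (fun y => proj1 (andP (r01 y))) (Cc_cont Cf) (Cc_cont Cg).
rewrite !E; first last.
- by move=> y /sf ->; rewrite mul0r.
- by move=> y /sf ->; rewrite expr0n.
- by move=> y /sg ->; rewrite expr0n.
rewrite -(nrm_sq Cf) -(nrm_sq Cg) -exprMn => H.
by rewrite -ler_sqr ?nnegrE ?mulr_ge0 ?nrm_ge0// real_normK ?num_real.
Qed.

Lemma nrm_le f g : Cc f -> Cc g -> (forall y, `|f y| <= `|g y|) -> nrm f <= nrm g.
Proof.
move=> Cf Cg fg; rewrite ler_wsqrtr//; apply: I_le; [exact: Cc_sq|exact: Cc_sq|].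
by move=> y; rewrite -[f y ^+ 2]real_normK ?num_real// -[g y ^+ 2]real_normK ?num_real// lerXn2r ?nnegrE.
Qed.

Lemma nrmZ (c : R) f : Cc f -> nrm (fun y => c * f y) = `|c| * nrm f.
Proof.
move=> Cf; rewrite /nrm; under eq_fun do rewrite exprMn.
by rewrite I_scal; [rewrite sqrtrM ?sqr_ge0// sqrtr_sqr|exact: Cc_sq].
Qed.

Lemma nrmD f g : Cc f -> Cc g -> nrm (fun y => f y + g y) <= nrm f + nrm g.
Proof.
move=> Cf Cg; rewrite -ler_sqr ?nnegrE ?addr_ge0 ?nrm_ge0//.
rewrite nrm_sq; last exact: CcD.
have -> : (fun y => (f y + g y) ^+ 2) = (fun y => (f y ^+ 2 + 2 * (f y * g y)) + g y ^+ 2).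
  by apply/funext => y; ring.
have C3 : Cc (fun y => f y * g y) by apply: CcMr => //; exact: Cc_cont.
rewrite I_add ?I_add ?I_scal//; try exact: Cc_sq; try exact: CcZ; last first.
  by apply: CcD; [exact: Cc_sq|exact: CcZ].
rewrite -!nrm_sq// sqrrD lerD2r lerD2l -[leRHS]mulr_natl ler_pM2l//.
exact: le_trans (ler_norm _) (cauchy_schwarz_I Cf Cg).
Qed.

Lemma nrmN f : nrm (fun y => - f y) = nrm f.
Proof. by rewrite /nrm; under eq_fun do rewrite sqrrN. Qed.

Lemma nrmB f g : Cc f -> Cc g -> nrm (fun y => f y - g y) <= nrm f + nrm g.
Proof. by move=> Cf Cg; rewrite -(nrmN g); apply: nrmD => //; exact: CcN. Qed.

Lemma nrm0 : nrm (fun=> 0) = 0.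
Proof. by rewrite /nrm; under eq_fun do rewrite expr0n; rewrite I0 sqrtr0. Qed.

Lemma nrm_sum (T : Type) (s : seq T) (F : T -> V -> R) : (forall i, Cc (F i)) ->
  nrm (fun y => \sum_(i <- s) F i y) <= \sum_(i <- s) nrm (F i).
Proof.
move=> H; elim: s => [|i s IH].
  by under eq_fun do rewrite big_nil; rewrite nrm0 big_nil.
under eq_fun do rewrite big_cons.
by rewrite big_cons (le_trans (nrmD _ _))// ?lerD2l//; exact: Cc_sum.
Qed.

Lemma nrm_eq0 f : Cc f -> nrm f = 0 -> forall y, f y = 0.
Proof.
move=> Cf /eqP; rewrite sqrtr_eq0 => If y; apply/eqP; rewrite -sqrf_eq0; apply/eqP.
apply: (I_eq0 (f := fun y => f y ^+ 2)); first exact: Cc_sq.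
  by move=> z; exact: sqr_ge0.
by apply/eqP; rewrite eq_le If I_sq_ge0.
Qed.

Lemma nrm_bound A m f : 0 <= A -> 0 <= m -> continuous f -> supp A f ->
  (forall y, `|y| <= A -> `|f y| <= m) -> nrm f <= Num.sqrt ((2 * A) ^+ n) * m.
Proof.
move=> A0 m0 cf sf Hm.
rewrite -{1}(ger0_norm m0) -sqrtr_sqr -sqrtrM ?exprn_ge0 ?mulr_ge0// ler_wsqrtr//.
apply: le_trans (ler_norm _) _; apply: I_bound => //; first exact: sqr_ge0.
- exact: contM.
- by move=> y /sf ->; rewrite expr0n.
- by move=> y /Hm H; rewrite ger0_norm ?sqr_ge0// -real_normK ?num_real// lerXn2r ?nnegrE.
Qed.

(** Duality with a single test vector: a function defined through a functional is tested against
    itself. *)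
Lemma nrm_dual f (C : R) : Cc f -> 0 <= C -> `|I (fun y => f y * f y)| <= C * nrm f -> nrm f <= C.
Proof.
move=> Cf C0; have -> : (fun y => f y * f y) = (fun y => f y ^+ 2) by apply/funext => y; rewrite expr2.
rewrite -nrm_sq// ger0_norm ?sqr_ge0// expr2.
have := nrm_ge0 f; rewrite le_eqVlt => /orP[/eqP <- //|n0]; by rewrite ler_pM2r.
Qed.

Lemma cont_diff (f : V -> R) : continuous f -> continuous (fun p : V * V => f (p.1 - p.2)).
Proof.
move=> cf; apply: (@cont_comp R _ _ (fun p : V * V => p.1 - p.2) f) => // p.
apply: (@for_row R _ _ (fun p : V * V => p.1 - p.2)) => a.
have -> : (fun q : V * V => (q.1 - q.2) 0 a) = (fun q => q.1 0 a - q.2 0 a).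
  by apply/funext => q; rewrite !mxE.
have : continuous (fun q : V * V => q.1 0 a - q.2 0 a).
  apply: contB.
    exact: (@cont_comp R _ _ (fun q : V * V => q.1) (fun v : V => v 0 a) (@cont_fst _ _) (@coord_continuous R 1 n 0 a)).
  exact: (@cont_comp R _ _ (fun q : V * V => q.2) (fun v : V => v 0 a) (@cont_snd _ _) (@coord_continuous R 1 n 0 a)).
exact.
Qed.

Lemma supp2_diff A B rho g : supp A rho -> supp B g -> 0 <= A -> 0 <= B ->
  supp2 (A + B) (fun p : V * V => rho (p.1 - p.2) * g p.1).
Proof.
move=> sr sg A0 B0 x y /= H.
have [xB|xB] := ltP B `|x|; first by rewrite sg// mulr0.
case: H => H; first by lra.
rewrite sr ?mul0r//.
have := ler_normD (y - x) x; rewrite subrK distrC; lra.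
Qed.

Lemma cont_fst1 (g : V -> R) : continuous g -> continuous (fun p : V * V => g p.1).
Proof. exact: (cont_comp (@cont_fst _ _)). Qed.

Lemma cont_snd2 (g : V -> R) : continuous g -> continuous (fun p : V * V => g p.2).
Proof. exact: (cont_comp (@cont_snd _ _)). Qed.

(** Cauchy-Schwarz with weight rho(x - y) for each y, followed by an integration in y and an
    exchange of the two integrals. *)
Lemma schur (r : V * V -> R) rho g : continuous r -> Cc rho -> Cc g ->
  (forall x y, `|r (x, y)| <= rho (x - y)) ->
  Cc (fun y => I (fun x => r (x, y) * g x)) /\
  nrm (fun y => I (fun x => r (x, y) * g x)) <= I rho * nrm g.
Proof.
move=> cr Cr Cg Hr.
have [A A0 sA] := Cc_supp Cr; have [B B0 sB] := Cc_supp Cg.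
have r0 y : 0 <= rho y by rewrite -[y]subr0; exact: le_trans (normr_ge0 _) (Hr y 0).
have cg1 := cont_fst1 (Cc_cont Cg).
have cF : continuous (fun p : V * V => r p * g p.1) by exact: contM.
have s2 h : (forall x, B < `|x| -> h x = 0) -> supp2 (A + B) (fun p : V * V => rho (p.1 - p.2) * h p.1).
  by move=> sh; apply: supp2_diff.
have sF : supp2 (A + B) (fun p : V * V => r p * g p.1).
  move=> x y H; have := s2 g sB x y H => /=.
  move/eqP; rewrite mulf_eq0 => /orP[/eqP E|/eqP ->]; last by rewrite mulr0.
  have := Hr x y; rewrite E normr_le0 => /eqP ->; by rewrite mul0r.
have Cq : Cc (fun y => I (fun x => r (x, y) * g x)).
  apply: (@Cc_I R n n (A + B) (fun p => r (p.2, p.1) * g p.2)).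
    exact: (cont_swap cF).
  by move=> x y H; apply: (sF y x); case: H; [right|left].
split=> //.
rewrite -ler_sqr ?nnegrE ?mulr_ge0 ?nrm_ge0 ?I_ge0// exprMn !nrm_sq//.
have cD : continuous (fun p : V * V => rho (p.1 - p.2)) by apply: cont_diff; exact: Cc_cont.
have cD2 : continuous (fun p : V * V => rho (p.1 - p.2) * g p.1 ^+ 2).
  by apply: contM => //; apply: contM.
have sD2 : supp2 (A + B) (fun p : V * V => rho (p.1 - p.2) * g p.1 ^+ 2).
  by apply: (s2 (fun x => g x ^+ 2)) => x /sB ->; rewrite expr0n.
have Crh y : Cc (fun x => rho (x - y)).
  exact: (Cc_shift (- y) Cr).
have pw y : I (fun x => r (x, y) * g x) ^+ 2 <= I rho * I (fun x => rho (x - y) * g x ^+ 2).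
  have E : I rho = I (fun x => rho (x - y) * (fun _ : V => 1 : R) x ^+ 2).
    rewrite -(I_shift (- y) Cr); congr I; apply/funext => x; by rewrite expr1n mulr1.
  rewrite E; have -> : (fun x => rho (x - y) * g x ^+ 2) = (fun x => rho (x - y) * `|g x| ^+ 2).
    by apply/funext => x; rewrite real_normK ?num_real.
  apply: le_trans (weighted_CS (Crh y) (fun x => r0 _) (@cont_cst R V 1) (cont_abs (Cc_cont Cg))).
  have C1 : Cc (fun x => r (x, y) * g x) by apply: CcMl => //; exact: cont_pairl.
  have C2 : Cc (fun x => rho (x - y) * (1 * `|g x|)).
    by apply: CcMr => //; apply: contM; [exact: cont_cst|exact: cont_abs (Cc_cont Cg)].
  rewrite -[leLHS]real_normK ?num_real// lerXn2r ?nnegrE//.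
    by apply: I_ge0 => // x; rewrite mul1r mulr_ge0.
  apply: le_trans (I_abs C1) _; apply: I_le => // [|x]; first exact: Cc_abs.
  by rewrite normrM mul1r ler_wpM2r.
have cI := Cc_I (cont_swap cD2) (A := A + B) (fun x y H => sD2 y x ((or_comm _ _).1 H)).
rewrite /= in cI.
apply: le_trans (I_le (Cc_sq Cq) (CcZ (I rho) cI) pw) _.
rewrite I_scal// expr2 -mulrA ler_wpM2l ?I_ge0//.
rewrite -(I_swap cD2 sD2) /=.
have -> : (fun x => I (fun y => rho (x - y) * g x ^+ 2)) = (fun x => I rho * g x ^+ 2).
  apply/funext => x; under eq_fun do rewrite mulrC.
  rewrite I_scal ?I_reflect 1?mulrC//; exact: Cc_reflect.
by rewrite I_scal//; exact: Cc_sq.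
Qed.

End L2.

(** * Convolution of functionals, dilations and mollifiers *)

Section Convolution.
Variables (R : realType) (n : nat).
Local Notation V := 'rV[R]_n.

Lemma sm_affine (f : V -> R) (c : R) (h : V) : smooth f -> smooth (fun y => f (c *: y + h)).
Proof.
move=> sf k; apply: (@Ck_comp R n n k setT setT f (fun y => c *: y + h)) => //.
- exact: openT.
- exact: openT.
- move=> b; have -> : (fun y : V => (c *: y + h) 0 b) = (fun y => c * y 0 b + h 0 b).
    by apply/funext => y; rewrite !mxE.
  have : smooth (fun y : V => c * y 0 b + h 0 b).
    by apply: sm_add; [apply: sm_scal; exact: sm_coord|exact: sm_cst].
  exact.
Qed.

Lemma partial_affine (f : V -> R) (c : R) (h y : V) a : smooth f ->
  partial a (fun y => f (c *: y + h)) y = c * partial a f (c *: y + h).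
Proof.
move=> sf; apply: is_derive_partial.
have H := @chain_rule R n n setT f (fun y => c *: y + h) y (unitv R a) (c *: unitv R a)
  openT (sf 1%N) Logic.I.
apply: is_derive_eq (H _) _ => [b|].
  have -> : (fun z : V => (c *: z + h) 0 b) = (fun z => c * z 0 b + h 0 b).
    by apply/funext => z; rewrite !mxE.
  have sl : smooth (fun z : V => c * z 0 b + h 0 b).
    by apply: sm_add; [apply: sm_scal; exact: sm_coord|exact: sm_cst].
  apply: is_derive_eq (sm_derive a y sl) _.
  rewrite partialD ?partialZ ?partial_cst ?partial_coord ?addr0 ?mxE ?eqxx ?[b == a]eq_sym//; try exact: sm_coord; try exact: sm_cst.
  by apply: sm_scal; exact: sm_coord.
rewrite /grad_app (bigD1 a)//= big1 ?addr0 => [|b ba].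
  by rewrite !mxE !eqxx mulr1.
by rewrite !mxE eqxx /= (negbTE ba) mulr0 mul0r.
Qed.

Lemma sm_refl (f : V -> R) (x : V) : smooth f -> smooth (fun y => f (x - y)).
Proof. by move=> /(sm_affine (-1) x); under eq_fun do rewrite scaleN1r addrC. Qed.

Lemma partial_refl (f : V -> R) (x y : V) a : smooth f ->
  partial a (fun y => f (x - y)) y = - partial a f (x - y).
Proof.
move=> sf; have := partial_affine (-1) x y a sf.
by under eq_fun do rewrite scaleN1r addrC; rewrite scaleN1r mulN1r addrC.
Qed.

Implicit Types (z : V -> R) (t : R).

Definition dil t z : V -> R := fun y => t ^- n * z (t^-1 *: y).

Lemma dilE t z : dil t z = fun y => t ^- n * z (t^-1 *: y + 0).
Proof. by apply/funext => y; rewrite addr0. Qed.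

Lemma sm_dil t z : smooth z -> smooth (dil t z).
Proof. by move=> sz; rewrite dilE; apply: sm_scal; exact: sm_affine. Qed.

Lemma Cc_dil t z : 0 < t -> Cc z -> Cc (dil t z).
Proof. by move=> t0 Cz; rewrite dilE; apply: CcZ; apply: Cc_affine => //; rewrite invr_neq0// gt_eqF. Qed.

Lemma supp_dil t A z : 0 < t -> supp A z -> supp (t * A) (dil t z).
Proof.
move=> t0 sz y; rewrite mulrC -ltr_pdivlMr// => H.
rewrite /dil sz ?mulr0// normrZ gtr0_norm ?invr_gt0// mulrC; exact: H.
Qed.

Lemma I_dil t z : 0 < t -> Cc z -> I (dil t z) = I z.
Proof.
move=> t0 Cz; rewrite dilE I_scal; last by apply: Cc_affine => //; rewrite invr_neq0// gt_eqF.
rewrite I_affine ?invr_neq0 ?gt_eqF// gtr0_norm ?invr_gt0//.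
by rewrite exprVn invrK mulrA mulVf ?mul1r// expf_neq0// gt_eqF.
Qed.

Lemma dil_abs t z : 0 < t -> (fun y => `|dil t z y|) = dil t (fun y => `|z y|).
Proof.
move=> t0; apply/funext => y; rewrite /dil normrM ger0_norm//.
by rewrite invr_ge0 exprn_ge0// ltW.
Qed.

Lemma partial_dil t z a : smooth z ->
  partial a (dil t z) = (fun y => t^-1 * dil t (partial a z) y).
Proof.
move=> sz; apply/funext => y; rewrite dilE partialZ ?partial_affine//; last exact: sm_affine.
by rewrite /dil addr0 mulrCA.
Qed.

Lemma dil_coord t z a : t != 0 ->
  (fun y : V => y 0 a * dil t z y) = (fun y => t * dil t (fun y => y 0 a * z y) y).
Proof. by move=> t0; apply/funext => y; rewrite /dil !mxE; field; rewrite expf_neq0 ?t0. Qed.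

Lemma dil_norm2 t z : 0 < t ->
  (fun y : V => `|y| ^+ 2 * dil t z y) = (fun y => t ^+ 2 * dil t (fun y => `|y| ^+ 2 * z y) y).
Proof.
move=> t0; apply/funext => y; rewrite /dil normrZ gtr0_norm ?invr_gt0//.
by field; rewrite expf_neq0 ?gt_eqF.
Qed.

Lemma I_cbump_gt0 : 0 < I (@cbump R n).
Proof.
apply: (@I_gt0 R n _ 0).
- split; first exact: sm_cont (@sm_cbump R n).
  by exists 1 => y y1; apply: cbump_supp; exact: ltW.
- exact: cbump_ge0.
- by apply: cbump_gt0; rewrite normr0.
Qed.

Definition moll : V -> R := fun y => (I (@cbump R n))^-1 * cbump y.

Lemma sm_moll : smooth moll. Proof. by apply: sm_scal; exact: sm_cbump. Qed.

Lemma moll_supp y : 1 <= `|y| -> moll y = 0.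
Proof. by move=> y1; rewrite /moll cbump_supp ?mulr0. Qed.

Lemma supp_moll : supp 1 moll. Proof. by move=> y /ltW /moll_supp. Qed.

Lemma Cc_moll : Cc moll.
Proof. by split; [exact: sm_cont sm_moll|exists 1; exact: supp_moll]. Qed.

Lemma moll_ge0 y : 0 <= moll y.
Proof. by rewrite mulr_ge0 ?cbump_ge0// invr_ge0 ltW// I_cbump_gt0. Qed.

Lemma moll_even y : moll (- y) = moll y. Proof. by rewrite /moll cbump_even. Qed.

Lemma I_moll : I moll = 1.
Proof.
rewrite I_scal ?mulVf//; first by rewrite gt_eqF// I_cbump_gt0.
split; first exact: sm_cont (@sm_cbump R n).
by exists 1 => y y1; apply: cbump_supp; exact: ltW.
Qed.

Definition mk t := dil t moll.

Lemma mk_ge0 t y : 0 < t -> 0 <= mk t y.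
Proof. by move=> t0; rewrite mulr_ge0 ?moll_ge0// invr_ge0 exprn_ge0// ltW. Qed.

Lemma mk_even t y : mk t (- y) = mk t y.
Proof. by rewrite /mk /dil scalerN moll_even. Qed.

Lemma sm_mk t : smooth (mk t). Proof. exact: sm_dil sm_moll. Qed.

Lemma Cc_mk t : 0 < t -> Cc (mk t). Proof. by move=> t0; exact: Cc_dil Cc_moll. Qed.

Lemma I_mk t : 0 < t -> I (mk t) = 1. Proof. by move=> t0; rewrite I_dil ?I_moll//; exact: Cc_moll. Qed.

Lemma supp_mk t : 0 < t -> supp t (mk t).
Proof. by move=> t0; have := supp_dil t0 supp_moll; rewrite mulr1. Qed.

Implicit Types (w : (V -> R) -> R) (k g : V -> R).

(** Convolution of the functional w with the kernel k; for [w = ag g] it is the convolution of two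
    functions. *)
Definition cv w k : V -> R := fun x => w (fun y => k (x - y)).

Definition l2_bounded w (C : R) := forall f, Cc f -> `|w f| <= C * nrm f.

Lemma cont_cv w A C k : linear_functional w -> sup_bounded w A C -> continuous k ->
  continuous (cv w k).
Proof.
by move=> wl wb ck; exact: (functional_param (G := fun p : V * V => k (p.1 - p.2)) wl wb (cont_diff ck)).
Qed.

Lemma supp_cv w A C B k : linear_functional w -> sup_bounded w A C -> continuous k -> supp B k ->
  supp (A + B) (cv w k).
Proof.
move=> wl wb ck sk x xAB; apply/eqP; rewrite -normr_le0 -(mulr0 C).
apply: wb => // [|y yA]; first exact: (cont_pairr (cont_diff ck)).
rewrite sk ?normr0//.
have := ler_normD (x - y) y; rewrite subrK; lra.
Qed.

Lemma Cc_cv w A C k : linear_functional w -> sup_bounded w A C -> Cc k -> Cc (cv w k).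
Proof.
move=> wl wb [ck [B sB]]; split; first exact: cont_cv wb ck.
by exists (A + B); exact: (supp_cv wl wb ck sB).
Qed.

Lemma derive_cv w A C k a x : linear_functional w -> sup_bounded w A C -> smooth k ->
  is_derive x (unitv R a) (cv w k) (cv w (partial a k) x).
Proof.
move=> wl wb sk.
have E (f : V -> R) (s : R) : cv w f (x + s *: unitv R a) = w (fun y => f ((x - y) + s *: unitv R a)).
  by congr w; apply/funext => y; rewrite addrAC.
have cG (f : V -> R) : continuous f -> continuous (fun p : R * V => f ((x - p.2) + p.1 *: unitv R a)).
  move=> cf; apply: (@cont_comp R _ _ (fun p : R * V => (x - p.2) + p.1 *: unitv R a) f) => // p.
  apply: (@for_row R _ _ (fun p : R * V => (x - p.2) + p.1 *: unitv R a)) => b.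
  have -> : (fun q : R * V => (x - q.2 + q.1 *: unitv R a) 0 b)
      = (fun q => (x 0 b - q.2 0 b) + q.1 * unitv R a 0 b).
    by apply/funext => q; rewrite !mxE.
  have : continuous (fun q : R * V => (x 0 b - q.2 0 b) + q.1 * unitv R a 0 b).
    apply: contD; last by apply: contM; [exact: cont_fst|exact: cont_cst].
    apply: contB; first exact: cont_cst.
    exact: (@cont_comp R _ _ (fun q : R * V => q.2) (fun v : V => v 0 b) (@cont_snd _ _) (@coord_continuous R 1 n 0 b)).
  exact.
have D := functional_derive (G := fun p => k ((x - p.2) + p.1 *: unitv R a))
  (G' := fun p => partial a k ((x - p.2) + p.1 *: unitv R a)) wl wb (cG k (sm_cont sk))
  (cG _ (sm_cont (sm_partial a sk))) (fun s y => line_derive a (x - y) s sk) 0.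
rewrite /= -(E (partial a k)) scale0r addr0 in D.
rewrite -[x]addr0 -(scale0r (unitv R a)).
apply: (is_derive_line (cv w k) x (unitv R a) 0 _).2.
rewrite scale0r addr0.
have -> : (fun r => cv w k (x + r *: unitv R a)) = (fun r => w (fun y => k ((x - y) + r *: unitv R a))).
  by apply/funext => r; exact: E.
exact: D.
Qed.

Lemma partial_cv w A C k a : linear_functional w -> sup_bounded w A C -> smooth k ->
  partial a (cv w k) = cv w (partial a k).
Proof.
by move=> wl wb sk; apply/funext => x; apply: is_derive_partial; exact: derive_cv wb sk.
Qed.

Lemma sm_cv w A C k : linear_functional w -> sup_bounded w A C -> smooth k -> smooth (cv w k).
Proof.
move=> wl wb sk j; elim: j k sk => [|j IH] k sk.
  by split=> // y _; exact: (cont_cv wl wb (sm_cont sk)).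
apply: (CkS (df := fun a => cv w (partial a k))) => [|y _|a y _|a].
- exact: openT.
- exact: (cont_cv wl wb (sm_cont sk)).
- exact: derive_cv wb sk.
- by apply: IH; exact: sm_partial.
Qed.

Lemma I_functional w A C (k : V * V -> R) g : linear_functional w -> sup_bounded w A C ->
  continuous k -> Cc g ->
  I (fun x => w (fun y => k (x, y)) * g x) = w (fun y => I (fun x => k (x, y) * g x)).
Proof.
move=> wl wb ck Cg; have [B B0 sB] := Cc_supp Cg.
have cg := Cc_cont Cg.
have c1 : continuous (fun x => w (fun y => k (x, y)) * g x).
  by apply: contM => //; exact: functional_param wb ck.
have s1 : supp B (fun x => w (fun y => k (x, y)) * g x) by move=> x /sB ->; rewrite mulr0.
rewrite (I_BI B0 c1 s1).
have ckg : continuous (fun p : V * V => k p * g p.1) by apply: contM => //; exact: cont_fst1.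
have -> : (fun x => w (fun y => k (x, y)) * g x) = (fun x => w (fun y => k (x, y) * g x)).
  apply/funext => x; rewrite mulrC -lfunZ//; last exact: cont_pairr.
  by congr w; apply/funext => y; rewrite mulrC.
rewrite (functional_BI (G := fun p => k p * g p.1) wl wb ckg B0).
congr w; apply/funext => y; rewrite -(I_BI B0)//; first exact: (cont_pairl (G := fun p => k p * g p.1)).
by move=> x /sB /= ->; rewrite mulr0.
Qed.

(** The Schur test in dual form: paired with itself, the function moves its integral inside w, where
    the L^2 bound of w meets [schur]. The kernel is not assumed to depend on x - y alone, because
    Taylor remainders of coefficients will appear in it. *)
Lemma kernel_bound w A C C2 (k : V * V -> R) rho : linear_functional w -> sup_bounded w A C ->
  0 <= C2 -> l2_bounded w C2 -> continuous k -> Cc rho ->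
  (forall x y, `|k (x, y)| <= rho (x - y)) ->
  Cc (fun x => w (fun y => k (x, y))) /\ nrm (fun x => w (fun y => k (x, y))) <= C2 * I rho.
Proof.
move=> wl wb C20 w2 ck Cr Hr.
have Cv : Cc (fun x => w (fun y => k (x, y))).
  split; first exact: functional_param wb ck.
  have [B B0 sB] := Cc_supp Cr.
  exists (A + B) => x xAB; apply/eqP; rewrite -normr_le0 -(mulr0 C).
  apply: wb => // [|y yA]; first exact: cont_pairr.
  apply: le_trans (Hr x y) _; rewrite sB//.
  have := ler_normD (x - y) y; rewrite subrK; lra.
split=> //.
have r0 y : 0 <= rho y by rewrite -[y]subr0; exact: le_trans (normr_ge0 _) (Hr y 0).
apply: nrm_dual => //; first by rewrite mulr_ge0// I_ge0.
rewrite (I_functional wl wb ck Cv).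
have [h1 h2] := schur ck Cr Cv Hr.
apply: le_trans (w2 _ h1) _.
by rewrite -mulrA ler_wpM2l.
Qed.

Lemma cv_bound w A C C2 k : linear_functional w -> sup_bounded w A C ->
  0 <= C2 -> l2_bounded w C2 -> Cc k -> nrm (cv w k) <= C2 * I (fun y => `|k y|).
Proof.
move=> wl wb C20 w2 Ck.
apply: (kernel_bound (k := fun p => k (p.1 - p.2)) wl wb C20 w2 _ (Cc_abs Ck) _).2 => //.
exact: cont_diff (Cc_cont Ck).
Qed.

Definition ag g : (V -> R) -> R := fun f => I (fun y => f y * g y).

Lemma ag_functional g : Cc g -> exists A C, [/\ linear_functional (ag g), sup_bounded (ag g) A C
   & l2_bounded (ag g) (nrm g)].
Proof.
move=> Cg; have [A A0 sA] := Cc_supp Cg; have cg := Cc_cont Cg.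
exists A, (I (fun y => `|g y|)); split.
- move=> c f h cf ch; rewrite /ag -I_lin; try exact: CcMl.
  by congr I; apply/funext => y; ring.
- move=> f m cf m0 Hm; rewrite /ag.
  have Cfg : Cc (fun y => f y * g y) by exact: CcMl.
  apply: le_trans (I_abs Cfg) _; rewrite mulrC -I_scal; last exact: Cc_abs.
  apply: I_le => [||y]; [exact: Cc_abs|by apply: CcZ; exact: Cc_abs|].
  rewrite normrM; case: (leP `|y| A) => [/Hm h|/sA ->]; last by rewrite normr0 !mulr0.
  exact: ler_wpM2r.
- by move=> f Cf; rewrite [leRHS]mulrC; exact: (cauchy_schwarz_I Cf Cg).
Qed.

Definition cnv k g : V -> R := cv (ag g) k.

Lemma cnvE k g x : cnv k g x = I (fun y => k (x - y) * g y). Proof. by []. Qed.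

Lemma Cc_conv k g : Cc k -> Cc g -> Cc (cnv k g).
Proof. by move=> Ck /ag_functional[A [C [wl wb _]]]; exact: Cc_cv wb Ck. Qed.

Lemma sm_conv k g : smooth k -> Cc g -> smooth (cnv k g).
Proof. by move=> sk /ag_functional[A [C [wl wb _]]]; exact: sm_cv wb sk. Qed.

Lemma partial_conv k g a : smooth k -> Cc g -> partial a (cnv k g) = cnv (partial a k) g.
Proof. by move=> sk /ag_functional[A [C [wl wb _]]]; exact: partial_cv wb sk. Qed.

Lemma partial_convr k g a : smooth k -> Cc k -> smooth g -> Cc g ->
  partial a (cnv k g) = cnv k (partial a g).
Proof.
move=> sk Ck sg Cg; rewrite partial_conv//; apply/funext => x; rewrite !cnvE.
rewrite (I_parts a (sm_refl x sk) sg Cg) -I_opp.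
  by congr I; apply/funext => y; rewrite partial_refl// mulNr opprK.
apply: CcMl => //; apply: sm_cont; apply: sm_partial; exact: sm_refl.
Qed.

Lemma nrm_conv k g : Cc k -> Cc g -> nrm (cnv k g) <= I (fun y => `|k y|) * nrm g.
Proof.
move=> Ck Cg; have [A [C [wl wb w2]]] := ag_functional Cg.
by rewrite [leRHS]mulrC; exact: (cv_bound wl wb (nrm_ge0 g) w2 Ck).
Qed.

Lemma supp_conv A B k g : 0 <= A -> supp A k -> supp B g -> Cc k -> Cc g -> supp (A + B) (cnv k g).
Proof.
move=> A0 sk sg Ck Cg x xAB; rewrite cnvE (_ : (fun y => _) = (fun=> 0)) ?I0//.
apply/funext => y; have [yB|/sg ->] := leP `|y| B; last by rewrite mulr0.
rewrite sk ?mul0r//; have := ler_normD (x - y) y; rewrite subrK; lra.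
Qed.

Lemma cvB w A C k k' x : linear_functional w -> sup_bounded w A C -> continuous k -> continuous k' ->
  cv w (fun y => k y - k' y) x = cv w k x - cv w k' x.
Proof.
move=> wl wb ck ck'; apply: (@lfunB R n w (fun y => k (x - y)) (fun y => k' (x - y))) => //.
  exact: (cont_pairr (cont_diff ck)).
exact: (cont_pairr (cont_diff ck')).
Qed.

Lemma cvZ w A C (c : R) k x : linear_functional w -> sup_bounded w A C -> continuous k ->
  cv w (fun y => c * k y) x = c * cv w k x.
Proof.
move=> wl wb ck; apply: (@lfunZ R n w c (fun y => k (x - y))) => //.
exact: (cont_pairr (cont_diff ck)).
Qed.

(** Inside w both sides are integrals over z of a product of the two kernels, exchanged by the
    reflection z -> x + y - z. *)
Lemma conv_cv_comm w A C k k' : linear_functional w -> sup_bounded w A C -> Cc k -> Cc k' ->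
  cnv k (cv w k') = cnv k' (cv w k).
Proof.
move=> wl wb Ck Ck'; apply/funext => x.
have E (p q : V -> R) : Cc p -> Cc q -> cnv p (cv w q) x = w (fun y => I (fun z : V => q (z - y) * p (x - z))).
  move=> Cp Cq; rewrite cnvE.
  rewrite -(@I_functional w A C (fun r => q (r.1 - r.2)) (fun z : V => p (x - z)))//.
  - by congr I; apply/funext => z; rewrite mulrC.
  - exact: cont_diff (Cc_cont Cq).
  - exact: Cc_reflect.
rewrite !E//; congr w; apply/funext => y.
rewrite -(I_reflect (x + y)).
  congr I; apply/funext => z; rewrite mulrC; congr (k _ * k' _);
    by apply/rowP => i; rewrite !mxE; ring.
apply: CcMr; last exact: Cc_cont (Cc_reflect x Ck).
exact: (Cc_shift (- y) Ck').
Qed.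

End Convolution.

Section Approximation.
Variables (R : realType) (n : nat).
Local Notation V := 'rV[R]_n.
Implicit Types (f g z : V -> R).

Lemma Cc_bounded f : Cc f -> exists2 M : R, 0 <= M & forall y, `|f y| <= M.
Proof.
move=> Cf; have [A A0 sA] := Cc_supp Cf.
have ne : [set y : V | `|y| <= A] !=set0 by exists 0; rewrite /= normr0.
have cw : {within [set y : V | `|y| <= A], continuous (fun y => `|f y|)}.
  by apply: continuous_subspaceT; exact: cont_abs (Cc_cont Cf).
have [c _ Hc] := EVT_max_rV ne (@compact_box R n A) cw.
exists `|f c| => // y; have [yA|/sA ->] := leP `|y| A; last by rewrite normr0.
by apply: Hc; rewrite inE.
Qed.

Lemma Cc_uniform f (e : R) : Cc f -> 0 < e ->
  exists2 r : R, 0 < r & forall x y, `|x - y| < r -> `|f x - f y| <= e.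
Proof.
move=> Cf e0; have [A A0 sA] := Cc_supp Cf.
have cG : continuous (fun p : V * V => f (p.1 - (0 - p.2))).
  have := cont_diff (Cc_cont Cf).
  move=> /(cont_comp (G := fun p : V * V => (p.1, 0 - p.2))); apply.
  apply: cont_pair; first exact: cont_fst.
  move=> p; apply: (@for_row R _ _ (fun p : V * V => 0 - p.2)) => a.
  have -> : (fun q : V * V => (0 - q.2) 0 a) = (fun q => - q.2 0 a).
    by apply/funext => q; rewrite !mxE sub0r.
  have : continuous (fun q : V * V => - q.2 0 a).
    apply: contN.
    exact: (@cont_comp R _ _ (fun q : V * V => q.2) (fun v : V => v 0 a) (@cont_snd _ _) (@coord_continuous R 1 n 0 a)).
  exact.
have := @uniform_param R V V _ _ 0 _ (@compact_box R n (A + 1)) cG e0.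
move=> /near_norm[r r0 Hr].
exists (Num.min 1 r); first by rewrite lt_min ltr01.
move=> x y; rewrite lt_min => /andP[h1 hr].
have [yA|yA] := leP `|y| (A + 1).
  have := Hr (x - y); rewrite subr0 => /(_ hr y yA) /=.
  by rewrite sub0r !opprK subrK add0r.
have := ler_normB (x - y) x; rewrite addrAC subrr add0r normrN => h2.
by rewrite (sA x) ?(sA y) ?subrr ?normr0 ?(ltW e0)//; lra.
Qed.

Lemma smooth_lipschitz f : smooth f -> Cc f ->
  exists2 L : R, 0 <= L & forall x y, `|f x - f y| <= L * `|x - y|.
Proof.
move=> sf Cf.
have /choice[M HM] : forall a : 'I_n, exists M : R, 0 <= M /\ forall y, `|partial a f y| <= M.
  by move=> a; have [M M0 HM] := Cc_bounded (Cc_partial a sf Cf); exists M.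
pose S := \sum_(a < n) M a.
have S0 : 0 <= S by apply: sumr_ge0 => a _; case: (HM a).
exists (n%:R * S); first by rewrite mulr_ge0.
move=> x y; have := @increment_le R n f y (`|x - y| + 1) S (x - y) S0.
rewrite (_ : y + (x - y) = x); last by rewrite addrC subrK.
apply; last by rewrite ltrDl.
move=> z' a _; split; first by case: (sm_derive a z' sf).
apply: le_trans ((HM a).2 z') _; rewrite /S (bigD1 a)//= lerDl.
by apply: sumr_ge0 => b _; case: (HM b).
Qed.

(** The Taylor remainder of order one based at the second point: the error of the linearised
    coefficient in a commutator with a convolution. *)
Definition remainder f (p : V * V) : R :=
  f p.1 - f p.2 - \sum_(c < n) (p.1 0 c - p.2 0 c) * partial c f p.2.

(** Without its linear part at y, f has partial derivatives of size O(|x - y|) near y, and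
    [increment_le] contributes the other factor |x - y|. *)
Lemma taylor_le f : smooth f -> Cc f ->
  exists2 M : R, 0 <= M & forall x y, `|remainder f (x, y)| <= M * `|x - y| ^+ 2.
Proof.
move=> sf Cf.
have /choice[L HL] : forall a : 'I_n, exists L : R, 0 <= L /\ forall x y, `|partial a f x - partial a f y| <= L * `|x - y|.
  by move=> a; have [L L0 HL] := smooth_lipschitz (sm_partial a sf) (Cc_partial a sf Cf); exists L.
pose S := \sum_(a < n) L a.
have S0 : 0 <= S by apply: sumr_ge0 => a _; case: (HL a).
exists (n%:R * (S * 2)); first by rewrite !mulr_ge0.
move=> x y; have [->|xy] := eqVneq x y.
  rewrite /remainder /= subrr big1 ?subr0 ?normr0 ?mulr_ge0// => c _; by rewrite subrr mul0r.
have h0 : 0 < `|x - y| by rewrite normr_gt0 subr_eq0.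
pose g u := f u - \sum_(c < n) u 0 c * partial c f y.
have sl c : smooth (fun u : V => u 0 c * partial c f y).
  by apply: sm_mul; [exact: sm_coord|exact: sm_cst].
have sg : smooth g by apply: sm_sub => //; apply: sm_sum.
have dg a u : partial a g u = partial a f u - partial a f y.
  rewrite partialB ?partial_sum//; last exact: sm_sum.
  congr (_ - _); rewrite (bigD1 a)//= big1 ?addr0 => [|b ba].
    by rewrite partialM ?partial_coord ?partial_cst ?eqxx ?mulr0 ?addr0 ?mul1r//; [exact: sm_coord|exact: sm_cst].
  rewrite partialM ?partial_coord ?partial_cst ?mulr0 ?addr0 1?eq_sym ?(negbTE ba) ?mul0r//.
    exact: sm_coord.
  exact: sm_cst.
(* [increment_le] asks for a radius strictly larger than |x - y|; doubling provides one because x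
   and y are distinct here. *)
have := @increment_le R n g y (`|x - y| * 2) (S * (`|x - y| * 2)) (x - y).
rewrite (_ : y + (x - y) = x) => [H|]; last by rewrite addrC subrK.
have -> : remainder f (x, y) = g x - g y.
  rewrite /remainder /g /=; under eq_bigr => c _ do rewrite mulrBl.
  rewrite sumrB; ring.
apply: le_trans (H _ _ _) _.
- by rewrite mulr_ge0// mulr_ge0.
- move=> u a hu; split; first by case: (sm_derive a u sg).
  rewrite dg; apply: le_trans ((HL a).2 u y) _.
  apply: ler_pM => //; [by case: (HL a)| |exact: ltW].
  by rewrite /S (bigD1 a)//= lerDl; apply: sumr_ge0 => b _; case: (HL b).
- lra.
- by rewrite le_eqVlt; apply/orP; left; apply/eqP; ring.
Qed.

Lemma cont_remainder f : smooth f -> continuous (remainder f).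
Proof.
move=> sf; have cf := sm_cont sf.
have co c (pr : V * V -> V) : continuous pr -> continuous (fun p : V * V => pr p 0 c).
  by move=> cp; exact: (@cont_comp R _ _ pr (fun v : V => v 0 c) cp (@coord_continuous R 1 n 0 c)).
apply: contB; first by apply: contB; [exact: cont_fst1|exact: cont_snd2].
apply: cont_sum => c; apply: contM.
  by apply: contB; apply: co; [exact: cont_fst|exact: cont_snd].
by apply: cont_snd2; apply: sm_cont; exact: sm_partial.
Qed.

Lemma avg_le (t e d : R) g y : 0 < t -> continuous g -> (forall x, `|y - x| <= t -> `|g x - d| <= e) ->
  `|I (fun x => mk t (y - x) * g x) - d| <= e.
Proof.
move=> t0 cg H.
have Cm : Cc (fun x => mk t (y - x)) by apply: Cc_reflect; exact: Cc_mk.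
have E : I (fun x => mk t (y - x) * d) = d.
  under eq_fun do rewrite mulrC.
  by rewrite I_scal// I_reflect ?I_mk ?mulr1//; exact: Cc_mk.
have C1 : Cc (fun x => mk t (y - x) * g x) by exact: CcMr.
have C2 : Cc (fun x => mk t (y - x) * d) by apply: CcMr => //; exact: cont_cst.
rewrite -{1}E -I_sub//.
have C3 : Cc (fun x => mk t (y - x) * g x - mk t (y - x) * d) by exact: CcB.
apply: le_trans (I_abs C3) _.
have <- : I (fun x => e * mk t (y - x)) = e.
  by rewrite I_scal// I_reflect ?I_mk ?mulr1//; exact: Cc_mk.
apply: I_le => [||x]; [exact: Cc_abs|exact: CcZ|].
rewrite -mulrBr normrM (ger0_norm (mk_ge0 _ t0)) [leRHS]mulrC.
have [yx|yx] := leP `|y - x| t; first by rewrite ler_wpM2l ?mk_ge0//; exact: H.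
by rewrite supp_mk// !mul0r.
Qed.

Lemma conv_mk_unif f (e : R) : Cc f -> 0 < e ->
  exists2 r : R, 0 < r & forall (t : R) y, 0 < t < r -> `|cnv (mk t) f y - f y| <= e.
Proof.
move=> Cf e0; have [r r0 Hr] := Cc_uniform Cf e0.
exists r => // t y /andP[t0 tr]; apply: avg_le => //; first exact: Cc_cont.
by move=> x yx; apply: Hr; rewrite distrC; exact: le_lt_trans tr.
Qed.

Lemma conv_mk_sup f (t e : R) : 0 < t -> continuous f -> (forall y, `|f y| <= e) ->
  forall y, `|cnv (mk t) f y| <= e.
Proof.
move=> t0 cf H y; rewrite -[cnv _ _ _]subr0; apply: avg_le => // x _.
by rewrite subr0.
Qed.

Definition tk (k : nat) : R := 2^-1 ^+ k.

Lemma tk_gt0 k : 0 < tk k. Proof. by rewrite exprn_gt0. Qed.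

Lemma tk_le1 k : tk k <= 1. Proof. by apply: exprn_ile1 => //; lra. Qed.

Lemma tkS k : tk k.+1 = tk k / 2. Proof. by rewrite /tk exprSr. Qed.

Lemma tk_small (e : R) : 0 < e -> exists k0, forall k, (k0 <= k)%N -> tk k < e.
Proof.
move=> e0.
have := @cvg_expr R 2^-1; rewrite ger0_norm// => /(_ _)/cvgr0_norm_lt.
have h : (2^-1 : R) < 1 by lra.
move=> /(_ h e e0)[k0 _ Hk]; exists k0 => k /Hk /=.
by rewrite ger0_norm// ltW// tk_gt0.
Qed.

(** Decay by a factor mu per dyadic scale. For mollifications by mean zero kernels, mu = 2^-s plays
    the part of Sobolev order s. *)
Definition rate (mu : R) (F : nat -> V -> R) :=
  (forall k, Cc (F k)) /\ exists2 C, 0 <= C & forall k, nrm (F k) <= C * mu ^+ k.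

Lemma rateD mu F G : rate mu F -> rate mu G -> rate mu (fun k y => F k y + G k y).
Proof.
move=> [CF [C C0 HC]] [CG [D D0 HD]]; split; first by move=> k; exact: CcD.
exists (C + D); first exact: addr_ge0.
by move=> k; apply: le_trans (nrmD (CF k) (CG k)) _; rewrite mulrDl lerD.
Qed.

Lemma rate_sum mu (T : Type) (s : seq T) (F : T -> nat -> V -> R) : (forall i, rate mu (F i)) ->
  rate mu (fun k y => \sum_(i <- s) F i k y).
Proof.
move=> H; elim: s => [|i s IH].
  split; first by move=> k; under eq_fun do rewrite big_nil; exact: Cc0.
  by exists 0 => // k; under eq_fun do rewrite big_nil; rewrite nrm0 mul0r.
have -> : (fun k y => \sum_(j <- i :: s) F j k y) = (fun k y => F i k y + \sum_(j <- s) F j k y).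
  by apply/funext => k; apply/funext => y; rewrite big_cons.
exact: rateD.
Qed.

Lemma rate_le mu mu' F : 0 <= mu <= mu' -> rate mu F -> rate mu' F.
Proof.
move=> /andP[m0 mm] [CF [C C0 HC]]; split=> //; exists C => // k.
by apply: le_trans (HC k) _; rewrite ler_wpM2l// lerXn2r ?nnegrE// (le_trans m0).
Qed.

Lemma rate_tk mu F : 2^-1 <= mu -> (forall k, Cc (F k)) ->
  (exists2 C, 0 <= C & forall k, nrm (F k) <= C * tk k) -> rate mu F.
Proof.
by move=> hm CF [C C0 HC]; apply: (rate_le (mu := 2^-1)) => //; [rewrite hm andbT|split=> //; exists C].
Qed.

(** A mean zero kernel annihilates the constant g(y), and the Lipschitz bound leaves O(2^-k), which
    is where the lower bound 1/2 on mu comes from. *)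
Lemma rate_conv0 z g mu : 2^-1 <= mu -> smooth z -> Cc z -> I z = 0 -> smooth g -> Cc g ->
  rate mu (fun k => cnv (dil (tk k) z) g).
Proof.
move=> hm sz Cz Iz sg Cg.
have [L L0 HL] := smooth_lipschitz sg Cg.
have [A A0 sA] := Cc_supp Cz; have [B B0 sB] := Cc_supp Cg.
have Ck k : Cc (dil (tk k) z) by apply: Cc_dil => //; exact: tk_gt0.
have Cv k : Cc (cnv (dil (tk k) z) g) by exact: Cc_conv.
apply: rate_tk => //.
pose K := I (fun y => `|z y|).
have K0 : 0 <= K by apply: I_ge0 => //; exact: Cc_abs.
exists (Num.sqrt ((2 * (A + B)) ^+ n) * (L * A * K)).
  by rewrite mulr_ge0 ?sqrtr_ge0// !mulr_ge0.
move=> k; have t0 := tk_gt0 k; rewrite -[leRHS]mulrA.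
apply: nrm_bound => //.
- exact: addr_ge0.
- by rewrite !mulr_ge0// ltW.
- exact: Cc_cont.
- have sk : supp A (dil (tk k) z).
    by apply: supp_le (supp_dil t0 sA); rewrite ler_piMl// tk_le1.
  exact: supp_conv.
move=> y _; rewrite cnvE.
have Cr : Cc (fun x => dil (tk k) z (y - x)) by exact: Cc_reflect.
have E : I (fun x => dil (tk k) z (y - x) * g y) = 0.
  under eq_fun do rewrite mulrC.
  by rewrite I_scal// I_reflect// I_dil// Iz mulr0.
rewrite -[I _]subr0 -E -I_sub; first last.
- by apply: CcMr => //; exact: cont_cst.
- by apply: CcMr => //; exact: Cc_cont.
have C3 : Cc (fun x => dil (tk k) z (y - x) * g x - dil (tk k) z (y - x) * g y).
  by apply: CcB; apply: CcMr => //; [exact: Cc_cont|exact: cont_cst].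
apply: le_trans (I_abs C3) _.
have -> : L * A * K * tk k = I (fun x => (L * A * tk k) * `|dil (tk k) z (y - x)|).
  rewrite I_scal; last exact: Cc_abs.
  rewrite (I_reflect y (Cc_abs (Ck k))) dil_abs// I_dil//; last exact: Cc_abs.
  by rewrite /K; ring.
apply: I_le => [||x]; [exact: Cc_abs|by apply: CcZ; exact: Cc_abs|].
rewrite -mulrBr normrM mulrC.
have [yx|yx] := leP `|y - x| (tk k * A); last by rewrite (supp_dil t0 sA)// normr0 !mulr0.
rewrite ler_wpM2r//; apply: le_trans (HL x y) _.
by rewrite -mulrA ler_wpM2l// distrC mulrC.
Qed.

End Approximation.

(** * Weak solutions of first-order systems in a ball *)

Section LocalSystem.
Variables (R : realType) (n : nat).
Local Notation V := 'rV[R]_n.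
Variables (c : V) (rho : R).

(** The strict inequality leaves room for mollification at small scales. *)
Definition inside (f : V -> R) := exists2 r : R, r < rho & forall y, r < `|y - c| -> f y = 0.
Definition cin (f : V -> R) := continuous f /\ inside f.
Definition tin (f : V -> R) := smooth f /\ inside f.

Lemma inside_Cc f : inside f -> continuous f -> Cc f.
Proof.
move=> [r _ Hr] cf; split=> //; exists (`|c| + r) => y yr; apply: Hr.
have := ler_normD (y - c) c; rewrite subrK; lra.
Qed.

Lemma tin_smooth f : tin f -> smooth f. Proof. by case. Qed.

Lemma tin_Cc f : tin f -> Cc f.
Proof. by move=> [/sm_cont cf inf]; exact: inside_Cc. Qed.

Lemma tin_cin f : tin f -> cin f. Proof. by move=> [/sm_cont]. Qed.

Lemma cin_Cc f : cin f -> Cc f. Proof. by move=> [cf inf]; exact: inside_Cc. Qed.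

Lemma insideMr f g : inside f -> inside (fun y => f y * g y).
Proof. by move=> [r rr Hr]; exists r => // y /Hr ->; rewrite mul0r. Qed.

Lemma insideMl f g : inside g -> inside (fun y => f y * g y).
Proof. by move=> [r rr Hr]; exists r => // y /Hr ->; rewrite mulr0. Qed.

Lemma insideD f g : inside f -> inside g -> inside (fun y => f y + g y).
Proof.
move=> [r rr Hr] [s ss Hs]; exists (Num.max r s); first by rewrite gt_max rr.
by move=> y; rewrite gt_max => /andP[/Hr -> /Hs ->]; rewrite addr0.
Qed.

Lemma insideN f : inside f -> inside (fun y => - f y).
Proof. by move=> [r rr Hr]; exists r => // y /Hr ->; rewrite oppr0. Qed.

Lemma tinMr f g : tin f -> smooth g -> tin (fun y => f y * g y).
Proof. by move=> [sf inf] sg; split; [exact: sm_mul|exact: insideMr]. Qed.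

Lemma tinMl f g : smooth f -> tin g -> tin (fun y => f y * g y).
Proof. by move=> sf [sg ing]; split; [exact: sm_mul|exact: insideMl]. Qed.

Lemma tinD f g : tin f -> tin g -> tin (fun y => f y + g y).
Proof. by move=> [sf inf] [sg ing]; split; [exact: sm_add|exact: insideD]. Qed.

Lemma tinN f : tin f -> tin (fun y => - f y).
Proof. by move=> [sf inf]; split; [exact: sm_opp|exact: insideN]. Qed.

Lemma tinB f g : tin f -> tin g -> tin (fun y => f y - g y).
Proof. by move=> sf sg; apply: tinD => //; exact: tinN. Qed.

Lemma tin_scal (d : R) f : tin f -> tin (fun y => d * f y).
Proof. by apply: tinMl; exact: sm_cst. Qed.

Lemma tin_partial f a : tin f -> tin (partial a f).
Proof.
move=> [sf [r rr Hr]]; split; first exact: sm_partial.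
exists r => // y yr; rewrite (@partial_near R n f (fun=> 0)) ?partial_cst//.
have : \forall z \near y, r < `|z - c|.
  apply/nbhs_ballP; exists (`|y - c| - r) => [|z]; first by rewrite /= subr_gt0.
  rewrite -ball_normE /= => h; have := ler_normD (y - z) (z - c).
  rewrite addrA subrK; lra.
by apply: filterS => z; apply: Hr.
Qed.

Lemma cinMr f g : cin f -> continuous g -> cin (fun y => f y * g y).
Proof. by move=> [cf inf] cg; split; [exact: contM|exact: insideMr]. Qed.

Lemma tinM_cin f g : tin f -> continuous g -> cin (fun y => f y * g y).
Proof. by move=> /tin_cin; exact: cinMr. Qed.

Lemma cinD f g : cin f -> cin g -> cin (fun y => f y + g y).
Proof. by move=> [cf inf] [cg ing]; split; [exact: contD|exact: insideD]. Qed.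

Lemma cinZ (d : R) f : cin f -> cin (fun y => d * f y).
Proof. by move=> [cf inf]; split; [exact: contZ|exact: insideMl]. Qed.

Hypothesis rho0 : 0 < rho.

Lemma tin0 : tin (fun=> 0).
Proof. by split; [exact: sm_cst|exists 0]. Qed.

Lemma tin_sum (T : Type) (s : seq T) (F : T -> V -> R) : (forall i, tin (F i)) ->
  tin (fun y => \sum_(i <- s) F i y).
Proof.
move=> H; elim: s => [|i s IH].
  by under eq_fun do rewrite big_nil; exact: tin0.
by under eq_fun do rewrite big_cons; exact: tinD.
Qed.

(** An element of L^2_loc of the open ball, in weak form: the L^2 bound holds behind each cut-off
    chi and may degenerate towards the boundary. *)
Record local_functional (T : (V -> R) -> R) : Prop := LocalFunctional {
  lf_lin : forall (d : R) f g, cin f -> cin g -> T (fun y => d * f y + g y) = d * T f + T g;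
  lf_bd : forall chi, tin chi -> exists2 C : R, 0 <= C &
    forall f, Cc f -> `|T (fun y => chi y * f y)| <= C * nrm f }.

Definition cutf (T : (V -> R) -> R) (chi : V -> R) : (V -> R) -> R := fun f => T (fun y => chi y * f y).

Section Functional.
Variable T : (V -> R) -> R.
Hypothesis HT : local_functional T.

Lemma lfD f g : cin f -> cin g -> T (fun y => f y + g y) = T f + T g.
Proof.
move=> cf cg; have := lf_lin HT 1 cf cg; rewrite mul1r => <-.
by congr T; apply/funext => y; rewrite mul1r.
Qed.

Lemma lf0 : T (fun=> 0) = 0.
Proof.
have c0 := tin_cin tin0; have := lfD c0 c0.
by under eq_fun do rewrite addr0; move=> /esym/eqP; rewrite -subr_eq0 addrK => /eqP.
Qed.

Lemma lfZ (d : R) f : cin f -> T (fun y => d * f y) = d * T f.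
Proof.
move=> cf; have := lf_lin HT d cf (tin_cin tin0); rewrite lf0 addr0 => <-.
by congr T; apply/funext => y; rewrite addr0.
Qed.

Lemma lfN f : cin f -> T (fun y => - f y) = - T f.
Proof.
by move=> cf; rewrite -mulN1r -lfZ//; congr T; apply/funext => y; rewrite mulN1r.
Qed.

Lemma lfB f g : cin f -> cin g -> T (fun y => f y - g y) = T f - T g.
Proof.
move=> cf cg; rewrite -[T g]mul1r -mulNr addrC -lf_lin//; congr T; apply/funext => y.
by rewrite mulN1r addrC.
Qed.

Lemma lf_sum (J : Type) (s : seq J) (F : J -> V -> R) : (forall i, cin (F i)) ->
  T (fun y => \sum_(i <- s) F i y) = \sum_(i <- s) T (F i).
Proof.
move=> H.
have cs t : cin (fun y => \sum_(i <- t) F i y).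
  elim: t => [|i t IH]; first by under eq_fun do rewrite big_nil; exact: tin_cin tin0.
  by under eq_fun do rewrite big_cons; exact: cinD.
elim: s => [|i s IH].
  by under eq_fun do rewrite big_nil; rewrite lf0 big_nil.
under eq_fun do rewrite big_cons.
by rewrite big_cons lfD ?IH.
Qed.

Lemma cutf_functional chi : tin chi -> exists A C C2, [/\ linear_functional (cutf T chi),
  sup_bounded (cutf T chi) A C, 0 <= C2 & l2_bounded (cutf T chi) C2].
Proof.
move=> sc; have [C C0 HC] := lf_bd HT sc; have [A A0 sA] := Cc_supp (tin_Cc sc).
(* The L^2 bound concerns functions of compact support. Inserting a plateau equal to 1 on the
   support of chi turns it into a supremum bound for all continuous f. *)
have [th [Cth sth th01 th1]] := @plateau_Cc R n A.
have [B B0 sB] := Cc_supp Cth.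
exists B, (C * Num.sqrt ((2 * B) ^+ n)), C; split => //.
- move=> d f g cf cg; rewrite /cutf -(lf_lin HT); try exact: tinM_cin.
  by congr T; apply/funext => y; ring.
- move=> f m cf m0 Hm; rewrite /cutf.
  have -> : (fun y => chi y * f y) = (fun y => chi y * (th y * f y)).
    apply/funext => y; have [/th1 ->|/sA ->] := leP `|y| A; by rewrite ?mul1r ?mul0r.
  have C1 : Cc (fun y => th y * f y) by exact: CcMr.
  apply: le_trans (HC _ C1) _; rewrite -mulrA ler_wpM2l//.
  apply: nrm_bound => //; first exact: Cc_cont.
    by move=> y /sB ->; rewrite mul0r.
  move=> y /Hm h; rewrite normrM; apply: le_trans h; rewrite ler_piMl//.
  by case/andP: (th01 y) => t0 t1; rewrite ger0_norm.
Qed.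

End Functional.

Variables (Iu Je : finType) (a : Je -> Iu -> 'I_n -> V -> R) (B : Je -> Iu -> V -> R)
  (f : Je -> V -> R) (T : Iu -> (V -> R) -> R).

(** The last field is the weak form of sum_i (sum_b a_jib d_b + B_ji) T_i = f_j, the operator being
    transposed onto the test function. *)
Record solution : Prop := Solution {
  sol_a : forall j i b, smooth (a j i b) /\ Cc (a j i b);
  sol_B : forall j i, smooth (B j i);
  sol_f : forall j, smooth (f j);
  sol_T : forall i, local_functional (T i);
  sol_eq : forall j psi, tin psi ->
    \sum_i T i (fun y => B j i y * psi y - \sum_b partial b (fun z => a j i b z * psi z) y)
      = I (fun y => f j y * psi y) }.

Definition principal (v : Iu -> V -> R) j : V -> R :=
  fun x => \sum_i \sum_b a j i b x * partial b (v i) x.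

Definition apriori (lam : R) := exists2 C : R, 0 <= C & forall v : Iu -> V -> R, (forall i, tin (v i)) ->
  forall k i, nrm (fun x => v i x - cnv (mk (tk R k)) (v i) x) <=
    C * lam ^+ k * (\sum_i nrm (v i) + \sum_j nrm (principal v j)).

Definition S_rate (mu : R) := forall i chi z, tin chi -> smooth z -> Cc z -> I z = 0 ->
  rate mu (fun k => cv (cutf (T i) chi) (dil (tk R k) z)).

Hypothesis HS : solution.

Lemma S_rate1 : S_rate 1.
Proof.
move=> i chi z sc sz Cz Iz.
have [A [C [C2 [wl wb C20 w2]]]] := cutf_functional (sol_T HS i) sc.
have Ck k : Cc (dil (tk R k) z) by apply: Cc_dil => //; exact: tk_gt0.
split; first by move=> k; exact: Cc_cv wb (Ck k).
exists (C2 * I (fun y => `|z y|)).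
  by rewrite mulr_ge0// I_ge0//; exact: Cc_abs.
move=> k; rewrite expr1n mulr1.
apply: le_trans (cv_bound wl wb C20 w2 (Ck k)) _.
by rewrite dil_abs ?tk_gt0// I_dil ?tk_gt0//; exact: Cc_abs.
Qed.

(* The commutator of the operator with a mean zero convolution: to first order the
   coefficient a(x) - a(y) is a combination of x_c - y_c, and z_c (d_b z) has mean zero too. *)
Lemma principal_decomposition chi z t j x : 0 < t -> tin chi -> smooth z -> Cc z ->
  principal (fun i => cv (cutf (T i) chi) (dil t z)) j x =
  cnv (dil t z) (fun y => f j y * chi y) x
  + \sum_i cv (cutf (T i) (fun y => \sum_b partial b (fun u => a j i b u * chi u) y - B j i y * chi y)) (dil t z) x
  + \sum_i \sum_b (\sum_d cv (cutf (T i) (fun y => chi y * partial d (a j i b) y))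
        (dil t (fun y => y 0 d * partial b z y)) x
     + cutf (T i) chi (fun y => remainder (a j i b) (x, y) * partial b (dil t z) (x - y))).
Proof.
move=> t0 sc sz Cz; set k := dil t z.
have sk : smooth k by exact: sm_dil.
have skx : smooth (fun y => k (x - y)) by exact: sm_refl.
have skb b : smooth (fun y => partial b k (x - y)) by apply: sm_refl; exact: sm_partial.
have sa j' i b := (sol_a HS j' i b).1.
have spsi : tin (fun y => chi y * k (x - y)) by exact: tinMr.
have := sol_eq HS j spsi.
have E i : T i (fun y => B j i y * (chi y * k (x - y)) - \sum_b partial b (fun u => a j i b u * (chi u * k (x - u))) y)
   = \sum_b T i (fun y => chi y * (a j i b y * partial b k (x - y)))
     - cv (cutf (T i) (fun y => \sum_b partial b (fun u => a j i b u * chi u) y - B j i y * chi y)) k x.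
  have c1 : cin (fun y => \sum_b chi y * (a j i b y * partial b k (x - y))).
    apply: tin_cin; apply: tin_sum => b; apply: tinMr => //; exact: sm_mul.
  have c2 : tin (fun y => \sum_b partial b (fun u => a j i b u * chi u) y - B j i y * chi y).
    apply: tinB; last by apply: tinMl => //; exact: (sol_B HS).
    by apply: tin_sum => b; apply: tin_partial; exact: tinMl.
  have c3 : cin (fun y => (\sum_b partial b (fun u => a j i b u * chi u) y - B j i y * chi y) * k (x - y)).
    by apply: tinM_cin => //; exact: sm_cont.
  rewrite -(lf_sum (sol_T HS i)); last by move=> b; apply: tin_cin; apply: tinMr => //; exact: sm_mul.
  rewrite /cv /cutf -(lfB (sol_T HS i) c1 c3); congr (T i _); apply/funext => y.
  have Eb b : partial b (fun u => a j i b u * (chi u * k (x - u))) y =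
     partial b (fun u => a j i b u * chi u) y * k (x - y) - chi y * (a j i b y * partial b k (x - y)).
    have -> : (fun u => a j i b u * (chi u * k (x - u))) = (fun u => (a j i b u * chi u) * k (x - u)).
      by apply/funext => u; rewrite mulrA.
    rewrite partialM//; last by apply: sm_mul => //; exact: tin_smooth.
    by rewrite partial_refl//; ring.
  under eq_bigr => b _ do rewrite Eb.
  rewrite sumrB mulrBl mulr_suml; ring.
under eq_bigr => i _ do rewrite E.
rewrite sumrB => /eqP; rewrite subr_eq => /eqP H.
have -> : cnv k (fun y => f j y * chi y) x = I (fun y => f j y * (chi y * k (x - y))).
  by rewrite cnvE; congr I; apply/funext => y; ring.
rewrite -H -big_split /=; apply: eq_bigr => i _.
rewrite -big_split /=; apply: eq_bigr => b _.
have [A [C [C2 [wl wb C20 w2]]]] := cutf_functional (sol_T HS i) sc.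
rewrite (partial_cv b wl wb sk) /cv.
rewrite -(lfZ (sol_T HS i)); last by apply: tinM_cin => //; exact: sm_cont.
have cr : cin (fun y => chi y * (remainder (a j i b) (x, y) * partial b k (x - y))).
  apply: tinM_cin => //; apply: contM; last exact: sm_cont.
  exact: (cont_pairr (cont_remainder (sa j i b))).
have ce d : cin (fun y => (chi y * partial d (a j i b) y) * dil t (fun y => y 0 d * partial b z y) (x - y)).
  apply: tin_cin; apply: tinMr; first by apply: tinMr => //; exact: sm_partial.
  apply: sm_refl; apply: sm_dil; apply: sm_mul; [exact: sm_coord|exact: sm_partial].
have ca : cin (fun y => chi y * (a j i b y * partial b k (x - y))).
  by apply: tin_cin; apply: tinMr => //; exact: sm_mul.
rewrite /cutf -(lf_sum (sol_T HS i) _ ce).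
have cs : cin (fun y => \sum_d chi y * partial d (a j i b) y * dil t (fun y => y 0 d * partial b z y) (x - y)).
  apply: tin_cin; apply: tin_sum => d; apply: tinMr; first by apply: tinMr => //; exact: sm_partial.
  apply: sm_refl; apply: sm_dil; apply: sm_mul; [exact: sm_coord|exact: sm_partial].
rewrite -(lfD (sol_T HS i) cs cr) -(lfD (sol_T HS i) ca (cinD cs cr)).
congr (T i _); apply/funext => y; rewrite /remainder /=.
have Ed d : dil t (fun y => y 0 d * partial b z y) (x - y) = (x 0 d - y 0 d) * partial b k (x - y).
  rewrite /k partial_dil//.
  have := dil_coord (partial b z) d (lt0r_neq0 t0); move=> /(congr1 (fun g => g (x - y))).
  rewrite !mxE => e; rewrite mulrCA e mulrA mulVf ?mul1r// gt_eqF//.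
under eq_bigr => d _ do rewrite Ed.
have -> : \sum_d chi y * partial d (a j i b) y * ((x 0 d - y 0 d) * partial b k (x - y))
   = chi y * partial b k (x - y) * \sum_d (x 0 d - y 0 d) * partial d (a j i b) y.
  by rewrite mulr_sumr; apply: eq_bigr => d _; ring.
ring.
Qed.

End LocalSystem.

Section Translation.
Variables (R : realType) (n : nat).
Local Notation V := 'rV[R]_n.
Implicit Types (g z psi : V -> R).

Lemma derive_dir g (x v : V) : smooth g -> is_derive x v g (grad_app g x v).
Proof.
move=> sg; have := @chain_rule R n n setT g (fun y => y) x v v openT (sg 1%N) Logic.I.
apply => b.
rewrite -[x]addr0 -(scale0r v).
apply: (is_derive_line (fun z : V => z 0 b) x v 0 _).2.
have -> : (fun r : R => (x + r *: v) 0 b) = (fun r => x 0 b + r * v 0 b).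
  by apply/funext => r; rewrite !mxE.
exact: is_derive_affine.
Qed.

Lemma nrm_shift g (h : V) : Cc g -> nrm (fun y => g (y + h)) = nrm g.
Proof. by move=> Cg; rewrite /nrm (I_shift h (Cc_sq Cg)). Qed.

(** The translation is tested against psi, so that the mean value theorem applies to a scalar
    function of s along the segment from x to x + v. *)
Lemma shift_bound g psi (v : V) : smooth g -> Cc g -> Cc psi ->
  `|I (fun x => (g (x + v) - g x) * psi x)| <= `|v| * (\sum_d nrm (partial d g)) * nrm psi.
Proof.
move=> sg Cg Cpsi.
have [A [C [wl wb _]]] := ag_functional Cpsi.
have sgr : smooth (fun x => grad_app g x v).
  by apply: sm_sum => d _; apply: sm_scal; exact: sm_partial.
have D := functional_derive (G := fun p => g (p.2 + p.1 *: v))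
  (G' := fun p => grad_app g (p.2 + p.1 *: v) v) wl wb (@cont_line R n g v (sm_cont sg))
  (@cont_line R n _ v (sm_cont sgr))
  (fun s x => (is_derive_line g x v s _).1 (derive_dir _ v sg)).
have M s : `|ag psi (fun x => grad_app g (x + s *: v) v)| <= `|v| * (\sum_d nrm (partial d g)) * nrm psi.
  rewrite /ag.
  have Cd d : Cc (fun x => partial d g (x + s *: v)) by apply: Cc_shift; exact: Cc_partial.
  have -> : (fun x => grad_app g (x + s *: v) v * psi x)
      = (fun x => \sum_d v 0 d * (partial d g (x + s *: v) * psi x)).
    by apply/funext => x; rewrite /grad_app mulr_suml; apply: eq_bigr => d _; rewrite mulrA.
  have C1 d : Cc (fun x => partial d g (x + s *: v) * psi x) by apply: CcMr => //; exact: Cc_cont.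
  rewrite I_sum => [|d]; last exact: CcZ.
  apply: le_trans (ler_norm_sum _ _ _) _.
  rewrite mulr_sumr mulr_suml; apply: ler_sum => d _.
  rewrite I_scal// normrM -mulrA; apply: ler_pM => //; first exact: norm_coord.
  by have := cauchy_schwarz_I (Cd d) Cpsi; rewrite (nrm_shift (s *: v)) //; exact: Cc_partial.
have := @mvt_le R (fun s => ag psi (fun x => g (x + s *: v)))
   (fun s => ag psi (fun x => grad_app g (x + s *: v) v)) 0 1 _ (fun s _ => D s) (fun s _ => M s) ler01.
rewrite subr0 mulr1; apply: le_trans.
rewrite le_eqVlt; apply/orP; left; apply/eqP; congr (`|_|).
rewrite /ag -I_sub; first last.
- by apply: CcMr; [rewrite scale0r; under eq_fun do rewrite addr0|exact: Cc_cont].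
- by apply: CcMr; [exact: Cc_shift|exact: Cc_cont].
by congr I; apply/funext => x; rewrite scale1r scale0r addr0; ring.
Qed.

(** The mean zero kernel allows g(x) to be subtracted from g(x - y), and the kernel only sees |y| <=
    t A. Unlike [rate_conv0], the constant depends on g through the L^2 norm of its gradient
    alone. *)
Lemma cnv0_bound z g (A t : R) : 0 < t -> 0 <= A -> supp A z -> Cc z -> I z = 0 -> smooth g -> Cc g ->
  nrm (cnv (dil t z) g) <= t * A * I (fun y => `|z y|) * \sum_d nrm (partial d g).
Proof.
move=> t0 A0 sA Cz Iz sg Cg; set k := dil t z; set S := \sum_d _.
have S0 : 0 <= S by apply: sumr_ge0 => d _; exact: nrm_ge0.
have Ck : Cc k by exact: Cc_dil.
have sk : supp (t * A) k by exact: supp_dil.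
have Cv := Cc_conv Ck Cg; set psi := cnv k g in Cv *.
have K0 : 0 <= I (fun y => `|z y|) by apply: I_ge0 => //; exact: Cc_abs.
apply: nrm_dual => //; first by rewrite !mulr_ge0// ltW.
have [B [C [wl wb _]]] := ag_functional Ck.
have Cs (y : V) : Cc (fun x => g (x - y) * psi x) by apply: CcMr; [exact: (Cc_shift (- y) Cg)|exact: Cc_cont].
have -> : I (fun x => psi x * psi x) = I (fun y => I (fun x => g (x - y) * psi x) * k y).
  have E : psi = (fun x => ag k (fun y => g (x - y))).
    apply/funext => x; rewrite /psi cnvE /ag -(I_reflect x); last first.
      by apply: CcMr; [exact: Cc_reflect|exact: Cc_cont].
    by congr I; apply/funext => y; rewrite subKr mulrC.
  rewrite {1}E; exact: (@I_functional R n (ag k) B C (fun p => g (p.1 - p.2)) psi wl wb (cont_diff (Cc_cont Cg)) Cv).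
have cI : continuous (fun y : V => I (fun x => g (x - y) * psi x)).
  have [B' [C' [wl' wb' _]]] := ag_functional Cv.
  have := functional_param (G := fun p : V * V => g (p.2 - p.1)) wl' wb'.
  apply; exact: (cont_swap (cont_diff (Cc_cont Cg))).
have -> : I (fun y => I (fun x => g (x - y) * psi x) * k y)
   = I (fun y => I (fun x => (g (x - y) - g x) * psi x) * k y).
  have E0 : I (fun y => I (fun x => g x * psi x) * k y) = 0.
    by rewrite I_scal// I_dil// Iz mulr0.
  rewrite -[LHS]subr0 -E0 -I_sub; first last.
  - by apply: CcMl => //; exact: cont_cst.
  - exact: CcMl.
  congr I; apply/funext => y; rewrite -mulrBl -I_sub//.
    by congr (I _ * _); apply/funext => x; rewrite mulrBl.
  by apply: CcMr => //; exact: Cc_cont.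
have C5 : Cc (fun y => I (fun x => (g (x - y) - g x) * psi x) * k y).
  apply: CcMl => //.
  have -> : (fun y => I (fun x => (g (x - y) - g x) * psi x))
      = (fun y => I (fun x => g (x - y) * psi x) - I (fun x => g x * psi x)).
    apply/funext => y; rewrite -I_sub//; last by apply: CcMr => //; exact: Cc_cont.
    by congr I; apply/funext => x; rewrite mulrBl.
  by apply: contB => //; exact: cont_cst.
apply: le_trans (I_abs C5) _.
have -> : t * A * I (fun y => `|z y|) * S * nrm psi = I (fun y => (t * A * S * nrm psi) * `|k y|).
  rewrite I_scal; last exact: Cc_abs.
  by rewrite dil_abs// I_dil//; [ring|exact: Cc_abs].
apply: I_le => [||y]; [exact: Cc_abs|by apply: CcZ; exact: Cc_abs|].
rewrite normrM; have [yA|/sk ->] := leP `|y| (t * A); last by rewrite normr0 !mulr0.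
rewrite ler_wpM2r//; apply: le_trans (shift_bound (- y) sg Cg Cv) _.
by rewrite normrN -!mulrA [leRHS]mulrA ler_wpM2r// mulr_ge0// nrm_ge0.
Qed.

(** A mollified functional is supported in the ball only from some scale on; the finitely many
    earlier scales go into the constant. *)
Lemma rate_eventually (mu : R) (F : nat -> V -> R) (C : R) k0 : 0 < mu ->
  (forall k, Cc (F k)) -> 0 <= C -> (forall k, (k0 <= k)%N -> nrm (F k) <= C * mu ^+ k) -> rate mu F.
Proof.
move=> m0 CF C0 H; split=> //.
pose D := \sum_(k < k0) nrm (F k) / mu ^+ k.
have D0 : 0 <= D by apply: sumr_ge0 => k _; rewrite divr_ge0 ?nrm_ge0 ?exprn_ge0// ltW.
exists (C + D); first exact: addr_ge0.
move=> k; have mk0 : 0 < mu ^+ k by rewrite exprn_gt0.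
have [/H h|kk] := leqP k0 k; first by apply: le_trans h _; rewrite ler_pM2r// lerDl.
rewrite -ler_pdivrMr// (@le_trans _ _ D)// ?lerDr// /D (bigD1 (Ordinal kk))//= lerDl.
by apply: sumr_ge0 => j _; rewrite divr_ge0 ?nrm_ge0 ?exprn_ge0// ltW.
Qed.

Lemma telescope_bound (a D : nat -> V -> R) (C nu : R) : (forall k, Cc (a k)) -> (forall k, Cc (D k)) ->
  (forall k y, a k.+1 y - a k y = D k y) -> 0 <= C -> 0 <= nu < 1 ->
  (forall k, nrm (D k) <= C * nu ^+ k) ->
  forall k m, nrm (fun y => a (k + m)%N y - a k y) <= C / (1 - nu) * nu ^+ k.
Proof.
move=> Ca CD aD C0 /andP[n0 n1] HD k m.
have p : 0 < 1 - nu by rewrite subr_gt0.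
(* The exact partial geometric sum is what the induction on m preserves. *)
suff : nrm (fun y => a (k + m)%N y - a k y) <= C / (1 - nu) * nu ^+ k * (1 - nu ^+ m).
  move=> /le_trans; apply; rewrite ler_piMr//; last by rewrite gerBl exprn_ge0.
  by rewrite mulr_ge0 ?exprn_ge0// divr_ge0// ltW.
elim: m => [|m IH].
  rewrite addn0 expr0 subrr mulr0; under eq_fun do rewrite subrr.
  by rewrite nrm0.
have -> : (fun y => a (k + m.+1)%N y - a k y) = (fun y => D (k + m)%N y + (a (k + m)%N y - a k y)).
  by apply/funext => y; rewrite -aD addnS; ring.
apply: le_trans (nrmD (CD _) (CcB (Ca _) (Ca _))) _.
apply: le_trans (lerD (HD _) IH) _.
rewrite le_eqVlt; apply/orP; left; apply/eqP; rewrite exprD exprS; field; rewrite gt_eqF//.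
Qed.

Lemma telescope_bound_gt (a D : nat -> V -> R) (C nu : R) : (forall k, Cc (a k)) -> (forall k, Cc (D k)) ->
  (forall k y, a k.+1 y - a k y = D k y) -> 0 <= C -> 1 < nu ->
  (forall k, nrm (D k) <= C * nu ^+ k) ->
  forall k, nrm (a k) <= (nrm (a 0%N) + C / (nu - 1)) * nu ^+ k.
Proof.
move=> Ca CD aD C0 n1 HD k.
have p : 0 < nu - 1 by rewrite subr_gt0.
have np j : 1 <= nu ^+ j by apply: exprn_ege1; exact: ltW.
suff H : nrm (a k) <= nrm (a 0%N) + C / (nu - 1) * (nu ^+ k - 1).
  apply: le_trans H _; rewrite mulrDl lerD ?ler_peMr ?nrm_ge0//.
  by rewrite ler_wpM2l ?gerBl// divr_ge0// ltW.
elim: k => [|k IH]; first by rewrite expr0 subrr mulr0 addr0.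
have -> : a k.+1 = (fun y => D k y + a k y) by apply/funext => y; rewrite -aD subrK.
apply: le_trans (nrmD (CD _) (Ca _)) _; apply: le_trans (lerD (HD _) IH) _.
rewrite le_eqVlt; apply/orP; left; apply/eqP; rewrite exprS; field; rewrite gt_eqF//.
Qed.

(** Mollification is self-adjoint because its kernel is even. *)
Lemma I_cv_mk w A C psi (t : R) : linear_functional w -> sup_bounded w A C -> 0 < t -> Cc psi ->
  I (fun x => cv w (mk t) x * psi x) = w (cnv (mk t) psi).
Proof.
move=> wl wb t0 Cpsi.
have ck : continuous (fun p : V * V => mk t (p.1 - p.2)) by exact: cont_diff (Cc_cont (@Cc_mk R n t t0)).
apply: etrans (I_functional wl wb ck Cpsi) _.
congr w; apply/funext => y; rewrite cnvE; congr I; apply/funext => x.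
by rewrite -mk_even opprB.
Qed.

(* 1 - (1 - A_t)^2, with A_t the convolution by the mollifier at scale t *)
Definition twice w k : V -> R := fun x => 2 * cv w (mk (tk R k)) x - cnv (mk (tk R k)) (cv w (mk (tk R k))) x.

Lemma Cc_twice w A C k : linear_functional w -> sup_bounded w A C -> Cc (twice w k).
Proof.
move=> wl wb; have Ck := @Cc_mk R n _ (tk_gt0 R k).
have Cg := Cc_cv wl wb Ck.
by apply: CcB; [exact: CcZ|exact: Cc_conv].
Qed.

Lemma sm_twice w A C k : linear_functional w -> sup_bounded w A C -> smooth (twice w k).
Proof.
move=> wl wb; have Ck := @Cc_mk R n _ (tk_gt0 R k).
have Cg := Cc_cv wl wb Ck.
by apply: sm_sub; [apply: sm_scal; apply: (sm_cv wl wb); exact: sm_mk|apply: sm_conv => //; exact: sm_mk].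
Qed.

Lemma twice_weak w A C psi (e : R) : linear_functional w -> sup_bounded w A C -> Cc psi -> 0 < e ->
  exists k0, forall k, (k0 <= k)%N -> `|w psi - I (fun x => twice w k x * psi x)| <= e.
Proof.
move=> wl wb Cpsi e0; have C0 := sup_bounded_ge0 wl wb.
have e1 : 0 < e / (C * 2 + 1) by rewrite divr_gt0// ltr_wpDl// mulr_ge0.
have [r r0 Hr] := conv_mk_unif Cpsi e1.
have [k0 Hk0] := tk_small r0.
exists k0 => k /Hk0 kr; have t0 := tk_gt0 R k; set t := tk R k in kr t0 *.
have Cm := @Cc_mk R n t t0; have Cg := Cc_cv wl wb Cm.
have [A' [C' [wl' wb' _]]] := ag_functional Cg.
set M := cnv (mk t) psi; have CM : Cc M by exact: Cc_conv.
have CMM : Cc (cnv (mk t) M) by exact: Cc_conv.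
have -> : I (fun x => twice w k x * psi x) = 2 * w M - w (cnv (mk t) M).
  have -> : (fun x => twice w k x * psi x) = (fun x => 2 * (cv w (mk t) x * psi x) - cnv (mk t) (cv w (mk t)) x * psi x).
    by apply/funext => x; rewrite /twice -/t mulrBl mulrA.
  have cp := Cc_cont Cpsi.
  rewrite I_sub; [|by apply: CcZ; exact: CcMr|by apply: CcMr => //; exact: Cc_conv].
  rewrite I_scal; last exact: CcMr.
  rewrite (I_cv_mk wl wb)// [cnv _ (cv _ _)]/cnv (I_cv_mk wl' wb')//; congr (_ - _).
  rewrite -/M /ag -(I_cv_mk wl wb)//; congr I; apply/funext => x; by rewrite mulrC.
(* With A the mollification, this is w applied to (1 - A)^2 psi, whose supremum is at most twice
   that of (1 - A) psi. *)
have E : w psi - (2 * w M - w (cnv (mk t) M)) = w (fun y => (cnv (mk t) M y - M y) - (M y - psi y)).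
  have cp := Cc_cont Cpsi; have cM := Cc_cont CM; have cMM := Cc_cont CMM.
  rewrite (lfunB wl (f := fun y => cnv (mk t) M y - M y) (g := fun y => M y - psi y)); [|exact: contB|exact: contB].
  by rewrite (lfunB wl cMM cM) (lfunB wl cM cp); ring.
rewrite E; have h1 y : `|M y - psi y| <= e / (C * 2 + 1) by apply: Hr; rewrite t0.
have h2 y : `|cnv (mk t) M y - M y| <= e / (C * 2 + 1).
  have := @conv_mk_sup R n (fun y => M y - psi y) t (e / (C * 2 + 1)) t0.
  move=> /(_ (contB (Cc_cont CM) (Cc_cont Cpsi)) h1 y); congr (`|_| <= _).
  rewrite !cnvE -I_sub; try by apply: CcMr; [exact: Cc_reflect|exact: Cc_cont].
  by congr I; apply/funext => x; rewrite mulrBr.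
apply: le_trans (wb _ (2 * (e / (C * 2 + 1))) _ _ _) _.
- by apply: contB; apply: contB; exact: Cc_cont.
- by rewrite mulr_ge0// ltW.
- move=> y _; apply: le_trans (ler_normB _ _) _; have := h1 y; have := h2 y; lra.
- by rewrite !mulrA ler_pdivrMr ?ltr_wpDl ?mulr_ge0// mulrC ler_wpM2l ?lerDl// ltW.
Qed.

End Translation.

Section Unfold.
Variables (R : realType) (n : nat).
Local Notation V := 'rV[R]_n.

Lemma twiceE w k : twice w k = fun x : V =>
  2 * cv w (mk (tk R k)) x - cnv (mk (tk R k)) (cv w (mk (tk R k))) x.
Proof. by []. Qed.

Lemma cvE w k x : cv w k x = w (fun y : V => k (x - y)). Proof. by []. Qed.

Lemma agE (g f : V -> R) : ag g f = I (fun y => f y * g y). Proof. by []. Qed.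

Lemma tkV k : (tk R k)^-1 = 2 ^+ k. Proof. by rewrite /tk exprVn invrK. Qed.

Lemma tk_exp k (m : R) : tk R k * (2 * m) ^+ k = m ^+ k.
Proof. by rewrite exprMn -tkV mulrA divff ?mul1r// gt_eqF// tk_gt0. Qed.

(** The increment of the mollifier from one scale to the next is a dilate of one fixed mean zero
    kernel. *)
Lemma dil_mk_diff k : dil (tk R k) (fun y : V => dil 2^-1 (@moll R n) y - moll y)
  = (fun y => mk (tk R k.+1) y - mk (tk R k) y).
Proof.
apply/funext => y; rewrite /mk /dil tkS mulrBr; congr (_ - _).
rewrite mulrA scalerA; congr (_ * moll (_ *: y)).
  by rewrite -invfM -exprMn.
by rewrite invfM mulrC.
Qed.

Lemma cv_split w (g : V -> R) k x : cv w k x = cv (fun h => w h - ag g h) k x + cnv k g x.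
Proof. by rewrite /cnv /cv subrK. Qed.

Lemma cnvDr (K g h : V -> R) y : Cc K -> continuous g -> continuous h ->
  cnv K (fun x => g x - h x) y = cnv K g y - cnv K h y.
Proof.
move=> CK cg ch; have Cr := Cc_reflect y CK.
rewrite !cnvE -I_sub; try exact: CcMr.
by congr I; apply/funext => u; rewrite mulrBr.
Qed.

Lemma cnvZr (K g : V -> R) (d : R) y : Cc K -> continuous g ->
  cnv K (fun x => d * g x) y = d * cnv K g y.
Proof.
move=> CK cg; have Cr := Cc_reflect y CK.
rewrite !cnvE -I_scal; last exact: CcMr.
by congr I; apply/funext => u; rewrite mulrCA.
Qed.

End Unfold.

Local Opaque I nrm cnv cv mk dil tk twice moll ag.

(** * Bootstrap of the decay rate up to the first derivative *)

Section Gain.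
Variables (R : realType) (n : nat).
Local Notation V := 'rV[R]_n.
Variables (c : V) (rho : R) (rho0 : 0 < rho).
Variables (Iu Je : finType) (a : Je -> Iu -> 'I_n -> V -> R) (B : Je -> Iu -> V -> R)
  (f : Je -> V -> R) (T : Iu -> (V -> R) -> R).
Hypothesis HS : solution c rho a B f T.

(** Term by term in [principal_decomposition]: the data are smooth, so their term is O(2^-k); the
    linear terms are mean zero mollifications of T, covered by the hypothesis; the quadratic
    vanishing of the remainder outweighs the factor 2^k of the differentiated kernel and leaves
    O(2^-k). *)
Lemma rate_principal mu chi z j : 2^-1 <= mu <= 1 -> S_rate c rho T mu -> tin c rho chi ->
  smooth z -> Cc z -> I z = 0 ->
  rate mu (fun k => principal a (fun i => cv (cutf (T i) chi) (dil (tk R k) z)) j).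
Proof.
move=> /andP[m1 m2] HR sc sz Cz Iz.
have sa j' i b := (sol_a HS j' i b).1.
have Ca j' i b := (sol_a HS j' i b).2.
have -> : (fun k => principal a (fun i => cv (cutf (T i) chi) (dil (tk R k) z)) j) = (fun k x =>
  cnv (dil (tk R k) z) (fun y => f j y * chi y) x
  + \sum_i cv (cutf (T i) (fun y => \sum_b partial b (fun u => a j i b u * chi u) y - B j i y * chi y)) (dil (tk R k) z) x
  + \sum_i \sum_b (\sum_d cv (cutf (T i) (fun y => chi y * partial d (a j i b) y))
        (dil (tk R k) (fun y => y 0 d * partial b z y)) x
     + cutf (T i) chi (fun y => remainder (a j i b) (x, y) * partial b (dil (tk R k) z) (x - y)))).
  apply/funext => k; apply/funext => x.
  by apply: (principal_decomposition rho0 HS) => //; exact: tk_gt0.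
have sz' d b : smooth (fun y => y 0 d * partial b z y).
  by apply: sm_mul; [exact: sm_coord|exact: sm_partial].
have Cz' d b : Cc (fun y : V => y 0 d * partial b z y).
  by apply: CcMl; [exact: coord_continuous|exact: Cc_partial].
apply: rateD; first apply: rateD.
- apply: rate_conv0 => //.
    by apply: sm_mul; [exact: (sol_f HS)|exact: tin_smooth sc].
  by apply: CcMl; [exact: sm_cont (sol_f HS j)|exact: tin_Cc sc].
- apply: rate_sum => i; apply: HR => //.
  apply: tinB; last by apply: tinMl => //; exact: (sol_B HS).
  by apply: tin_sum => // b; apply: tin_partial; exact: tinMl.
apply: rate_sum => i; apply: rate_sum => b; apply: rateD.
  apply: rate_sum => d; apply: HR => //.
    by apply: tinMr => //; exact: sm_partial.
  (* The kernel y_d (d_b z) has mean zero: by parts its integral is minus that of z if b = d, and 0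
     otherwise. *)
  rewrite (I_parts b (@sm_coord R n d) sz Cz).
  have -> : (fun y => partial b (fun y : V => y 0 d) y * z y) = (fun y => (b == d)%:R * z y).
    by apply/funext => y; rewrite partial_coord.
  by rewrite I_scal// Iz mulr0 oppr0.
have [A [C [C2 [wl wb C20 w2]]]] := cutf_functional (sol_T HS i) sc.
have [M M0 HM] := taylor_le (sa j i b) (Ca j i b).
pose g k := partial b (dil (tk R k) z).
have sg k : smooth (g k) by apply: sm_partial; exact: sm_dil.
have Cg k : Cc (g k) by apply: Cc_partial; [exact: sm_dil|apply: Cc_dil => //; exact: tk_gt0].
have cn : continuous (fun y : V => `|y| ^+ 2).
  by apply: contM; exact: norm_continuous.
pose r k (y : V) := M * (`|y| ^+ 2 * `|g k y|).
have Cr k : Cc (r k) by apply: CcZ; apply: CcMl => //; exact: Cc_abs.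
have ck k : continuous (fun p : V * V => remainder (a j i b) p * g k (p.1 - p.2)).
  by apply: contM; [exact: cont_remainder|exact: cont_diff (sm_cont (sg k))].
have Hk k x y : `|remainder (a j i b) (x, y) * g k (x - y)| <= r k (x - y).
  by rewrite normrM /r mulrA ler_wpM2r.
have KB k := kernel_bound wl wb C20 w2 (ck k) (Cr k) (Hk k).
apply: rate_tk => // [k|]; first exact: (KB k).1.
pose K := I (fun y => `|y| ^+ 2 * `|partial b z y|).
have CK : Cc (fun y : V => `|y| ^+ 2 * `|partial b z y|).
  by apply: CcMl => //; apply: Cc_abs; exact: Cc_partial.
exists (C2 * (M * K)).
  by rewrite !mulr_ge0// I_ge0// => y; rewrite mulr_ge0// exprn_ge0.
move=> k; apply: le_trans (KB k).2 _; have t0 := tk_gt0 R k.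
rewrite -mulrA ler_wpM2l// le_eqVlt; apply/orP; left; apply/eqP.
rewrite /r I_scal; last by apply: CcMl => //; exact: Cc_abs.
have -> : (fun y : V => `|y| ^+ 2 * `|g k y|) = (fun y => tk R k * dil (tk R k) (fun y => `|y| ^+ 2 * `|partial b z y|) y).
  apply/funext => y; rewrite /g partial_dil// normrM (gtr0_norm (x := (tk R k)^-1)) ?invr_gt0//.
  have := dil_norm2 (fun y => `|partial b z y|) t0; move=> /(congr1 (fun h => h y)) e.
  have := dil_abs (partial b z) t0; move=> /(congr1 (fun h => h y)) ->.
  by rewrite mulrCA e; field; rewrite gt_eqF.
rewrite I_scal; last exact: Cc_dil.
by rewrite I_dil// /K; ring.
Qed.

Lemma eventually_tin chi z i : tin c rho chi -> smooth z -> Cc z ->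
  exists k0, forall k, (k0 <= k)%N -> tin c rho (cv (cutf (T i) chi) (dil (tk R k) z)).
Proof.
move=> sc sz Cz; have [r rr Hr] := sc.2; have [A A0 sA] := Cc_supp Cz.
have [D [C [C2 [wl wb C20 w2]]]] := cutf_functional (sol_T HS i) sc.
have e0 : 0 < (rho - r) / (A + 1) by rewrite divr_gt0 ?subr_gt0// ltr_wpDl.
have [k0 Hk0] := tk_small e0.
have A1 : 0 < A + 1 by rewrite ltr_wpDl.
exists k0 => k /Hk0; rewrite (ltr_pdivlMr _ _ A1) => kr.
have t0 := tk_gt0 R k.
split; first by apply: (sm_cv wl wb); exact: sm_dil.
exists (r + tk R k * A); first by lra.
move=> x xr; rewrite cvE /cutf -[RHS](lf0 rho0 (sol_T HS i)); congr (T i _); apply/funext => y.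
have [yr|/Hr ->] := leP `|y - c| r; last by rewrite mul0r.
rewrite (supp_dil t0 sA) ?mulr0//.
have := ler_normD (x - y) (y - c); rewrite addrA subrK; lra.
Qed.

Variable lam : R.
Hypothesis lam01 : 0 < lam < 1.
Hypothesis HE : apriori c rho a lam.

(** The a priori estimate for mean zero mollifications of T: both terms on its right decay like
    mu^k, and it adds the factor lam^k. The offset s is there because an increment of [twice]
    involves two consecutive scales. *)
Lemma rate_gain mu chi z i (s : nat) : (s <= 1)%N -> 2^-1 <= mu <= 1 -> S_rate c rho T mu ->
  tin c rho chi -> smooth z -> Cc z -> I z = 0 ->
  rate (lam * mu) (fun k x => cv (cutf (T i) chi) (dil (tk R k) z) x
     - cnv (mk (tk R (k + s))) (cv (cutf (T i) chi) (dil (tk R k) z)) x).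
Proof.
move=> s1 mm HR sc sz Cz Iz; case/andP: lam01 => l0 l1; case/andP: (mm) => m1 m2.
have m0 : 0 < mu by apply: lt_le_trans m1; rewrite invr_gt0.
pose v k i := cv (cutf (T i) chi) (dil (tk R k) z).
have Cv k i' : Cc (v k i').
  have [D [C [C2 [wl wb C20 w2]]]] := cutf_functional (sol_T HS i') sc.
  by apply: (Cc_cv wl wb); apply: Cc_dil => //; exact: tk_gt0.
have [C C0 HC] := HE.
have /choice[k1 Hk1] i' := eventually_tin i' sc sz Cz.
have rp j := rate_principal j mm HR sc sz Cz Iz.
have rv i' := HR i' chi z sc sz Cz Iz.
have /choice[P HP] j : exists P : R, 0 <= P /\ forall k, nrm (principal a (v k) j) <= P * mu ^+ k.
  by have [_ [P P0 HP]] := rp j; exists P.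
have /choice[Q HQ] i' : exists Q : R, 0 <= Q /\ forall k, nrm (v k i') <= Q * mu ^+ k.
  by have [_ [Q Q0 HQ]] := rv i'; exists Q.
apply: (@rate_eventually R n (lam * mu) _ (C * (\sum_i' Q i' + \sum_j P j)) (\max_i' k1 i')).
- by rewrite mulr_gt0.
- by move=> k; have Cm := @Cc_mk R n _ (tk_gt0 R (k + s)); exact: (CcB (Cv k i) (Cc_conv Cm (Cv k i))).
- rewrite mulr_ge0// addr_ge0//; apply: sumr_ge0 => i' _; [by case: (HQ i')|by case: (HP i')].
move=> k kk.
have sv i' : tin c rho (v k i').
  by apply: Hk1; apply: leq_trans kk; exact: (leq_bigmax i').
have H2 : \sum_i' nrm (v k i') + \sum_j nrm (principal a (v k) j) <= (\sum_i' Q i' + \sum_j P j) * mu ^+ k.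
  rewrite mulrDl !mulr_suml; apply: lerD; apply: ler_sum => i' _; [exact: (HQ i').2|exact: (HP i').2].
have X0 : 0 <= \sum_i' nrm (v k i') + \sum_j nrm (principal a (v k) j).
  by rewrite addr_ge0//; apply: sumr_ge0 => i' _; exact: nrm_ge0.
have key : nrm (fun x => v k i x - cnv (mk (tk R (k + s))) (v k i) x) <=
    C * lam ^+ k * (\sum_i' nrm (v k i') + \sum_j nrm (principal a (v k) j)).
  have := HC (v k) sv (k + s)%N i; move=> /le_trans; apply.
  apply: ler_wpM2r => //; apply: ler_wpM2l => //.
  by apply: ler_wiXn2l; rewrite ?(ltW l0) ?(ltW l1)// leq_addr.
apply: le_trans key _; rewrite exprMn.
apply: le_trans (ler_wpM2l _ H2) _; first by rewrite mulr_ge0// exprn_ge0// ltW.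
by rewrite le_eqVlt; apply/orP; left; apply/eqP; ring.
Qed.

Section Telescope.
Variables (mu : R) (chi : V -> R) (i : Iu).
Hypothesis mm : 2^-1 <= mu <= 1.
Hypothesis HR : S_rate c rho T mu.
Hypothesis sc : tin c rho chi.

Let w := cutf (T i) chi.
Let z0 : V -> R := fun y => dil 2^-1 (@moll R n) y - moll y.

Let sz0 : smooth z0.
Proof. by apply: sm_sub; [apply: sm_dil|]; exact: sm_moll. Qed.

Let Cz0 : Cc z0.
Proof. by apply: CcB; [apply: Cc_dil => //|]; exact: Cc_moll. Qed.

Let Iz0 : I z0 = 0.
Proof.
rewrite I_sub ?I_dil ?subrr//; [exact: Cc_moll|by apply: Cc_dil => //; exact: Cc_moll|exact: Cc_moll].
Qed.

Let dz0 k : dil (tk R k) z0 = (fun y => mk (tk R k.+1) y - mk (tk R k) y).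
Proof.
exact: dil_mk_diff.
Qed.

(** With A and A' the mollifications at scales k and k + 1, this is ((1 - A) + (1 - A')) (A' - A) w,
    the factored form of ((1 - A)^2 - (1 - A')^2) w. *)
Let D k (x : V) := (cv w (dil (tk R k) z0) x - cnv (mk (tk R (k + 0))) (cv w (dil (tk R k) z0)) x)
   + (cv w (dil (tk R k) z0) x - cnv (mk (tk R (k + 1))) (cv w (dil (tk R k) z0)) x).

Let wP : exists A C C2, [/\ linear_functional w, sup_bounded w A C, 0 <= C2 & l2_bounded w C2].
Proof.
by have [A [C [C2 H]]] := cutf_functional (sol_T HS i) sc; exists A, C, C2.
Qed.

Let twiceD k x : twice w k.+1 x - twice w k x = D k x.
Proof.
have [A [C [C2 [wl wb _ _]]]] := wP.
have Ck := @Cc_mk R n _ (tk_gt0 R k); have CS := @Cc_mk R n _ (tk_gt0 R k.+1).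
have Cg := Cc_cv wl wb Ck; have CgS := Cc_cv wl wb CS.
have E : cv w (dil (tk R k) z0) = (fun x => cv w (mk (tk R k.+1)) x - cv w (mk (tk R k)) x).
  apply/funext => y; rewrite dz0.
  exact: (cvB y wl wb (Cc_cont CS) (Cc_cont Ck)).
have cg := Cc_cont Cg; have cgS := Cc_cont CgS.
rewrite /D E addn0 addn1 (cnvDr x Ck cgS cg) (cnvDr x CS cgS cg) !twiceE (conv_cv_comm wl wb Ck CS).
move: (cnv _ _ x) (cnv _ _ x) (cnv _ _ x) (cv _ _ x) (cv _ _ x) => p1 p2 p3 p4 p5; ring.
Qed.

Let CD k : Cc (D k).
Proof.
have [A [C [C2 [wl wb _ _]]]] := wP.
have Ct := @Cc_dil R n _ _ (tk_gt0 R k) Cz0.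
have Cv := Cc_cv wl wb Ct.
by apply: CcD; apply: CcB => //; apply: Cc_conv => //; apply: Cc_mk; exact: tk_gt0.
Qed.

Let rateD0 : rate (lam * mu) D.
Proof. by apply: rateD; apply: rate_gain. Qed.

Let partialDk b k x : partial b (D k) x = (tk R k)^-1 *
  ((cv w (dil (tk R k) (partial b z0)) x - cnv (mk (tk R (k + 0))) (cv w (dil (tk R k) (partial b z0))) x)
   + (cv w (dil (tk R k) (partial b z0)) x - cnv (mk (tk R (k + 1))) (cv w (dil (tk R k) (partial b z0))) x)).
Proof.
have [A [C [C2 [wl wb _ _]]]] := wP.
have t0 := tk_gt0 R k.
have sd : smooth (dil (tk R k) z0) by exact: sm_dil.
have Cd : Cc (dil (tk R k) z0) by exact: Cc_dil.
have sv := sm_cv wl wb sd; have Cv := Cc_cv wl wb Cd.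
have Cdp : Cc (dil (tk R k) (partial b z0)) by apply: Cc_dil => //; exact: Cc_partial.
have Cvp := Cc_cv wl wb Cdp.
have pv : partial b (cv w (dil (tk R k) z0)) = (fun x => (tk R k)^-1 * cv w (dil (tk R k) (partial b z0)) x).
  rewrite (partial_cv b wl wb sd); apply/funext => y; rewrite partial_dil//.
  exact: (cvZ _ y wl wb (Cc_cont Cdp)).
have pc s : partial b (cnv (mk (tk R s)) (cv w (dil (tk R k) z0)))
    = (fun x => (tk R k)^-1 * cnv (mk (tk R s)) (cv w (dil (tk R k) (partial b z0))) x).
  rewrite partial_convr//; [|exact: sm_mk|by apply: Cc_mk; exact: tk_gt0].
  rewrite pv; apply/funext => y; apply: cnvZr; last exact: Cc_cont.
  by apply: Cc_mk; exact: tk_gt0.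
have sc' s : smooth (cnv (mk (tk R s)) (cv w (dil (tk R k) z0))).
  by apply: sm_conv => //; exact: sm_mk.
rewrite /D partialD; [|exact: sm_sub|exact: sm_sub].
by rewrite !partialB// !pc !pv; ring.
Qed.

(** The derivative falls on the kernel, and d_b z0 has mean zero again; the dilation costs 2^k. *)
Let partial_bound b : exists2 C : R, 0 <= C & forall k, nrm (partial b (D k)) <= C * (2 * (lam * mu)) ^+ k.
Proof.
have szp : smooth (partial b z0) by exact: sm_partial.
have Czp : Cc (partial b z0) by exact: Cc_partial.
have Izp : I (partial b z0) = 0 by exact: I_partial.
have := rateD (rate_gain i (leq0n 1) mm HR sc szp Czp Izp) (rate_gain i (leqnn 1) mm HR sc szp Czp Izp).
move=> [C1 [C C0 HC]]; exists C => // k.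
have -> : partial b (D k) = (fun x => (tk R k)^-1 *
  ((cv w (dil (tk R k) (partial b z0)) x - cnv (mk (tk R (k + 0))) (cv w (dil (tk R k) (partial b z0))) x)
   + (cv w (dil (tk R k) (partial b z0)) x - cnv (mk (tk R (k + 1))) (cv w (dil (tk R k) (partial b z0))) x))).
  by apply/funext => x; exact: partialDk.
rewrite nrmZ; last exact: C1.
rewrite gtr0_norm ?invr_gt0 ?tk_gt0// exprMn mulrCA tkV.
apply: ler_wpM2l; [exact: exprn_ge0|exact: HC].
Qed.

Let lm01 : 0 <= lam * mu < 1.
Proof.
case/andP: lam01 => l0 l1; case/andP: mm => m1 m2.
have m0 : 0 < mu by apply: lt_le_trans m1; rewrite invr_gt0.
rewrite mulr_ge0 ?ltW//=; apply: le_lt_trans l1; rewrite ler_piMr// ltW//.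
Qed.

Let Ctw k : Cc (twice w k).
Proof. by have [A [C [C2 [wl wb _ _]]]] := wP; exact: Cc_twice wl wb. Qed.

Let stw k : smooth (twice w k).
Proof. by have [A [C [C2 [wl wb _ _]]]] := wP; exact: sm_twice wl wb. Qed.

(** The increments from scale k on sum to the distance between w and [twice w k], because [twice]
    converges weakly to w. *)
Let weak_bound : exists2 C : R, 0 <= C & forall k psi, Cc psi ->
  `|w psi - I (fun x => twice w k x * psi x)| <= C * (lam * mu) ^+ k * nrm psi.
Proof.
have [A [C' [C2 [wl wb _ _]]]] := wP.
have [_ [C C0 HC]] := rateD0; case/andP: lm01 => n0 n1.
exists (C / (1 - lam * mu)); first by rewrite divr_ge0// subr_ge0 ltW.
move=> k psi Cpsi; apply/ler_addgt0Pr => e e0.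
have [k0 Hk0] := twice_weak wl wb Cpsi e0.
have := telescope_bound Ctw CD twiceD C0 lm01 HC k k0 => H.
have := Hk0 (k + k0)%N (leq_addl _ _).
have Cp := Cc_cont Cpsi.
pose X := I (fun x => twice w (k + k0) x * psi x); move=> h.
have -> : w psi - I (fun x => twice w k x * psi x) = (w psi - X) + (X - I (fun x => twice w k x * psi x)) by ring.
apply: le_trans (ler_normD _ _) _; rewrite addrC; apply: lerD => //.
rewrite /X -I_sub; try exact: CcMr.
have -> : (fun x => twice w (k + k0) x * psi x - twice w k x * psi x) = (fun x => (twice w (k + k0) x - twice w k x) * psi x).
  apply/funext => x; exact/esym/mulrBl.
have C1 : Cc (fun x => twice w (k + k0) x - twice w k x) by exact: CcB.
apply: le_trans (cauchy_schwarz_I C1 Cpsi) _.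
by apply: ler_wpM2r => //; exact: nrm_ge0.
Qed.

(** Split w at scale k into [w - twice w k], of L^2 norm O((lam mu)^k), and [twice w k], with
    gradient O((2 mu')^k). By [cnv0_bound] a mean zero kernel of width 2^-k turns the latter into
    O(mu'^k). *)
Lemma rate_step mu' z : 2^-1 < mu' -> lam * mu <= mu' -> smooth z -> Cc z -> I z = 0 ->
  rate mu' (fun k => cv w (dil (tk R k) z)).
Proof.
move=> m1 mm' sz Cz Iz; case/andP: lm01 => n0 n1.
have [A [C' [C2 [wl wb _ _]]]] := wP.
have [C C0 HC] := weak_bound.
have Ck k : Cc (dil (tk R k) z) by apply: Cc_dil => //; exact: tk_gt0.
have E : (fun k => cv w (dil (tk R k) z)) = (fun k x =>
   cv (fun g => w g - ag (twice w k) g) (dil (tk R k) z) x + cnv (dil (tk R k) z) (twice w k) x).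
  by apply/funext => k; apply/funext => x; exact: cv_split.
rewrite E; apply: rateD.
  apply: (rate_le (mu := lam * mu)); first by rewrite n0.
  have P k : exists A C, [/\ linear_functional (fun g => w g - ag (twice w k) g)
     & sup_bounded (fun g => w g - ag (twice w k) g) A C].
    have [A' [C3 [wl' wb' _]]] := ag_functional (Ctw k).
    exists (Num.max A A'), (C' + C3); split.
      by move=> d g h cg ch; rewrite wl// wl'//; ring.
    move=> g m cg m0 Hm; apply: le_trans (ler_normB _ _) _; rewrite mulrDl; apply: lerD.
      by apply: wb => // y yA; apply: Hm; rewrite le_max yA.
    by apply: wb' => // y yA; apply: Hm; rewrite le_max yA orbT.
  have w2 k : l2_bounded (fun g => w g - ag (twice w k) g) (C * (lam * mu) ^+ k).
    move=> g Cg; have := HC k g Cg; congr (`|_ - _| <= _); rewrite agE.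
    by congr I; apply/funext => x; rewrite mulrC.
  split; first by move=> k; have [A' [C3 [wl' wb']]] := P k; exact: Cc_cv wl' wb' (Ck k).
  exists (C * I (fun y => `|z y|)); first by rewrite mulr_ge0// I_ge0//; exact: Cc_abs.
  move=> k; have [A' [C3 [wl' wb']]] := P k.
  have h0 : 0 <= C * (lam * mu) ^+ k by rewrite mulr_ge0// exprn_ge0.
  apply: le_trans (cv_bound wl' wb' h0 (w2 k) (Ck k)) _.
  rewrite dil_abs ?tk_gt0// I_dil ?tk_gt0//; last exact: Cc_abs.
  by rewrite mulrAC.
have [A1 A10 sA1] := Cc_supp Cz.
have /choice[Q HQ] b : exists Q : R, 0 <= Q /\ forall k, nrm (partial b (twice w k)) <= Q * (2 * mu') ^+ k.
  have [Cb Cb0 HCb] := partial_bound b.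
  (* Since mu' > 1/2 the sum of the increments of the gradient is a growing geometric series,
     dominated by its last term. *)
  have m2 : 1 < 2 * mu' by rewrite mulrC -ltr_pdivrMr// div1r.
  exists (nrm (partial b (twice w 0)) + Cb / (2 * mu' - 1)).
  split; first by rewrite addr_ge0 ?nrm_ge0// divr_ge0// subr_ge0 ltW.
  apply: (@telescope_bound_gt R n (fun k => partial b (twice w k)) (fun k => partial b (D k))) => //.
  - by move=> k; apply: Cc_partial.
  - move=> k; have -> : D k = (fun x => twice w k.+1 x - twice w k x) by apply/funext => x; rewrite twiceD.
    by apply: Cc_partial; [exact: sm_sub|exact: CcB].
  - move=> k y; have -> : D k = (fun x => twice w k.+1 x - twice w k x) by apply/funext => x; rewrite twiceD.
    by rewrite partialB.
  move=> k; apply: le_trans (HCb k) _; apply: ler_wpM2l => //.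
  apply: lerXn2r; rewrite ?nnegrE; [exact: mulr_ge0| |by rewrite ler_pM2l].
  by rewrite ltW// (lt_trans _ m2).
split; first by move=> k; apply: Cc_conv.
exists (A1 * I (fun y => `|z y|) * \sum_b Q b).
  rewrite !mulr_ge0// ?I_ge0//; first exact: Cc_abs.
  by apply: sumr_ge0 => b _; case: (HQ b).
move=> k; apply: le_trans (cnv0_bound (tk_gt0 R k) A10 sA1 Cz Iz (stw k) (Ctw k)) _.
have -> : A1 * I (fun y => `|z y|) * (\sum_b Q b) * mu' ^+ k = tk R k * A1 * I (fun y => `|z y|) * \sum_b Q b * (2 * mu') ^+ k.
  rewrite -mulr_suml -(tk_exp k mu'); ring.
apply: ler_wpM2l; last by apply: ler_sum => b _; exact: (HQ b).2.
by rewrite !mulr_ge0// ?I_ge0// ?(ltW (tk_gt0 R k))//; exact: Cc_abs.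
Qed.

(** Below 1/2 the increments of the gradient of [twice] are summable, so these gradients are bounded
    in L^2 and pass to the weak limit. *)
Lemma derivative_bounded b : lam * mu < 2^-1 -> exists2 C : R, 0 <= C & forall psi, smooth psi -> Cc psi ->
  `|T i (fun y => chi y * partial b psi y)| <= C * nrm psi.
Proof.
move=> lm; case/andP: lm01 => n0 n1.
have [A [C' [C2 [wl wb _ _]]]] := wP.
have [Cb Cb0 HCb] := partial_bound b.
have l2 : 0 <= 2 * (lam * mu) < 1.
  by rewrite mulr_ge0//= mulrC -ltr_pdivlMr// div1r.
pose Q := nrm (partial b (twice w 0)) + Cb / (1 - 2 * (lam * mu)).
have Q0 : 0 <= Q.
  by rewrite addr_ge0 ?nrm_ge0// divr_ge0// subr_ge0 ltW//; case/andP: l2.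
have ED k : D k = (fun x => twice w k.+1 x - twice w k x) by apply/funext => x; rewrite twiceD.
have Cp k : Cc (partial b (twice w k)) by apply: Cc_partial.
have HQ k : nrm (partial b (twice w k)) <= Q.
  have := @telescope_bound R n (fun k => partial b (twice w k)) (fun k => partial b (D k)) Cb (2 * (lam * mu)).
  move=> /(_ Cp) H; have {}H := H _ _ Cb0 l2 HCb 0%N k; rewrite add0n expr0 mulr1 in H.
  have -> : partial b (twice w k) = (fun y => partial b (twice w 0) y + (partial b (twice w k) y - partial b (twice w 0) y)).
    by apply/funext => y; rewrite addrC subrK.
  apply: le_trans (nrmD (Cp _) (CcB (Cp _) (Cp _))) _; rewrite lerD2l; apply: H.
  - by move=> j; rewrite ED; apply: Cc_partial; [exact: sm_sub|exact: CcB].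
  - by move=> j y; rewrite ED partialB.
exists Q => // psi sp Cpsi.
have Cpp : Cc (partial b psi) by exact: Cc_partial.
apply/ler_addgt0Pr => e e0.
have [k0 Hk0] := twice_weak wl wb Cpp e0.
have := Hk0 k0 (leqnn _); rewrite (I_parts b (stw k0) sp Cpsi) opprK => h.
have h2 : `|I (fun y => partial b (twice w k0) y * psi y)| <= Q * nrm psi.
  by apply: le_trans (cauchy_schwarz_I (Cp k0) Cpsi) _; apply: ler_wpM2r; [exact: nrm_ge0|exact: HQ].
rewrite -/(cutf (T i) chi _) -/w.
have -> : w (partial b psi) = (w (partial b psi) + I (fun y => partial b (twice w k0) y * psi y)) - I (fun y => partial b (twice w k0) y * psi y) by ring.
by apply: le_trans (ler_normB _ _) _; rewrite addrC; apply: lerD.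
Qed.

End Telescope.

Theorem regularity1 i b chi : tin c rho chi -> exists2 C : R, 0 <= C & forall psi, smooth psi -> Cc psi ->
  `|T i (fun y => chi y * partial b psi y)| <= C * nrm psi.
Proof.
move=> sc; case/andP: (lam01) => l0 l1.
(* Chosen in ]1/2, 1[ with lam nu < 1/2: indeed 1/2 - lam (1 - lam / 2) = (1 - lam)^2 / 2. *)
pose nu := 1 - lam / 2.
have nu1 : 2^-1 < nu by rewrite /nu; lra.
have nu2 : nu <= 1 by rewrite /nu; lra.
have nul : lam * nu < 2^-1.
  rewrite /nu -subr_gt0 (_ : _ - _ = (1 - lam) ^+ 2 / 2); last by field.
  by rewrite divr_gt0// exprn_gt0// subr_gt0.
have mb k : 2^-1 <= Num.max (lam ^+ k) nu <= 1.
  by rewrite le_max (ltW nu1) orbT ge_max nu2 andbT exprn_ile1// ltW.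
(* Each pass multiplies the rate by lam until it falls to nu, which stays above the floor 1/2
   demanded by [rate_step]. *)
have HRk k : S_rate c rho T (Num.max (lam ^+ k) nu).
  elim: k => [|k IH].
    by rewrite expr0 max_l//; exact: (S_rate1 HS).
  move=> i' chi' z sc' sz Cz Iz; apply: (rate_step (mu := Num.max (lam ^+ k) nu)) => //.
    by rewrite lt_max nu1 orbT.
  rewrite exprS; case: (leP (lam ^+ k) nu) => h.
    rewrite le_max; apply/orP; right; rewrite ler_piMl ?(ltW l1)//; lra.
  by rewrite le_max lexx.
have [k Hk] : exists k, lam ^+ k <= nu.
  have := @cvg_expr R lam; rewrite gtr0_norm// => /(_ l1)/cvgr0_norm_lt.
  have nu0 : 0 < nu by apply: lt_trans nu1; rewrite invr_gt0.
  move=> /(_ nu nu0)[k0 _ H]; exists k0; have := H k0 (leqnn _).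
  by rewrite /= ger0_norm ?exprn_ge0 ?(ltW l0)// => /ltW.
have := HRk k; rewrite max_r// => HRn.
by apply: (derivative_bounded (mu := nu)) => //; rewrite ltW.
Qed.

End Gain.

Local Transparent I nrm cnv cv mk dil tk twice moll ag.

(** * Extension of functionals and derivatives of all orders *)

Section Tends.
Variable R : realType.
Implicit Types u v : nat -> R.

Definition tends u (L : R) : Prop := u @ \oo --> L.

Lemma tendsP u (L : R) : (forall e : R, 0 < e -> exists k0, forall k, (k0 <= k)%N -> `|u k - L| <= e) -> tends u L.
Proof. by move=> H; apply/cvgrPdist_le => e /H[k0 Hk]; exists k0 => // k /Hk; rewrite distrC. Qed.

Lemma tends_ex u : (forall e : R, 0 < e -> exists k0, forall k l, (k0 <= k)%N -> (k0 <= l)%N ->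
  `|u k - u l| <= e) -> exists L, tends u L.
Proof.
move=> H; suff cu : cvgn u by exists (limn u).
apply/cauchy_cvgP/cauchy_ballP => e e0.
have [k0 Hk] := H (e / 2) (divr_gt0 e0 (ltr0n _ 2)).
exists (u @` [set k | (k0 <= k)%N], u @` [set k | (k0 <= k)%N]).
  by split; exists k0 => // k kk; exists k.
move=> [x y] /= [[k hk <-] [l hl <-]]; apply: le_lt_trans (Hk _ _ hk hl) _.
by rewrite ltr_pdivrMr// ltr_pMr// ltr1n.
Qed.

Lemma tends_cst (L : R) : tends (fun=> L) L.
Proof. exact: cvg_cst. Qed.

Lemma tends_lin (d : R) u v L L' : tends u L -> tends v L' -> tends (fun k => d * u k + v k) (d * L + L').
Proof. by move=> hu hv; apply: cvgD => //; exact: cvgMl_tmp. Qed.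

Lemma tends_eventually u v L : (exists k0, forall k, (k0 <= k)%N -> u k = v k) -> tends u L -> tends v L.
Proof. by move=> [k0 H]; apply: cvg_trans; apply: near_eq_cvg; exists k0 => // k /H ->. Qed.

Lemma filter_cvg_le (F : set_system nat) (FF : ProperFilter F) u L (K : R) : u @ F --> L ->
  (\forall k \near F, `|u k| <= K) -> `|L| <= K.
Proof.
move=> uL uK; apply/ler_addgt0Pr => e e0.
have /cvgrPdist_le/(_ e e0) h := uL.
have [k [h1 h2]] := filter_ex (filterI h uK).
have := ler_normD (L - u k) (u k); rewrite subrK; lra.
Qed.

Lemma filter_cvg_unique (F : set_system nat) (FF : ProperFilter F) u (L L' : R) :
  u @ F --> L -> u @ F --> L' -> L = L'.
Proof.
move=> h h'; rewrite -(cvg_lim (@norm_hausdorff R R) h).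
by rewrite (cvg_lim (@norm_hausdorff R R) h').
Qed.

Lemma tends_le u L (b : R) : (exists k0, forall k, (k0 <= k)%N -> `|u k| <= b) -> tends u L -> `|L| <= b.
Proof. by move=> [k0 H] uL; apply: (filter_cvg_le _ uL); exists k0. Qed.

Lemma tends_unique u L L' : tends u L -> tends u L' -> L = L'.
Proof. exact: filter_cvg_unique. Qed.

End Tends.

Local Opaque I nrm cnv cv mk dil tk twice moll ag.

Section Extend.
Variables (R : realType) (n : nat).
Local Notation V := 'rV[R]_n.

Lemma nrm_conv_mk (f : V -> R) (e : R) : Cc f -> 0 < e -> exists k0, forall k, (k0 <= k)%N ->
  nrm (fun y => cnv (mk (tk R k)) f y - f y) <= e.
Proof.
move=> Cf e0; have [A A0 sA] := Cc_supp Cf.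
pose N := Num.sqrt ((2 * (1 + A)) ^+ n) + 1.
have N0 : 0 < N by rewrite ltr_wpDl// sqrtr_ge0.
have [r r0 Hr] := conv_mk_unif Cf (divr_gt0 e0 N0).
have [k0 Hk] := tk_small r0; exists k0 => k /Hk kr; have t0 := tk_gt0 R k.
have Cm := @Cc_mk R n _ t0.
have s1 : supp (1 + A) (cnv (mk (tk R k)) f).
  apply: supp_le (supp_conv (ltW t0) (supp_mk t0) sA Cm Cf).
  by rewrite lerD2r tk_le1.
have A1 : 0 <= 1 + A by rewrite addr_ge0.
have e1 : 0 <= e / N by rewrite divr_ge0// ltW.
apply: le_trans (nrm_bound A1 e1 (Cc_cont (CcB (Cc_conv Cm Cf) Cf)) _ _) _.
- by move=> y yA; rewrite s1// sA ?subrr//; lra.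
- by move=> y _; apply: Hr; rewrite t0.
- rewrite mulrA ler_pdivrMr// mulrC ler_wpM2l ?(ltW e0)// /N; lra.
Qed.

Variables (c : V) (rho : R) (rho0 : 0 < rho).

Lemma inside_ge0 (f : V -> R) : inside c rho f ->
  exists2 r : R, 0 <= r < rho & forall y, r < `|y - c| -> f y = 0.
Proof.
move=> [r rr Hr]; exists (Num.max r 0); first by rewrite le_max lexx orbT gt_max rr.
by move=> y; rewrite gt_max => /andP[/Hr].
Qed.

Lemma tin_plateau (r : R) : 0 <= r < rho -> exists chi : V -> R, [/\ tin c rho chi,
  forall y, 0 <= chi y <= 1 & forall y, `|y - c| <= r -> chi y = 1].
Proof.
move=> /andP[r0 rr]; pose s := (r + rho) / 2.
have rs : r < s by rewrite /s; lra.
exists (plateau c r s); split.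
- split; first exact: sm_plateau.
  exists s; first by rewrite /s; lra.
  by move=> y /ltW; apply: plateau_out; exact: le_lt_trans rs.
- by move=> y; exact: plateau_01.
- by move=> y; exact: plateau_in.
Qed.

(** One chi and one k0 serve every f supported in radius r: mollification at scales below the
    half-gap between r and rho stays where chi is 1. *)
Lemma cutoff (r : R) : 0 <= r < rho -> exists chi k0, [/\ tin c rho chi,
   forall y, `|y - c| <= r -> chi y = 1 &
   forall f, continuous f -> (forall y, r < `|y - c| -> f y = 0) -> forall k, (k0 <= k)%N ->
     tin c rho (cnv (mk (tk R k)) f) /\ (fun y => chi y * cnv (mk (tk R k)) f y) = cnv (mk (tk R k)) f].
Proof.
move=> /andP[r0 rr]; pose s := (r + rho) / 2.
have rs : r < s by rewrite /s; lra.
have sr : 0 <= s < rho by rewrite (le_trans r0 (ltW rs))/= /s; lra.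
have [chi [tc _ c1]] := tin_plateau sr.
have [k0 Hk] := @tk_small R (s - r) ltac:(by rewrite subr_gt0).
exists chi, k0; split => // [y h|f cf Hf k /Hk kr]; first by apply: c1; exact: le_trans h (ltW rs).
have t0 := tk_gt0 R k; have Cm := @Cc_mk R n _ t0.
have inf : inside c rho f by exists r.
have z0 x : s < `|x - c| -> cnv (mk (tk R k)) f x = 0.
  move=> sx; rewrite cnvE -[RHS](@I0 R n); congr I; apply/funext => y.
  have [yr|/Hf ->] := leP `|y - c| r; last by rewrite mulr0.
  rewrite (supp_mk t0) ?mul0r//; have := ler_normD (x - y) (y - c); rewrite addrA subrK; lra.
split; first split.
- by apply: sm_conv; [exact: sm_mk|exact: inside_Cc inf cf].
- by exists s => //; rewrite /s; lra.
- by apply/funext => y; have [/c1 ->|/z0 ->] := leP `|y - c| s; rewrite ?mul1r ?mulr0.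
Qed.

Variable (D : (V -> R) -> R).
Hypothesis Dlin : forall (d : R) f g, tin c rho f -> tin c rho g ->
  D (fun y => d * f y + g y) = d * D f + D g.
Hypothesis Dbd : forall chi, tin c rho chi -> exists2 C : R, 0 <= C &
  forall psi, smooth psi -> Cc psi -> `|D (fun y => chi y * psi y)| <= C * nrm psi.

Let DB chi f g : tin c rho f -> tin c rho g -> (fun y => chi y * f y) = f -> (fun y => chi y * g y) = g ->
  D f - D g = D (fun y => chi y * (f y - g y)).
Proof.
move=> tf tg ef eg; rewrite [LHS]addrC -mulN1r -Dlin//; congr D; apply/funext => y.
by rewrite mulrBr (congr1 (@^~ y) ef) (congr1 (@^~ y) eg) mulN1r addrC.
Qed.

(** D is only meaningful on smooth test functions, as when it involves a derivative, while
    [local_functional] speaks of continuous ones. The extension is the limit of D on mollifications,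
    a Cauchy sequence by the L^2 bound. *)
Lemma extension : exists T', local_functional c rho T' /\ forall psi, tin c rho psi -> T' psi = D psi.
Proof.
have /choice[T' HT'] (psi : V -> R) : exists L, cin c rho psi -> tends (fun k => D (cnv (mk (tk R k)) psi)) L.
  have [[cp ip]|h] := pselect (cin c rho psi); last by exists 0.
  have Cp := inside_Cc ip cp.
  have [r rr Hr] := inside_ge0 ip; have [chi [k0 [tc c1 H]]] := cutoff rr.
  have [C C0 HC] := Dbd tc.
  have C1 : 0 < C + 1 by rewrite ltr_wpDl.
  suff /tends_ex[L HL] : forall e : R, 0 < e -> exists k0, forall k l, (k0 <= k)%N -> (k0 <= l)%N ->
      `|D (cnv (mk (tk R k)) psi) - D (cnv (mk (tk R l)) psi)| <= e by exists L.
  move=> e e0; have C2 : 0 < 2 * (C + 1) by rewrite mulr_gt0.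
  have [k1 Hk1] := nrm_conv_mk Cp (divr_gt0 e0 C2).
  exists (maxn k0 k1) => k l; rewrite !geq_max => /andP[k0k /Hk1 k1k] /andP[k0l /Hk1 k1l].
  have [tk' ek] := H psi cp Hr k k0k; have [tl' el] := H psi cp Hr l k0l.
  rewrite (DB tk' tl' ek el).
  have t' := tinB tk' tl'.
  apply: le_trans (HC _ (tin_smooth t') (tin_Cc t')) _.
  have CB m : Cc (fun y => cnv (mk (tk R m)) psi y - psi y).
    by apply: CcB => //; apply: Cc_conv => //; apply: Cc_mk; exact: tk_gt0.
  have -> : (fun y => cnv (mk (tk R k)) psi y - cnv (mk (tk R l)) psi y) =
     (fun y => (cnv (mk (tk R k)) psi y - psi y) - (cnv (mk (tk R l)) psi y - psi y)).
    by apply/funext => y; rewrite opprB addrA subrK.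
  apply: le_trans (ler_wpM2l C0 (nrmB (CB k) (CB l))) _.
  have h : nrm (fun y => cnv (mk (tk R k)) psi y - psi y) + nrm (fun y => cnv (mk (tk R l)) psi y - psi y) <= e / (C + 1).
    have -> : e / (C + 1) = e / (2 * (C + 1)) + e / (2 * (C + 1)).
      by field; rewrite gt_eqF.
    exact: lerD k1k k1l.
  apply: le_trans (ler_wpM2l C0 h) _.
  by rewrite mulrA ler_pdivrMr// mulrC ler_wpM2l ?(ltW e0)// lerDl.
exists T'; split; last first.
  move=> psi tp; have cp := tin_cin tp; have [r rr Hr] := inside_ge0 cp.2.
  have [chi [k0 [tc c1 H]]] := cutoff rr; have [C C0 HC] := Dbd tc.
  apply: (tends_unique (HT' psi cp)); apply: tendsP => e e0.
  have C1 : 0 < C + 1 by rewrite ltr_wpDl.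
  have [k1 Hk1] := nrm_conv_mk (tin_Cc tp) (divr_gt0 e0 C1).
  exists (maxn k0 k1) => k; rewrite geq_max => /andP[k0k /Hk1 h].
  have [tk' ek] := H psi cp.1 Hr k k0k.
  have ep : (fun y => chi y * psi y) = psi.
    by apply/funext => y; have [/c1 ->|/Hr ->] := leP `|y - c| r; rewrite ?mul1r ?mulr0.
  rewrite (DB tk' tp ek ep); have t' := tinB tk' tp.
  apply: le_trans (HC _ (tin_smooth t') (tin_Cc t')) _.
  apply: le_trans (ler_wpM2l C0 h) _.
  by rewrite mulrA ler_pdivrMr// mulrC ler_wpM2l ?(ltW e0)// lerDl.
split.
  move=> d f g cf cg.
  have cl : cin c rho (fun y => d * f y + g y) by apply: cinD => //; exact: cinZ.
  apply: (tends_unique (HT' _ cl)).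
  refine (tends_eventually _ (tends_lin (HT' f cf) (HT' g cg))).
  have [r rr Hr] := inside_ge0 cf.2; have [r' rr' Hr'] := inside_ge0 cg.2.
  have [chi [k0 [_ _ H]]] := cutoff rr; have [chi' [k0' [_ _ H']]] := cutoff rr'.
  exists (maxn k0 k0') => k; rewrite geq_max => /andP[h h'].
  rewrite -Dlin; [|exact: (H f cf.1 Hr k h).1|exact: (H' g cg.1 Hr' k h').1].
  congr D; apply/funext => y; rewrite !cnvE.
  have Cm := Cc_reflect y (@Cc_mk R n _ (tk_gt0 R k)).
  rewrite -I_lin; [|exact: (CcMr Cm cf.1)|exact: (CcMr Cm cg.1)].
  by congr I; apply/funext => x; rewrite mulrDr mulrCA.
move=> chi tc; have [r rr Hr] := inside_ge0 tc.2.
have [chi' [k0 [tc' c1 H]]] := cutoff rr; have [C C0 HC] := Dbd tc'.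
have [M M0 HM] := Cc_bounded (tin_Cc tc).
exists (C * M); first exact: mulr_ge0.
move=> f Cf; have Cp : Cc (fun y => chi y * f y) by apply: CcMr; [exact: tin_Cc tc|exact: Cc_cont].
have Hp y : r < `|y - c| -> chi y * f y = 0 by move=> /Hr ->; rewrite mul0r.
have cp : cin c rho (fun y => chi y * f y) by apply: tinM_cin => //; exact: Cc_cont.
apply: (tends_le _ (HT' _ cp)); exists k0 => k kk.
have [t e] := H _ cp.1 Hp k kk.
rewrite -e; apply: le_trans (HC _ (tin_smooth t) (tin_Cc t)) _.
rewrite -mulrA ler_wpM2l//.
have Cm := @Cc_mk R n _ (tk_gt0 R k).
apply: le_trans (nrm_conv Cm Cp) _.
have -> : (fun y : V => `|mk (tk R k) y|) = mk (tk R k).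
  by apply/funext => y; rewrite ger0_norm// mk_ge0// tk_gt0.
rewrite I_mk ?tk_gt0// mul1r -[M in leRHS]ger0_norm// -nrmZ//.
apply: nrm_le => //; first exact: CcZ.
by move=> y; rewrite !normrM ler_wpM2r// (ger0_norm M0).
Qed.

End Extend.

Lemma big_option (R : nmodType) (T : finType) (F : option T -> R) :
  \sum_o F o = F None + \sum_t F (Some t).
Proof. rewrite (bigD1 None)//=; congr (_ + _); rewrite (@reindex_omap _ _ _ _ _ Some id); last by case.
by apply: eq_bigl => t; rewrite eqxx. Qed.

Lemma big_pair (R : nmodType) (U W : finType) (F : U * W -> R) : \sum_p F p = \sum_i \sum_j F (i, j).
Proof. by rewrite pair_big; apply: eq_bigr => -[]. Qed.

Section Prolongation.
Variables (R : realType) (n : nat).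
Local Notation V := 'rV[R]_n.
Variables (c : V) (rho : R) (rho0 : 0 < rho).
Variables (Iu Je : finType) (a : Je -> Iu -> 'I_n -> V -> R) (B : Je -> Iu -> V -> R)
  (f : Je -> V -> R) (T : Iu -> (V -> R) -> R).

(* The system satisfied by T together with its first derivatives, the index None
   standing for T itself. *)
Definition pa (q : option 'I_n * Je) (p : option 'I_n * Iu) b : V -> R :=
  if q.1 == p.1 then a q.2 p.2 b else fun=> 0.
(** Row [Some d] is the equation differentiated in direction d: the derivatives of the leading
    coefficients multiply the new unknowns d_b T, hence enter at order zero. *)
Definition pB (q : option 'I_n * Je) (p : option 'I_n * Iu) : V -> R :=
  match q.1, p.1 with
  | None, None => B q.2 p.2
  | None, Some _ => fun=> 0
  | Some d, None => partial d (B q.2 p.2)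
  | Some d, Some b => fun y => (b == d)%:R * B q.2 p.2 y + partial d (a q.2 p.2 b) y
  end.
Definition pf (q : option 'I_n * Je) : V -> R :=
  if q.1 is Some d then partial d (f q.2) else f q.2.

Hypothesis HS : solution c rho a B f T.
Variable lam : R.
Hypothesis lam01 : 0 < lam < 1.
Hypothesis HE : apriori c rho a lam.

(** The prolonged principal part is block diagonal with copies of [a], so C and lam do not change.
    This is what allows the prolongation to be iterated. *)
Lemma apriori_prolong : apriori c rho pa lam.
Proof.
have [C C0 HC] := HE; exists C => // v tv k [oi i].
apply: le_trans (HC (fun i => v (oi, i)) (fun i => tv (oi, i)) k i) _.
apply: ler_wpM2l; first by rewrite mulr_ge0// exprn_ge0//; case/andP: lam01 => /ltW.
have E j : principal pa v (oi, j) = principal a (fun i => v (oi, i)) j.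
  apply/funext => x; rewrite /principal big_pair.
  rewrite (bigD1 oi)//= [X in _ + X]big1 ?addr0.
    by apply: eq_bigr => i' _; apply: eq_bigr => b _; rewrite /pa eqxx.
  move=> o' oo; rewrite big1// => i' _; rewrite big1// => b _.
  by rewrite /pa eq_sym (negbTE oo) mul0r.
apply: lerD.
  rewrite big_pair (bigD1 oi)//= lerDl.
  by apply: sumr_ge0 => o' _; apply: sumr_ge0 => i' _; exact: nrm_ge0.
rewrite big_pair (bigD1 oi)//=.
under [X in _ <= X + _]eq_bigr => j _ do rewrite E.
by rewrite lerDl; apply: sumr_ge0 => o' _; apply: sumr_ge0 => i' _; exact: nrm_ge0.
Qed.

Let sa j i b : smooth (a j i b). Proof. exact: (sol_a HS j i b).1. Qed.
Let sB j i : smooth (B j i). Proof. exact: (sol_B HS j i). Qed.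

Lemma derived_functional b i : exists T', local_functional c rho T' /\
  forall psi, tin c rho psi -> T' psi = - T i (partial b psi).
Proof.
have HT := sol_T HS i.
apply: (extension rho0 (D := fun psi => - T i (partial b psi))).
  move=> d g h tg th; rewrite mulrN -opprD -(lf_lin HT); try exact/tin_cin/tin_partial.
  congr (- T i _); apply/funext => y; rewrite partialD; [|exact: sm_scal (tin_smooth tg)|exact: tin_smooth th].
  by rewrite partialZ//; exact: tin_smooth tg.
move=> chi tc; have [C C0 HC] := regularity1 rho0 HS lam01 HE i b tc.
have [C' C0' HC'] := lf_bd HT (tin_partial b tc).
exists (C + C'); first exact: addr_ge0.
move=> psi sp Cp; rewrite normrN.
have -> : partial b (fun y => chi y * psi y) = (fun y => partial b chi y * psi y + chi y * partial b psi y).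
  by apply/funext => y; rewrite partialM//; exact: tin_smooth tc.
rewrite (lfD HT); [|apply: tinM_cin (tin_partial b tc) (sm_cont sp)|apply: tinM_cin tc (sm_cont (sm_partial b sp))].
apply: le_trans (ler_normD _ _) _; rewrite mulrDl addrC; apply: lerD; [exact: HC|exact: HC'].
Qed.

(** Tested on psi, row [Some d] reduces to minus the original equation tested on d_d psi; the terms
    match because second derivatives commute. *)
Lemma prolongation : exists T1 : option 'I_n * Iu -> (V -> R) -> R,
  [/\ forall i, T1 (None, i) = T i,
      forall b i psi, tin c rho psi -> T1 (Some b, i) psi = - T i (partial b psi) &
      solution c rho pa pB pf T1].
Proof.
have /choice[T' HT'] (p : 'I_n * Iu) : exists T', local_functional c rho T' /\
  forall psi, tin c rho psi -> T' psi = - T p.2 (partial p.1 psi) by exact: derived_functional.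
exists (fun p => if p.1 is Some b then T' (b, p.2) else T p.2); split => //.
  by move=> b i psi tp /=; rewrite (HT' (b, i)).2.
split.
- move=> [oj j] [oi i] b; rewrite /pa /=; case: ifP => _; first exact: (sol_a HS).
  by split; [exact: sm_cst|exact: Cc0].
- move=> [[d|] j] [[b|] i]; rewrite /pB /=.
  + by apply: sm_add; [exact: sm_scal|exact: sm_partial].
  + exact: sm_partial.
  + exact: sm_cst.
  + exact: sB.
- by move=> [[d|] j]; rewrite /pf /=; [apply: sm_partial|]; exact: (sol_f HS).
- by move=> [[b|] i] /=; [exact: (HT' (b, i)).1|exact: (sol_T HS)].
have tmul g psi : smooth g -> tin c rho psi -> tin c rho (fun y => g y * psi y) by exact: tinMl.
have p0 b (psi : V -> R) y : partial b (fun z => 0 * psi z) y = 0.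
  have -> : (fun z => 0 * psi z) = (fun=> 0) by apply/funext => z; rewrite mul0r.
  by rewrite partial_cst.
move=> [oj j] psi tp.
rewrite big_pair big_option; case: oj => [d|]; rewrite /pB /pa /pf /=; last first.
  rewrite (sol_eq HS)// big1 ?addr0// => b _; rewrite big1// => i _.
  rewrite -[RHS](lf0 rho0 (HT' (b, i)).1); congr (T' _ _); apply/funext => y.
  by rewrite mul0r big1 ?subr0.
pose L i psi y := B j i y * psi y - \sum_b partial b (fun z => a j i b z * psi z) y.
have tL i : tin c rho (L i psi).
  apply: tinB; first exact: tmul.
  by apply: (tin_sum rho0) => b; apply: tin_partial; exact: tmul.
have tdp := tin_partial d tp.
have Ei i b : T' (b, i) (fun y => ((b == d)%:R * B j i y + partial d (a j i b) y) * psi y -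
    \sum_b0 partial b0 (fun z => (if Some d == Some b then a j i b0 else fun=> 0) z * psi z) y)
   = - T i (partial b (fun y => partial d (a j i b) y * psi y)) - (b == d)%:R * T i (partial d (L i psi)).
  have t1 : tin c rho (fun y => partial d (a j i b) y * psi y) by apply: tmul => //; exact: sm_partial.
  have -> : (fun y => ((b == d)%:R * B j i y + partial d (a j i b) y) * psi y -
    \sum_b0 partial b0 (fun z => (if Some d == Some b then a j i b0 else fun=> 0) z * psi z) y)
    = (fun y => (b == d)%:R * L i psi y + partial d (a j i b) y * psi y).
    apply/funext => y; rewrite (eq_sym b) (inj_eq Some_inj); case: eqP => [_|_].
      by rewrite !mul1r /L; ring.
    by rewrite !mul0r !add0r big1 ?subr0.
  rewrite (HT' (b, i)).2; last by apply: tinD => //; exact: tin_scal.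
  have -> : partial b (fun y => (b == d)%:R * L i psi y + partial d (a j i b) y * psi y) =
     (fun y => (b == d)%:R * partial b (L i psi) y + partial b (fun y => partial d (a j i b) y * psi y) y).
    apply/funext => y; rewrite partialD; [|exact/sm_scal/tin_smooth/tL|exact: tin_smooth t1].
    by rewrite partialZ//; exact/tin_smooth/tL.
  rewrite (lf_lin (sol_T HS i)); [|exact/tin_cin/tin_partial|exact/tin_cin/tin_partial].
  have XZ (F : 'I_n -> R) : (b == d)%:R * F b = (b == d)%:R * F d.
    by case: (eqVneq b d) => [->//|_]; rewrite !mul0r.
  rewrite opprD addrC; exact: (congr1 (fun r => _ - r) (XZ (fun b => T i (partial b (L i psi))))).
under [X in _ + X]eq_bigr => b _ do under eq_bigr => i _ do rewrite Ei.
rewrite exchange_big -big_split /=.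
have Fi i : T i (fun y => partial d (B j i) y * psi y - \sum_b partial b (fun z => 0 * psi z) y)
   + \sum_b (- T i (partial b (fun y => partial d (a j i b) y * psi y)) - (b == d)%:R * T i (partial d (L i psi)))
   = - T i (L i (partial d psi)).
  have S1 : \sum_(b < n) (b == d)%:R = 1 :> R.
    by rewrite (bigD1 d)//= eqxx big1 ?addr0// => b /negbTE ->.
  rewrite sumrB -mulr_suml S1 mul1r.
  have t1 : tin c rho (fun y => partial d (B j i) y * psi y) by apply: tmul => //; exact: sm_partial.
  have t2 b : tin c rho (fun y => partial d (a j i b) y * psi y) by apply: tmul => //; exact: sm_partial.
  have -> : (fun y => partial d (B j i) y * psi y - \sum_b partial b (fun z => 0 * psi z) y) =
     (fun y => partial d (B j i) y * psi y).
    by apply/funext => y; rewrite big1 ?subr0.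
  rewrite sumrN -(lf_sum rho0 (sol_T HS i)); last by move=> b; exact/tin_cin/tin_partial.
  have c3 : cin c rho (fun y => \sum_b partial b (fun y => partial d (a j i b) y * psi y) y).
    by apply: tin_cin; apply: (tin_sum rho0) => b; exact: tin_partial.
  have c4 : cin c rho (partial d (L i psi)) by exact/tin_cin/tin_partial.
  rewrite -opprD -(lfD (sol_T HS i) c3 c4) -(lfB (sol_T HS i) (tin_cin t1) (cinD c3 c4)).
  have c5 : cin c rho (L i (partial d psi)).
    apply: tin_cin; apply: tinB; first exact: tmul.
    by apply: (tin_sum rho0) => b; apply: tin_partial; exact: tmul.
  rewrite -(lfN rho0 (sol_T HS i) c5); congr (T i _); apply/funext => y.
  have sp := tin_smooth tp; have sdp := tin_smooth tdp.
  have sap b : smooth (fun z => a j i b z * psi z) by exact: sm_mul.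
  rewrite {1}/L partialB; [|exact: sm_mul|by apply: sm_sum => b _; exact: sm_partial].
  rewrite partialM// partial_sum; last by move=> b; exact: sm_partial.
  have Eb b : partial d (partial b (fun z => a j i b z * psi z)) y =
     partial b (fun y => partial d (a j i b) y * psi y) y + partial b (fun z => a j i b z * partial d psi z) y.
    rewrite (partial_comm _ _ _ (sap b)) -partialD; [|exact: tin_smooth (t2 b)|exact: sm_mul].
    congr (partial b _ y); apply/funext => z; exact: partialM.
  under [X in _ - (_ + (_ - X))]eq_bigr => b _ do rewrite Eb.
  rewrite big_split /= /L; ring.
under eq_bigr => i _ do rewrite Fi.
rewrite sumrN; apply: etrans (congr1 -%R (sol_eq HS j tdp)) _.
by rewrite (I_parts d (sol_f HS j) (tin_smooth tp) (tin_Cc tp)) opprK.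
Qed.

End Prolongation.

Section AllDerivatives.
Variables (R : realType) (n : nat).
Local Notation V := 'rV[R]_n.

Definition pd (s : seq 'I_n) (g : V -> R) : V -> R := foldr (@partial R n) g s.

Lemma sm_pd s g : smooth g -> smooth (pd s g).
Proof. by move=> sg; elim: s => //= b s IH; exact: sm_partial. Qed.

Lemma Cc_pd s g : smooth g -> Cc g -> Cc (pd s g).
Proof. by move=> sg Cg; elim: s => //= b s IH; apply: Cc_partial => //; exact: sm_pd. Qed.

(** The induction on s runs over all systems at once: a derivative of T is a component of the
    prolonged system, to which the hypothesis for the shorter list applies. *)
Theorem all_derivatives_bounded (c : V) (rho lam : R) s : 0 < rho -> 0 < lam < 1 ->
  forall (Iu Je : finType) (a : Je -> Iu -> 'I_n -> V -> R) (B : Je -> Iu -> V -> R)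
    (f : Je -> V -> R) (T : Iu -> (V -> R) -> R),
  solution c rho a B f T -> apriori c rho a lam ->
  forall i chi, tin c rho chi -> exists2 C : R, 0 <= C & forall psi, smooth psi -> Cc psi ->
    `|T i (fun y => chi y * pd s psi y)| <= C * nrm psi.
Proof.
move=> rho0 lam01; elim: s => [|b s IH] Iu Je a B f T HS HE i chi tc.
  by have [C C0 HC] := lf_bd (sol_T HS i) tc; exists C => // psi _; exact: HC.
have [T1 [H0 Hb HS1]] := prolongation rho0 HS lam01 HE.
have HE1 : apriori c rho (pa a) lam by exact: apriori_prolong.
have [C C0 HC] := IH _ _ _ _ _ _ HS1 HE1 (Some b, i) _ tc.
have [C' C0' HC'] := IH _ _ _ _ _ _ HS1 HE1 (None, i) _ (tin_partial b tc).
exists (C + C'); first exact: addr_ge0.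
move=> psi sp Cp; have sps := sm_pd s sp.
have t1 : tin c rho (fun y => chi y * pd s psi y) by exact: tinMr.
have -> : T i (fun y => chi y * pd (b :: s) psi y) =
   - T1 (Some b, i) (fun y => chi y * pd s psi y) - T1 (None, i) (fun y => partial b chi y * pd s psi y).
  rewrite Hb// opprK H0 -(lfB (sol_T HS i)).
  - congr (T i _); apply/funext => y /=; rewrite partialM//; last exact: tin_smooth tc.
    by rewrite addrC addKr.
  - exact/tin_cin/tin_partial.
  - by apply: tinM_cin; [exact: tin_partial|exact: sm_cont].
apply: le_trans (ler_normB _ _) _; rewrite normrN mulrDl; apply: lerD; [exact: HC|exact: HC'].
Qed.

End AllDerivatives.

Local Transparent I nrm cnv cv mk dil tk twice moll ag.

Lemma supp_pd (R : realType) (n : nat) (A : R) (f : 'rV[R]_n -> R) s : supp A f -> supp A (pd s f).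
Proof. by move=> sA; elim: s => //= a s; exact: supp_partial. Qed.

(** * Sobolev embedding and smooth densities *)

Section Slices.
Variables (R : realType) (n : nat).
Implicit Types f : 'rV[R]_n.+1 -> R.

Lemma cns_shift (t s : R) (v : 'rV[R]_n) : cns t v + s *: unitv R ord0 = cns (t + s) v.
Proof.
apply/rowP => j; rewrite mxE [X in _ + X]mxE [in X in _ + X]mxE /=; case: (unliftP ord0 j) => [j' ->|->].
  by rewrite !cnsS mulr0 addr0.
by rewrite !cns0 mulr1.
Qed.

Lemma cns_shiftS (t s : R) (v : 'rV[R]_n) a :
  cns t (v + s *: unitv R a) = cns t v + s *: unitv R (lift ord0 a).
Proof.
apply/rowP => j; rewrite [RHS]mxE [(s *: unitv R (lift ord0 a)) 0 j]mxE unitvE.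
case: (unliftP ord0 j) => [j' ->|->]; last by rewrite !cns0 mulr0 addr0.
by rewrite !cnsS mxE [(s *: unitv R a) 0 j']mxE unitvE (inj_eq lift_inj).
Qed.

Lemma sm_slice f t : smooth f -> smooth (fun v => f (cns t v)).
Proof.
move=> sf k; apply: (@Ck_comp _ _ _ k setT setT f (cns t)) => //; try exact: openT.
move=> b; case: (unliftP ord0 b) => [j ->|->].
  by under eq_fun do rewrite cnsS; exact: Ck_coord openT.
by under eq_fun do rewrite cns0; exact: (Ck_cst k t openT).
Qed.

Lemma partial_slice f t v a : smooth f ->
  partial a (fun v => f (cns t v)) v = partial (lift ord0 a) f (cns t v).
Proof.
move=> sf; apply: is_derive_partial.
have -> : v = v + 0 *: unitv R a by rewrite scale0r addr0.
rewrite scale0r addr0 -{1}[v]addr0 -(scale0r (unitv R a)); apply/is_derive_line; have := line_derive (lift ord0 a) (cns t v) 0 sf.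
by rewrite scale0r addr0 => h; under eq_fun do rewrite cns_shiftS.
Qed.

Lemma derive_slice0 f (t : R) v : smooth f ->
  is_derive t 1 (fun s => f (cns s v)) (partial ord0 f (cns t v)).
Proof.
move=> sf; have := line_derive ord0 (cns 0 v) t sf; rewrite cns_shift add0r.
by under eq_fun do rewrite cns_shift add0r.
Qed.

Lemma pd_slice f t s : smooth f ->
  pd s (fun v => f (cns t v)) = (fun v => pd (map (lift ord0) s) f (cns t v)).
Proof.
move=> sf; elim: s => //= a s ->; apply/funext => v; rewrite partial_slice//; exact: sm_pd.
Qed.

Lemma Cc_slice f t : Cc f -> Cc (fun v => f (cns t v)).
Proof.
move=> [cf [A sA]]; split; first exact: cont_slice1.
by exists A => v vA; apply: sA; rewrite norm_cns lt_max vA orbT.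
Qed.

End Slices.

Section SupBound.
Variable R : realType.

Lemma ndecr_derive (f df : R -> R) (a b : R) : a <= b ->
  (forall s : R, a <= s <= b -> is_derive s 1 f (df s)) ->
  (forall s : R, a <= s <= b -> 0 <= df s) -> f a <= f b.
Proof.
rewrite le_eqVlt => /orP[/eqP->//|ab] D D0.
have [x|x xab|s sab e] := @MVT R f df a b ab.
- by rewrite in_itv /= => /andP[/ltW x1 /ltW x2]; apply: D; rewrite x1.
- apply: derivable_within_continuous => y; rewrite in_itv /= => h; exact: (@ex_derive _ _ _ _ _ _ _ (D y h)).
move: sab; rewrite in_itv /= => /andP[/ltW s1 /ltW s2].
by rewrite -subr_ge0 e mulr_ge0 ?D0 ?s1 ?s2// subr_ge0 ltW.
Qed.

(** If F is an antiderivative of |g'|, then F + g and F - g are nondecreasing, and g vanishes at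
    both ends. *)
Lemma sup_J1 (A t : R) (g g' : R -> R) : continuous g' ->
  (forall s : R, is_derive s 1 g (g' s)) -> (forall s, A <= `|s| -> g s = 0) -> 0 <= A ->
  `|g t| <= J1 A (fun s => `|g' s|).
Proof.
move=> cg D g0 A0; have ca := cont_abs cg.
have [F DF ->//] := J1_ex A ca.
have mono (e : R) s s' : `|e| = 1 -> - A <= s -> s <= s' -> F s + e * g s <= F s' + e * g s'.
  move=> e1 h1 h2; apply: (@ndecr_derive (fun s => F s + e * g s) (fun s => `|g' s| + e * g' s)) => //.
    move=> x /andP[x1 x2]; have DFx := DF x (le_trans h1 x1).
    by have := is_deriveD (DFx) (is_deriveZ e (D x)); rewrite /= !fctE /GRing.scale/=.
  move=> x _; have : - (e * g' x) <= `|g' x| by rewrite -[leRHS]mul1r -e1 -normrM -normrN ler_norm.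
    lra.
have [tA|tA] := leP A `|t|.
  rewrite g0// normr0 subr_ge0; have := mono 1 (- A) A (normr1 _) (lexx _) ltac:(by rewrite ge0_cp).
  by rewrite !g0 ?normrN ?ger0_norm// !mulr0 !addr0.
have := ltW tA; rewrite ler_norml => /andP[t1 t2].
have gA : g A = 0 by rewrite g0// ger0_norm.
have gNA : g (- A) = 0 by rewrite g0// normrN ger0_norm.
have n1 : `|-1 : R| = 1 by rewrite normrN1.
have m1 := mono 1 _ _ (normr1 _) (lexx _) t1; have m2 := mono (-1) _ _ n1 (lexx _) t1.
have m3 := mono 1 _ _ (normr1 _) t1 t2; have m4 := mono (-1) _ _ n1 t1 t2.
move: m1 m2 m3 m4; rewrite gA gNA !mulr0 !addr0 !mulN1r !mul1r => m1 m2 m3 m4.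
by rewrite ler_norml; apply/andP; split; lra.
Qed.

(** Every direction once: the mixed derivative d_1 ... d_n, whose L^1 norm bounds the supremum. The
    order makes the first coordinate the innermost derivative, as the induction by slices
    requires. *)
Fixpoint dirs n : seq 'I_n :=
  match n return seq 'I_n with
  | 0 => [::]
  | n'.+1 => rcons (map (lift ord0) (dirs n')) ord0
  end.

Lemma pd_rcons n s (a : 'I_n) (f : 'rV[R]_n -> R) : pd (rcons s a) f = pd s (partial a f).
Proof. by rewrite /pd foldr_rcons. Qed.

Lemma sup_pd n (f : 'rV[R]_n -> R) x : smooth f -> Cc f -> `|f x| <= I (fun y => `|pd (dirs n) f y|).
Proof.
elim: n f x => [|n IH] f x sf Cf.
  rewrite /I /= (_ : x = 0)//; by apply/rowP => -[].
have [A A0 sA] := Cc_supp Cf; have [t [v ->]] := cnsP x.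
pose h := pd (dirs n.+1) f.
have sh : smooth h by exact: sm_pd.
have sAh : supp (A + 1) (fun y => `|h y|).
  move=> y yA; suff -> : h y = 0 by rewrite normr0.
  by apply: (supp_pd _ sA); lra.
have A1 : 0 <= A + 1 by rewrite addr_ge0.
have ch : continuous (fun y => `|h y|) by apply: cont_abs; exact: sm_cont.
rewrite -/h (I_BI A1 ch sAh) /=.
have sp := sm_partial ord0 sf; have Cp := Cc_partial ord0 sf Cf.
have cp0 : continuous (fun s : R => partial ord0 f (cns s v)).
  move=> s; apply: differentiable_continuous; apply/derivable1_diffP.
  exact: (@ex_derive _ _ _ _ _ _ _ (derive_slice0 s v sp)).
apply: le_trans (@sup_J1 (A + 1) t (fun s => f (cns s v)) (fun s => partial ord0 f (cns s v)) _ _ _ A1) _.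
- exact: cp0.
- by move=> s; exact: derive_slice0.
- by move=> s sA1; apply: sA; rewrite norm_cns lt_max; apply/orP; left; lra.
have cs : continuous (fun p : R * 'rV[R]_n => `|h (cns p.1 p.2)|).
  exact: (cont_slice ch).
apply: J1_le => //.
- exact: cont_abs.
- exact: (BI_param A1 cs).
move=> s _; have ss := sm_slice s sp.
apply: le_trans (IH (fun v => partial ord0 f (cns s v)) v ss (Cc_slice s Cp)) _.
rewrite (pd_slice s _ sp) le_eqVlt; apply/orP; left; apply/eqP.
rewrite /h /= pd_rcons; apply: I_BI => //.
  by move: (@cont_slice1 R n _ s ch); rewrite /h /= pd_rcons.
move=> y yA; have := sAh (cns s y); rewrite /h /= pd_rcons; apply.
by rewrite norm_cns lt_max yA orbT.
Qed.

Lemma sup_nrm_pd n (A : R) : exists2 K : R, 0 <= K & forall f : 'rV[R]_n -> R, smooth f -> supp A f ->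
  forall x, `|f x| <= K * nrm (pd (dirs n) f).
Proof.
have [th [Cth sth th01 th1]] := @plateau_Cc R n A.
exists (nrm th); first exact: nrm_ge0.
move=> f sf sA x; have Cf : Cc f by split; [exact: sm_cont|exists A].
apply: le_trans (sup_pd x sf Cf) _; rewrite mulrC.
have Ch := Cc_pd (dirs n) sf Cf; have sh : supp A (pd (dirs n) f).
  exact: supp_pd.
have -> : (fun y => `|pd (dirs n) f y|) = (fun y => `|pd (dirs n) f y| * th y).
  by apply/funext => y; have [/th1 ->|/sh ->] := leP `|y| A; rewrite ?mulr1 ?normr0 ?mul0r.
apply: le_trans (ler_norm _) _; apply: le_trans (cauchy_schwarz_I (Cc_abs Ch) Cth) _.
apply: ler_wpM2r; first exact: nrm_ge0.
by apply: nrm_le => //; [exact: Cc_abs|move=> y; rewrite normr_id].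
Qed.

End SupBound.

Local Opaque I nrm cnv cv mk dil tk twice moll ag.

Section Representation.
Variables (R : realType) (n : nat).
Local Notation V := 'rV[R]_n.

Lemma lipschitz_partial (f : V -> R) (m : R) : smooth f -> 0 <= m ->
  (forall a z, `|partial a f z| <= m) -> forall x y, `|f x - f y| <= n%:R * m * `|x - y|.
Proof.
move=> sf m0 H x y; have -> : x = y + (x - y) by rewrite addrC subrK.
apply: le_trans (@increment_le R n f y (`|x - y| + 1) m (x - y) m0 _ _) _.
- by move=> z a _; split; [exact: (@ex_derive _ _ _ _ _ _ _ (sm_derive a z sf))|exact: H].
- by rewrite ltrDl.
- by rewrite [y + _ - y]addrC addKr.
Qed.

Lemma pd_convr k (g : V -> R) s : smooth k -> Cc k -> smooth g -> Cc g ->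
  pd s (cnv k g) = cnv k (pd s g).
Proof.
move=> sk Ck sg Cg; elim: s => //= a s ->; apply: partial_convr => //; [exact: sm_pd|exact: Cc_pd].
Qed.

Lemma I_parts_pd (f g : V -> R) s : smooth f -> Cc f -> smooth g -> Cc g ->
  `|I (fun y => pd s f y * g y)| = `|I (fun y => f y * pd (rev s) g y)|.
Proof.
move=> sf Cf; elim: s g => [|a s IH] g sg Cg //=.
rewrite rev_cons pd_rcons -IH; [|exact: sm_partial|exact: Cc_partial].
by rewrite (I_parts a (sm_pd s sf) sg Cg) normrN.
Qed.

Variables (w : (V -> R) -> R) (A C : R).
Hypothesis wl : linear_functional w.
Hypothesis wb : sup_bounded w A C.
Hypothesis wpd : forall s, exists2 K : R, 0 <= K &
  forall psi, smooth psi -> Cc psi -> `|w (pd s psi)| <= K * nrm psi.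

Let g k := cv w (mk (tk R k)).

Let Cm k : Cc (@mk R n (tk R k)). Proof. exact: Cc_mk (tk_gt0 R k). Qed.
Let sg k : smooth (g k). Proof. by apply: (sm_cv wl wb); exact: sm_mk. Qed.
Let Cg k : Cc (g k). Proof. exact: (Cc_cv wl wb (Cm k)). Qed.
Let suppg k : supp (A + 1) (g k).
Proof.
apply: supp_le (supp_cv wl wb (Cc_cont (Cm k)) (supp_mk (tk_gt0 R k))).
by rewrite lerD2l tk_le1.
Qed.

Let absmk k : (fun y : V => `|mk (tk R k) y|) = mk (tk R k).
Proof. by apply/funext => y; rewrite ger0_norm// mk_ge0// tk_gt0. Qed.

(** Paired with itself, the derivative of [g k] is unloaded by parts onto the other factor, then
    through the mollifier onto w, where the bound for the reversed list applies. *)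
Let nrm_bounded s : exists2 K : R, 0 <= K & forall k, nrm (pd s (g k)) <= K.
Proof.
have [K K0 HK] := wpd (rev s); exists K => // k.
have sp := sm_pd s (sg k); have Cp := Cc_pd s (sg k) (Cg k).
have Cr := Cc_pd (rev s) sp Cp.
apply: nrm_dual => //; rewrite I_parts_pd// (I_cv_mk wl wb (tk_gt0 R k) Cr).
rewrite -pd_convr//; last exact: sm_mk.
apply: le_trans (HK _ _ _) _; [by apply: sm_conv => //; exact: sm_mk|exact: Cc_conv|].
apply: ler_wpM2l => //; apply: le_trans (nrm_conv (Cm k) Cp) _.
by rewrite absmk I_mk ?mul1r// tk_gt0.
Qed.

Let sup_pd_bounded s : exists2 M : R, 0 <= M & forall k x, `|pd s (g k) x| <= M.
Proof.
have [K K0 HK] := sup_nrm_pd n (A + 1); have [K' K0' HK'] := nrm_bounded (dirs n ++ s).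
exists (K * K'); first exact: mulr_ge0.
move=> k x; apply: le_trans (HK _ (sm_pd s (sg k)) _ x) _.
  exact: supp_pd.
by apply: ler_wpM2l => //; apply: le_trans (HK' k); rewrite /pd foldr_cat.
Qed.

Let lip s : exists2 L : R, 0 <= L & forall k x y, `|pd s (g k) x - pd s (g k) y| <= L * `|x - y|.
Proof.
have /choice[M HM] a : exists M : R, 0 <= M /\ forall k x, `|pd (a :: s) (g k) x| <= M.
  by have [M M0 HM] := sup_pd_bounded (a :: s); exists M.
have M0 : 0 <= \sum_a M a by apply: sumr_ge0 => a _; case: (HM a).
exists (n%:R * \sum_a M a); first exact: mulr_ge0.
move=> k; apply: lipschitz_partial => //; first exact: sm_pd.
move=> a z; apply: le_trans ((HM a).2 k z) _; rewrite (bigD1 a)//= lerDl.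
by apply: sumr_ge0 => b _; case: (HM b).
Qed.

Let avg s (L : R) k l x : (forall x y, `|pd s (g k) x - pd s (g k) y| <= L * `|x - y|) -> 0 <= L ->
  `|cnv (mk (tk R l)) (pd s (g k)) x - pd s (g k) x| <= L * tk R l.
Proof.
move=> HL L0; rewrite cnvE; apply: (avg_le (tk_gt0 R l)); first exact: sm_cont (sm_pd s (sg k)).
by move=> y yt; apply: le_trans (HL _ _) _; rewrite ler_wpM2l// distrC.
Qed.

(** Mollifying [g k] at scale l and [g l] at scale k give the same function, and each operation
    moves its argument by at most L times the scale. *)
Let cauchy s (L : R) k l x : (forall k x y, `|pd s (g k) x - pd s (g k) y| <= L * `|x - y|) -> 0 <= L ->
  `|pd s (g k) x - pd s (g l) x| <= L * tk R k + L * tk R l.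
Proof.
move=> HL L0; have h1 := avg l x (HL k) L0; have h2 := avg k x (HL l) L0.
have sm j : smooth (@mk R n (tk R j)) by exact: sm_mk.
have e : cnv (mk (tk R l)) (pd s (g k)) = cnv (mk (tk R k)) (pd s (g l)).
  rewrite -(pd_convr s (sm l) (Cm l) (sg k) (Cg k)) -(pd_convr s (sm k) (Cm k) (sg l) (Cg l)).
  exact: (congr1 (pd s) (conv_cv_comm wl wb (Cm l) (Cm k))).
rewrite e in h1; move: h1 h2.
move: (cnv (mk (tk R k)) (pd s (g l)) x) (pd s (g k) x) (pd s (g l) x) => p q r h1 h2.
have -> : q - r = - (p - q) + (p - r) by ring.
by apply: le_trans (ler_normD _ _) _; rewrite normrN addrC; apply: lerD.
Qed.

Let u_ex : exists u : seq 'I_n -> V -> R, forall s x, tends (fun k => pd s (g k) x) (u s x).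
Proof.
have /choice[u Hu] (p : seq 'I_n * V) : exists L, tends (fun k => pd p.1 (g k) p.2) L.
  apply: tends_ex => e e0; have [L L0 HL] := lip p.1.
  have L1 : 0 < 2 * (L + 1) by rewrite mulr_gt0// ltr_wpDl.
  have [k0 Hk] := tk_small (divr_gt0 e0 L1).
  exists k0 => k l /Hk hk /Hk hl; apply: le_trans (cauchy _ _ _ HL L0) _.
  move: hk hl; rewrite !ltr_pdivlMr// -mulrDr => hk hl.
  have := tk_gt0 R k; have := tk_gt0 R l; move: hk hl; move: (tk R k) (tk R l) => x y; nra.
by exists (fun s x => u (s, x)) => s x; exact: (Hu (s, x)).
Qed.

Lemma smooth_representation : exists u : V -> R, [/\ smooth u, Cc u &
  forall psi, Cc psi -> w psi = I (fun y => u y * psi y)].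
Proof.
have [u Hu] := u_ex.
have ulip s : exists2 L : R, 0 <= L & (forall x y, `|u s x - u s y| <= L * `|x - y|) /\
   (forall k x, `|pd s (g k) x - u s x| <= L * tk R k).
  have [L L0 HL] := lip s; exists L => //; split.
    move=> x y; apply: (tends_le (u := fun k => -1 * pd s (g k) y + pd s (g k) x)).
      by exists 0%N => k _; rewrite addrC mulN1r.
    have -> : u s x - u s y = -1 * u s y + u s x by rewrite mulN1r addrC.
    exact: tends_lin.
  move=> k x; apply/ler_addgt0Pr => e e0.
  have L1 : 0 < L + 1 by rewrite ltr_wpDl.
  have [k0 Hk0] := tk_small (divr_gt0 e0 L1).
  apply: (tends_le (u := fun l => -1 * pd s (g l) x + pd s (g k) x)).
    exists k0 => l /Hk0 hl; rewrite addrC mulN1r; apply: le_trans (cauchy _ _ _ HL L0) _.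
    rewrite lerD2l; move: hl; rewrite ltr_pdivlMr//.
    by have := tk_gt0 R l; move: (tk R l) => y; nra.
  have -> : pd s (g k) x - u s x = -1 * u s x + pd s (g k) x by rewrite mulN1r addrC.
  by apply: tends_lin => //; exact: tends_cst.
(* The mean value theorem for [g k], with the Lipschitz constant of the next derivative, is uniform
   in k and so survives the limit. *)
have uder s b x : is_derive x (unitv R b) (u s) (u (b :: s) x).
  have -> : x = x + 0 *: unitv R b by rewrite scale0r addr0.
  apply/is_derive_line; rewrite scale0r addr0; apply: is_derive_dist => e e0.
  have [L L0 HL] := lip (b :: s).
  have L1 : 0 < L + 1 by rewrite ltr_wpDl.
  exists (e / (L + 1)); first exact: divr_gt0.
  move=> h; rewrite ltr_pdivlMr// => hr; rewrite add0r scale0r addr0.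
  apply: (tends_le (u := fun k => - h * pd (b :: s) (g k) x + (-1 * pd s (g k) x + pd s (g k) (x + h *: unitv R b)))); last first.
    have -> : u s (x + h *: unitv R b) - u s x - h * u (b :: s) x
      = - h * u (b :: s) x + (-1 * u s x + u s (x + h *: unitv R b)) by ring.
    by apply: tends_lin => //; apply: tends_lin.
  exists 0%N => k _.
  have [xi xih E] := @mvt_ex R (fun r => pd s (g k) (x + r *: unitv R b)) (fun r => pd (b :: s) (g k) (x + r *: unitv R b)) h
    (fun r _ => line_derive b x r (sm_pd s (sg k))).
  rewrite scale0r addr0 in E.
  have -> : - h * pd (b :: s) (g k) x + (-1 * pd s (g k) x + pd s (g k) (x + h *: unitv R b))
    = h * (pd (b :: s) (g k) (x + xi *: unitv R b) - pd (b :: s) (g k) x).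
    move: (pd s (g k) (x + h *: unitv R b)) (pd s (g k) x) (pd (b :: s) (g k) (x + xi *: unitv R b)) (pd (b :: s) (g k) x) E.
    by move=> p q r r' E; have -> : p = q + r * h by [rewrite -E addrC subrK]; ring.
  rewrite normrM mulrC ler_wpM2r//; apply: le_trans (HL k _ _) _.
  have -> : x + xi *: unitv R b - x = xi *: unitv R b by rewrite addrC addKr.
  rewrite normrZ; apply: le_trans (_ : L * `|h| <= _).
    rewrite ler_wpM2l//; apply: le_trans xih; rewrite ler_piMr//; exact: norm_unitv.
  have := normr_ge0 h; nra.
have ucont s : continuous (u s).
  move=> x; apply: for_dist => e e0; have [L L0 [HL _]] := ulip s.
  have L1 : 0 < L + 1 by rewrite ltr_wpDl.
  apply/nbhs_ballP; exists (e / (L + 1)); first exact: divr_gt0.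
  move=> z; rewrite -ball_normE /= ltr_pdivlMr// => h; apply: le_trans (HL _ _) _.
  by rewrite distrC; have := normr_ge0 (x - z); nra.
have usm k s : Ck k setT (u s).
  elim: k s => [|k IH] s; first by split => // y _; exact: ucont.
  apply: (@CkS _ _ k setT (u s) (fun b => u (b :: s))) => //; first exact: openT.
  by move=> y _; exact: ucont.
have [L L0 [_ HL]] := ulip [::].
have Cu : Cc (u [::]).
  split; first exact: ucont.
  exists (A + 1) => y yA; apply: (tends_unique (Hu [::] y)).
  refine (tends_eventually _ (@tends_cst R 0)); exists 0%N => k _; by rewrite /= suppg.
exists (u [::]); split => // psi Cpsi.
have t1 : tends (fun k => I (fun y => g k y * psi y)) (w psi).
  apply: tendsP => e e0; have C0 := sup_bounded_ge0 wl wb.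
  have C1 : 0 < C + 1 by rewrite ltr_wpDl.
  have [r r0 Hr] := conv_mk_unif Cpsi (divr_gt0 e0 C1).
  have [k0 Hk0] := tk_small r0; exists k0 => k /Hk0 kr.
  rewrite (I_cv_mk wl wb (tk_gt0 R k) Cpsi) -(lfunB wl); [|exact: Cc_cont (Cc_conv (Cm k) Cpsi)|exact: Cc_cont].
  apply: le_trans (wb (m := e / (C + 1)) _ _ _) _.
  - by apply: contB; [exact: Cc_cont (Cc_conv (Cm k) Cpsi)|exact: Cc_cont].
  - by rewrite ltW// divr_gt0.
  - by move=> y _; apply: Hr; rewrite tk_gt0.
  - by rewrite mulrA ler_pdivrMr// mulrC ler_wpM2l ?(ltW e0)// lerDl.
apply: (tends_unique t1); apply: tendsP => e e0.
pose N := I (fun y => `|psi y|); have Ca := Cc_abs Cpsi.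
have N0 : 0 <= N by apply: I_ge0.
have M1 : 0 < L * N + 1 by rewrite ltr_wpDl// mulr_ge0.
have [k0 Hk0] := tk_small (divr_gt0 e0 M1); exists k0 => k /Hk0; rewrite ltr_pdivlMr// => hk.
have cp := Cc_cont Cpsi.
rewrite -I_sub; [|exact: (CcMr (Cg k) cp)|exact: (CcMr Cu cp)].
apply: le_trans (I_abs _) _; first by apply: CcB; exact: CcMr.
apply: le_trans (_ : I (fun y => (L * tk R k) * `|psi y|) <= _).
  apply: I_le; [apply: Cc_abs; apply: CcB; exact: CcMr|exact: CcZ|].
  by move=> y; rewrite -mulrBl normrM ler_wpM2r//; exact: HL.
rewrite I_scal// -/N; have := tk_gt0 R k; move: hk; move: (tk R k) => y; nra.
Qed.

End Representation.

Theorem local_regularity (R : realType) (n : nat) (c : 'rV[R]_n) (rho lam : R)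
  (Iu Je : finType) (a : Je -> Iu -> 'I_n -> 'rV[R]_n -> R) (B : Je -> Iu -> 'rV[R]_n -> R)
  (f : Je -> 'rV[R]_n -> R) (T : Iu -> ('rV[R]_n -> R) -> R) :
  0 < rho -> 0 < lam < 1 -> solution c rho a B f T -> apriori c rho a lam ->
  forall i chi, tin c rho chi -> exists u : 'rV[R]_n -> R, [/\ smooth u, Cc u &
    forall psi, Cc psi -> T i (fun y => chi y * psi y) = I (fun y => u y * psi y)].
Proof.
move=> rho0 lam01 HS HE i chi tc.
have [A [C [C2 [wl wb _ _]]]] := cutf_functional (sol_T HS i) tc.
apply: (smooth_representation wl wb) => s.
exact: (all_derivatives_bounded s rho0 lam01 HS HE).
Qed.

Local Transparent I nrm cnv cv mk dil tk twice moll ag.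

Lemma mkE (R : realType) (n : nat) (t : R) (y : 'rV[R]_n) : mk t y = t ^- n * moll (t^-1 *: y).
Proof. by []. Qed.

Lemma IE (R : realType) (n : nat) (f : 'rV[R]_n -> R) : I f = fine (iint (fun y => (f y)%:E)).
Proof. by []. Qed.

(** Nonnegativity of the variance of x. *)
Lemma sum_sq_le (R : realType) (T : finType) (x : T -> R) :
  (\sum_a x a) ^+ 2 <= #|T|%:R * \sum_a x a ^+ 2.
Proof.
have [N0|N0] := posnP #|T|.
  have E (y : T -> R) : \sum_a y a = 0 by rewrite big1// => a _; have := card0_eq N0 a; rewrite inE.
  by rewrite !E expr0n /= mulr0.
set S := \sum_a x a; set N : R := #|T|%:R; pose m := S / N.
have Np : 0 < N by rewrite ltr0n.
have mN : m * N = S by rewrite /m divfK// gt_eqF.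
have : 0 <= \sum_a (x a - m) ^+ 2 by apply: sumr_ge0 => a _; exact: sqr_ge0.
rewrite (eq_bigr (fun a => x a ^+ 2 + (- (2 * m) * x a + m ^+ 2))); last by move=> a _; ring.
have EN : \sum_(a : T) m ^+ 2 = N * m ^+ 2 by rewrite sumr_const mulr_natl.
rewrite !big_split /= EN -mulr_sumr -/S.
move: (\sum_a _) => Q h; have : 0 <= N * (Q + (- (2 * m) * S + N * m ^+ 2)) by rewrite mulr_ge0// ltW.
by rewrite (_ : N * _ = N * Q - 2 * (m * N) * S + (m * N) ^+ 2); [rewrite mN; lra|ring].
Qed.

(** * Fourier analysis: a lower Plancherel bound and the gain of mollification *)

Section Monotone.
Variable R : realType.

Lemma iint_ge0 n (f : 'rV[R]_n -> \bar R) : (forall y, 0 <= f y)%E -> (0 <= iint f)%E.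
Proof.
elim: n f => [|n IH] f H /=; first exact: H.
by apply: integral_ge0 => t _; apply: IH => v; exact: H.
Qed.

(* No measurability is needed: the integral of a nonnegative function is a supremum over
   the simple functions below it. *)
Lemma ge0_integral_mono (f g : R -> \bar R) : (forall x, 0 <= f x)%E -> (forall x, f x <= g x)%E ->
  (\int[lebesgue_measure]_x f x <= \int[lebesgue_measure]_x g x)%E.
Proof.
move=> f0 fg; have g0 x : (0 <= g x)%E := le_trans (f0 x) (fg x).
rewrite !ge0_integralTE//; apply: le_ereal_sup => _ [h /= hf <-]; exists h => //= x.
exact: le_trans (hf x) (fg x).
Qed.

Lemma iint_mono n (f g : 'rV[R]_n -> \bar R) : (forall y, 0 <= f y)%E -> (forall y, f y <= g y)%E ->
  (iint f <= iint g)%E.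
Proof.
elim: n f g => [|n IH] f g f0 fg /=; first exact: fg.
apply: ge0_integral_mono => t; first by apply: iint_ge0 => v; exact: f0.
by apply: IH => v.
Qed.

End Monotone.

Section Trig.
Variables (R : realType) (n : nat).
Local Notation V := 'rV[R]_n.
Implicit Types (x y z xi : V) (g k : V -> R).

Lemma dotpC x y : dotp x y = dotp y x.
Proof. by apply: eq_bigr => a _; rewrite mulrC. Qed.

Lemma dotpDl x y z : dotp (x + y) z = dotp x z + dotp y z.
Proof. by rewrite -big_split; apply: eq_bigr => a _; rewrite mxE mulrDl. Qed.

Lemma dotpZl (c : R) x z : dotp (c *: x) z = c * dotp x z.
Proof. by rewrite [RHS]mulr_sumr; apply: eq_bigr => a _; rewrite mxE mulrA. Qed.

Lemma dotpNl x z : dotp (- x) z = - dotp x z.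
Proof. by rewrite -scaleN1r dotpZl mulN1r. Qed.

Lemma dotp_ge0 x : 0 <= dotp x x.
Proof. by apply: sumr_ge0 => a _; exact: sqr_ge0. Qed.

Lemma cont_dotp : continuous (fun p : V * V => dotp p.1 p.2).
Proof.
apply: cont_sum => a; apply: contM.
  by apply: (cont_comp (f := fun x : V => x 0 a)); [exact: cont_fst|exact: coord_continuous].
by apply: (cont_comp (f := fun x : V => x 0 a)); [exact: cont_snd|exact: coord_continuous].
Qed.

Lemma cont_trig (h : R -> R) : continuous h -> continuous (fun p : V * V => h (dotp p.1 p.2)).
Proof. by move=> ch; apply: (cont_comp (f := h)) => //; exact: cont_dotp. Qed.

Lemma cont_dotpl xi : continuous (fun x => dotp x xi).
Proof.
by apply: cont_sum => a; apply: contM; [exact: coord_continuous|exact: cst_continuous].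
Qed.

Lemma cont_trigl (h : R -> R) xi : continuous h -> continuous (fun x => h (dotp x xi)).
Proof.
move=> ch; by apply: (@cont_comp R R V (fun x => dotp x xi) h) => //; exact: cont_dotpl.
Qed.

(** Up to the normalising power of 2 pi, the Fourier transform of a real g is [Ct g - i St g]. *)
Definition Ct g xi := I (fun x => cos (dotp x xi) * g x).
Definition St g xi := I (fun x => sin (dotp x xi) * g x).

Let ccos := @continuous_cos R.
Let csin := @continuous_sin R.

Lemma Cc_cos g xi : Cc g -> Cc (fun x => cos (dotp x xi) * g x).
Proof. by apply: CcMl; exact: cont_trigl. Qed.

Lemma Cc_sin g xi : Cc g -> Cc (fun x => sin (dotp x xi) * g x).
Proof. by apply: CcMl; exact: cont_trigl. Qed.

Lemma cont_Ct g : Cc g -> continuous (Ct g).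
Proof.
move=> Cg; have [A [C [wl wb _]]] := ag_functional Cg.
exact: (functional_param (G := fun p : V * V => cos (dotp p.2 p.1)) wl wb (cont_swap (cont_trig ccos))).
Qed.

Lemma cont_St g : Cc g -> continuous (St g).
Proof.
move=> Cg; have [A [C [wl wb _]]] := ag_functional Cg.
exact: (functional_param (G := fun p : V * V => sin (dotp p.2 p.1)) wl wb (cont_swap (cont_trig csin))).
Qed.

Lemma trig_le g (h : V -> R) : Cc g -> continuous h -> (forall x, `|h x| <= 1) ->
  `|I (fun x => h x * g x)| <= I (fun x => `|g x|).
Proof.
move=> Cg ch h1; have Chg := CcMl ch Cg.
apply: le_trans (I_abs Chg) _; apply: I_le; [exact: Cc_abs|exact: Cc_abs|].
by move=> x; rewrite normrM ler_piMl.
Qed.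

Lemma Ct_abs g xi : Cc g -> `|Ct g xi| <= I (fun x => `|g x|).
Proof. by move=> Cg; apply: trig_le => //; [exact: cont_trigl|move=> x; exact: cos_max]. Qed.

Lemma St_abs g xi : Cc g -> `|St g xi| <= I (fun x => `|g x|).
Proof. by move=> Cg; apply: trig_le => //; [exact: cont_trigl|move=> x; exact: sin_max]. Qed.

Lemma Ct_refl g xi : Cc g -> Ct (fun x => g (- x)) xi = Ct g xi.
Proof.
move=> Cg; rewrite /Ct -(I_reflect 0 (Cc_cos xi Cg)); congr I; apply/funext => x.
by rewrite sub0r dotpNl cosN.
Qed.

Lemma St_refl g xi : Cc g -> St (fun x => g (- x)) xi = - St g xi.
Proof.
move=> Cg; rewrite /St -(I_reflect 0 (Cc_sin xi Cg)) -I_opp.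
  by congr I; apply/funext => x; rewrite sub0r dotpNl sinN mulNr opprK.
exact: (Cc_reflect 0 (Cc_sin xi Cg)).
Qed.

Lemma St_even g xi : Cc g -> (forall x, g (- x) = g x) -> St g xi = 0.
Proof.
move=> Cg ev; have := St_refl xi Cg; rewrite (_ : (fun x => g (- x)) = g); last exact/funext.
by move=> h; lra.
Qed.

Lemma I_conv_trig (h : R -> R) k g xi : continuous h -> Cc k -> Cc g ->
  I (fun x => h (dotp x xi) * cnv k g x) = I (fun y => I (fun x => h (dotp (x + y) xi) * k x) * g y).
Proof.
move=> ch Ck Cg; have [A A0 sA] := Cc_supp Ck; have [B B0 sB] := Cc_supp Cg.
pose F (p : V * V) := h (dotp p.1 xi) * (k (p.1 - p.2) * g p.2).
have cF : continuous F.
  have c1 : continuous (fun p : V * V => h (dotp p.1 xi)).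
    by apply: (@cont_comp R V _ fst (fun x => h (dotp x xi))); [exact: cont_fst|exact: cont_trigl].
  exact: (contM c1 (contM (cont_diff (Cc_cont Ck)) (cont_snd2 (Cc_cont Cg)))).
have s2 : supp2 (A + B) F.
  move=> x y H; rewrite /F /=.
  have [yB|/sB ->] := leP `|y| B; last by rewrite !mulr0.
  rewrite sA ?mul0r ?mulr0//; case: H => H; last by lra.
  have := ler_normD (x - y) y; rewrite subrK; lra.
have := I_swap cF s2.
have -> : (fun x => I (fun y => F (x, y))) = (fun x => h (dotp x xi) * cnv k g x).
  apply/funext => x; rewrite cnvE -I_scal//.
  by apply: CcMl => //; exact: Cc_cont (Cc_reflect x Ck).
move=> ->; congr I; apply/funext => y.
have Ch : Cc (fun x => h (dotp (x + y) xi) * k x).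
  apply: CcMl => //.
  apply: (@cont_comp R R V (fun x => dotp (x + y) xi) h) => //.
  rewrite (_ : (fun x => _) = (fun x => dotp x xi + dotp y xi)); last first.
    by apply/funext => x; exact: dotpDl.
  by apply: contD; [exact: cont_dotpl|exact: cst_continuous].
rewrite -(I_shift (- y) Ch) mulrC -I_scal; last exact: (Cc_shift (- y) Ch).
by congr I; apply/funext => x; rewrite /F /= subrK; ring.
Qed.

Lemma Ct_conv k g xi : Cc k -> Cc g -> Ct (cnv k g) xi = Ct k xi * Ct g xi - St k xi * St g xi.
Proof.
move=> Ck Cg; rewrite /Ct I_conv_trig// mulrC [St k xi * _]mulrC /St.
rewrite -!(mulrC (I (fun x => _ (dotp x xi) * k x))).
rewrite -!I_scal; [|exact: Cc_sin|exact: Cc_cos].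
rewrite -I_sub; [|exact/CcZ/Cc_cos|exact/CcZ/Cc_sin].
congr I; apply/funext => y.
have -> : (fun x => cos (dotp (x + y) xi) * k x) = (fun x => cos (dotp y xi) * (cos (dotp x xi) * k x)
    - sin (dotp y xi) * (sin (dotp x xi) * k x)).
  by apply/funext => x; rewrite dotpDl cosD; ring.
rewrite I_sub; [|exact/CcZ/Cc_cos|exact/CcZ/Cc_sin].
rewrite !I_scal; [|exact: Cc_sin|exact: Cc_cos].
ring.
Qed.

Lemma St_conv k g xi : Cc k -> Cc g -> St (cnv k g) xi = St k xi * Ct g xi + Ct k xi * St g xi.
Proof.
move=> Ck Cg; rewrite /St I_conv_trig// /Ct.
rewrite -!I_scal; [|exact: Cc_sin|exact: Cc_cos].
rewrite -I_add; [|exact/CcZ/Cc_cos|exact/CcZ/Cc_sin].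
congr I; apply/funext => y.
have -> : (fun x => sin (dotp (x + y) xi) * k x) = (fun x => cos (dotp y xi) * (sin (dotp x xi) * k x)
    + sin (dotp y xi) * (cos (dotp x xi) * k x)).
  by apply/funext => x; rewrite dotpDl sinD; ring.
rewrite I_add; [|exact/CcZ/Cc_sin|exact/CcZ/Cc_cos].
rewrite !I_scal; [|exact: Cc_cos|exact: Cc_sin].
ring.
Qed.

Lemma Ct_dil (t : R) g xi : 0 < t -> Cc g -> Ct (dil t g) xi = Ct g (t *: xi).
Proof.
move=> t0 Cg; rewrite /Ct -(I_dil t0 (Cc_cos _ Cg)); congr I; apply/funext => x.
rewrite /dil dotpZl [dotp x (t *: xi)]dotpC dotpZl dotpC mulrA mulVf ?gt_eqF// mul1r; ring.
Qed.

(** The derivatives of the sine as phase shifts, in the form asked for by [smooth1]. *)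
Definition sink (k : nat) (x : R) : R := sin (x + (pi / 2) *+ k).

Lemma smooth1_sin : smooth1 sink.
Proof.
move=> k x; rewrite /sink [(pi / 2) *+ k.+1]mulrSr addrA sinDpihalf.
have D1 : is_derive x 1 (fun r : R => r + (pi / 2) *+ k) 1.
  have := @is_derive_affine R ((pi / 2) *+ k) 1 x.
  by under eq_fun do rewrite mulr1 addrC.
have := @is_derive1_comp R (@sin R) (fun r : R => r + (pi / 2) *+ k) x _ _ (is_derive_sin _) D1.
by rewrite /GRing.scale /= mulr1.
Qed.

Lemma sm_dotp xi : smooth (fun x => dotp x xi).
Proof. by apply: sm_sum => a _; apply: sm_mul; [exact: sm_coord|exact: sm_cst]. Qed.

Lemma derive_dotp xi a x : is_derive x (unitv R a) (fun x => dotp x xi) (xi 0 a).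
Proof.
have -> : x = x + 0 *: unitv R a by rewrite scale0r addr0.
apply/is_derive_line; have := @is_derive_affine R (dotp x xi) (xi 0 a) 0.
move=> D; rewrite (_ : (fun r => _) = (fun r : R => dotp x xi + r * xi 0 a))//.
apply/funext => r; rewrite dotpDl dotpZl; congr (_ + r * _).
rewrite /dotp (bigD1 a)//= unitvE eqxx mul1r big1 ?addr0// => b /negbTE ba.
by rewrite unitvE eq_sym ba mul0r.
Qed.

Lemma sin0k : sink 0 = @sin R. Proof. by apply/funext => x; rewrite /sink mulr0n addr0. Qed.
Lemma sin1k : sink 1 = @cos R. Proof. by apply/funext => x; rewrite /sink mulr1n sinDpihalf. Qed.
Lemma sm_sin xi : smooth (fun x => sin (dotp x xi)).
Proof. by have := sm_comp1 0 smooth1_sin (sm_dotp xi); rewrite sin0k. Qed.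
Lemma sm_cos xi : smooth (fun x => cos (dotp x xi)).
Proof. by have := sm_comp1 1 smooth1_sin (sm_dotp xi); rewrite sin1k. Qed.

Lemma partial_sin xi a x : partial a (fun x => sin (dotp x xi)) x = xi 0 a * cos (dotp x xi).
Proof.
apply: is_derive_partial; rewrite mulrC.
exact: (is_derive_comp1 (is_derive_sin _) (derive_dotp xi a x)).
Qed.

Lemma partial_cos xi a x : partial a (fun x => cos (dotp x xi)) x = - (xi 0 a * sin (dotp x xi)).
Proof.
apply: is_derive_partial; rewrite mulrC -mulNr.
exact: (is_derive_comp1 (is_derive_cos _) (derive_dotp xi a x)).
Qed.

Lemma St_partial g xi a : smooth g -> Cc g -> St (partial a g) xi = - (xi 0 a * Ct g xi).
Proof.
move=> sg Cg; rewrite /St (I_parts a (sm_sin xi) sg Cg) /Ct -I_scal; last exact: Cc_cos.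
by congr (- I _); apply/funext => x; rewrite partial_sin mulrA.
Qed.

Lemma Ct_partial g xi a : smooth g -> Cc g -> Ct (partial a g) xi = xi 0 a * St g xi.
Proof.
move=> sg Cg; rewrite /Ct (I_parts a (sm_cos xi) sg Cg) /St -I_scal; last exact: Cc_sin.
rewrite -I_opp; last by apply: CcMl => //; exact/sm_cont/sm_partial/sm_cos.
by congr I; apply/funext => x; rewrite partial_cos mulNr opprK mulrA.
Qed.

(** Each integration by parts in a direction a of l yields a factor xi_a; a direction may be listed
    several times. *)
Lemma trig_decay (l : seq 'I_n) g : smooth g -> Cc g -> exists2 K : R, 0 <= K & forall xi,
  `|Ct g xi| * (\prod_(a <- l) (1 + `|xi 0 a|)) <= K /\ `|St g xi| * (\prod_(a <- l) (1 + `|xi 0 a|)) <= K.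
Proof.
elim: l g => [|a l IH] g sg Cg.
  exists (I (fun x => `|g x|)); first by apply: I_ge0 => //; exact: Cc_abs.
  by move=> xi; rewrite big_nil !mulr1; split; [exact: Ct_abs|exact: St_abs].
have [K K0 HK] := IH g sg Cg.
have [K' K0' HK'] := IH _ (sm_partial a sg) (Cc_partial a sg Cg).
exists (K + K'); first exact: addr_ge0.
move=> xi; have [h1 h2] := HK xi; have := HK' xi.
rewrite St_partial// Ct_partial// normrN !normrM big_cons => -[h3 h4].
by split; rewrite mulrA mulrDr mulr1 mulrDl; apply: lerD => //; rewrite [_ * `|xi 0 a|]mulrC.
Qed.

End Trig.

Section AtanBound.
Variable R : realType.

(** An integrable majorant on R^n whose box integrals are powers of arctangents. *)
Definition invsq n (z : 'rV[R]_n) : R := \prod_(a < n) (1 + z 0 a ^+ 2)^-1.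

Lemma one_sq_gt0 (x : R) : 0 < 1 + x ^+ 2. Proof. by rewrite ltr_wpDr// sqr_ge0. Qed.

Lemma cont_invsq1 : continuous (fun x : R => (1 + x ^+ 2)^-1).
Proof.
move=> x; apply: (@forV R R (fun x => 1 + x ^+ 2)); first by rewrite gt_eqF// one_sq_gt0.
apply: (@forD R R (fun=> 1) (fun x => x ^+ 2)); first exact: cst_continuous.
by apply: (@forM R R id id); exact: cvg_id.
Qed.

Lemma invsq_gt0 n (z : 'rV[R]_n) : 0 < invsq z.
Proof. by apply: prodr_gt0 => a _; rewrite invr_gt0 one_sq_gt0. Qed.

Lemma sm_invsq n : smooth (@invsq n).
Proof.
apply: sm_prod => a _; apply: sm_inv => [|y]; last by rewrite gt_eqF// one_sq_gt0.
apply: sm_add; first exact: sm_cst.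
exact: (sm_mul (@sm_coord R n a) (@sm_coord R n a)).
Qed.

Lemma BI_invsq (A : R) n : 0 <= A -> 0 <= BI A (@invsq n) <= pi ^+ n.
Proof.
move=> A0; elim: n => [|n IH]; first by rewrite /= /invsq big_ord0 expr0 ler01 lexx.
have [wl wb] := @BI_functional R A n A0.
have E : BI A (@invsq n.+1) = 2 * atan A * BI A (@invsq n).
  rewrite /=.
  have -> : (fun t => BI A (fun v : 'rV[R]_n => invsq (cns t v))) = (fun t => (1 + t ^+ 2)^-1 * BI A (@invsq n)).
    apply/funext => t; rewrite -(lfunZ _ wl); last exact: sm_cont (sm_invsq _).
    congr (BI A _); apply/funext => v; rewrite /invsq big_ord_recl cns0; congr (_ * _).
    by apply: eq_bigr => j _; rewrite cnsS.
  have -> : (fun t => (1 + t ^+ 2)^-1 * BI A (@invsq n)) = (fun t => BI A (@invsq n) * (1 + t ^+ 2)^-1 + 0).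
    by apply/funext => t; rewrite addr0 mulrC.
  rewrite (J1_lin _ cont_invsq1)//; last exact: cst_continuous.
  rewrite (J1_cst _ A0) mul0r addr0.
  rewrite (J1E cont_invsq1 A0 (fun x _ => is_derive1_atan x)) atanN; ring.
case/andP: IH => I0 I1.
have a0 : 0 <= 2 * atan A.
  rewrite mulr_ge0//; have [->|An0] := eqVneq A 0; first by rewrite atan0.
  have := @ndecr_derive R atan (fun x => (1 + x ^+ 2)^-1) 0 A A0 (fun x _ => is_derive1_atan x).
  by rewrite atan0; apply => x _; rewrite invr_ge0 ltW// one_sq_gt0.
have a1 : 2 * atan A <= pi.
  by have := atan_ltpi2 A; lra.
rewrite E; apply/andP; split; first exact: mulr_ge0.
by rewrite exprS; apply: ler_pM.
Qed.

End AtanBound.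

Local Opaque I nrm cnv cv mk dil moll.

Section Plancherel.
Variables (R : realType) (n : nat).
Local Notation V := 'rV[R]_n.

Let Cm := @Cc_moll R n.

(** The transform of moll convolved with itself; the self-convolution is taken to make it
    nonnegative. *)
Definition freq (z : V) : R := Ct (@moll R n) z ^+ 2.

Lemma cont_freq : continuous freq.
Proof. exact: contM (cont_Ct Cm) (cont_Ct Cm). Qed.

Lemma freq_ge0 z : 0 <= freq z. Proof. exact: sqr_ge0. Qed.

Lemma freq0 : freq 0 = 1.
Proof.
rewrite /freq (_ : Ct _ 0 = 1) ?expr1n// /Ct -[RHS](@I_moll R n); congr I; apply/funext => x.
by rewrite (_ : dotp x 0 = 0) ?cos0 ?mul1r// /dotp big1// => a _; rewrite mxE mulr0.
Qed.

Lemma freqE z : freq z = Ct (cnv (@moll R n) (@moll R n)) z.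
Proof. by rewrite (Ct_conv z Cm Cm) (St_even z Cm (@moll_even R n)) mulr0 subr0. Qed.

(** One factor 1 + |z_b| for each direction, squared, majorises the reciprocal of [invsq]; the
    direction a in which |z| is attained is listed once more to pay for |z|. *)
Lemma freq_decay : exists2 Q : R, 0 <= Q & forall z, `|z| * freq z <= Q * invsq z.
Proof.
have /choice[K HK] a : exists K : R, 0 <= K /\ forall z,
    `|Ct (@moll R n) z| * (\prod_(b <- a :: enum 'I_n) (1 + `|z 0 b|)) <= K.
  by have [K K0 HK] := trig_decay (a :: enum 'I_n) (@sm_moll R n) Cm; exists K; split => // z; case: (HK z).
have K0 : 0 <= \sum_a K a by apply: sumr_ge0 => a _; case: (HK a).
exists ((\sum_a K a) ^+ 2); first exact: sqr_ge0.
move=> z; pose q := \prod_(a < n) (1 + z 0 a ^+ 2).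
have q0 : 0 < q by apply: prodr_gt0 => a _; exact: one_sq_gt0.
have -> : invsq z = q^-1 by rewrite /invsq /q prodfV.
rewrite ler_pdivlMr//.
pose P := \prod_a (1 + `|z 0 a|).
have P0 : 0 <= P by apply: prodr_ge0 => a _; rewrite addr_ge0.
have P1 : q <= P ^+ 2.
  rewrite /P /q expr2 -big_split /=; apply: ler_prod => a _; rewrite ltW ?one_sq_gt0//=.
  by rewrite -[z 0 a ^+ 2]real_normK ?num_real//; have := normr_ge0 (z 0 a); move: (`|z 0 a|) => t; nra.
have [->|z0] := eqVneq z 0; first by rewrite normr0 !mul0r sqr_ge0.
have X0 := normr_ge0 (Ct (@moll R n) z); have z1 := normr_ge0 z.
have zK : (1 + `|z|) * (`|Ct (@moll R n) z| * P) <= \sum_a K a.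
  have [a za] : exists a, `|z| = `|z 0 a|.
    apply: contrapT => H; have : `|z| < `|z|; last by rewrite ltxx.
    apply: norm_lt_coord; first by rewrite normr_gt0.
    by move=> a; rewrite lt_neqAle norm_coord andbT; apply/eqP => e; apply: H; exists a.
  have := (HK a).2 z; rewrite big_cons big_enum /= -/P -za => h.
  apply: le_trans (_ : K a <= _); first by move: h; rewrite mulrCA.
  by rewrite (bigD1 a)//= lerDl; apply: sumr_ge0 => b _; case: (HK b).
rewrite /freq -(real_normK (num_real (Ct _ z))).
apply: le_trans (_ : ((1 + `|z|) * (`|Ct (@moll R n) z| * P)) ^+ 2 <= _); last first.
  by apply: lerXn2r; rewrite ?nnegrE// mulr_ge0// ?mulr_ge0// addr_ge0.
rewrite !exprMn [leRHS]mulrA; apply: ler_pM => //.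
  exact: ltW.
by apply: ler_wpM2r; [exact: sqr_ge0|nra].
Qed.

(** The autocorrelation. Its transform is the power spectrum of g and its value at 0 the squared
    norm, so that Plancherel becomes Fourier inversion at the origin. *)
Definition autoc (g : V -> R) := cnv g (fun x => g (- x)).

Lemma Cc_opp (g : V -> R) : Cc g -> Cc (fun x => g (- x)).
Proof. by move=> Cg; have := Cc_reflect 0 Cg; under eq_fun do rewrite sub0r. Qed.

Lemma Cc_autoc g : Cc g -> Cc (autoc g).
Proof. by move=> Cg; apply: Cc_conv => //; exact: Cc_opp. Qed.

Lemma autoc0 g : Cc g -> autoc g 0 = I (fun x => g x ^+ 2).
Proof.
move=> Cg; rewrite /autoc cnvE -(I_reflect 0 (Cc_sq Cg)); congr I; apply/funext => x.
by rewrite sub0r expr2.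
Qed.

Lemma Ct_autoc g xi : Cc g -> Ct (autoc g) xi = Ct g xi ^+ 2 + St g xi ^+ 2.
Proof.
by move=> Cg; rewrite Ct_conv ?Ct_refl ?St_refl//; [rewrite mulrN opprK !expr2|exact: Cc_opp].
Qed.

(** A frequency cut-off of compact support, which widens as d tends to 0; its own transform is a
    dilate of [freq]. *)
Definition cutfreq (d : R) (xi : V) : R := cnv (@moll R n) (@moll R n) (d *: xi).

Lemma Cc_cutfreq d : 0 < d -> Cc (cutfreq d).
Proof.
move=> d0; have := Cc_affine 0 (lt0r_neq0 d0) (Cc_conv Cm Cm).
by under eq_fun do rewrite addr0.
Qed.

(** The multiplication formula: the transform of the cut-off is d^-n freq(h / d), and h = d z gives
    the right-hand side. *)
Lemma plancherel_identity g d : Cc g -> 0 < d ->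
  I (fun xi => cutfreq d xi * (Ct g xi ^+ 2 + St g xi ^+ 2)) = I (fun z => freq z * autoc g (d *: z)).
Proof.
move=> Cg d0; have CR := Cc_autoc Cg; have CK := Cc_cutfreq d0.
have [A [C [wl wb _]]] := ag_functional CR.
pose k (p : V * V) := cos (dotp p.1 p.2).
have ck : continuous k by apply: cont_trig; exact: continuous_cos.
have := I_functional wl wb ck CK; rewrite /ag /k /= => E.
have -> : (fun xi => cutfreq d xi * (Ct g xi ^+ 2 + St g xi ^+ 2)) =
   (fun xi => I (fun h => cos (dotp xi h) * autoc g h) * cutfreq d xi).
  apply/funext => xi; rewrite -(Ct_autoc _ Cg) mulrC /Ct; congr (I _ * _).
  by apply/funext => h; rewrite dotpC.
rewrite E.
have Ek h : I (fun xi => cos (dotp xi h) * cutfreq d xi) = d ^- n * freq (d^-1 *: h).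
  have C1 := Cc_cos (d^-1 *: h) (Cc_conv Cm Cm).
  have := I_affine 0 (lt0r_neq0 d0) C1; rewrite gtr0_norm// -/(Ct _ _) -freqE => <-.
  congr I; apply/funext => xi; rewrite addr0 /cutfreq; congr (cos _ * _).
  by rewrite dotpZl [dotp xi (d^-1 *: h)]dotpC dotpZl dotpC mulrA divff ?mul1r// gt_eqF.
have -> : (fun h => I (fun xi => cos (dotp xi h) * cutfreq d xi) * autoc g h) =
   (fun h => d ^- n * (freq (d^-1 *: h) * autoc g h)).
  by apply/funext => h; rewrite Ek; exact/esym/mulrA.
have CF : Cc (fun z => freq z * autoc g (d *: z)).
  apply: CcMl; first exact: cont_freq.
  by have := Cc_affine 0 (lt0r_neq0 d0) CR; under eq_fun do rewrite addr0.
have di : d^-1 != 0 by rewrite invr_eq0 gt_eqF.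
have := I_affine 0 di CF; rewrite gtr0_norm ?invr_gt0//.
have -> : (fun y => freq (d^-1 *: y + 0) * autoc g (d *: (d^-1 *: y + 0))) = (fun h => freq (d^-1 *: h) * autoc g h).
  by apply/funext => h; rewrite addr0 scalerA divff ?scale1r// gt_eqF.
have CF' : Cc (fun h => freq (d^-1 *: h) * autoc g h).
  apply: CcMl => //; apply: (@cont_comp R V V (fun h => d^-1 *: h) freq); last exact: cont_freq.
  by have := @cont_affine R n d^-1 0; under eq_fun do rewrite addr0.
move=> e; rewrite I_scal// e exprVn invrK mulrA mulVf ?mul1r//.
by rewrite expf_neq0// gt_eqF.
Qed.

(** As d tends to 0, the average of the autocorrelation concentrates at the origin. The constant
    retains only the part of the integral of [freq] under a plateau supported in |z| <= 1, and the
    Lipschitz bound together with [freq_decay] makes the error O(d). *)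
Lemma plancherel_lower : exists2 c0 : R, 0 < c0 & forall g, smooth g -> Cc g -> forall e : R, 0 < e ->
  exists2 d1 : R, 0 < d1 & forall d, 0 < d <= d1 -> c0 * I (fun x => g x ^+ 2) - e <=
     I (fun xi => cutfreq d xi * (Ct g xi ^+ 2 + St g xi ^+ 2)).
Proof.
have h12 : (2^-1 : R) < 1 by rewrite invf_lt1// ltr1n.
pose psi : V -> R := plateau 0 2^-1 1.
have psi01 y : 0 <= psi y <= 1 by exact: plateau_01.
have psi_out y : 1 < `|y| -> psi y = 0.
  by move=> /ltW h; apply: plateau_out => //; rewrite subr0.
have Cpsi : Cc psi by split; [exact: sm_cont (sm_plateau 0 h12)|exists 1 => y; exact: psi_out].
have Cfp : Cc (fun z => freq z * psi z) by apply: CcMl Cpsi; exact: cont_freq.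
exists (I (fun z => freq z * psi z)).
  apply: (I_gt0 (y := 0)) => // [y|]; first by rewrite mulr_ge0 ?freq_ge0//; case/andP: (psi01 y).
  by rewrite freq0 mul1r /psi plateau_in// ?subrr ?normr0 ?ltr01// invr_ge0.
move=> g sg Cg e e0; have CR := Cc_autoc Cg.
have sR : smooth (autoc g) by apply: sm_conv => //; exact: Cc_opp.
have [L L0 HL] := smooth_lipschitz sR CR; have [B B0 sB] := Cc_supp CR.
have [Q Q0 HQ] := freq_decay.
have [th [Cth sth th01 th1]] := @plateau_Cc R n (B + 1).
have pi0 : 0 <= (pi : R) ^+ n by rewrite exprn_ge0// pi_ge0.
pose N := L * Q * pi ^+ n + 1.
have N0 : 0 < N by rewrite ltr_wpDl// !mulr_ge0.
exists (Num.min 1 (e / N)); first by rewrite lt_min ltr01 divr_gt0.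
move=> d /andP[d0]; rewrite le_min => /andP[d1]; rewrite ler_pdivlMr// => dN.
rewrite plancherel_identity// -autoc0//.
have Cthd : Cc (fun z => th (d *: z)).
  by have := Cc_affine 0 (lt0r_neq0 d0) Cth; under eq_fun do rewrite addr0.
have CRd : Cc (fun z => autoc g (d *: z)).
  by have := Cc_affine 0 (lt0r_neq0 d0) CR; under eq_fun do rewrite addr0.
have ci : continuous (@invsq R n) by exact: sm_cont (@sm_invsq R n).
have CI : Cc (fun z => invsq z * th (d *: z)) by exact: CcMl.
have Ile : I (fun z => invsq z * th (d *: z)) <= pi ^+ n.
  have [D D0 sD] := Cc_supp CI; rewrite (I_BI D0 (Cc_cont CI) sD).
  case/andP: (@BI_invsq R D n D0) => _; apply: le_trans; rewrite -subr_ge0.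
  have [wl wb] := @BI_functional R D n D0.
  rewrite -(lfunB wl ci (Cc_cont CI)); apply: BI_ge0 => //.
    exact: (contB ci (Cc_cont CI)).
  move=> y _; rewrite subr_ge0 ler_piMr ?(ltW (invsq_gt0 y))//.
  by case/andP: (th01 (d *: y)).
have R00 : 0 <= autoc g 0 by rewrite autoc0//; exact: I_sq_ge0.
(* The plateau th(d z) is 1 wherever the autocorrelation is nonzero and dominates psi. It confines
   the Lipschitz loss to a compact set, so that the error term can be integrated. *)
have key z : autoc g 0 * (freq z * psi z) - L * d * Q * (invsq z * th (d *: z)) <= freq z * autoc g (d *: z).
  have [t0 t1] := andP (th01 (d *: z)); have [p0 p1] := andP (psi01 z); have f0 := freq_ge0 z.
  have Rth : autoc g (d *: z) = th (d *: z) * autoc g (d *: z).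
    have [h|h] := leP `|d *: z| B; last by rewrite (sB _ h) mulr0.
    by rewrite th1 ?mul1r//; lra.
  have psith : psi z <= th (d *: z).
    have [h|/psi_out ->//] := leP `|z| 1.
    rewrite th1// normrZ gtr0_norm//; have := normr_ge0 z; nra.
  have low : autoc g 0 - L * (d * `|z|) <= autoc g (d *: z).
    have := HL 0 (d *: z); rewrite sub0r normrN normrZ (gtr0_norm d0).
    by have := ler_norm (autoc g 0 - autoc g (d *: z)); lra.
  have zf := HQ z.
  rewrite Rth; apply: le_trans (_ : freq z * (th (d *: z) * (autoc g 0 - L * (d * `|z|))) <= _); last first.
    by apply: ler_wpM2l => //; exact: ler_wpM2l.
  have h1 : autoc g 0 * (freq z * psi z) <= autoc g 0 * (freq z * th (d *: z)).
    by apply: ler_wpM2l => //; exact: ler_wpM2l.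
  have h2 : L * d * th (d *: z) * (`|z| * freq z) <= L * d * th (d *: z) * (Q * invsq z).
    by apply: ler_wpM2l => //; rewrite !mulr_ge0// ltW.
  have -> : freq z * (th (d *: z) * (autoc g 0 - L * (d * `|z|))) =
     autoc g 0 * (freq z * th (d *: z)) - L * d * th (d *: z) * (`|z| * freq z) by ring.
  have -> : L * d * Q * (invsq z * th (d *: z)) = L * d * th (d *: z) * (Q * invsq z) by ring.
  exact: lerB.
have Cl : Cc (fun z => autoc g 0 * (freq z * psi z) - L * d * Q * (invsq z * th (d *: z))).
  by apply: CcB; exact: CcZ.
have Cr : Cc (fun z => freq z * autoc g (d *: z)) by apply: CcMl => //; exact: cont_freq.
have := I_le Cl Cr key; rewrite I_sub; [|exact: CcZ|exact: CcZ].
rewrite !I_scal// mulrC => h; apply: le_trans h; rewrite lerD2l lerN2.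
apply: le_trans (_ : L * d * Q * pi ^+ n <= _); first by apply: ler_wpM2l => //; rewrite !mulr_ge0// ltW.
by apply: le_trans dN; rewrite /N; have := ltW d0; nra.
Qed.

End Plancherel.

Section FourierGain.
Variables (R : realType) (n : nat).
Local Notation V := 'rV[R]_n.
Implicit Types (g : V -> R).

Lemma one_cos_le (x : R) : `|1 - cos x| <= `|x|.
Proof.
have := @mvt_le_sym R (@cos R) (fun s => - sin s) x 0 1 (fun s _ => is_derive_cos s).
rewrite cos0 sub0r normrN mul1r; apply => s _; rewrite normrN; exact: sin_max.
Qed.

Lemma Ct_moll_lip (eta : V) : `|1 - Ct (@moll R n) eta| <= \sum_a `|eta 0 a|.
Proof.
have Cm := @Cc_moll R n; rewrite -{1}(@I_moll R n) /Ct -I_sub//; last exact: Cc_cos.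
have CB : Cc (fun x => moll x - cos (dotp x eta) * moll x) by apply: CcB => //; exact: Cc_cos.
apply: le_trans (I_abs CB) _.
rewrite -[leRHS]mulr1 -(@I_moll R n) -I_scal//.
apply: I_le; [exact: Cc_abs|exact: CcZ|].
move=> x; rewrite -{1}[moll x]mul1r -mulrBl normrM (ger0_norm (moll_ge0 x)).
have [x1|x1] := leP `|x| 1; last by rewrite supp_moll// !mulr0.
apply: ler_wpM2r; first exact: moll_ge0.
apply: le_trans (one_cos_le _) _; apply: le_trans (ler_norm_sum _ _ _) _.
apply: ler_sum => a _; rewrite normrM ler_piMl//; exact: le_trans (norm_coord x a) x1.
Qed.

Lemma powR_le_exp (x s : R) : 0 <= x <= 1 -> 0 < s <= 1 -> x <= x `^ s.
Proof.
move=> /andP[x0 x1] /andP[s0 s1]; have [->|xn] := eqVneq x 0; first exact: powR_ge0.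
have xp : 0 < x by rewrite lt_neqAle eq_sym xn.
rewrite /powR (negbTE xn) -{1}[x]lnK ?posrE// ler_expR.
have l0 : ln x <= 0 by rewrite ln_le0.
nra.
Qed.

(** With X = t^2 (1 + |xi|^2): if X >= 1 the left side is at most 4, as |Ct| <= 1; if X < 1 it is at
    most n X <= n X^s, as s <= 1. *)
Lemma multiplier_le (s t : R) (xi : V) : 0 < s <= 1 ->
  (1 - Ct (@moll R n) (t *: xi)) ^+ 2 <= (4 + n%:R) * (t ^+ 2) `^ s * (1 + dotp xi xi) `^ s.
Proof.
move=> s01; case/andP: (s01) => s0 s1; have D0 := dotp_ge0 xi.
rewrite -mulrA -powRM ?sqr_ge0//; last by rewrite addr_ge0.
set X := t ^+ 2 * _.
have X0 : 0 <= X by rewrite mulr_ge0 ?sqr_ge0// addr_ge0.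
have p0 : 0 <= X `^ s by exact: powR_ge0.
have n0 : 0 <= n%:R :> R by [].
have c1 : `|Ct (@moll R n) (t *: xi)| <= 1.
  apply: le_trans (Ct_abs _ (@Cc_moll R n)) _.
  rewrite (_ : (fun x => _) = @moll R n) ?I_moll//; apply/funext => x.
  by rewrite ger0_norm// moll_ge0.
have [X1|X1] := leP 1 X.
  have : 1 <= X `^ s.
    have := ge0_ler_powR (ltW s0) (x := 1) (y := X); rewrite powR1; apply => //.
    by rewrite nnegrE.
  by move: c1; rewrite ler_norml => /andP[]; nra.
have h := Ct_moll_lip (t *: xi).
have q : (\sum_a `|(t *: xi) 0 a|) ^+ 2 <= n%:R * X.
  apply: le_trans (_ : n%:R * \sum_a `|(t *: xi) 0 a| ^+ 2 <= _).
    by have := sum_sq_le (fun a => `|(t *: xi) 0 a|); rewrite card_ord.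
  apply: ler_wpM2l => //; rewrite /X mulrDr mulr1 /dotp mulr_sumr ler_wpDl ?sqr_ge0//.
  apply: ler_sum => a _; rewrite mxE normrM exprMn !real_normK ?num_real//.
have XX : X <= X `^ s by apply: powR_le_exp => //; rewrite X0 ltW.
have : (1 - Ct (@moll R n) (t *: xi)) ^+ 2 <= (\sum_a `|(t *: xi) 0 a|) ^+ 2.
  rewrite -real_normK ?num_real// lerXn2r ?nnegrE//.
  by apply: sumr_ge0.
nra.
Qed.

Lemma csq_fourier (v1 v2 : V -> R) (xi : V) : Cc v1 -> Cc v2 ->
  csq (fourier (fun y => (v1 y +i* v2 y)%C) xi) =
   (Num.sqrt (2 * pi) ^- n) ^+ 2 * ((Ct v1 xi + St v2 xi) ^+ 2 + (Ct v2 xi - St v1 xi) ^+ 2).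
Proof.
move=> C1 C2; rewrite /fourier /csq /ciint /=.
rewrite -!IE.
have -> : I (fun y : V => v1 y * cos (dotp y xi) - v2 y * - sin (dotp y xi)) = Ct v1 xi + St v2 xi.
  rewrite /Ct /St -I_add; [|exact: Cc_cos|exact: Cc_sin].
  by congr I; apply/funext => y; ring.
have -> : I (fun y : V => v1 y * - sin (dotp y xi) + v2 y * cos (dotp y xi)) = Ct v2 xi - St v1 xi.
  rewrite /Ct /St -I_sub; [|exact: Cc_cos|exact: Cc_sin].
  by congr I; apply/funext => y; ring.
move: (_ ^- n) (Ct v1 xi + St v2 xi) (Ct v2 xi - St v1 xi) => a b c; ring.
Qed.

(** On the transform side 1 - A is multiplication by [mt], which [multiplier_le] bounds by the
    Sobolev weight. Plancherel is used only to bound L^2 norms by frequency integrals. *)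
Theorem fourier_gain (s : R) : 0 < s <= 1 -> exists2 C : R, 0 <= C & forall v1 v2 : V -> R,
  smooth v1 -> Cc v1 -> smooth v2 -> Cc v2 -> forall (t h : R), 0 < t ->
  (hs_sq s (fun y => (v1 y +i* v2 y)%C) <= h%:E)%E ->
  I (fun x => (v1 x - cnv (mk t) v1 x) ^+ 2) + I (fun x => (v2 x - cnv (mk t) v2 x) ^+ 2)
    <= C * (t ^+ 2) `^ s * h.
Proof.
move=> s01; case/andP: (s01) => s0 s1.
have [c0 c00 HP] := @plancherel_lower R n.
pose w : R := (Num.sqrt (2 * pi) ^- n) ^+ 2.
have w0 : 0 < w.
  by rewrite exprn_gt0// invr_gt0 exprn_gt0// sqrtr_gt0 mulr_gt0// pi_gt0.
have Cm := @Cc_moll R n.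
have [M M0 HM] := Cc_bounded (Cc_conv Cm Cm).
exists (c0^-1 * w^-1 * (M + 1) * (4 + n%:R)).
  have M1 : 0 <= M + 1 by rewrite addr_ge0.
  have n4 : 0 <= 4 + n%:R :> R by rewrite addr_ge0.
  by rewrite !mulr_ge0 ?invr_ge0 ?(ltW c00) ?(ltW w0).
move=> v1 v2 sv1 Cv1 sv2 Cv2 t h t0 Hh.
have Cmt := @Cc_mk R n _ t0.
pose g (v : V -> R) x := v x - cnv (mk t) v x.
have sg v : smooth v -> Cc v -> smooth (g v).
  by move=> sv Cv; apply: sm_sub => //; apply: sm_conv => //; exact: sm_mk.
have Cg v : Cc v -> Cc (g v) by move=> Cv; apply: CcB => //; exact: Cc_conv.
pose mt xi := 1 - Ct (@moll R n) (t *: xi).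
have Ctk xi : Ct (mk t) xi = Ct (@moll R n) (t *: xi) by exact: Ct_dil.
have Cgt v xi : Cc v -> Ct (g v) xi = mt xi * Ct v xi.
  move=> Cv; rewrite /g /Ct.
  have -> : (fun x => cos (dotp x xi) * (v x - cnv (mk t) v x)) =
     (fun x => cos (dotp x xi) * v x - cos (dotp x xi) * cnv (mk t) v x) by apply/funext => x; rewrite mulrBr.
  rewrite I_sub; [|exact: Cc_cos|by apply: Cc_cos; exact: Cc_conv].
  rewrite -!/(Ct _ _) Ct_conv// (St_even xi Cmt (@mk_even R n t)) Ctk /mt; ring.
have Sgt v xi : Cc v -> St (g v) xi = mt xi * St v xi.
  move=> Cv; rewrite /g /St.
  have -> : (fun x => sin (dotp x xi) * (v x - cnv (mk t) v x)) =
     (fun x => sin (dotp x xi) * v x - sin (dotp x xi) * cnv (mk t) v x) by apply/funext => x; rewrite mulrBr.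
  rewrite I_sub; [|exact: Cc_sin|by apply: Cc_sin; exact: Cc_conv].
  rewrite -!/(St _ _) St_conv// (St_even xi Cmt (@mk_even R n t)) Ctk /mt; ring.
pose K := (4 + n%:R) * (t ^+ 2) `^ s.
have K0 : 0 <= K by rewrite mulr_ge0 ?powR_ge0// addr_ge0.
apply/ler_addgt0Pr => e e0.
have e1 : 0 < c0 * e / 2 by rewrite divr_gt0// mulr_gt0.
have [d1 d10 H1] := HP _ (sg _ sv1 Cv1) (Cg _ Cv1) _ e1.
have [d2 d20 H2] := HP _ (sg _ sv2 Cv2) (Cg _ Cv2) _ e1.
pose d := Num.min d1 d2.
have d0 : 0 < d by rewrite lt_min d10.
have {}H1 := H1 d ltac:(by rewrite d0 ge_min lexx).
have {}H2 := H2 d ltac:(by rewrite d0 ge_min lexx orbT).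
have Ck : Cc (@cutfreq R n d) by exact: Cc_cutfreq.
have k0 xi : 0 <= @cutfreq R n d xi.
  rewrite /cutfreq cnvE; apply: I_ge0; last by move=> y; rewrite mulr_ge0 ?moll_ge0.
  by apply: CcMl => //; exact: Cc_cont (Cc_reflect _ Cm).
have kM xi : @cutfreq R n d xi <= M by apply: le_trans (ler_norm _) (HM _).
have kev xi : @cutfreq R n d (- xi) = cutfreq d xi.
  rewrite /cutfreq scalerN !cnvE.
  have C1 : Cc (fun y => moll (- (d *: xi) - y) * @moll R n y).
    by apply: CcMl => //; exact: Cc_cont (Cc_reflect _ Cm).
  rewrite -(I_reflect 0 C1); congr I; apply/funext => y.
  by rewrite sub0r moll_even -[X in moll X]opprB moll_even opprK addrC.
have Cev (v : V -> R) (xi : V) : Ct v (- xi) = Ct v xi.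
  by congr I; apply/funext => y; rewrite dotpC dotpNl cosN dotpC.
have Sodd (v : V -> R) (xi : V) : Cc v -> St v (- xi) = - St v xi.
  move=> Cv; rewrite /St -I_opp; last exact: Cc_sin.
  by congr I; apply/funext => y; rewrite dotpC dotpNl sinN dotpC mulNr.
have mev xi : mt (- xi) = mt xi by rewrite /mt scalerN Cev.
pose F xi := (Ct v1 xi + St v2 xi) ^+ 2 + (Ct v2 xi - St v1 xi) ^+ 2.
have F0 xi : 0 <= F xi by rewrite addr_ge0 ?sqr_ge0.
have cF : continuous F.
  have c1 := contD (cont_Ct Cv1) (cont_St Cv2); have c2 := contB (cont_Ct Cv2) (cont_St Cv1).
  exact: contD (contM c1 c1) (contM c2 c2).
pose P (xi : V) := (1 + dotp xi xi) `^ s : R.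
have P0 xi : 0 <= P xi by exact: powR_ge0.
have cP : continuous P.
  move=> xi; have q0 (x : V) : 0 < 1 + dotp x x by rewrite ltr_wpDr ?dotp_ge0.
  have -> : P = (fun x => expR (s * ln (1 + dotp x x))).
    by apply/funext => x; rewrite /P /powR gt_eqF.
  have cd : continuous (fun x : V => 1 + dotp x x).
    apply: contD; first exact: cst_continuous.
    by apply: cont_sum => a; apply: contM; exact: coord_continuous.
  apply: (@for_comp R V R (fun x => s * ln (1 + dotp x x)) expR xi); last exact: continuous_expR.
  apply: forM; first exact: cst_continuous.
  by apply: (@for_comp R V R (fun x => 1 + dotp x x) (@ln R) xi); [exact: cd|exact: continuous_ln].
have cmt : continuous mt.
  apply: contB; first exact: cst_continuous.
  apply: (@cont_comp R V V (fun x => t *: x) (Ct (@moll R n))); last exact: cont_Ct.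
  by have := @cont_affine R n t 0; under eq_fun do rewrite addr0.
have C1 : Cc (fun xi => cutfreq d xi * (P xi * F xi)) by apply: CcMr => //; exact: contM.
have C2 : Cc (fun xi => cutfreq d xi * (mt xi ^+ 2 * F xi)).
  by apply: CcMr => //; exact: contM (contM cmt cmt) cF.
have M1 : 0 < M + 1 by rewrite ltr_wpDl.
(* Divided by M + 1 the cut-off is at most 1, so a compactly supported integrand lies below that of
   [hs_sq]. *)
have up : w * I (fun xi => cutfreq d xi * (P xi * F xi)) <= (M + 1) * h.
  have CC := CcZ (w / (M + 1)) C1.
  have : ((I (fun xi => w / (M + 1) * (cutfreq d xi * (P xi * F xi))))%:E <= h%:E)%E.
    rewrite -(iint_I CC); apply: le_trans Hh; apply: iint_mono => xi.
      by rewrite lee_fin; have := k0 xi; have := P0 xi; have := F0 xi; have := ltW w0; have := ltW M1;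
         move=> *; rewrite !mulr_ge0// invr_ge0.
    rewrite lee_fin csq_fourier// -/w -/(F xi) -/(P xi).
    have -> : P xi * (w * F xi) = w / (M + 1) * ((M + 1) * (P xi * F xi)) by field; rewrite gt_eqF.
    apply: ler_wpM2l; first by rewrite divr_ge0// ltW.
    apply: ler_wpM2r; first exact: mulr_ge0.
    by have := kM xi; lra.
  by rewrite lee_fin (I_scal _ C1) mulrAC ler_pdivrMr// [h * _]mulrC.
have mid : I (fun xi => cutfreq d xi * (mt xi ^+ 2 * F xi)) <= K * I (fun xi => cutfreq d xi * (P xi * F xi)).
  rewrite -I_scal//; apply: I_le => //; first exact: CcZ.
  move=> xi; rewrite [leRHS]mulrCA; apply: ler_wpM2l => //; rewrite mulrA; apply: ler_wpM2r => //.
  exact: multiplier_le.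
pose G v xi := cutfreq d xi * (Ct (g v) xi ^+ 2 + St (g v) xi ^+ 2).
have CG v : Cc v -> Cc (G v).
  move=> Cv; apply: CcMr => //; have c1 := cont_Ct (Cg v Cv); have c2 := cont_St (Cg v Cv).
  exact: contD (contM c1 c1) (contM c2 c2).
(* F is the spectrum of v1 + i v2. Its cross terms are odd in xi, while cut-off and multiplier are
   even, so they cancel when the integral is averaged with its reflection. *)
have ev : I (fun xi => cutfreq d xi * (mt xi ^+ 2 * F xi)) = I (G v1) + I (G v2).
  have E := I_reflect 0 C2.
  have Cr := Cc_reflect 0 C2.
  have EG := I_add (CG v1 Cv1) (CG v2 Cv2); have := I_add C2 Cr; rewrite E.
  have -> : (fun y => cutfreq d y * (mt y ^+ 2 * F y) + cutfreq d (0 - y) * (mt (0 - y) ^+ 2 * F (0 - y))) =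
     (fun y => 2 * (G v1 y + G v2 y)).
    apply/funext => y; rewrite sub0r kev mev /F /G !Cev !Sodd// !Cgt// !Sgt//; ring.
  rewrite (I_scal _ (CcD (CG v1 Cv1) (CG v2 Cv2))) EG; lra.
move: H1 H2; rewrite -/(G v1) -/(G v2); move=> H1 H2.
have tot : c0 * (I (fun x => g v1 x ^+ 2) + I (fun x => g v2 x ^+ 2)) - c0 * e <= K * (w^-1 * ((M + 1) * h)).
  have u2 : I (fun xi => cutfreq d xi * (P xi * F xi)) <= w^-1 * ((M + 1) * h).
    by rewrite mulrC ler_pdivlMr// mulrC.
  apply: le_trans (ler_wpM2l K0 u2); apply: le_trans mid; rewrite ev; lra.
rewrite -(ler_pM2l c00).
have -> : c0 * (c0^-1 * w^-1 * (M + 1) * (4 + n%:R) * (t ^+ 2) `^ s * h + e) = K * (w^-1 * ((M + 1) * h)) + c0 * e.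
  by rewrite /K; field; rewrite !gt_eqF.
by rewrite -lerBlDr.
Qed.

End FourierGain.

Local Transparent I nrm cnv cv mk dil moll.

(** The filter of the lists that contain a given finite list turns near-covering compactness into a
    finite choice of centres. *)
Lemma compact_seq_cover (T : topologicalType) (K : set T) (O : T -> set T) : compact K ->
  (forall x, K x -> open (O x) /\ O x x) ->
  exists s : seq T, (forall x, x \in s -> K x) /\ forall y, K y -> exists2 x, x \in s & O x y.
Proof.
move=> cK H.
pose F : set_system (seq T) := fun A => exists s0 : seq T, forall s, {subset s0 <= s} -> A s.
have FF : Filter F.
  split; first by exists [::].
  - move=> A B [s0 HA] [s1 HB]; exists (s0 ++ s1) => s ss; split.
      by apply: HA => x xs; apply: ss; rewrite mem_cat xs.
    by apply: HB => x xs; apply: ss; rewrite mem_cat xs orbT.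
  - by move=> A B AB [s0 HA]; exists s0 => s /HA; exact: AB.
have := (compact_near_coveringP K).1 cK (seq T) F (fun s y => exists2 x, (x \in s /\ K x) & O x y) FF.
case=> [x Kx|s0 Hs0].
  have [oO Ox] := H x Kx.
  exists (O x, [set s : seq T | x \in s]) => /=.
    by split; [exact: open_nbhs_nbhs|exists [:: x] => s; apply; rewrite inE].
  by move=> [y s] /= [Oy xs]; exists x.
have := Hs0 s0 (fun x xs => xs) => {}Hs0.
exists [seq x <- s0 | `[< K x >]]; split => [x|y /Hs0[x [xs Kx] Oy]].
  by rewrite mem_filter => /andP[/asboolP].
by exists x => //; rewrite mem_filter xs andbT; apply/asboolP.
Qed.

Local Opaque I nrm cnv cv mk dil moll.

(** * Change of variables up to a constant, and finite nets *)

Section ChangeOfVariables.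
Variables (R : realType) (n : nat).
Local Notation V := 'rV[R]_n.

(* No Jacobian is needed: mollifying f, what matters is the volume of the set of x with
   |Psi x - z| <= t, which has diameter at most 2 L t. *)
Lemma change_vars (th : V -> R) (Psi : V -> V) (L : R) : Cc th -> (forall x, 0 <= th x <= 1) ->
  continuous Psi -> 0 <= L ->
  (forall x x', th x != 0 -> th x' != 0 -> `|x - x'| <= L * `|Psi x - Psi x'|) ->
  exists2 C : R, 0 <= C & forall f : V -> R, Cc f -> (forall y, 0 <= f y) ->
    I (fun x => th x * f (Psi x)) <= C * I f.
Proof.
move=> Cth th01 cPsi L0 HL; have [M M0 HM] := Cc_bounded (@Cc_moll R n).
have C0 : 0 <= (2 * (L * 2)) ^+ n * M by rewrite mulr_ge0// exprn_ge0// !mulr_ge0.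
exists ((2 * (L * 2)) ^+ n * M) => // f Cf f0.
have It : 0 <= I th by apply: I_ge0 => // y; case/andP: (th01 y).
have cfP (h : V -> R) : continuous h -> continuous (fun x => h (Psi x)).
  by move=> ch; apply: (cont_comp (f := h)).
apply/ler_addgt0Pr => e e0.
have e1 : 0 < e / (I th + 1) by rewrite divr_gt0// ltr_wpDl.
have [t [t0 Ht]] : exists t : R, 0 < t /\ forall y, `|cnv (mk t) f y - f y| <= e / (I th + 1).
  have [r r0 Hr] := conv_mk_unif Cf e1; exists (r / 2); split; first exact: divr_gt0.
  by move=> y; apply: Hr; rewrite divr_gt0//= ltr_pdivrMr// ltr_pMr// ltr1n.
have Cm := @Cc_mk R n _ t0; have Cfc := Cc_conv Cm Cf.
have C1 : Cc (fun x => th x * cnv (mk t) f (Psi x)) by apply: CcMr => //; exact: cfP (Cc_cont Cfc).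
have C2 : Cc (fun x => th x * f (Psi x)) by apply: CcMr => //; exact: cfP (Cc_cont Cf).
apply: le_trans (_ : I (fun x => th x * cnv (mk t) f (Psi x) + e / (I th + 1) * th x) <= _).
  apply: I_le => //; first by apply: CcD => //; exact: CcZ.
  move=> x; rewrite [e / _ * _]mulrC -mulrDr; apply: ler_wpM2l; first by case/andP: (th01 x).
  by have := Ht (Psi x); rewrite ler_norml => /andP[]; lra.
rewrite I_add//; last exact: CcZ.
rewrite I_scal//; apply: lerD; last first.
  by rewrite mulrAC ler_pdivrMr ?ltr_wpDl// ler_wpM2l ?(ltW e0)// lerDl.
have [A [C [wl wb _]]] := ag_functional Cf.
pose k (p : V * V) := mk t (Psi p.1 - p.2).
have ck : continuous k.
  apply: (@cont_comp R V _ (fun p : V * V => Psi p.1 - p.2) (mk t)); last exact: Cc_cont.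
  move=> p; apply: cvgB; last exact: cvg_snd.
  by apply: (@cvg_comp _ _ _ fst Psi _ (nbhs p.1)); [exact: cvg_fst|exact: cPsi].
have [A' [C' [wl' wb' _]]] := ag_functional Cth.
have cI : continuous (fun z => I (fun x => k (x, z) * th x)).
  exact: (functional_param wl' wb' (cont_swap ck)).
have -> : I (fun x => th x * cnv (mk t) f (Psi x)) = I (fun z => I (fun x => k (x, z) * th x) * f z).
  have := I_functional wl wb ck Cth; rewrite /ag => <-.
  by congr I; apply/funext => x; rewrite mulrC cnvE.
rewrite -I_scal//; apply: I_le; [exact: CcMl|exact: CcZ|].
move=> z; apply: ler_wpM2r => //.
have [[x1 x1t x1z]|H] := pselect (exists2 x1, th x1 != 0 & `|Psi x1 - z| <= t); last first.
  rewrite (_ : (fun x => _) = fun=> 0) ?I0//; apply/funext => x.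
  have [->|tx] := eqVneq (th x) 0; first by rewrite mulr0.
  have [xz|xz] := leP `|Psi x - z| t; first by case: H; exists x.
  by rewrite /k (supp_mk t0) ?mul0r.
have Ck1 : Cc (fun x => k (x, z) * th x).
  by apply: CcMl Cth; exact: (@cont_pairl R V V k z ck).
rewrite -(I_shift x1 Ck1); apply: le_trans (ler_norm _) _.
apply: le_trans (@I_bound R n (L * 2 * t) (t ^- n * M) _ _ _ (Cc_cont (Cc_shift x1 Ck1)) _ _) _.
- by rewrite !mulr_ge0// ltW.
- by rewrite mulr_ge0// invr_ge0 exprn_ge0// ltW.
- move=> x xA; have [->|tx] := eqVneq (th (x + x1)) 0; first by rewrite mulr0.
  have [xz|xz] := leP `|Psi (x + x1) - z| t; last by rewrite /k (supp_mk t0) ?mul0r.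
  have := HL _ _ tx x1t; rewrite addrK => h; move: xA; rewrite ltNge => /negP[].
  apply: le_trans h _; rewrite -mulrA ler_wpM2l//.
  have := ler_normB (Psi (x + x1) - z) (Psi x1 - z); rewrite opprB addrA subrK; lra.
- move=> x _; rewrite normrM; case/andP: (th01 (x + x1)) => h0 h1.
  rewrite (ger0_norm h0); apply: le_trans (ler_piMr (normr_ge0 _) h1) _.
  rewrite /k mkE normrM ger0_norm ?invr_ge0 ?exprn_ge0 ?(ltW t0)//.
  by apply: ler_wpM2l => //; rewrite invr_ge0 exprn_ge0// ltW.
rewrite (_ : 2 * (L * 2 * t) = 2 * (L * 2) * t); last by ring.
rewrite exprMn -mulrA (mulrA (t ^+ n)) divff ?mul1r//.
by rewrite expf_neq0// gt_eqF.
Qed.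

(** Compactness of mollification at a fixed scale: the mollified function is Lipschitz with constant
    proportional to the norm of v, so its values on a net control it. *)
Lemma conv_net (A t e : R) : 0 < t -> 0 <= A -> 0 < e ->
  exists (s : seq V), exists2 C : R, 0 <= C & forall v, Cc v -> supp A v ->
    nrm (cnv (mk t) v) <= e * nrm v + C * \sum_(x <- s) `|cnv (mk t) v x|.
Proof.
move=> t0 A0 e0; have Cm := @Cc_mk R n _ t0.
have [L L0 HL] := smooth_lipschitz (sm_mk _ t) Cm.
have [th [Cth _ th01 th1]] := @plateau_Cc R n A.
have At0 : 0 <= t + A by rewrite addr_ge0// ltW.
pose N := Num.sqrt ((2 * (t + A)) ^+ n); have N0 : 0 <= N by exact: sqrtr_ge0.
pose K := L * nrm th; have K0 : 0 <= K by rewrite mulr_ge0// nrm_ge0.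
have P0 : 0 < K * N + 1 by rewrite ltr_wpDl// mulr_ge0.
(* The mesh: N is the root of the volume and [K * nrm v] the Lipschitz constant, so that N K d <=
   e. *)
pose d := e / (K * N + 1); have d0 : 0 < d by rewrite divr_gt0.
have [s [_ Hs]] := @compact_seq_cover _ _ (fun x : V => ball x d) (@compact_box R n (t + A))
   (fun x _ => conj (ball_open x d) (ballxx x d0)).
exists s, N => // v Cv sv; have Cc1 := Cc_conv Cm Cv.
have lip x y : `|cnv (mk t) v x - cnv (mk t) v y| <= K * nrm v * `|x - y|.
  have C1 z : Cc (fun u => mk t (z - u) * v u) by apply: CcMl => //; exact: Cc_cont (Cc_reflect z Cm).
  rewrite !cnvE -I_sub//; apply: le_trans (I_abs (CcB (C1 x) (C1 y))) _.
  apply: le_trans (_ : I (fun u => L * `|x - y| * (th u * `|v u|)) <= _).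
    apply: I_le; [exact/Cc_abs/CcB|by apply: CcZ; apply: CcMr => //; exact/cont_abs/Cc_cont|].
    move=> u; rewrite -mulrBl normrM.
    have [uA|uA] := leP `|u| A; last by rewrite sv// normr0 !mulr0.
    rewrite th1// mul1r; apply: ler_wpM2r => //.
    by apply: le_trans (HL _ _) _; rewrite opprB addrA subrK.
  rewrite I_scal; last by apply: CcMr => //; exact/cont_abs/Cc_cont.
  have -> : K * nrm v * `|x - y| = L * `|x - y| * (nrm th * nrm v) by rewrite /K; ring.
  apply: ler_wpM2l; first exact: mulr_ge0.
  apply: le_trans (ler_norm _) _; apply: le_trans (cauchy_schwarz_I Cth (Cc_abs Cv)) _.
  apply: ler_wpM2l; first exact: nrm_ge0.
  by apply: nrm_le => //; [exact: Cc_abs|move=> y'; rewrite normr_id].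
have S0 : 0 <= \sum_(x <- s) `|cnv (mk t) v x| by apply: sumr_ge0.
have v0 := nrm_ge0 v.
apply: le_trans (@nrm_bound R n (t + A) (K * nrm v * d + \sum_(x <- s) `|cnv (mk t) v x|) _ At0 _ _ _ _) _.
- apply: addr_ge0 => //; apply: mulr_ge0; [exact: mulr_ge0|exact: ltW].
- exact: Cc_cont.
- exact: (supp_conv (ltW t0) (supp_mk t0) sv Cm Cv).
- move=> y yA; have [x xs xy] := Hs y yA.
  have := lip y x; have := ler_normB (cnv (mk t) v y - cnv (mk t) v x) (- cnv (mk t) v x).
  rewrite opprK subrK normrN => h1 h2.
  have h3 : K * nrm v * `|y - x| <= K * nrm v * d.
    apply: ler_wpM2l; first exact: mulr_ge0.
    by move: xy; rewrite -ball_normE /= distrC => /ltW.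
  have h4 : `|cnv (mk t) v x| <= \sum_(x <- s) `|cnv (mk t) v x|.
    by rewrite (big_rem x)//= lerDl sumr_ge0.
  by apply: le_trans (le_trans h1 (lerD (le_trans h2 h3) h4)) _.
- rewrite -/N mulrDr; apply: lerD => //.
  have -> : N * (K * nrm v * d) = K * N * d * nrm v by ring.
  apply: ler_wpM2r => //; rewrite /d mulrA ler_pdivrMr// mulrC ler_wpM2l ?(ltW e0)// lerDl//.
Qed.

End ChangeOfVariables.

Section ReIm.
Variable R : realType.
Implicit Types x y : R[i].
Local Notation Re := (@complex.Re R).
Local Notation Im := (@complex.Im R).

Lemma cReD x y : Re (x + y) = Re x + Re y. Proof. by case: x; case: y. Qed.
Lemma cImD x y : Im (x + y) = Im x + Im y. Proof. by case: x; case: y. Qed.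
Lemma cReM x y : Re (x * y) = Re x * Re y - Im x * Im y. Proof. by case: x; case: y. Qed.
Lemma cImM x y : Im (x * y) = Re x * Im y + Im x * Re y. Proof. by case: x; case: y. Qed.
Lemma cRe_sum (T : Type) (s : seq T) (F : T -> R[i]) : Re (\sum_(i <- s) F i) = \sum_(i <- s) Re (F i).
Proof. exact: (big_morph Re cReD). Qed.
Lemma cIm_sum (T : Type) (s : seq T) (F : T -> R[i]) : Im (\sum_(i <- s) F i) = \sum_(i <- s) Im (F i).
Proof. exact: (big_morph Im cImD). Qed.
Lemma complex_ext x y : Re x = Re y -> Im x = Im y -> x = y.
Proof. by case: x => a b; case: y => c d /= -> ->. Qed.
End ReIm.

Lemma for_near (R : realType) (T : topologicalType) (f g : T -> R) (x : T) : (\near x, f x = g x) ->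
  {for x, continuous f} -> {for x, continuous g}.
Proof.
move=> fg cf; apply: for_dist => e e0.
have fx : f x = g x by exact: nbhs_singleton fg.
move/cvgrPdist_le : cf => /(_ e e0); apply: filterS2 fg => z <-.
by rewrite -fx distrC.
Qed.

Local Notation inv := Defs.inv.

(** * Charts, cut-offs and changes of chart *)

Section ManifoldCalculus.
Variables (R : realType) (n : nat) (M : topologicalType) (A : manifold R n M).
Local Notation V := 'rV[R]_n.
Implicit Types (i j : idx A) (U W : set M) (f g : M -> R) (c y z : V).

Lemma open_chart i U : open U -> open (tgt (ch i) `&` inv (ch i) @^-1` U).
Proof.
move=> oU; rewrite openE => y [Ty Uy]; apply: filterI.
  by apply: open_nbhs_nbhs; split => //; exact: tgt_open.
by apply: (Defs.inv_continuous Ty); exact: open_nbhs_nbhs.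
Qed.

Lemma open_src i (W' : set V) : open W' -> open (src (ch i) `&` to (ch i) @^-1` W').
Proof.
move=> oW; rewrite openE => x [sx Wx]; apply: filterI.
  by apply: open_nbhs_nbhs; split => //; exact: src_open.
by apply: (to_continuous sx); exact: open_nbhs_nbhs.
Qed.

Lemma open_overlap i j : open (tgt (ch i) `&` inv (ch i) @^-1` src (ch j)).
Proof. by apply: open_chart; exact: src_open. Qed.

Lemma rsm_sub U W f : W `<=` U -> rsmooth_on A U f -> rsmooth_on A W f.
Proof. by move=> WU sf i k; apply: Ck_sub (sf i k) => y [Ty /WU]. Qed.

Lemma rsm_ext U f g : open U -> (forall x, U x -> f x = g x) -> rsmooth_on A U f -> rsmooth_on A U g.
Proof. by move=> oU fg sf i k; apply: Ck_ext (sf i k); [exact: open_chart|move=> y [Ty /fg]]. Qed.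

Lemma rsm_local U f : (forall x, U x -> exists W, [/\ open W, W x & rsmooth_on A W f]) -> open U ->
  rsmooth_on A U f.
Proof.
move=> H oU i k; apply: Ck_local; first exact: open_chart.
move=> y [Ty Uy]; have [W [oW Wy sf]] := H _ Uy.
by exists (tgt (ch i) `&` inv (ch i) @^-1` W); split; [exact: open_chart|by split|exact: sf].
Qed.

Lemma rsm_cst U (d : R) : open U -> rsmooth_on A U (fun=> d).
Proof. by move=> oU i k; apply: (Ck_cst k d); exact: open_chart. Qed.

Lemma rsm_add U f g : open U -> rsmooth_on A U f -> rsmooth_on A U g -> rsmooth_on A U (fun x => f x + g x).
Proof. by move=> oU sf sg i k; apply: Ck_add; [exact: open_chart|exact: sf|exact: sg]. Qed.

Lemma rsm_mul U f g : open U -> rsmooth_on A U f -> rsmooth_on A U g -> rsmooth_on A U (fun x => f x * g x).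
Proof. by move=> oU sf sg i k; apply: Ck_mul; [exact: open_chart|exact: sf|exact: sg]. Qed.

Lemma rsm_opp U f : open U -> rsmooth_on A U f -> rsmooth_on A U (fun x => - f x).
Proof.
move=> oU sf; apply: (rsm_ext oU (f := fun x => -1 * f x)); first by move=> x _; rewrite mulN1r.
by apply: rsm_mul => //; exact: rsm_cst.
Qed.

Lemma rsm_inv U f : open U -> (forall x, U x -> f x != 0) -> rsmooth_on A U f -> rsmooth_on A U (fun x => (f x)^-1).
Proof.
move=> oU f0 sf i k; apply: (@Ck_inv _ _ _ _ (f \o inv (ch i))); first exact: open_chart.
  by move=> y [_ /f0].
exact: sf.
Qed.

Lemma rsm_sum U (T : Type) (s : seq T) (F : T -> M -> R) : open U ->
  (forall t, rsmooth_on A U (F t)) -> rsmooth_on A U (fun x => \sum_(t <- s) F t x).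
Proof.
move=> oU H; elim: s => [|t s IH].
  by under eq_fun do rewrite big_nil; exact: rsm_cst.
by under eq_fun do rewrite big_cons; exact: rsm_add.
Qed.

Lemma rsm_prod U (T : Type) (s : seq T) (F : T -> M -> R) : open U ->
  (forall t, rsmooth_on A U (F t)) -> rsmooth_on A U (fun x => \prod_(t <- s) F t x).
Proof.
move=> oU H; elim: s => [|t s IH].
  by under eq_fun do rewrite big_nil; exact: rsm_cst.
by under eq_fun do rewrite big_cons; exact: rsm_mul.
Qed.

Lemma rsm_to i (h : V -> R) : smooth h -> rsmooth_on A (src (ch i)) (fun x => h (to (ch i) x)).
Proof.
move=> sh j k; have oj := @open_overlap j i.
exact: (@Ck_comp R n n k setT _ h (fun y => to (ch i) (inv (ch j) y)) openT oj
  (fun y _ => Logic.I) (sh k) (fun b => @transition_smooth R n M A j i b k)).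
Qed.

Lemma rsm_cont U f : open U -> rsmooth_on A U f -> forall x, U x -> {for x, continuous f}.
Proof.
move=> oU sf x Ux; pose i := at_pt A x; have sx : src (ch i) x := at_ptP A x.
have Ty := to_tgt sx; have e := toK sx.
have c1 : {for to (ch i) x, continuous (f \o inv (ch i))}.
  by apply: Ck_cont (sf i 0%N) _; split => //=; rewrite e.
have c2 := for_comp (to_continuous sx) c1.
apply: for_near c2.
have : \near x, src (ch i) x by apply: open_nbhs_nbhs; split => //; exact: src_open.
by apply: filterS => z sz /=; rewrite toK.
Qed.

Definition ballin i c (r : R) := forall y, `|y - c| <= r -> tgt (ch i) y.

Lemma ballin_le i c (r s : R) : r <= s -> ballin i c s -> ballin i c r.
Proof. by move=> rs H y yr; apply: H; exact: le_trans rs. Qed.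

Definition kball i c (r : R) : set M := [set x | src (ch i) x /\ `|to (ch i) x - c| <= r].

Lemma open_far c (r : R) : open [set y : V | r < `|y - c|].
Proof.
rewrite openE => y /= yr; apply/nbhs_ballP; exists (`|y - c| - r) => [|z]; first by rewrite /= subr_gt0.
rewrite -ball_normE /= => h; have := ler_normD (y - z) (z - c); rewrite addrA subrK; lra.
Qed.

Lemma compact_cball c (r : R) : compact [set y : V | `|y - c| <= r].
Proof.
have := @continuous_compact _ _ (fun y : V => 1 *: y + c) _ _ (@compact_box R n r).
have -> : [set (1 *: y + c) | y in [set y : V | `|y| <= r]] = [set y : V | `|y - c| <= r].
  apply/seteqP; split => [_ /= [y yr <-]|y /= yr]; first by rewrite scale1r addrK.
  by exists (y - c) => //; rewrite scale1r subrK.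
by apply; apply: continuous_subspaceT; exact: cont_affine.
Qed.

Lemma kballE i c (r : R) : ballin i c r -> kball i c r = inv (ch i) @` [set y : V | `|y - c| <= r].
Proof.
move=> B; apply/seteqP; split => [x [sx xr]|_ [y yr <-]].
  by exists (to (ch i) x) => //; exact: toK.
by have Ty := B y yr; split; [exact: Defs.inv_src|rewrite Defs.invK].
Qed.

Lemma compact_kball i c (r : R) : ballin i c r -> compact (kball i c r).
Proof.
move=> B; rewrite kballE//; apply: continuous_compact; last exact: compact_cball.
apply: continuous_in_subspaceT => y /set_mem /= yr.
exact: (Defs.inv_continuous (B y yr)).
Qed.

Lemma closed_kball i c (r : R) : ballin i c r -> closed (kball i c r).
Proof. by move=> B; apply: compact_closed; [exact: manifold_hausdorff A|exact: compact_kball]. Qed.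

Definition mlift i (h : V -> R) (x : M) : R := if `[< src (ch i) x >] then h (to (ch i) x) else 0.

Lemma mlift_src i h x : src (ch i) x -> mlift i h x = h (to (ch i) x).
Proof. by move=> sx; rewrite /mlift; case: asboolP. Qed.

Lemma mlift_inv i h y : tgt (ch i) y -> mlift i h (inv (ch i) y) = h y.
Proof. by move=> Ty; rewrite mlift_src ?Defs.invK//; exact: Defs.inv_src. Qed.

(** Unlike in [tin] the radius of the support is explicit, to keep track of nested balls in one
    chart. *)
Definition cutin c (r : R) (h : V -> R) := smooth h /\ forall y, r < `|y - c| -> h y = 0.

Lemma cutinMr c (r : R) (h k : V -> R) : cutin c r h -> smooth k -> cutin c r (fun y => h y * k y).
Proof. by move=> [sh H] sk; split; [exact: sm_mul|move=> y /H ->; rewrite mul0r]. Qed.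

Lemma cutin_Cc c (r : R) h : cutin c r h -> Cc h.
Proof.
move=> [sh H]; split; first exact: sm_cont.
by exists (`|c| + r) => y yr; apply: H; have := ler_normD (y - c) c; rewrite subrK; lra.
Qed.

Lemma cutin_plateau c (r1 r2 : R) : 0 <= r1 -> r1 < r2 -> cutin c r2 (plateau c r1 r2).
Proof.
move=> r0 r12; split; first exact: sm_plateau.
by move=> y /ltW; apply: plateau_out; exact: le_lt_trans r12.
Qed.

Lemma mlift_out i c (r : R) h x : cutin c r h -> ~ kball i c r x -> mlift i h x = 0.
Proof.
move=> [_ H] nk; rewrite /mlift; case: asboolP => // sx; apply: H.
by rewrite ltNge; apply/negP => xr; apply: nk.
Qed.

(** The extension by 0 is smooth across the chart boundary because [kball], compact in a Hausdorff
    space, is closed in M. *)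
Lemma sm_mlift i c (r : R) h : ballin i c r -> cutin c r h -> rsmooth_on A setT (mlift i h).
Proof.
move=> B ch'; apply: rsm_local openT => x _.
have [kx|nk] := pselect (kball i c r x).
  exists (src (ch i)); split; [exact: src_open|by case: kx|].
  apply: rsm_ext (rsm_to i ch'.1); first exact: src_open.
  by move=> z sz; rewrite mlift_src.
exists (~` kball i c r); split => //; first by apply: closed_openC; exact: closed_kball.
apply: rsm_ext (rsm_cst 0 _); [|move=> z nz; rewrite (mlift_out ch' nz)//|];
  by apply: closed_openC; exact: closed_kball.
Qed.

Lemma sm_pull i c (r : R) h U f : open U -> (forall y, `|y - c| <= r -> tgt (ch i) y /\ U (inv (ch i) y)) ->
  cutin c r h -> rsmooth_on A U f -> smooth (fun y => h y * f (inv (ch i) y)).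
Proof.
move=> oU B [sh H] sf k; apply: Ck_local; first exact: openT.
move=> y _; have [yr|yr] := leP `|y - c| r.
  exists (tgt (ch i) `&` inv (ch i) @^-1` U); split; [exact: open_chart|exact: B|].
  apply: Ck_mul; [exact: open_chart|exact: smooth_Cinfty|exact: sf].
exists [set y | r < `|y - c|]; split => //; first exact: open_far.
apply: (@Ck_ext _ _ _ _ (fun=> 0)); [exact: open_far|move=> z /= /H ->; by rewrite mul0r|].
by apply: Ck_cst; exact: open_far.
Qed.

Lemma small_ball i U x : open U -> U x -> src (ch i) x ->
  exists2 r : R, 0 < r & forall y, `|y - to (ch i) x| <= r -> tgt (ch i) y /\ U (inv (ch i) y).
Proof.
move=> oU Ux sx; have [|r r0 Hr] := @near_norm R n (fun y => tgt (ch i) y /\ U (inv (ch i) y)) (to (ch i) x).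
  apply: (@open_nbhs_nbhs _ _ (tgt (ch i) `&` inv (ch i) @^-1` U)); split; first exact: open_chart.
  by split; [exact: to_tgt|rewrite /= toK].
exists (r / 2); first exact: divr_gt0.
by move=> y yr; apply: Hr; apply: le_lt_trans yr _; rewrite ltr_pdivrMr// ltr_pMr// ltr1n.
Qed.

(** [change_vars] wants a continuous map on all of R^n that is expanding up to a constant where the
    weight is nonzero. Psi is the transition map cut off by larger plateaus; F is the inverse
    transition cut off likewise, and its Lipschitz constant gives the expansion. *)
Lemma chart_change i j c1 (r1 s1 : R) c2 (r2 s2 : R) phi psi : 0 <= r1 -> r1 < s1 -> 0 <= r2 -> r2 < s2 ->
  ballin i c1 s1 -> ballin j c2 s2 -> cutin c1 r1 phi -> cutin c2 r2 psi ->
  (forall y, 0 <= phi y <= 1) -> (forall y, 0 <= psi y <= 1) ->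
  exists2 C : R, 0 <= C & forall f : V -> R, Cc f -> (forall y, 0 <= f y) ->
    Cc (fun y => phi y * mlift j psi (inv (ch i) y) * f (to (ch j) (inv (ch i) y))) /\
    I (fun y => phi y * mlift j psi (inv (ch i) y) * f (to (ch j) (inv (ch i) y))) <= C * I f.
Proof.
move=> r10 rs1 r20 rs2 B1 B2 cphi cpsi phi01 psi01.
pose phi' := plateau c1 r1 s1; pose psi' := plateau c2 r2 s2.
have cp1 : cutin c1 s1 phi' by exact: cutin_plateau.
have cp2 : cutin c2 s2 psi' by exact: cutin_plateau.
have B1' y : `|y - c1| <= s1 -> tgt (ch i) y /\ [set: M] (inv (ch i) y) by move=> /B1.
have B2' y : `|y - c2| <= s2 -> tgt (ch j) y /\ [set: M] (inv (ch j) y) by move=> /B2.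
pose Psi y : V := \row_b (phi' y * mlift j (fun z => psi' z * z 0 b) (inv (ch i) y)).
pose F b z := psi' z * mlift i (fun y => phi' y * y 0 b) (inv (ch j) z).
have sF b : smooth (F b).
  apply: (sm_pull openT B2' cp2); apply: (sm_mlift B1); apply: cutinMr => //; exact: sm_coord.
have CF b : Cc (F b).
  by split; [exact: sm_cont|have [_ [K HK]] := cutin_Cc cp2; exists K => y /HK e; rewrite /F e mul0r].
have /choice[L HL] b : exists L : R, 0 <= L /\ forall z z', `|F b z - F b z'| <= L * `|z - z'|.
  by have [L L0 HL] := smooth_lipschitz (sF b) (CF b); exists L.
have L0 : 0 <= \sum_b L b by apply: sumr_ge0 => b _; case: (HL b).
have B1r y : `|y - c1| <= r1 -> tgt (ch i) y /\ [set: M] (inv (ch i) y).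
  by move=> h; apply: B1'; exact: le_trans h (ltW rs1).
pose th y := phi y * mlift j psi (inv (ch i) y).
have sth : smooth th.
  by apply: (sm_pull openT B1r cphi); apply: sm_mlift cpsi; exact: ballin_le (ltW rs2) B2.
have Cth : Cc th.
  by split; [exact: sm_cont|have [_ [K HK]] := cutin_Cc cphi; exists K => y /HK e; rewrite /th e mul0r].
have l01 x : 0 <= mlift j psi x <= 1 by rewrite /mlift; case: asboolP => // _; rewrite lexx ler01.
have th01 y : 0 <= th y <= 1.
  case/andP: (phi01 y) => p0 p1; case/andP: (l01 (inv (ch i) y)) => q0 q1.
  by rewrite mulr_ge0//= mulr_ile1.
have sPsi b : smooth (fun y => phi' y * mlift j (fun z => psi' z * z 0 b) (inv (ch i) y)).
  by apply: (sm_pull openT B1' cp1); apply: (sm_mlift B2); apply: cutinMr => //; exact: sm_coord.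
have cPsi : continuous Psi.
  move=> y; apply: for_row => b.
  have -> : (fun z : V => Psi z 0 b) = (fun y => phi' y * mlift j (fun z => psi' z * z 0 b) (inv (ch i) y)).
    by apply/funext => z; rewrite mxE.
  by apply: sm_cont; exact: sPsi.
have th_ne y : th y != 0 -> [/\ tgt (ch i) y, Psi y = to (ch j) (inv (ch i) y) &
    forall b, F b (Psi y) = y 0 b].
  move=> ty; have p0 : phi y != 0 by apply: contraNneq ty => e; rewrite /th e mul0r.
  have q0 : mlift j psi (inv (ch i) y) != 0 by apply: contraNneq ty => e; rewrite /th e mulr0.
  have yr : `|y - c1| <= r1 by rewrite leNgt; apply/negP => /(cphi.2) /eqP; rewrite (negbTE p0).
  have Ty := (B1r y yr).1.
  have [sj qr] : kball j c2 r2 (inv (ch i) y).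
    by apply: contrapT => /(mlift_out cpsi)/eqP; rewrite (negbTE q0).
  have py : phi' y = 1 by rewrite /phi' plateau_in.
  have qz : psi' (to (ch j) (inv (ch i) y)) = 1 by rewrite /psi' plateau_in.
  have E : Psi y = to (ch j) (inv (ch i) y).
    by apply/rowP => b; rewrite mxE py mlift_src// qz !mul1r.
  by split => // b; rewrite E /F qz toK// mlift_inv// py !mul1r.
have lipPsi x x' : th x != 0 -> th x' != 0 -> `|x - x'| <= (\sum_b L b) * `|Psi x - Psi x'|.
  move=> /th_ne[_ _ e] /th_ne[_ _ e']; apply: norm_le_coord; first exact: mulr_ge0.
  move=> b; rewrite !mxE -e -e'; apply: le_trans ((HL b).2 _ _) _; apply: ler_wpM2r => //.
  by rewrite (bigD1 b)//= lerDl; apply: sumr_ge0 => b' _; case: (HL b').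
have [C C0 HC] := change_vars Cth th01 cPsi L0 lipPsi.
exists C => // f Cf f0; have -> : (fun y => phi y * mlift j psi (inv (ch i) y) * f (to (ch j) (inv (ch i) y))) =
    (fun y => th y * f (Psi y)).
  apply/funext => y; rewrite -/(th y); have [->|/th_ne[_ -> _]//] := eqVneq (th y) 0.
  by rewrite !mul0r.
split; last exact: HC.
by apply: CcMr => //; apply: (cont_comp (f := f)) => //; exact: Cc_cont.
Qed.

Lemma partial_jac i j U (u : M -> R) x a : open U -> U x -> rsmooth_on A U u ->
  src (ch i) x -> src (ch j) x ->
  partial a (u \o inv (ch i)) (to (ch i) x) =
  \sum_b jac i j x a b * partial b (u \o inv (ch j)) (to (ch j) x).
Proof.
move=> oU Ux su si sj; set y := to (ch i) x.
pose G z := to (ch j) (inv (ch i) z).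
have Ty : tgt (ch i) y := to_tgt si.
have Gy : G y = to (ch j) x by rewrite /G /y toK.
pose dG : V := \row_b jac i j x a b.
have D := @chain_rule R n n _ (u \o inv (ch j)) G y (unitv R a) dG
  (@open_chart j U oU) (su j 1%N).
have D' := D (conj _ _) _; rewrite Gy in D'.
have <- : grad_app (u \o inv (ch j)) (to (ch j) x) dG =
    \sum_b jac i j x a b * partial b (u \o inv (ch j)) (to (ch j) x).
  by apply: eq_bigr => b _; rewrite mxE.
have <- : partial a ((u \o inv (ch j)) \o G) y = grad_app (u \o inv (ch j)) (to (ch j) x) dG.
  apply: is_derive_partial; apply: D'; rewrite /= ?Gy ?toK//; first exact: to_tgt.
  move=> b; rewrite mxE /jac mxE -/y.
  by apply: (Cinfty_derive a (@transition_smooth R n M A i j b)); split => //=; rewrite toK.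
apply: partial_near.
have : nbhs y (tgt (ch i) `&` inv (ch i) @^-1` src (ch j)).
  by apply: open_nbhs_nbhs; split; [exact: open_overlap|split => //=; rewrite toK].
by apply: filterS => z [Tz sz] /=; rewrite /G toK.
Qed.

Definition vcomp i (X : rvf R n M) (b : 'I_n) (x : M) : R := (X x *m jac (at_pt A x) i x) 0 b.

(** [vf_app] is computed in the preferred chart of x, which varies with x; here is its expression in
    one fixed chart. *)
Lemma vf_app_chart i (Z : cvf R n M) (f : M -> R[i]) U x : open U -> U x -> csmooth_on A U f -> src (ch i) x ->
  let pr b := partial b ((fun x => complex.Re (f x)) \o inv (ch i)) (to (ch i) x) in
  let pi b := partial b ((fun x => complex.Im (f x)) \o inv (ch i)) (to (ch i) x) in
  complex.Re (vf_app A Z f x) = \sum_b (vcomp i (re_vf Z) b x * pr b - vcomp i (im_vf Z) b x * pi b) /\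
  complex.Im (vf_app A Z f x) = \sum_b (vcomp i (re_vf Z) b x * pi b + vcomp i (im_vf Z) b x * pr b).
Proof.
move=> oU Ux [sre sim] sx pr pi; have s0 := at_ptP A x; rewrite /vf_app cRe_sum cIm_sum.
have Er a := partial_jac a oU Ux sre s0 sx; have Ei a := partial_jac a oU Ux sim s0 sx.
have ER a : complex.Re (cpartial a (f \o inv (ch (at_pt A x))) (to (ch (at_pt A x)) x)) =
   \sum_b jac (at_pt A x) i x a b * pr b by exact: Er.
have EI a : complex.Im (cpartial a (f \o inv (ch (at_pt A x))) (to (ch (at_pt A x)) x)) =
   \sum_b jac (at_pt A x) i x a b * pi b by exact: Ei.
have vE (X : rvf R n M) (q : 'I_n -> R) : \sum_b vcomp i X b x * q b = \sum_a X x 0 a * \sum_b jac (at_pt A x) i x a b * q b.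
  under eq_bigr => b _ do rewrite /vcomp mxE mulr_suml.
  rewrite exchange_big; apply: eq_bigr => a _; rewrite mulr_sumr; apply: eq_bigr => b _.
  by rewrite mulrA.
split.
  rewrite sumrB !vE -sumrB; apply: eq_bigr => a _.
  by rewrite cReM ER EI /re_vf /im_vf !mxE.
rewrite big_split /= !vE -big_split; apply: eq_bigr => a _.
by rewrite cImM ER EI /re_vf /im_vf !mxE.
Qed.

End ManifoldCalculus.

Lemma exp_powR (R : realType) (x s : R) k : 0 <= x -> (x ^+ k) `^ s = (x `^ s) ^+ k.
Proof.
by move=> x0; elim: k => [|k IH]; rewrite ?expr0 ?powR1// !exprS powRM ?exprn_ge0// IH.
Qed.

(** * From subellipticity to the estimate in a coordinate ball *)

Section LocalEstimate.
Variables (R : realType) (n : nat) (M : topologicalType) (A : manifold R n M).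
Variables (g : riemannian_metric A) (P : partition_of_unity A) (D : cvf_distribution A).
Local Notation V := 'rV[R]_n.

Lemma pou_le1 k x : P k x <= 1.
Proof. by rewrite -(pou_sum P x) (bigD1 k)//= lerDl; apply: sumr_ge0 => k' _; exact: pou_ge0. Qed.

Lemma pou_pos x : exists k, 0 < P k x.
Proof.
apply: contrapT => H; have := pou_sum P x; rewrite big1 => [/eqP|k _]; first by rewrite eq_sym oner_eq0.
by apply/eqP; rewrite eq_le pou_ge0 andbT leNgt; apply/negP => Pk; apply: H; exists k.
Qed.

Definition density k x := Num.sqrt (\det (metric_coef g (pou_chart (p := P) k) x)).

Lemma density_bounded k x : src (ch (pou_chart k)) x -> exists2 B : R, 0 <= B & \near x, density k x <= B.
Proof.
move=> sx; set i := pou_chart k in sx *.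
have sd : rsmooth_on A (src (ch i)) (fun x => \det (metric_coef g i x)).
  apply: rsm_sum => [|s]; first exact: src_open.
  apply: rsm_mul; [exact: src_open|apply: rsm_cst; exact: src_open|].
  by apply: rsm_prod => [|a]; [exact: src_open|exact: rmetric_smooth].
have cd := rsm_cont (@src_open _ _ _ (ch i)) sd sx.
exists (Num.sqrt (\det (metric_coef g i x) + 1)); first exact: sqrtr_ge0.
have /cvgrPdist_lt/(_ 1 ltr01) := cd; apply: filterS => z h.
apply: ler_wsqrtr; rewrite -lerBlDl; apply: le_trans (ler_norm _) _; rewrite distrC; exact: ltW h.
Qed.

Lemma iint0 (f : V -> \bar R) : (forall y, f y = 0%E) -> iint f = 0%E.
Proof. by move=> f0; rewrite (_ : f = fun=> 0%:E) ?(iint_I (@Cc0 R n)) ?I0//; exact/funext. Qed.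

Lemma push_tgt (Z : zmodType) (c : chart R n M) (f : M -> Z) y : tgt c y -> push c f y = f (Defs.inv c y).
Proof. by move=> Ty; rewrite /push /patch mem_set. Qed.

Lemma push_out (Z : zmodType) (c : chart R n M) (f : M -> Z) y : ~ tgt c y -> push c f y = 0.
Proof. by move=> Ty; rewrite /push /patch memNset. Qed.

(** One term of the volume integral lives in the chart of the k-th member of the partition and is
    compared with a Lebesgue integral in chart i. If p is outside that chart, the member vanishes
    near p; otherwise the density is bounded near p and [chart_change] applies. *)
Lemma mint_term (i : idx A) p k : src (ch i) p -> exists2 O : set M, open O /\ O p &
  forall r s : R, 0 <= r -> r < s -> ballin i (to (ch i) p) s ->
    (forall y, `|y - to (ch i) p| <= s -> O (inv (ch i) y)) ->
    exists2 C : R, 0 <= C & forall G : V -> R, Cc G -> (forall y, 0 <= G y) ->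
      (forall y, r < `|y - to (ch i) p| -> G y = 0) ->
      (iint (fun y => (push (ch (pou_chart k)) (fun x => P k x * mlift i G x * density k x) y)%:E) <= (C * I G)%:E)%E.
Proof.
move=> sp; set c := to (ch i) p; set j := pou_chart k.
have kO (O : set M) (r s : R) G x : r < s -> (forall y, `|y - c| <= s -> O (inv (ch i) y)) ->
    (forall y, r < `|y - c| -> G y = 0) -> mlift i G x != 0 -> [/\ src (ch i) x, `|to (ch i) x - c| <= r & O x].
  move=> rs HO HG; rewrite /mlift; case: asboolP => [sx|]; last by rewrite eqxx.
  move=> G0; have xr : `|to (ch i) x - c| <= r by rewrite leNgt; apply/negP => /HG/eqP; rewrite (negbTE G0).
  split => //; rewrite -(toK sx); apply: HO; exact: le_trans xr (ltW rs).
have [sj|nj] := pselect (src (ch j) p); last first.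
  exists (~` tsupport (P k)).
    split; first by apply: closed_openC; exact: closed_closure.
    by move=> /pou_supp.
  move=> r s r0 rs B HO; exists 0 => // G CG G0 HG; rewrite mul0r iint0// => y.
  have [Ty|nT] := pselect (tgt (ch j) y); last by rewrite push_out.
  rewrite push_tgt//; congr EFin; have [->|l0] := eqVneq (mlift i G (inv (ch j) y)) 0.
    by rewrite mulr0 mul0r.
  have [_ _ nO] := kO _ _ _ _ _ rs HO HG l0.
  have [->|Pk] := eqVneq (P k (inv (ch j) y)) 0; first by rewrite !mul0r.
  by case: nO; exact: subset_closure.
have [B B0 HB] := density_bounded sj.
have [s1 s10 Hs1] := small_ball openT (Logic.I : [set: M] p) sj.
set y1 := to (ch j) p in Hs1.
pose O1 := [set x | density k x <= B]°.
pose O2 := src (ch j) `&` to (ch j) @^-1` (ball y1 (s1 / 2)).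
have h2 : 0 < s1 / 2 by rewrite divr_gt0.
exists (O1 `&` O2).
  split; first by apply: openI; [exact: open_interior|apply: open_src; exact: ball_open].
  by split; [exact: HB|split => //; exact: ballxx].
move=> r s r0 rs Bs HO.
pose r1 := 3 * s1 / 4.
have r10 : 0 <= r1 by rewrite /r1; lra.
have h1 : s1 / 2 < r1 by rewrite /r1; lra.
have rs1 : r1 < s1 by rewrite /r1; lra.
pose s' := (r + s) / 2.
have s'0 : 0 <= s' by rewrite /s'; lra.
have rs' : r < s' by rewrite /s'; lra.
have ss' : s' < s by rewrite /s'; lra.
have B1 : ballin j y1 s1 by move=> y /Hs1[].
have [C C0 HC] := chart_change r10 rs1 s'0 ss' B1 Bs (cutin_plateau y1 (ltW h2) h1) (cutin_plateau c r0 rs')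
  (fun y => plateau_01 y1 y h1) (fun y => plateau_01 c y rs').
exists (B * C); first exact: mulr_ge0.
move=> G CG G0 HG; have [Cg Ig] := HC G CG G0.
have l01 x : 0 <= mlift i (plateau c r s') x.
  by rewrite /mlift; case: asboolP => // _; case/andP: (plateau_01 c (to (ch i) x) rs').
apply: le_trans (iint_mono _ _) (_ : (iint (fun y => (B * (plateau y1 (s1 / 2) r1 y * mlift i (plateau c r s') (inv (ch j) y) * G (to (ch i) (inv (ch j) y))))%:E) <= _)%E).
- move=> y; rewrite lee_fin; have [Ty|nT] := pselect (tgt (ch j) y); last by rewrite push_out.
  rewrite push_tgt//; apply: mulr_ge0; last exact: sqrtr_ge0.
  by apply: mulr_ge0; [exact: pou_ge0|rewrite /mlift; case: asboolP].
- move=> y; rewrite lee_fin.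
  have R0 : 0 <= B * (plateau y1 (s1 / 2) r1 y * mlift i (plateau c r s') (inv (ch j) y) * G (to (ch i) (inv (ch j) y))).
    by rewrite !mulr_ge0//; case/andP: (plateau_01 y1 y h1).
  have [Ty|nT] := pselect (tgt (ch j) y); last by rewrite push_out.
  rewrite push_tgt//; have [->|l0] := eqVneq (mlift i G (inv (ch j) y)) 0.
    by rewrite mulr0 mul0r.
  have [sx xr [h1x [_ h2x]]] := kO _ _ _ _ _ rs HO HG l0.
  have d1 : density k (inv (ch j) y) <= B by exact: (@interior_subset _ _ _ h1x).
  rewrite plateau_in//; last first.
    by move: h2x; rewrite /= Defs.invK// -ball_normE /= distrC => /ltW.
  rewrite !mlift_src// plateau_in// !mul1r mulrC.
  apply: ler_pM => //; [exact: sqrtr_ge0|by rewrite mulr_ge0// pou_ge0|].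
  by rewrite ler_piMl// pou_le1.
by rewrite (iint_I (CcZ B Cg)) lee_fin (I_scal _ Cg) -mulrA ler_wpM2l.
Qed.

Lemma l2_upper (i : idx A) p : src (ch i) p -> exists2 O : set M, open O /\ O p &
  forall r s : R, 0 <= r -> r < s -> ballin i (to (ch i) p) s ->
    (forall y, `|y - to (ch i) p| <= s -> O (inv (ch i) y)) ->
    exists2 C : R, 0 <= C & forall (G : V -> R) (u : M -> R[i]), Cc G -> (forall y, 0 <= G y) ->
      (forall y, r < `|y - to (ch i) p| -> G y = 0) -> (forall x, csq (u x) = mlift i G x) ->
      (l2_sq g P u <= (C * I G)%:E)%E.
Proof.
move=> sp.
have /choice[N HO] k : exists O : set M, (open O /\ O p) /\
  forall r s : R, 0 <= r -> r < s -> ballin i (to (ch i) p) s ->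
    (forall y, `|y - to (ch i) p| <= s -> O (inv (ch i) y)) ->
    exists C : R, 0 <= C /\ forall G : V -> R, Cc G -> (forall y, 0 <= G y) ->
      (forall y, r < `|y - to (ch i) p| -> G y = 0) ->
      (iint (fun y => (push (ch (pou_chart k)) (fun x => P k x * mlift i G x * density k x) y)%:E) <= (C * I G)%:E)%E.
  have [N oO HO] := mint_term k sp; exists N; split => // r s r0 rs B H.
  by have [C C0 HC] := HO r s r0 rs B H; exists C.
pose S := [set x | forall k, N k x]°.
exists S.
  split; first exact: open_interior.
  by apply: filter_forall => k; apply: open_nbhs_nbhs; exact: (HO k).1.
move=> r s r0 rs B HS.
have /choice[C HC] k : exists C : R, 0 <= C /\ forall G : V -> R, Cc G -> (forall y, 0 <= G y) ->
      (forall y, r < `|y - to (ch i) p| -> G y = 0) ->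
      (iint (fun y => (push (ch (pou_chart k)) (fun x => P k x * mlift i G x * density k x) y)%:E) <= (C * I G)%:E)%E.
  by apply: (HO k).2 r0 rs B _ => y /HS /interior_subset; apply.
exists (\sum_k C k); first by apply: sumr_ge0 => k _; case: (HC k).
move=> G u CG G0 HG Hu; rewrite /l2_sq /mint mulr_suml -sumEFin; apply: lee_sum => k _.
apply: le_trans ((HC k).2 G CG G0 HG); rewrite le_eqVlt; apply/orP; left; apply/eqP.
by congr iint; apply/funext => y; congr EFin; congr (push _ _ y); apply/funext => x; rewrite Hu.
Qed.

(** Components exact up to radius 5 rho and cut off at 6 rho. Integer multiples of rho nest all
    cut-offs: the estimate concerns vectors supported in 5 rho, and the chart contains the ball of
    radius 7 rho. *)
Definition zcoef (i : idx A) c (rho : R) (X : rvf R n M) (b : 'I_n) (y : V) : R :=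
  plateau c (5 * rho) (6 * rho) y * vcomp i X b (inv (ch i) y).

Lemma sm_zcoef (i : idx A) c (rho : R) X b : 0 < rho -> ballin i c (7 * rho) -> rvf_smooth A X ->
  cutin c (6 * rho) (zcoef i c rho X b).
Proof.
move=> r0 B sX.
have r56 : 5 * rho < 6 * rho by rewrite ltr_pM2r// ltr_nat.
have r5 : 0 <= 5 * rho by rewrite mulr_ge0// ltW.
have cp := cutin_plateau c r5 r56.
split; last by move=> y /cp.2; rewrite /zcoef => ->; rewrite mul0r.
apply: (sm_pull (@src_open _ _ _ (ch i)) _ cp (sX i b)) => y h.
have Ty : tgt (ch i) y by apply: B; apply: le_trans h _; rewrite ler_pM2r// ler_nat.
by split => //; exact: Defs.inv_src.
Qed.

(** With [dIm], the real and imaginary parts of (X + i Y)(v1 + i v2). *)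
Definition dRe (X Y : 'I_n -> V -> R) (v1 v2 : V -> R) (y : V) : R :=
  \sum_b (X b y * partial b v1 y - Y b y * partial b v2 y).
Definition dIm (X Y : 'I_n -> V -> R) (v1 v2 : V -> R) (y : V) : R :=
  \sum_b (X b y * partial b v2 y + Y b y * partial b v1 y).

Lemma sq_split (k r s x y a b : R) : (k * r + (a * x - b * y)) ^+ 2 + (k * s + (b * x + a * y)) ^+ 2 <=
  2 * k ^+ 2 * (r ^+ 2 + s ^+ 2) + 2 * (x ^+ 2 + y ^+ 2) * (a ^+ 2 + b ^+ 2).
Proof.
rewrite -subr_ge0 (_ : _ - _ = (k * r - (a * x - b * y)) ^+ 2 + (k * s - (b * x + a * y)) ^+ 2); last by ring.
by rewrite addr_ge0 ?sqr_ge0.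
Qed.

Lemma partial_far c (r : R) (h : V -> R) b y : cutin c r h -> r < `|y - c| -> partial b h y = 0.
Proof.
move=> [sh H] yr; rewrite (@partial_near R n h (fun=> 0)) ?partial_cst//.
have : nbhs y [set z | r < `|z - c|] by apply: open_nbhs_nbhs; split => //; exact: open_far.
by apply: filterS => z; exact: H.
Qed.

Theorem local_subelliptic p (W : set M) : open W -> W p -> subelliptic_at g P D p ->
  exists (i : idx A) (rho : R) (m : nat) (L : 'I_m -> cvf R n M) (lam : R),
  [/\ src (ch i) p, 0 < rho & forall y, `|y - to (ch i) p| <= 7 * rho -> tgt (ch i) y /\ W (inv (ch i) y)] /\
  [/\ forall j, D (L j), 0 < lam < 1 & exists2 C : R, 0 <= C & forall v1 v2 k,
    cutin (to (ch i) p) (5 * rho) v1 -> cutin (to (ch i) p) (5 * rho) v2 ->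
    let X j := zcoef i (to (ch i) p) rho (re_vf (L j)) in
    let Y j := zcoef i (to (ch i) p) rho (im_vf (L j)) in
    I (fun x => (v1 x - cnv (mk (tk R k)) v1 x) ^+ 2) + I (fun x => (v2 x - cnv (mk (tk R k)) v2 x) ^+ 2)
    <= C * (lam ^+ k) ^+ 2 * (I (fun x => v1 x ^+ 2) + I (fun x => v2 x ^+ 2)
        + \sum_j (I (fun x => dRe (X j) (Y j) v1 v2 x ^+ 2) + I (fun x => dIm (X j) (Y j) v1 v2 x ^+ 2)))].
Proof.
move=> oW Wp [U [eps [C1 [m [L [[oU Up] eps0 C10 HL Hsub]]]]]].
have [k0 Pk0] := pou_pos p; pose i := pou_chart k0.
have sp : src (ch i) p by apply: pou_supp; apply: subset_closure; rewrite /= gt_eqF.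
have [N [oO Op] HO] := l2_upper sp.
pose S := [set x | [/\ W x, U x, N x & 0 < P k0 x]]°.
have Sp : S p.
  have near1 : \forall x \near p, 0 < P k0 x.
    exact: (@cvgr_gt _ _ _ _ _ _ (rsm_cont openT (pou_smooth k0) (Logic.I : [set: M] p)) _ Pk0).
  have n1 : nbhs p W by apply: open_nbhs_nbhs.
  have n2 : nbhs p U by apply: open_nbhs_nbhs.
  have n3 : nbhs p N by apply: open_nbhs_nbhs.
  by apply: filterS3 (filterI n1 n2) n3 near1 => x [? ?] ? ?.
have [s0 s00 Hs0] := small_ball (open_interior _) Sp sp.
set c := to (ch i) p in Hs0 *.
pose rho := s0 / 7; have r0 : 0 < rho by rewrite divr_gt0.
have r7 : 7 * rho = s0 by rewrite /rho mulrC divfK.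
have HS y : `|y - c| <= 7 * rho -> tgt (ch i) y /\ [/\ W (inv (ch i) y), U (inv (ch i) y), N (inv (ch i) y) & 0 < P k0 (inv (ch i) y)].
  by rewrite r7 => /Hs0[Ty /interior_subset].
(* Lowering the order to at most 1, as [fourier_gain] requires, only weakens the Sobolev norm. At
   scale t = 2^-k the gain (t^2)^s is lam^(2k) with lam = 2^-s. *)
pose s := Num.min eps 1; have s01 : 0 < s <= 1 by rewrite lt_min eps0 ltr01 ge_min lexx orbT.
pose lam : R := 2^-1 `^ s.
have lam01 : 0 < lam < 1.
  have h2 : (0 : R) < 2^-1 by rewrite invr_gt0.
  rewrite powR_gt0//= /lam /powR gt_eqF// -[X in _ < X]expR0 ltr_expR.
  case/andP: s01 => s0' _; rewrite pmulr_rlt0// ln_lt0// h2 invf_lt1// ltr1n//.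
exists i, rho, m, L, lam; split; first by split => // y /HS[Ty []].
split => //.
have B7 : ballin i c (7 * rho) by move=> y /HS[].
have le k k' : (k < k')%N -> k%:R * rho < k'%:R * rho by move=> kk; rewrite ltr_pM2r// ltr_nat.
have ge0 k : 0 <= k%:R * rho by rewrite mulr_ge0// ltW.
pose big := plateau c (6 * rho) (7 * rho).
have cbig : cutin c (7 * rho) big by exact: cutin_plateau (ge0 _) (le _ _ _).
(* The Sobolev norm sees u only through [P k0 * u]. The test function u = v / P_k0 makes this
   product v itself, and the derivatives of kap add only terms of order zero. *)
pose kap z := big z * (P k0 (inv (ch i) z))^-1.
have oS := @open_interior _ [set x | [/\ W x, U x, N x & 0 < P k0 x]].
have sPi : rsmooth_on A S (fun x => (P k0 x)^-1).
  apply: rsm_inv => //; last by apply: rsm_sub (pou_smooth k0).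
  by move=> x /interior_subset[_ _ _ Px]; rewrite gt_eqF.
have skap : smooth kap by apply: (sm_pull oS _ cbig sPi) => y; rewrite r7; exact: Hs0.
have Ckap : Cc kap.
  by split; [exact: sm_cont|have [_ [K HK]] := cutin_Cc cbig; exists K => y /HK e; rewrite /kap e mul0r].
have [K K0 HK] := Cc_bounded Ckap.
have [C2 C20 HC2] := HO (5 * rho) (7 * rho) (ge0 _) (le 5 7 isT) B7 (fun y yr => let: And4 _ _ Oy _ := (HS y yr).2 in Oy).
have [C3 C30 HC3] := fourier_gain n s01.
pose X j := zcoef i c rho (re_vf (L j)); pose Y j := zcoef i c rho (im_vf (L j)).
have sX j b : cutin c (6 * rho) (X j b) by apply: sm_zcoef => //; exact: (dist_smooth (HL j)).1.
have sY j b : cutin c (6 * rho) (Y j b) by apply: sm_zcoef => //; exact: (dist_smooth (HL j)).2.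
pose xx j z := \sum_b X j b z * partial b kap z; pose yy j z := \sum_b Y j b z * partial b kap z.
have /choice[Q HQ] j : exists Q : R, 0 <= Q /\ forall z, xx j z ^+ 2 + yy j z ^+ 2 <= Q.
  have Cx : Cc (xx j) by apply: Cc_sum => b; apply: CcMr; [exact: cutin_Cc (sX j b)|exact/sm_cont/sm_partial].
  have Cy : Cc (yy j) by apply: Cc_sum => b; apply: CcMr; [exact: cutin_Cc (sY j b)|exact/sm_cont/sm_partial].
  have [q q0 Hq] := Cc_bounded (CcD (Cc_sq Cx) (Cc_sq Cy)).
  by exists q; split => // z; apply: le_trans (ler_norm _) (Hq z).
(* C1 is the subelliptic constant, C2 compares the volume with Lebesgue measure, C3 comes from
   [fourier_gain]. In the last factor K^2 bounds the term of order zero, 2 K^2 and the Q j come from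
   [sq_split]. *)
exists (C3 * (C1 * C2) * (2 * K ^+ 2 + K ^+ 2 + 2 * \sum_j Q j)).
  rewrite !mulr_ge0 ?(ltW C10)// !addr_ge0 ?mulr_ge0 ?sqr_ge0//.
  by apply: sumr_ge0 => j _; case: (HQ j).
move=> v1 v2 k cv1 cv2; lazy zeta.
have [sv1 sv2] := (cv1.1, cv2.1); have [Cv1 Cv2] := (cutin_Cc cv1, cutin_Cc cv2).
pose v1k z := v1 z * kap z; pose v2k z := v2 z * kap z.
have c1 : cutin c (5 * rho) v1k by exact: cutinMr.
have c2 : cutin c (5 * rho) v2k by exact: cutinMr.
have B5 : ballin i c (5 * rho) by apply: ballin_le B7; exact: ltW (le 5 7 isT).
pose w x := (mlift i v1k x +i* mlift i v2k x)%C.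
have sw : csmooth_on A setT w by split; [exact: sm_mlift B5 c1|exact: sm_mlift B5 c2].
have w0 x : ~ kball i c (5 * rho) x -> w x = 0.
  by move=> nx; rewrite /w (mlift_out c1 nx) (mlift_out c2 nx).
have tw : tsupport w `<=` kball i c (5 * rho).
  have cl := closed_kball B5.
  have sub : [set x | w x != 0] `<=` kball i c (5 * rho).
    by move=> x /= wx; apply: contrapT => /w0/eqP; rewrite (negbTE wx).
  by move=> x /(closure_subset sub); rewrite -((closure_id _).1 cl).
have test : test_function A U w.
  split => //.
    by apply: subclosed_compact (compact_kball B5) tw; exact: closed_closure.
  move=> x /tw[sx xr]; rewrite -(toK sx).
  by have [] := (HS _ (le_trans xr (ltW (le 5 7 isT)))).2.
have v0 (v : V -> R) y : cutin c (5 * rho) v -> v y = v y * big y.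
  move=> [_ H]; have [yr|/H ->] := leP `|y - c| (5 * rho); last by rewrite mul0r.
  by rewrite /big plateau_in ?mulr1//; [exact: le|exact: le_trans yr (ltW (le 5 6 isT))].
have Epush : push (ch i) (fun x => (P k0 x)%:C%C * w x) = (fun y => (v1 y +i* v2 y)%C).
  apply/funext => y; have [Ty|nT] := pselect (tgt (ch i) y); last first.
    rewrite push_out// cv1.2 ?cv2.2//; rewrite ltNge; apply/negP => /B5; exact: nT.
  rewrite push_tgt// /w !mlift_inv// /v1k /v2k /kap.
  have Pn : big y != 0 -> P k0 (inv (ch i) y) != 0.
    move=> bn; have yr : `|y - c| <= 7 * rho.
      by rewrite leNgt; apply/negP => /cbig.2/eqP; rewrite (negbTE bn).
    by have [_ [_ _ _ Px]] := HS y yr; rewrite gt_eqF.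
  have Ev v : cutin c (5 * rho) v -> P k0 (inv (ch i) y) * (v y * (big y / P k0 (inv (ch i) y))) = v y.
    move=> cv; rewrite [RHS](v0 v y cv); have [->|/Pn Pnn] := eqVneq (big y) 0; first by rewrite mul0r !mulr0.
    by field.
  by apply: complex_ext; rewrite ?cReM ?cImM /= !mul0r ?subr0 ?addr0 Ev.
have hs : (hs_sq s (fun y => (v1 y +i* v2 y)%C) <= sobolev_sq P eps w)%E.
  have pos t f : (0 <= hs_sq t f)%E.
    by apply: iint_ge0 => y; rewrite lee_fin mulr_ge0 ?powR_ge0// addr_ge0 ?sqr_ge0.
  rewrite /sobolev_sq (bigD1 k0)//= -/i Epush.
  apply: le_trans (leeDl _ _); last by apply: sume_ge0 => k' _; exact: pos.
  apply: iint_mono => y; rewrite lee_fin; first by rewrite mulr_ge0 ?powR_ge0// addr_ge0 ?sqr_ge0.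
  apply: ler_wpM2r; first by rewrite addr_ge0 ?sqr_ge0.
  by apply: ler_powR; [rewrite lerDl dotp_ge0|rewrite ge_min lexx].
pose G0 z := v1k z ^+ 2 + v2k z ^+ 2.
pose Gj j z := dRe (X j) (Y j) v1k v2k z ^+ 2 + dIm (X j) (Y j) v1k v2k z ^+ 2.
have [CK1 CK2] := (cutin_Cc c1, cutin_Cc c2).
have CG0 : Cc G0 by apply: CcD; exact: Cc_sq.
have Cdre j u1 u2 : smooth u1 -> smooth u2 -> Cc (dRe (X j) (Y j) u1 u2) /\ Cc (dIm (X j) (Y j) u1 u2).
  move=> s1 s2; have Cm (F : 'I_n -> V -> R) b u : cutin c (6 * rho) (F b) -> smooth u -> Cc (fun y => F b y * partial b u y).
    by move=> /cutin_Cc CF su; apply: CcMr => //; exact/sm_cont/sm_partial.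
  by split; apply: Cc_sum => b; [apply: CcB|apply: CcD]; exact: Cm.
have CGj j : Cc (Gj j) by apply: CcD; apply: Cc_sq; case: (Cdre j _ _ c1.1 c2.1).
have l0 : (l2_sq g P w <= (C2 * I G0)%:E)%E.
  apply: HC2 => //.
  - by move=> y; rewrite addr_ge0 ?sqr_ge0.
  - by move=> y yr; rewrite /G0 c1.2// c2.2// expr0n addr0.
  - by move=> x; rewrite /csq /w /= /mlift; case: asboolP => // _; rewrite expr0n addr0.
have lj j : (l2_sq g P (vf_app A (L j) w) <= (C2 * I (Gj j))%:E)%E.
  apply: HC2 => //.
  - by move=> y; rewrite addr_ge0 ?sqr_ge0.
  - move=> y yr; rewrite /Gj /dRe /dIm !big1 ?expr0n ?addr0// => b _;
      by rewrite !(partial_far b c1 yr) !(partial_far b c2 yr) !mulr0 ?subr0 ?addr0.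
  move=> x; have [sx|nx] := pselect (src (ch i) x); last first.
    have nk : ~ kball i c (5 * rho) x by case.
    rewrite /mlift; case: asboolP => // _; have s0' := at_ptP A x.
    have [e1 e2] := vf_app_chart (L j) openT (Logic.I : [set: M] x) sw s0'.
    have p0 (u : V -> R) b : cutin c (5 * rho) u ->
        partial b ((mlift i u) \o inv (ch (at_pt A x))) (to (ch (at_pt A x)) x) = 0.
      move=> cu; rewrite (@partial_near R n _ (fun=> 0)) ?partial_cst//.
      have : nbhs (to (ch (at_pt A x)) x) (tgt (ch (at_pt A x)) `&` inv (ch (at_pt A x)) @^-1` (~` kball i c (5 * rho))).
        apply: open_nbhs_nbhs; split; first by apply: open_chart; apply: closed_openC; exact: closed_kball.
        by split; [exact: to_tgt|rewrite /= toK].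
      by apply: filterS => y [_ ny] /=; exact: mlift_out cu ny.
    rewrite /csq e1 e2 !big1 ?expr0n ?addr0// => b _;
      by rewrite !(p0 v1k b c1) !(p0 v2k b c2) !mulr0 ?subr0 ?addr0.
  rewrite mlift_src//; have [e1 e2] := vf_app_chart (L j) openT (Logic.I : [set: M] x) sw sx.
  have pE (u : V -> R) b : cutin c (5 * rho) u ->
      partial b ((mlift i u) \o inv (ch i)) (to (ch i) x) = partial b u (to (ch i) x).
    move=> cu; apply: partial_near.
    have : nbhs (to (ch i) x) (tgt (ch i)) by apply: open_nbhs_nbhs; split; [exact: tgt_open|exact: to_tgt].
    by apply: filterS => y Ty /=; rewrite mlift_inv.
  have zE (F : rvf R n M) b u : cutin c (5 * rho) u ->
     vcomp i F b x * partial b u (to (ch i) x) = zcoef i c rho F b (to (ch i) x) * partial b u (to (ch i) x).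
    move=> cu; have [zr|zr] := leP `|to (ch i) x - c| (5 * rho); last by rewrite (partial_far b cu zr) !mulr0.
    by rewrite /zcoef plateau_in ?mul1r ?toK//; exact: le.
  rewrite /csq e1 e2 /Gj; congr (_ ^+ 2 + _ ^+ 2); apply: eq_bigr => b _;
    by rewrite !(pE v1k b c1) !(pE v2k b c2) !(zE _ _ _ c1) !(zE _ _ _ c2).
have hK z : kap z ^+ 2 <= K ^+ 2 by rewrite -real_normK ?num_real// lerXn2r ?nnegrE.
pose N1 := I (fun x => v1 x ^+ 2) + I (fun x => v2 x ^+ 2).
pose Nj j := I (fun x => dRe (X j) (Y j) v1 v2 x ^+ 2) + I (fun x => dIm (X j) (Y j) v1 v2 x ^+ 2).
have CN1 : Cc (fun z => v1 z ^+ 2 + v2 z ^+ 2) by apply: CcD; exact: Cc_sq.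
have CNj j : Cc (fun z => dRe (X j) (Y j) v1 v2 z ^+ 2 + dIm (X j) (Y j) v1 v2 z ^+ 2).
  by have [d1 d2] := Cdre j _ _ sv1 sv2; apply: CcD; exact: Cc_sq.
have N10 : 0 <= N1 by rewrite addr_ge0// I_sq_ge0.
have Nj0 j : 0 <= Nj j by have [d1 d2] := Cdre j _ _ sv1 sv2; rewrite addr_ge0// I_sq_ge0.
have b0 : I G0 <= K ^+ 2 * N1.
  rewrite /N1 -I_add; [|exact: Cc_sq|exact: Cc_sq].
  rewrite -I_scal//; apply: I_le => //; first exact: CcZ.
  move=> z; rewrite /G0 /v1k /v2k [(v1 z * kap z) ^+ 2]exprMn [(v2 z * kap z) ^+ 2]exprMn -mulrDl.
  have p0 : 0 <= v1 z ^+ 2 + v2 z ^+ 2 by rewrite addr_ge0 ?sqr_ge0.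
  by rewrite mulrC; exact: (ler_wpM2r p0 (hK z)).
have bj j : I (Gj j) <= 2 * K ^+ 2 * Nj j + 2 * Q j * N1.
  have [d1 d2] := Cdre j _ _ sv1 sv2; rewrite /N1 /Nj -I_add; [|exact: Cc_sq|exact: Cc_sq].
  rewrite -I_add; [|exact: Cc_sq|exact: Cc_sq].
  rewrite -!I_scal// -I_add; [|exact: CcZ|exact: CcZ].
  apply: I_le => //; first by apply: CcD; exact: CcZ.
  move=> z.
  have Pv1 b : partial b v1k z = partial b v1 z * kap z + v1 z * partial b kap z by exact: partialM.
  have Pv2 b : partial b v2k z = partial b v2 z * kap z + v2 z * partial b kap z by exact: partialM.
  have Ere : dRe (X j) (Y j) v1k v2k z = kap z * dRe (X j) (Y j) v1 v2 z + (v1 z * xx j z - v2 z * yy j z).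
    rewrite /dRe /xx /yy !mulr_sumr -sumrB -big_split /=; apply: eq_bigr => b _.
    rewrite Pv1 Pv2; ring.
  have Eim : dIm (X j) (Y j) v1k v2k z = kap z * dIm (X j) (Y j) v1 v2 z + (v2 z * xx j z + v1 z * yy j z).
    rewrite /dIm /xx /yy !mulr_sumr -!big_split /=; apply: eq_bigr => b _.
    rewrite Pv1 Pv2; ring.
  rewrite /Gj Ere Eim; apply: le_trans (sq_split _ _ _ _ _ _ _) _; apply: lerD.
    apply: ler_wpM2r; first by rewrite addr_ge0 ?sqr_ge0.
    by apply: ler_wpM2l => //; exact: hK.
  apply: ler_wpM2r; first by rewrite addr_ge0 ?sqr_ge0.
  by apply: ler_wpM2l => //; exact: (HQ j).2.
pose h := C1 * (C2 * I G0 + \sum_j C2 * I (Gj j)).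
have Hh : (hs_sq s (fun y => (v1 y +i* v2 y)%C) <= h%:E)%E.
  apply: le_trans hs _; apply: le_trans (Hsub w test) _.
  rewrite /h EFinM; apply: lee_wpmul2l; first by rewrite lee_fin ltW.
  rewrite EFinD -sumEFin; apply: leeD => //; apply: lee_sum => j _; exact: lj.
apply: le_trans (HC3 v1 v2 sv1 Cv1 sv2 Cv2 (tk R k) h (tk_gt0 R k) Hh) _.
have -> : (tk R k ^+ 2) `^ s = (lam ^+ k) ^+ 2.
  have h2 : 0 <= (2^-1 : R) by rewrite invr_ge0.
  by rewrite /tk !exp_powR// exprn_ge0.
have hb : h <= C1 * C2 * (2 * K ^+ 2 + K ^+ 2 + 2 * \sum_j Q j) * (N1 + \sum_j Nj j).
  rewrite /h -mulr_sumr -mulrDr mulrA -!mulrA; apply: ler_wpM2l; first exact: ltW.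
  apply: ler_wpM2l => //.
  have sj : \sum_j I (Gj j) <= 2 * K ^+ 2 * (\sum_j Nj j) + 2 * (\sum_j Q j) * N1.
    rewrite !mulr_sumr mulr_suml -big_split; apply: ler_sum => j _; exact: bj.
  have SN : 0 <= \sum_j Nj j by apply: sumr_ge0.
  have SQ : 0 <= \sum_j Q j by apply: sumr_ge0 => j _; case: (HQ j).
  apply: le_trans (lerD b0 sj) _; have := sqr_ge0 K; move: (K ^+ 2) (\sum_j Nj j) (\sum_j Q j) SN SQ => a b d; nra.
have L0 : 0 <= C3 * (lam ^+ k) ^+ 2 by rewrite mulr_ge0// sqr_ge0.
apply: le_trans (ler_wpM2l L0 hb) _.
have -> : C3 * lam ^+ k ^+ 2 * (C1 * C2 * (2 * K ^+ 2 + K ^+ 2 + 2 * \sum_j Q j) * (N1 + \sum_j Nj j)) =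
  C3 * (C1 * C2) * (2 * K ^+ 2 + K ^+ 2 + 2 * \sum_j Q j) * lam ^+ k ^+ 2 * (N1 + \sum_j Nj j) by ring.
exact: lexx.
Qed.

End LocalEstimate.

Local Notation ssmooth := section_smooth.

(** * The equation in a local frame *)

Section Frame.
Variables (R : realType) (n : nat) (M : topologicalType) (A : manifold R n M).
Variables (r : nat) (E : vbundle A r).
Implicit Types (s : section E) (t : tidx E) (x : M).

Lemma section_ext s s' : (forall x, s x = s' x) -> s = s'.
Proof. exact: functional_extensionality_dep. Qed.

Lemma trivZD t x (d : R[i]) (u v : E x) : tdom t x -> triv t (d *: u + v) = d *: triv t u + triv t v.
Proof. by move=> tx; exact: triv_linear. Qed.

Lemma triv0 t x : tdom t x -> triv t (0 : E x) = 0.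
Proof.
move=> tx; have := trivZD (-1) (0 : E x) 0 tx.
by rewrite scaler0 addr0 scaleN1r addNr.
Qed.

Lemma trivZ t x (d : R[i]) (u : E x) : tdom t x -> triv t (d *: u) = d *: triv t u.
Proof. by move=> tx; have := trivZD d u 0 tx; rewrite triv0// !addr0. Qed.

Lemma trivD t x (u v : E x) : tdom t x -> triv t (u + v) = triv t u + triv t v.
Proof. by move=> tx; have := trivZD 1 u v tx; rewrite !scale1r. Qed.

Lemma triv_sum t x (T : Type) (l : seq T) (F : T -> E x) : tdom t x ->
  triv t (\sum_(k <- l) F k) = \sum_(k <- l) triv t (F k).
Proof.
by move=> tx; elim: l => [|k l IH]; rewrite ?big_nil ?triv0// !big_cons trivD// IH.
Qed.

Lemma triv_inj t x (u v : E x) : tdom t x -> triv t u = triv t v -> u = v.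
Proof. by move=> /triv_bij/bij_inj; apply. Qed.

Lemma csm_mul (U : set M) (f g : M -> R[i]) : open U -> csmooth_on A U f -> csmooth_on A U g ->
  csmooth_on A U (fun x => f x * g x).
Proof.
move=> oU [f1 f2] [g1 g2]; split.
  apply: (rsm_ext oU (f := fun x => complex.Re (f x) * complex.Re (g x) + - (complex.Im (f x) * complex.Im (g x)))).
    by move=> x _; rewrite cReM.
  by apply: rsm_add => //; [exact: rsm_mul|apply: rsm_opp => //; exact: rsm_mul].
apply: (rsm_ext oU (f := fun x => complex.Re (f x) * complex.Im (g x) + complex.Im (f x) * complex.Re (g x))).
  by move=> x _; rewrite cImM.
by apply: rsm_add => //; exact: rsm_mul.
Qed.

Lemma csm_add (U : set M) (f g : M -> R[i]) : open U -> csmooth_on A U f -> csmooth_on A U g ->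
  csmooth_on A U (fun x => f x + g x).
Proof.
move=> oU [f1 f2] [g1 g2]; split.
  by apply: rsm_ext (rsm_add oU f1 g1) => // x _; rewrite cReD.
by apply: rsm_ext (rsm_add oU f2 g2) => // x _; rewrite cImD.
Qed.

Lemma csm_ext (U : set M) (f g : M -> R[i]) : open U -> (forall x, U x -> f x = g x) ->
  csmooth_on A U f -> csmooth_on A U g.
Proof.
by move=> oU fg [f1 f2]; split; [apply: rsm_ext f1|apply: rsm_ext f2] => // x Ux; rewrite fg.
Qed.

Lemma csm_real (U : set M) (f : M -> R) : open U -> rsmooth_on A U f -> csmooth_on A U (fun x => (f x)%:C%C).
Proof. by move=> oU sf; split => //; exact: rsm_cst. Qed.

Lemma ssm_add s s' : ssmooth s -> ssmooth s' -> ssmooth (fun x => s x + s' x).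
Proof.
move=> H H' t b; have oT := tdom_open t.
apply: csm_ext (csm_add oT (H t b) (H' t b)) => // x tx.
by rewrite trivD// mxE.
Qed.

Lemma ssm_scale (f : M -> R[i]) s : csmooth_on A setT f -> ssmooth s -> ssmooth (fun x => f x *: s x).
Proof.
move=> [f1 f2] H t b; have oT := tdom_open t.
have fT : csmooth_on A (tdom t) f by split; apply: rsm_sub (subsetT _) _.
apply: csm_ext (csm_mul oT fT (H t b)) => // x tx.
by rewrite trivZ// mxE.
Qed.

Lemma ssm0 : ssmooth (fun x => 0 : E x).
Proof.
move=> t b; have oT := tdom_open t.
apply: (csm_ext oT (f := fun=> 0)); last by split; exact: rsm_cst.
by move=> x tx; rewrite triv0// mxE.
Qed.

Lemma ssm_sum (T : Type) (l : seq T) (F : T -> section E) : (forall k, ssmooth (F k)) ->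
  ssmooth (fun x => \sum_(k <- l) F k x).
Proof.
move=> H; elim: l => [|k l IH].
  rewrite (_ : (fun x => _) = fun x => 0 : E x); first exact: ssm0.
  by apply: section_ext => x; rewrite big_nil.
rewrite (_ : (fun x => _) = fun x => F k x + \sum_(k <- l) F k x); first exact: ssm_add.
by apply: section_ext => x; rewrite big_cons.
Qed.

Lemma ssm_cst_scale (d : R[i]) s : ssmooth s -> ssmooth (fun x => d *: s x).
Proof. by apply: ssm_scale; split; exact: (rsm_cst _ openT). Qed.

Variable (nabla : connection E).

Lemma nab_sum (X : rvf R n M) (T : Type) (l : seq T) (F : T -> section E) x : rvf_smooth A X ->
  (forall k, ssmooth (F k)) ->
  nabla X (fun z => \sum_(k <- l) F k z) x = \sum_(k <- l) nabla X (F k) x.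
Proof.
move=> sX H; have z0 : nabla X (fun z => 0 : E z) x = 0.
  have := nab_linear nabla (-1) sX ssm0 ssm0 x; rewrite scaleN1r addNr => e; rewrite -[RHS]e.
  by congr (nabla X _ x); apply: section_ext => z; rewrite scaler0 addr0.
elim: l => [|k l IH].
  by rewrite big_nil -[RHS]z0; congr (nabla X _ x); apply: section_ext => z; rewrite big_nil.
rewrite big_cons -IH -[nabla X (F k) x]scale1r -nab_linear//; last exact: ssm_sum.
by congr (nabla X _ x); apply: section_ext => z; rewrite big_cons scale1r.
Qed.

Lemma cnab_smooth (Z : cvf R n M) s : cvf_smooth A Z -> ssmooth s -> ssmooth (cnab nabla Z s).
Proof.
move=> [s1 s2] ss; apply: ssm_add; first exact: nab_smooth.
by apply: ssm_cst_scale; exact: nab_smooth.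
Qed.

Lemma cnab_lin (d : R[i]) (Z : cvf R n M) s s' x : cvf_smooth A Z -> ssmooth s -> ssmooth s' ->
  cnab nabla Z (fun z => d *: s z + s' z) x = d *: cnab nabla Z s x + cnab nabla Z s' x.
Proof.
move=> [s1 s2] ss ss'; rewrite /cnab !nab_linear// !scalerDr !scalerA [_ * d]mulrC.
by rewrite addrACA.
Qed.

Local Notation V := 'rV[R]_n.
Variables (i : idx A) (t : tidx E) (c : V) (rho : R).
Hypothesis rho0 : 0 < rho.
Hypothesis ball7 : forall y, `|y - c| <= 7 * rho -> tgt (ch i) y /\ tdom t (inv (ch i) y).
Implicit Types (y : V).

Definition plat k : V -> R := plateau c (k%:R * rho) (k.+1%:R * rho).

Lemma rho_lt k l : (k < l)%N -> k%:R * rho < l%:R * rho.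
Proof. by move=> kl; rewrite ltr_pM2r// ltr_nat. Qed.
Lemma rho_le k l : (k <= l)%N -> k%:R * rho <= l%:R * rho.
Proof. by move=> kl; rewrite ler_pM2r// ler_nat. Qed.
Lemma rho_ge k : 0 <= k%:R * rho. Proof. by rewrite mulr_ge0// ltW. Qed.

Lemma cutin_plat k : cutin c (k.+1%:R * rho) (plat k).
Proof. by apply: cutin_plateau; [exact: rho_ge|exact: rho_lt]. Qed.

Lemma plat01 k y : 0 <= plat k y <= 1.
Proof. by apply: plateau_01; exact: rho_lt. Qed.

Lemma plat_in k y : `|y - c| <= k%:R * rho -> plat k y = 1.
Proof. by apply: plateau_in; exact: rho_lt. Qed.

Lemma ballin_plat k : (k <= 7)%N -> ballin i c (k%:R * rho).
Proof. by move=> k7 y yr; have [] := ball7 (le_trans yr (rho_le k7)). Qed.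

Lemma kball_tdom k x : (k <= 7)%N -> kball i c (k%:R * rho) x -> tdom t x.
Proof. by move=> k7 [sx xr]; rewrite -(toK sx); exact: (ball7 (le_trans xr (rho_le k7))).2. Qed.

(** True selects the real part: a section of complex rank r has 2 r real coordinates. *)
Definition rcoord s (q : bool * 'I_r) x : R :=
  if q.1 then complex.Re (triv t (s x) 0 q.2) else complex.Im (triv t (s x) 0 q.2).

Definition loc s q y : R := plat 5 y * rcoord s q (inv (ch i) y).

Lemma sm_loc s q : ssmooth s -> cutin c (6 * rho) (loc s q).
Proof.
move=> ss; have [sp H] := cutin_plat 5; split; last by move=> y /H; rewrite /loc => ->; rewrite mul0r.
apply: (sm_pull (tdom_open t) _ (cutin_plat 5)) => [y yr|].
  by apply: ball7; exact: le_trans yr (rho_le (isT : (6 <= 7)%N)).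
by have [s1 s2] := ss t q.2; rewrite /rcoord; case: q.1.
Qed.

Lemma frame_ex x b : exists v : E x, tdom t x -> triv t v = delta_mx 0 b.
Proof.
have [tx|nx] := pselect (tdom t x); last by exists 0.
by have [f _ fK] := triv_bij tx; exists (f (delta_mx 0 b)) => _; rewrite fK.
Qed.

(** The local frame made global, since a connection acts on global sections only. It is exact up to
    radius 6 rho, and the arbitrary vector chosen outside [tdom t] is multiplied by 0. *)
Definition frame b : section E := fun x => (mlift i (plat 6) x)%:C%C *: sval (cid (frame_ex x b)).

Lemma frame_out b x : ~ kball i c (7 * rho) x -> frame b x = 0.
Proof. by move=> nk; rewrite /frame (mlift_out (cutin_plat 6) nk) scale0r. Qed.

Lemma triv_frame b x : tdom t x -> triv t (frame b x) = (mlift i (plat 6) x)%:C%C *: delta_mx 0 b.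
Proof. by move=> tx; rewrite /frame trivZ//; case: cid => v /= ->. Qed.

Lemma frame_smooth b : ssmooth (frame b).
Proof.
move=> t' b'; have [T [sT HT]] := triv_smooth t t'.
have oT := tdom_open t'; have oTT : open (tdom t `&` tdom t') by apply: openI; exact: tdom_open.
have oK : open (tdom t' `&` ~` kball i c (7 * rho)).
  by apply: openI => //; apply: closed_openC; apply: closed_kball; exact: ballin_plat.
have sl : rsmooth_on A setT (mlift i (plat 6)) by apply: sm_mlift (cutin_plat 6); exact: ballin_plat.
have on1 : csmooth_on A (tdom t `&` tdom t') (fun x => triv t' (frame b x) 0 b').
  apply: (csm_ext oTT (f := fun x => (mlift i (plat 6) x)%:C%C * T x b b')).
    move=> x [tx tx']; rewrite HT// triv_frame// -scalemxAl mxE -rowE mxE.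
    by [].
  apply: csm_mul => //.
  by apply: csm_real => //; exact: rsm_sub sl.
have on2 : csmooth_on A (tdom t' `&` ~` kball i c (7 * rho)) (fun x => triv t' (frame b x) 0 b').
  apply: (csm_ext oK (f := fun=> 0)); last by split; exact: rsm_cst.
  by move=> x [tx nk]; rewrite frame_out// triv0// mxE.
by split; apply: rsm_local => // x tx'; (have [kx|nk] := pselect (kball i c (7 * rho) x);
  [exists (tdom t `&` tdom t'); split; [|split => //; exact: kball_tdom kx|]; [|case: on1]
  |exists (tdom t' `&` ~` kball i c (7 * rho)); split; [|split|case: on2]]).
Qed.

Definition lfn s b (x : M) : R[i] := (mlift i (loc s (true, b)) x +i* mlift i (loc s (false, b)) x)%C.

Lemma lfn_smooth s b : ssmooth s -> csmooth_on A setT (lfn s b).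
Proof.
move=> ss; have B6 := @ballin_plat 6 isT.
by split; [exact: (sm_mlift B6 (sm_loc (true, b) ss))|exact: (sm_mlift B6 (sm_loc (false, b) ss))].
Qed.

Lemma lfnE s b x : src (ch i) x -> lfn s b x = (plat 5 (to (ch i) x))%:C%C * triv t (s x) 0 b.
Proof.
move=> sx; rewrite /lfn !mlift_src// /loc /rcoord /= toK//.
by apply: complex_ext; rewrite ?cReM ?cImM /= mul0r ?subr0 ?addr0.
Qed.

Lemma decompose s x : (mlift i (plat 5) x)%:C%C *: s x = \sum_b lfn s b x *: frame b x.
Proof.
have [kx|nk] := pselect (kball i c (6 * rho) x).
  have tx := @kball_tdom 6 x isT kx; have [sx xr] := kx.
  apply: (triv_inj tx); rewrite trivZ// triv_sum//; apply/rowP => b; rewrite mxE summxE.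
  rewrite (bigD1 b)//= big1 ?addr0; last first.
    by move=> b' bb; rewrite trivZ// triv_frame// !mxE eqxx /= (eq_sym b) (negbTE bb) !mulr0.
  rewrite trivZ// triv_frame// !mxE !eqxx /= mulr1 lfnE// !mlift_src// (@plat_in 6)// mulr1.
  by [].
rewrite (mlift_out (cutin_plat 5) nk) scale0r big1// => b _.
have l0 q : mlift i (loc s q) x = 0.
  rewrite /mlift; case: asboolP => // sx; rewrite /loc (cutin_plat 5).2 ?mul0r//.
  by rewrite ltNge; apply/negP => xr; apply: nk.
by rewrite /lfn !l0 scale0r.
Qed.

Lemma vf_app_plat5 (X : rvf R n M) x : src (ch i) x -> `|to (ch i) x - c| < 5 * rho ->
  vf_app A (of_rvf X) (fun z => (mlift i (plat 5) z)%:C%C) x = 0.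
Proof.
move=> sx xr; have B6 := @ballin_plat 6 isT.
have s5 := csm_real openT (sm_mlift B6 (cutin_plat 5)).
have [e1 e2] := vf_app_chart (of_rvf X) openT (Logic.I : [set: M] x) s5 sx.
have y0 : to (ch i) x = to (ch i) x by [].
have p1 b : partial b (mlift i (plat 5) \o inv (ch i)) (to (ch i) x) = 0.
  rewrite (@partial_near R n _ (fun=> 1)) ?partial_cst//.
  have : nbhs (to (ch i) x) (ball c (5 * rho) `&` tgt (ch i)).
    apply: open_nbhs_nbhs; split; first by apply: openI; [exact: ball_open|exact: tgt_open].
    by split; [rewrite -ball_normE /= distrC|exact: to_tgt].
  apply: filterS => y [yr Ty] /=; rewrite mlift_inv// plat_in//.
  by move: yr; rewrite -ball_normE /= distrC => /ltW.
have p2 b : partial b ((fun x => complex.Im ((mlift i (plat 5) x)%:C%C)) \o inv (ch i)) (to (ch i) x) = 0.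
  exact: partial_cst.
by apply: complex_ext; rewrite ?e1 ?e2 big1// => b _; rewrite p1 p2 !mulr0 ?subr0 ?addr0.
Qed.

(** Locality of the connection is drawn from the Leibniz rule: s is replaced by its product with
    [plat 5], a combination of the frame, and the derivative of that plateau vanishes within 5
    rho. *)
Lemma nab_frame (X : rvf R n M) s x b : rvf_smooth A X -> ssmooth s ->
  src (ch i) x -> `|to (ch i) x - c| < 5 * rho ->
  triv t (nabla X s x) 0 b = vf_app A (of_rvf X) (lfn s b) x + \sum_b' lfn s b' x * triv t (nabla X (frame b') x) 0 b.
Proof.
move=> sX ss sx xr.
have tx : tdom t x by apply: (@kball_tdom 5 x isT); split => //; exact: ltW.
have B6 := @ballin_plat 6 isT.
have s5 := csm_real openT (sm_mlift B6 (cutin_plat 5)).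
have H := nab_leibniz nabla s5 sX ss x.
rewrite vf_app_plat5// scale0r add0r mlift_src// (plat_in (ltW xr)) scale1r in H.
rewrite -H (_ : (fun z => _) = fun z => \sum_b' lfn s b' z *: frame b' z); last first.
  by apply: section_ext => z; exact: decompose.
rewrite nab_sum//; last by move=> b'; apply: ssm_scale; [exact: lfn_smooth|exact: frame_smooth].
rewrite triv_sum// summxE.
have T b' : triv t (nabla X (fun z => lfn s b' z *: frame b' z) x) 0 b =
    vf_app A (of_rvf X) (lfn s b') x * (b == b')%:R + lfn s b' x * triv t (nabla X (frame b') x) 0 b.
  rewrite (nab_leibniz nabla (lfn_smooth b' ss) sX (frame_smooth b') x).
  rewrite trivD// [triv t (vf_app _ _ _ _ *: _)]trivZ// [triv t (lfn _ _ _ *: _)]trivZ// triv_frame// mlift_src//.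
  rewrite (@plat_in 6); last by apply: le_trans (ltW xr) _; exact: (@rho_le 5 6).
  by rewrite scale1r !mxE eqxx.
rewrite (eq_bigr _ (fun b' _ => T b')).
rewrite big_split /=; congr (_ + _).
rewrite (bigD1 b)//= eqxx mulr1 big1 ?addr0// => b' bb.
by rewrite eq_sym (negbTE bb) mulr0.
Qed.

Lemma vf_app_split (Z : cvf R n M) (f : M -> R[i]) x :
  vf_app A Z f x = vf_app A (of_rvf (re_vf Z)) f x + (0 +i* 1)%C * vf_app A (of_rvf (im_vf Z)) f x.
Proof.
rewrite /vf_app mulr_sumr -big_split; apply: eq_bigr => a _ /=.
rewrite mulrA -mulrDl; congr (_ * _); rewrite /of_rvf /re_vf /im_vf !mxE.
by apply: complex_ext; rewrite ?cReD ?cImD ?cReM ?cImM /=; ring.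
Qed.

(** Multiplication by X + i Y as a real matrix: X on the diagonal, -Y from imaginary to real part
    and Y back. *)
Definition acoef (Z : cvf R n M) (j q : bool * 'I_r) (b : 'I_n) : V -> R :=
  if j.2 == q.2 then
    if j.1 == q.1 then zcoef i c rho (re_vf Z) b
    else if j.1 then (fun y => - zcoef i c rho (im_vf Z) b y) else zcoef i c rho (im_vf Z) b
  else fun=> 0.

(** The connection matrix in the frame, in the same real form. *)
Definition bcoef (Z : cvf R n M) (j q : bool * 'I_r) : V -> R :=
  let G part := loc (cnab nabla Z (frame q.2)) (part, j.2) in
  if j.1 == q.1 then G true else if j.1 then (fun y => - G false y) else G false.

Lemma sum_bool_pair (F : bool * 'I_r -> R) : \sum_q F q = \sum_b F (true, b) + \sum_b F (false, b).
Proof. by rewrite big_pair big_bool. Qed.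

Lemma acoef_sum Z (v : bool * 'I_r -> V -> R) b y :
  let X := zcoef i c rho (re_vf Z) in let Y := zcoef i c rho (im_vf Z) in
  \sum_q \sum_a acoef Z (true, b) q a y * partial a (v q) y = dRe X Y (v (true, b)) (v (false, b)) y /\
  \sum_q \sum_a acoef Z (false, b) q a y * partial a (v q) y = dIm X Y (v (true, b)) (v (false, b)) y.
Proof.
move=> X Y.
have S (F : 'I_r -> R) : (forall b', b' != b -> F b' = 0) -> \sum_b' F b' = F b.
  by move=> F0; rewrite (bigD1 b)//= big1 ?addr0.
have Z0 p part b' : b' != b -> \sum_a acoef Z (p, b) (part, b') a y * partial a (v (part, b')) y = 0.
  by move=> bb; rewrite big1// => a _; rewrite /acoef /= eq_sym (negbTE bb) mul0r.
by split; rewrite sum_bool_pair !S//; try (by move=> b'; exact: Z0);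
  rewrite /dRe /dIm -big_split /=; apply: eq_bigr => a _; rewrite /acoef /= eqxx /X /Y; ring.
Qed.

Lemma local_form (Z : cvf R n M) s j y : cvf_smooth A Z -> ssmooth s -> `|y - c| < 5 * rho ->
  loc (cnab nabla Z s) j y = \sum_q \sum_a acoef Z j q a y * partial a (loc s q) y + \sum_q bcoef Z j q y * loc s q y.
Proof.
move=> [sre sim] ss yr; set x := inv (ch i) y.
have B6 := @ballin_plat 6 isT.
have y5 : `|y - c| <= 5 * rho by exact: ltW.
have Ty : tgt (ch i) y by apply: (@ballin_plat 5 isT).
have sx : src (ch i) x by exact: Defs.inv_src.
have yx : to (ch i) x = y by rewrite /x Defs.invK.
have tx : tdom t x by apply: (@kball_tdom 5 x isT); split => //; rewrite yx.
have xr : `|to (ch i) x - c| < 5 * rho by rewrite yx.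
have L b part : rcoord (cnab nabla Z s) (part, b) x = loc (cnab nabla Z s) (part, b) y.
  by rewrite /loc plat_in// mul1r.
have E1 b : triv t (cnab nabla Z s x) 0 b = vf_app A Z (lfn s b) x +
    \sum_b' lfn s b' x * triv t (cnab nabla Z (frame b') x) 0 b.
  rewrite /cnab trivD// trivZ// mxE [X in _ + X]mxE !nab_frame// (vf_app_split Z) mulrDr addrACA; congr (_ + _).
  rewrite mulr_sumr -big_split; apply: eq_bigr => b' _ /=.
  by rewrite trivD// trivZ// mxE [X in _ * (_ + X)]mxE mulrDr mulrCA.
have e b := vf_app_chart Z openT (Logic.I : [set: M] x) (lfn_smooth b ss) sx.
have pE part b a : partial a (mlift i (loc s (part, b)) \o inv (ch i)) (to (ch i) x) = partial a (loc s (part, b)) y.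
  rewrite yx; apply: partial_near.
  have : nbhs y (tgt (ch i)) by apply: open_nbhs_nbhs; split => //; exact: tgt_open.
  by apply: filterS => z Tz /=; rewrite mlift_inv.
have zE F a : vcomp i F a x = zcoef i c rho F a y.
  by rewrite /zcoef -[plateau _ _ _ y]/(plat 5 y) plat_in// mul1r.
have lE b : lfn s b x = (loc s (true, b) y +i* loc s (false, b) y)%C by rewrite /lfn !mlift_src// yx.
have G b' b part : rcoord (cnab nabla Z (frame b')) (part, b) x = loc (cnab nabla Z (frame b')) (part, b) y.
  by rewrite /loc plat_in// mul1r.
case: j => part b; rewrite -L /rcoord /= E1; case: part.
  rewrite (acoef_sum Z (loc s) b y).1 cReD (e b).1 cRe_sum; congr (_ + _).
    by apply: eq_bigr => a _; rewrite !zE -(pE true) -(pE false).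
  rewrite sum_bool_pair -big_split /=; apply: eq_bigr => b' _.
  by rewrite cReM lE /= /bcoef /= -!G /rcoord /=; ring.
rewrite (acoef_sum Z (loc s) b y).2 cImD (e b).2 cIm_sum; congr (_ + _).
  by apply: eq_bigr => a _; rewrite !zE -(pE true) -(pE false).
rewrite sum_bool_pair -big_split /=; apply: eq_bigr => b' _.
by rewrite cImM lE /= /bcoef /= -!G /rcoord /=; ring.
Qed.

End Frame.

(** * Fibre norms and coordinates *)

Section Comparability.
Variables (R : realType) (n : nat) (M : topologicalType) (A : manifold R n M).
Variables (r : nat) (E : vbundle A r) (h : hermitian_metric E).
Local Notation V := 'rV[R]_n.

Definition hsq x (v : E x) : R := complex.Re (h x v v).

Definition hre x (u v : E x) : R := complex.Re (h x u v).

Lemma hre_linear x (d : R) (u v w : E x) : hre (d%:C%C *: u + v) w = d * hre u w + hre v w.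
Proof. by rewrite /hre hform_linear cReD cReM /= mul0r subr0. Qed.

Lemma hreC x (u v : E x) : hre u v = hre v u.
Proof. by rewrite /hre hform_conj; case: (h x v u). Qed.

Lemma hre0 x (w : E x) : hre 0 w = 0.
Proof.
have := hre_linear (-1) 0 0 w; rewrite scaler0 addr0 mulN1r addNr.
by [].
Qed.

Lemma hre_sum x (T : Type) (s : seq T) (d : T -> R) (u : T -> E x) w :
  hre (\sum_(k <- s) (d k)%:C%C *: u k) w = \sum_(k <- s) d k * hre (u k) w.
Proof.
by elim: s => [|k s IH]; rewrite ?big_nil ?hre0// !big_cons hre_linear IH.
Qed.

Lemma hsq_gt0 x (v : E x) : v != 0 -> 0 < hsq v.
Proof. by move=> /(hform_pos h); rewrite ltcE /= => /andP[]. Qed.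

Lemma hsq_ge0 x (v : E x) : 0 <= hsq v.
Proof.
have [->|/hsq_gt0/ltW//] := eqVneq v 0.
by rewrite /hsq -/(hre 0 0) hre0.
Qed.

Lemma hsqZ x (d : R) (v : E x) : hsq (d%:C%C *: v) = d ^+ 2 * hsq v.
Proof.
have Z u w : hre (d%:C%C *: u) w = d * hre u w by have := hre_linear d u 0 w; rewrite hre0 !addr0.
by rewrite /hsq -!/(hre _ _) Z hreC Z mulrA expr2.
Qed.

Variables (i : idx A) (t : tidx E) (c : V) (rho : R).
Hypothesis rho0 : 0 < rho.
Hypothesis ball7 : forall y, `|y - c| <= 7 * rho -> tgt (ch i) y /\ tdom t (inv (ch i) y).
Local Notation Iu := (bool * 'I_r)%type.
Local Notation frame := (frame i t c rho).
Local Notation plat := (plat c rho).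

Definition rframe (q : Iu) : section E := fun x => (if q.1 then 1%C else (0 +i* 1)%C) *: frame q.2 x.

Lemma rframe_smooth q : ssmooth (rframe q).
Proof. by apply: ssm_cst_scale; exact: frame_smooth rho0 ball7 _. Qed.

Lemma triv_rframe q x : kball i c (6 * rho) x -> triv t (rframe q x) = (if q.1 then 1%C else (0 +i* 1)%C) *: delta_mx 0 q.2.
Proof.
move=> kx; have tx := kball_tdom rho0 ball7 (isT : (6 <= 7)%N) kx; have [sx xr] := kx.
by rewrite trivZ// triv_frame// mlift_src// (plat_in rho0 xr) scale1r.
Qed.

Lemma real_combination (d : Iu -> R) (s : section E) x : kball i c (6 * rho) x ->
  s x = \sum_q (d q)%:C%C *: rframe q x <-> forall q, rcoord t s q x = d q.
Proof.
move=> kx; have tx := kball_tdom rho0 ball7 (isT : (6 <= 7)%N) kx.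
have E1 : triv t (\sum_q (d q)%:C%C *: rframe q x) = \row_b (d (true, b) +i* d (false, b))%C.
  rewrite triv_sum//; apply/rowP => b; rewrite summxE mxE.
  under eq_bigr do rewrite trivZ// triv_rframe// !mxE eqxx /=.
  rewrite big_pair exchange_big /= (bigD1 b)//= [X in _ + X]big1 ?addr0; last first.
    by move=> b' bb; rewrite big_bool /= eq_sym (negbTE bb) !mulr0 addr0.
  rewrite big_bool /= eqxx !mulr1.
  by apply: complex_ext; rewrite ?cReD ?cImD ?cReM ?cImM /=; ring.
split=> [sE q|H].
  by rewrite /rcoord sE E1 mxE; case: q => -[].
apply: (triv_inj tx); rewrite E1; apply/rowP => b; rewrite mxE -!H /rcoord /=.
by case: (triv t (s x) 0 b).
Qed.

Definition gram (q q' : Iu) (x : M) : R := hre (rframe q x) (rframe q' x).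

Lemma sm_gram q q' : rsmooth_on A setT (gram q q').
Proof. by have [] := hform_smooth h (rframe_smooth q) (rframe_smooth q'). Qed.

Lemma hsq_gram (d : Iu -> R) x : hsq (\sum_q (d q)%:C%C *: rframe q x) = \sum_q \sum_q' d q * d q' * gram q q' x.
Proof.
rewrite /hsq -/(hre _ _) hre_sum; apply: eq_bigr => q _.
rewrite hreC hre_sum mulr_sumr; apply: eq_bigr => q' _.
by rewrite hreC mulrA.
Qed.

(** The Gram form of the real frame is continuous and positive on the compact product of a closed
    ball with the unit sphere, hence bounded below there by some m > 0; homogeneity does the
    rest. *)
Lemma hsq_lower : exists2 C : R, 0 <= C & forall (s : section E) x, kball i c (6 * rho) x ->
  \sum_q (rcoord t s q x) ^+ 2 <= C * hsq (s x).
Proof.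
have B6 := ballin_plat rho0 ball7 (isT : (6 <= 7)%N); have B7 := ballin_plat rho0 ball7 (isT : (7 <= 7)%N).
pose N := #|{: Iu}|; pose W := 'rV[R]_N; pose z0 (z : W) (q : Iu) : R := z 0 (enum_rank q).
pose G q q' y := plat 6 y * gram q q' (inv (ch i) y).
have c6 := cutin_plat c rho0 6.
have sG q q' : smooth (G q q') by apply: (sm_pull openT _ c6 (sm_gram q q')) => y /B7.
pose F (p : V * W) : R := \sum_q \sum_q' z0 p.2 q * z0 p.2 q' * G q q' p.1.
have cF : continuous F.
  have cz q : continuous (fun p : V * W => z0 p.2 q).
    apply: (@cont_comp R W (V * W)%type (@snd V W) (fun z : W => z0 z q)); first exact: cont_snd.
    exact: (sm_cont (@sm_coord R N (enum_rank q))).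
  apply: cont_sum => q; apply: cont_sum => q'; apply: contM; first exact: contM.
  by apply: (@cont_comp R V (V * W)%type (@fst V W) (G q q')); [exact: cont_fst|exact: sm_cont].
pose K := [set y : V | `|y - c| <= 6 * rho] `*` ([set z : W | `|z| <= 1] `&` [set z : W | 1 <= `|z|]).
have cK : compact K.
  apply: compact_setX; first exact: compact_cball.
  apply: compact_closedI; first exact: (@compact_box R N 1).
  rewrite (_ : [set z : W | 1 <= `|z|] = (fun z : W => `|z|) @^-1` [set x | 1 <= x]); last by [].
  by apply: closed_comp => [z _|]; [exact: norm_continuous|exact: closed_ge].
have FE y z (x := inv (ch i) y) : `|y - c| <= 6 * rho ->
    F (y, z) = hsq (\sum_q (z0 z q)%:C%C *: rframe q x).
  move=> yr; rewrite hsq_gram; apply: eq_bigr => q _; apply: eq_bigr => q' _ /=.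
  by rewrite /G (plat_in rho0 yr) mul1r.
have kx y : `|y - c| <= 6 * rho -> kball i c (6 * rho) (inv (ch i) y).
  by move=> yr; split; [exact: Defs.inv_src (B6 _ yr)|rewrite Defs.invK//; exact: B6].
have Fpos p : K p -> 0 < F p.
  case: p => y z [/= yr [_ z1]]; rewrite FE//; apply: hsq_gt0; apply: contraTneq z1 => e.
  pose s : section E := fun x => \sum_q (z0 z q)%:C%C *: rframe q x.
  have /real_combination H : s (inv (ch i) y) = \sum_q (z0 z q)%:C%C *: rframe q (inv (ch i) y) by [].
  have z00 : z = 0.
    apply/rowP => k; rewrite mxE -(enum_valK k) -[LHS]/(z0 z (enum_val k)) -(H (kx _ yr)) /rcoord.
    have tx := kball_tdom rho0 ball7 (isT : (6 <= 7)%N) (kx _ yr).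
    by rewrite [s _]e (triv0 tx) mxE; case: ifP.
  by rewrite z00 normr0 ler10.
have [m m0 Hm] : exists2 m : R, 0 < m & forall p, K p -> m <= F p.
  have [[p0 Kp0]|nK] := pselect (exists p, K p); last by exists 1 => // p Kp; case: nK; exists p.
  have [p1 Kp1 H] := @compact_EVT_min _ _ F K (ex_intro _ _ Kp0) cK (continuous_subspaceT cF).
  by exists (F p1) => [|p Kp]; [exact: Fpos (set_mem Kp1)|exact: H (mem_set Kp)].
have N0 : 0 <= N%:R / m by rewrite divr_ge0 ?ler0n ?ltW.
exists (N%:R / m) => // s x kx1; have [sx xr] := kx1.
pose z : W := \row_k rcoord t s (enum_val k) x.
have zE q : z0 z q = rcoord t s q x by rewrite /z0 mxE enum_rankK.
have sE : s x = \sum_q (z0 z q)%:C%C *: rframe q x by apply/real_combination.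
have S : \sum_q rcoord t s q x ^+ 2 <= N%:R * `|z| ^+ 2.
  have -> : N%:R * `|z| ^+ 2 = \sum_(q : Iu) `|z| ^+ 2 by rewrite sumr_const mulr_natl.
  apply: ler_sum => q _; rewrite -zE -[z0 z q ^+ 2]real_normK ?num_real// lerXn2r ?nnegrE//.
  exact: (@norm_coord R N).
apply: le_trans S _; rewrite -mulrA; apply: ler_wpM2l; first exact: ler0n.
have [->|nz] := eqVneq z 0.
  by rewrite normr0 expr0n; apply: mulr_ge0; [rewrite invr_ge0 ltW|exact: hsq_ge0].
have zn : 0 < `|z| by rewrite normr_gt0.
have Kz : K (to (ch i) x, `|z|^-1 *: z).
  by split => //=; rewrite normrZ normfV normr_id mulVf ?gt_eqF// lexx.
have := Hm _ Kz; rewrite FE// toK//.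
have -> : \sum_q (z0 (`|z|^-1 *: z) q)%:C%C *: rframe q x = (`|z|^-1)%:C%C *: s x.
  rewrite sE scaler_sumr; apply: eq_bigr => q _; rewrite scalerA; congr (_ *: _).
  by rewrite /z0 mxE; apply: complex_ext; rewrite ?cReM ?cImM /= ?mul0r ?mulr0 ?subr0 ?addr0.
rewrite hsqZ exprVn => H; rewrite mulrC ler_pdivlMr// mulrC.
by rewrite -ler_pdivlMr ?exprn_gt0// mulrC.
Qed.

End Comparability.

(** * Compactness and weak limits in a ball *)

Section LocalCompactness.
Variables (R : realType) (n : nat).
Local Notation V := 'rV[R]_n.
Variables (c : V) (rho lam : R) (Iu Je : finType).
Variables (a : Je -> Iu -> 'I_n -> V -> R) (B : Je -> Iu -> V -> R).
Hypotheses (rho0 : 0 < rho) (lam01 : 0 < lam < 1) (HE : apriori c rho a lam).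
Hypotheses (sa : forall j i b, smooth (a j i b) /\ Cc (a j i b)) (sB : forall j i, smooth (B j i)).
Variable eta : V -> R.
Hypotheses (teta : tin c rho eta) (eta01 : forall y, 0 <= eta y <= 1).
Implicit Types v : Iu -> V -> R.

Definition full v j (y : V) : R := \sum_i \sum_b a j i b y * partial b (v i) y + \sum_i B j i y * v i y.

Lemma sm_full v j : (forall i, smooth (v i)) -> smooth (full v j).
Proof.
move=> sv; apply: sm_add; apply: sm_sum => i; last by move=> _; exact: sm_mul.
by move=> _; apply: sm_sum => b _; apply: sm_mul; [case: (sa j i b)|exact: sm_partial].
Qed.

Lemma nrm_mul_le (k : V -> R) : Cc k -> exists2 C : R, 0 <= C & forall f,
  Cc f -> nrm (fun y => k y * f y) <= C * nrm f.
Proof.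
move=> Ck; have [C C0 HC] := Cc_bounded Ck; exists C => // f Cf.
rewrite -[C in leRHS]ger0_norm// -nrmZ//; apply: nrm_le; [exact: CcMl (Cc_cont Ck) Cf|exact: CcZ|move=> y].
by rewrite !normrM ler_wpM2r// (ger0_norm C0).
Qed.

Let K j i (y : V) : R := \sum_b a j i b y * partial b eta y - eta y * B j i y.

Let CK j i : Cc (K j i).
Proof.
have Ce := tin_Cc teta; apply: CcB; last by apply: CcMr => //; exact: sm_cont.
by apply: Cc_sum => b; apply: CcMr; [case: (sa j i b)|exact/sm_cont/sm_partial/tin_smooth/teta].
Qed.

Lemma principal_cut v j : (forall i, smooth (v i)) ->
  principal a (fun i y => eta y * v i y) j = fun y => eta y * full v j y + \sum_i K j i y * v i y.
Proof.
move=> sv; apply/funext => y; rewrite /principal /full mulrDr -addrA !mulr_sumr -!big_split /=.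
apply: eq_bigr => i _; rewrite /K mulrBl mulr_suml.
have -> : eta y * (\sum_b a j i b y * partial b (v i) y) + (eta y * (B j i y * v i y) +
   (\sum_b a j i b y * partial b eta y * v i y - eta y * B j i y * v i y)) =
   eta y * (\sum_b a j i b y * partial b (v i) y) + \sum_b a j i b y * partial b eta y * v i y by ring.
rewrite mulr_sumr -big_split /=; apply: eq_bigr => b _.
rewrite (partialM b y (tin_smooth teta) (sv i)).
by move: (partial b eta y) (partial b (v i) y) => p q; ring.
Qed.

(** The cut-off vector is split into its mollification error, small by the a priori estimate at a
    fine scale, and its mollification at that scale, controlled by finitely many values through
    [conv_net]. *)
Lemma local_compactness (e : R) : 0 < e -> exists2 t : R, 0 < t &
  exists (s : seq V), exists2 C : R, 0 <= C & forall v, (forall i, smooth (v i)) -> (forall i, Cc (v i)) ->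
  \sum_i nrm (fun y => eta y * v i y) <=
    e * (\sum_i nrm (v i) + \sum_j nrm (fun y => eta y * full v j y)) +
    C * \sum_(x <- s) \sum_i `|I (fun y => mk t (x - y) * eta y * v i y)|.
Proof.
move=> e0; have [C0 C00 HC0] := HE; have Ce := tin_Cc teta.
have /choice[M0 HM0] (p : Je * Iu) : exists C : R, 0 <= C /\ forall f,
    Cc f -> nrm (fun y => K p.1 p.2 y * f y) <= C * nrm f.
  by have [C ? HC] := nrm_mul_le (CK p.1 p.2); exists C.
pose M1 := 1 + \sum_p M0 p.
have M10 : 0 <= M1 by rewrite addr_ge0//; apply: sumr_ge0 => p _; case: (HM0 p).
pose N : R := #|Iu|%:R; have N0 : 0 <= N by rewrite ler0n.
have D0 : 0 < 2 * (N * (C0 * M1) + 1) by rewrite mulr_gt0// ltr_wpDl// !mulr_ge0.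
(* M1 accounts for the commutator with eta and the terms of order zero; k is taken so large that
   lam^k outweighs N C0 M1. *)
have [k Hk] : exists k, lam ^+ k <= e / (2 * (N * (C0 * M1) + 1)).
  have l1 : `|lam| < 1 by case/andP: lam01 => l0 l1; rewrite gtr0_norm.
  have /cvgrPdist_le/(_ _ (divr_gt0 e0 D0))[k _ /(_ k (leqnn k))] := cvg_expr l1.
  have lk : 0 <= lam ^+ k by rewrite exprn_ge0// ltW//; case/andP: lam01.
  by rewrite /= sub0r normrN ger0_norm// => h; exists k.
have [A A0 sA] := Cc_supp Ce; have t0 := tk_gt0 R k.
have [s [C CC0 HC]] := @conv_net R n A (tk R k) (e / 2) t0 A0 (divr_gt0 e0 (ltr0n _ 2)).
exists (tk R k) => //; exists s, C => // v sv Cv.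
pose u i y := eta y * v i y.
have tu i : tin c rho (u i) by exact: tinMr.
have Cu i : Cc (u i) by exact: tin_Cc (tu i).
have su i : smooth (u i) by exact: tin_smooth (tu i).
pose N1 := \sum_i nrm (v i); pose N2 := \sum_j nrm (fun y => eta y * full v j y).
have N10 : 0 <= N1 by apply: sumr_ge0 => i _; exact: nrm_ge0.
have N20 : 0 <= N2 by apply: sumr_ge0 => j _; exact: nrm_ge0.
have uv i : nrm (u i) <= nrm (v i).
  apply: nrm_le => // y; rewrite normrM ler_piMl//.
  by case/andP: (eta01 y) => h1 h2; rewrite ger0_norm.
have PN : \sum_i nrm (u i) + \sum_j nrm (principal a u j) <= M1 * (N1 + N2).
  have : \sum_j nrm (principal a u j) <= N2 + (\sum_p M0 p) * N1.
    rewrite (big_pair M0) mulr_suml -big_split; apply: ler_sum => j _.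
    rewrite principal_cut//.
    have CF : Cc (fun y => eta y * full v j y) by apply: CcMr => //; apply: sm_cont; exact: sm_full.
    have CKv i : Cc (fun y => K j i y * v i y) by apply: CcMl => //; exact: Cc_cont.
    apply: le_trans (nrmD CF (Cc_sum _ CKv)) _; apply: lerD => //.
    apply: le_trans (nrm_sum _ CKv) _; rewrite mulr_suml; apply: ler_sum => i _.
    apply: le_trans ((HM0 (j, i)).2 _ (Cv i)) _.
    apply: ler_wpM2l; first by case: (HM0 (j, i)).
    by rewrite /N1 (bigD1 i)//= lerDl; apply: sumr_ge0 => i' _; exact: nrm_ge0.
  have : \sum_i nrm (u i) <= N1 by apply: ler_sum.
  have : 0 <= \sum_p M0 p by apply: sumr_ge0 => p _; case: (HM0 p).
  rewrite /M1; move: (\sum_p M0 p) (\sum_i nrm (u i)) (\sum_j _) => x1 x2 x3; nra.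
have b1 i : nrm (fun x => u i x - cnv (mk (tk R k)) (u i) x) <= C0 * lam ^+ k * (M1 * (N1 + N2)).
  apply: le_trans (HC0 u tu k i) _; apply: ler_wpM2l => //.
  by rewrite mulr_ge0// exprn_ge0// ltW//; case/andP: lam01.
have b2 i : nrm (u i) <= C0 * lam ^+ k * (M1 * (N1 + N2)) +
    (e / 2 * nrm (v i) + C * \sum_(x <- s) `|I (fun y => mk (tk R k) (x - y) * eta y * v i y)|).
  have Cm := @Cc_mk R n _ t0; have Cc1 := Cc_conv Cm (Cu i).
  rewrite (_ : u i = fun y => (u i y - cnv (mk (tk R k)) (u i) y) + cnv (mk (tk R k)) (u i) y); last first.
    by apply/funext => y; rewrite subrK.
  apply: le_trans (nrmD (CcB (Cu i) Cc1) Cc1) _; apply: lerD; first exact: b1.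
  have sAu : supp A (u i) by move=> y /sA h; rewrite /u h mul0r.
  apply: le_trans (HC (u i) (Cu i) sAu) _; apply: lerD; first by rewrite ler_wpM2l// divr_ge0// ltW.
  rewrite ler_wpM2l//; apply: ler_sum => x _; rewrite cnvE /u.
  by under eq_fun do rewrite mulrA.
apply: le_trans (ler_sum _ (fun i _ => b2 i)) _.
rewrite big_split /= big_split /= -!mulr_sumr [X in _ + (_ + X)](_ : _ = C * \sum_(x <- s) \sum_i `|I (fun y => mk (tk R k) (x - y) * eta y * v i y)|); last first.
  by rewrite exchange_big.
rewrite addrA; apply: lerD => //.
have SC (x : R) : \sum_(i : Iu) x = N * x by rewrite /N sumr_const [RHS]mulr_natl.
rewrite SC -/N1 -/N2.
have -> : C0 * lam ^+ k * (M1 * (N * (N1 + N2))) = N * (C0 * lam ^+ k * (M1 * (N1 + N2))) by ring.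
have : N * (C0 * lam ^+ k * (M1 * (N1 + N2))) <= e / 2 * (N1 + N2).
  have -> : N * (C0 * lam ^+ k * (M1 * (N1 + N2))) = N * (C0 * M1) * lam ^+ k * (N1 + N2) by ring.
  apply: ler_wpM2r; first exact: addr_ge0.
  have P0 : 0 <= N * (C0 * M1) by rewrite !mulr_ge0.
  apply: le_trans (ler_wpM2l P0 Hk) _.
  move: (N * (C0 * M1)) P0 => x x0.
  by rewrite mulrA ler_pdivrMr ?mulr_gt0 ?ltr_wpDl//; nra.
by move: (N * _) (e0) N10 N20 => x; nra.
Qed.

Lemma full_weak v j psi : (forall i, smooth (v i)) -> (forall i, Cc (v i)) -> tin c rho psi ->
  \sum_i I (fun y => v i y * (B j i y * psi y - \sum_b partial b (fun z => a j i b z * psi z) y)) =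
  I (fun y => full v j y * psi y).
Proof.
move=> sv Cv tp; have sp := tin_smooth tp; have Cp := tin_Cc tp.
have sap i b : smooth (fun z => a j i b z * psi z) by apply: sm_mul => //; case: (sa j i b).
have Cap i b : Cc (fun z => a j i b z * psi z) by apply: CcMl => //; apply: sm_cont; case: (sa j i b).
have C1 i : Cc (fun y => v i y * (B j i y * psi y)).
  by apply: CcMr => //; apply: contM; exact: sm_cont.
have C2 i b : Cc (fun y => v i y * partial b (fun z => a j i b z * psi z) y).
  by apply: CcMr => //; apply: sm_cont; exact: sm_partial.
have C3 i b : Cc (fun y => partial b (v i) y * (a j i b y * psi y)).
  by apply: CcMl => //; apply: sm_cont; exact: sm_partial.
have C4 i : Cc (fun y => \sum_b partial b (v i) y * (a j i b y * psi y)) by apply: Cc_sum.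
transitivity (\sum_i I (fun y => v i y * (B j i y * psi y) + \sum_b partial b (v i) y * (a j i b y * psi y))).
  apply: eq_bigr => i _; rewrite I_add// (I_sum _ (C3 i)).
  rewrite (_ : (fun y => _) = fun y => v i y * (B j i y * psi y) - \sum_b v i y * partial b (fun z => a j i b z * psi z) y); last first.
    by apply/funext => y; rewrite mulrBr mulr_sumr.
  rewrite I_sub//; last exact: Cc_sum.
  congr (_ + _); rewrite (I_sum _ (C2 i)) -sumrN; apply: eq_bigr => b _.
  by rewrite (I_parts b (sv i) (sap i b) (Cap i b)) opprK.
rewrite -I_sum; last by move=> i; exact: CcD.
congr I; apply/funext => y; rewrite /full mulrDl !mulr_suml -big_split /=; apply: eq_bigr => i _.
rewrite [RHS]addrC mulr_suml; congr (_ + _); first by rewrite mulrCA mulrA.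
by apply: eq_bigr => b _; rewrite mulrCA mulrA.
Qed.

End LocalCompactness.

Section UltraLimit.
Variables (R : realType) (U : set_system nat) (UU : UltraFilter U).
Implicit Types u v : nat -> R.

(** A single ultrafilter gives limits for all test functions at once, in place of diagonal
    extractions. *)
Lemma ultra_cvg u (K : R) : (\forall k \near U, `|u k| <= K) -> exists L : R, u @ U --> L.
Proof.
move=> uK; have FU : ProperFilter (u @ U) by exact: fmap_proper_filter.
have cK : compact `[- K, K]%classic by exact: segment_compact.
have [|L [_ cl]] := cK (u @ U) FU.
  by apply: filterS uK => k; rewrite /= in_itv /= ler_norml.
exists L => W WL.
have [//|nW] := in_ultra_setVsetC (u @^-1` W) UU.
have [x [nx Wx]] : (~` W) `&` W !=set0 by apply: cl WL.
by [].
Qed.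

Lemma ultra_sum (T : Type) (s : seq T) (F : T -> nat -> R) (L : T -> R) : (forall x, F x @ U --> L x) ->
  (fun k => \sum_(x <- s) F x k) @ U --> \sum_(x <- s) L x.
Proof.
move=> H; elim: s => [|x s IH].
  by under eq_fun do rewrite big_nil; rewrite big_nil; exact: cvg_cst.
by under eq_fun do rewrite big_cons; rewrite big_cons; exact: cvgD.
Qed.

End UltraLimit.

Section LocalLimit.
Variables (R : realType) (n : nat).
Local Notation V := 'rV[R]_n.
Variables (c : V) (rho lam : R) (Iu Je : finType).
Variables (a : Je -> Iu -> 'I_n -> V -> R) (B : Je -> Iu -> V -> R).
Hypotheses (rho0 : 0 < rho) (lam01 : 0 < lam < 1) (HE : apriori c rho a lam).
Hypotheses (sa : forall j i b, smooth (a j i b) /\ Cc (a j i b)) (sB : forall j i, smooth (B j i)).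
Variables (eta chi : V -> R) (r1 r2 : R).
Hypotheses (teta : tin c rho eta) (eta01 : forall y, 0 <= eta y <= 1) (tchi : tin c rho chi) (r12 : r1 < r2).
Hypotheses (etar1 : forall y, r1 < `|y - c| -> eta y = 0) (chir2 : forall y, `|y - c| <= r2 -> chi y = 1).

(** On the support of eta, chi is 1 in a neighbourhood because r1 < r2, so its derivatives do not
    appear. *)
Lemma full_cut (v w : Iu -> V -> R) j y : (forall i, smooth (v i)) -> (forall i, smooth (w i)) ->
  eta y * full a B (fun i z => chi z * v i z - w i z) j y = eta y * full a B v j y - eta y * full a B w j y.
Proof.
move=> sv sw; have [yr|/etar1 ->] := leP `|y - c| r1; last by rewrite !mul0r subr0.
have c1 : chi y = 1 by apply: chir2; exact: le_trans (ltW r12).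
have near1 : \forall z \near y, chi z = 1.
  have : nbhs y (ball c r2).
    apply: open_nbhs_nbhs; split; first exact: ball_open.
    by rewrite -ball_normE /= distrC; exact: le_lt_trans r12.
  by apply: filterS => z; rewrite -ball_normE /= distrC => /ltW/chir2.
have p i b : partial b (fun z => chi z * v i z - w i z) y = partial b (v i) y - partial b (w i) y.
  rewrite -partialB//; apply: partial_near.
  by apply: filterS near1 => z ->; rewrite mul1r.
rewrite -mulrBr; congr (_ * _); rewrite /full opprD addrACA -!sumrB; congr (_ + _); apply: eq_bigr => i _.
  by rewrite -sumrB; apply: eq_bigr => b _; rewrite p mulrBr.
by rewrite c1 mul1r mulrBr.
Qed.

Variables (U : set_system nat) (UU : UltraFilter U).

Lemma ultra_near (u : nat -> R) (L e : R) : u @ U --> L -> 0 < e -> \forall k \near U, `|u k - L| <= e.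
Proof. by move=> /cvgrPdist_le h /h; apply: filterS => k; rewrite distrC. Qed.

(** The limits of the pairings form a weak solution, smooth by [local_regularity]. Strong
    convergence then comes from [local_compactness] applied to the difference with the limit: its
    finitely many functionals tend to 0, and its norms stay bounded. *)
Theorem local_limit (v : nat -> Iu -> V -> R) (f : Je -> V -> R) (K : R) :
  (forall k i, smooth (v k i)) -> (forall k i, Cc (v k i)) ->
  (\forall k \near U, forall i, nrm (v k i) <= K) -> (forall j, smooth (f j)) ->
  (forall j psi, tin c rho psi -> (fun k => I (fun y => full a B (v k) j y * psi y)) @ U --> I (fun y => f j y * psi y)) ->
  (forall j e, 0 < e -> \forall k \near U, nrm (fun y => eta y * full a B (v k) j y - eta y * f j y) <= e) ->
  exists w : Iu -> V -> R, [/\ forall i, smooth (w i), forall i, Cc (w i) &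
    forall e, 0 < e -> \forall k \near U, \sum_i nrm (fun y => eta y * v k i y - eta y * w i y) <= e].
Proof.
move=> sv Cv vK sf weak strong.
have bnd i g : Cc g -> \forall k \near U, `|I (fun y => v k i y * g y)| <= K * nrm g.
  move=> Cg; apply: filterS vK => k /(_ i) h.
  by apply: le_trans (cauchy_schwarz_I (Cv k i) Cg) _; rewrite ler_wpM2r ?nrm_ge0.
have /choice[T0 HT0] (p : Iu * (V -> R)) : exists L : R, Cc p.2 -> (fun k => I (fun y => v k p.1 y * p.2 y)) @ U --> L.
  have [Cg|nC] := pselect (Cc p.2); last by exists 0.
  by have [L HL] := ultra_cvg UU (bnd p.1 p.2 Cg); exists L.
pose T i g := T0 (i, g).
have HT i g : Cc g -> (fun k => I (fun y => v k i y * g y)) @ U --> T i g by exact: (HT0 (i, g)).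
have lfT i : local_functional c rho (T i).
  split.
    move=> d g h cg ch'; have [Cg Ch] := (cin_Cc cg, cin_Cc ch').
    apply: (filter_cvg_unique _ (HT i _ (CcD (CcZ d Cg) Ch))).
    rewrite (_ : (fun k => _) = fun k => d * I (fun y => v k i y * g y) + I (fun y => v k i y * h y)); last first.
      apply/funext => k; rewrite -I_lin; [|exact: CcMr (Cc_cont Cg)|exact: CcMr (Cc_cont Ch)].
      by congr I; apply/funext => y; ring.
    by apply: cvgD; [apply: cvgMl_tmp|]; exact: HT.
  move=> ph tp; have [C C0 HC] := nrm_mul_le (tin_Cc tp).
  have [k0 Kk0] := filter_ex vK.
  have K0 : 0 <= K by apply: le_trans (nrm_ge0 _) (Kk0 i).
  exists (K * C); first exact: mulr_ge0.
  move=> g Cg; have Cp : Cc (fun y => ph y * g y) by apply: CcMl => //; exact: Cc_cont (tin_Cc tp).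
  rewrite -mulrA; apply: le_trans (_ : K * nrm (fun y => ph y * g y) <= _); last by rewrite ler_wpM2l// HC.
  by apply: (filter_cvg_le _ (HT i _ Cp)); exact: bnd.
have HS : solution c rho a B f T.
  split => // j psi tp; have sp := tin_smooth tp; have Cp := tin_Cc tp.
  have Cg i : Cc (fun y => B j i y * psi y - \sum_b partial b (fun z => a j i b z * psi z) y).
    apply: CcB; first by apply: CcMl => //; exact: sm_cont.
    apply: Cc_sum => b; have [sab Cab] := sa j i b; apply: Cc_partial; first exact: sm_mul.
    by apply: CcMl => //; exact: sm_cont.
  apply: (filter_cvg_unique _ _ (weak j psi tp)).
  rewrite (_ : (fun k => _) = fun k => \sum_i I (fun y => v k i y *
    (B j i y * psi y - \sum_b partial b (fun z => a j i b z * psi z) y))).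
    by apply: ultra_sum => i; exact: HT.
  by apply/funext => k; rewrite (full_weak sa sB j (sv k) (Cv k) tp).
have /choice[w Hw] i := local_regularity rho0 lam01 HS HE i tchi.
have sw i : smooth (w i) by case: (Hw i).
have Cw i : Cc (w i) by case: (Hw i).
exists w; split => // e e0.
(* w represents the limit only behind chi, so [v k] is cut off as well; eta does not see the
   difference. *)
pose x k i y := chi y * v k i y - w i y.
have sx k i : smooth (x k i) by apply: sm_sub => //; apply: sm_mul => //; exact: tin_smooth tchi.
have Cx k i : Cc (x k i) by apply: CcB => //; apply: CcMl => //; exact: Cc_cont (tin_Cc tchi).
have eE y : eta y * chi y = eta y.
  have [yr|/etar1 ->] := leP `|y - c| r1; last by rewrite mul0r.
  by rewrite chir2 ?mulr1//; exact: le_trans (ltW r12).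
have ex k i : (fun y => eta y * x k i y) = fun y => eta y * v k i y - eta y * w i y.
  by apply/funext => y; rewrite /x mulrBr mulrA eE.
have [C1 C10 HC1] := nrm_mul_le (tin_Cc tchi).
have Ce := tin_Cc teta.
have Cfull u j : (forall i, smooth (u i)) -> Cc (fun y => eta y * full a B u j y).
  by move=> su; apply: CcMr => //; apply: sm_cont; exact: (sm_full sa sB).
have Cf j : Cc (fun y => eta y * f j y) by apply: CcMr => //; exact: sm_cont.
pose K1 := \sum_i (C1 * K + nrm (w i)).
pose K2 := \sum_j (1 + nrm (fun y => eta y * f j y) + nrm (fun y => eta y * full a B w j y)).
have near1 : \forall k \near U, \sum_i nrm (x k i) <= K1.
  apply: filterS vK => k kK; apply: ler_sum => i _.
  have Cch : Cc (fun y => chi y * v k i y) by apply: CcMl => //; exact: Cc_cont (tin_Cc tchi).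
  apply: le_trans (nrmB Cch (Cw i)) _; rewrite lerD2r.
  by apply: le_trans (HC1 _ (Cv k i)) _; rewrite ler_wpM2l.
have near2 : \forall k \near U, \sum_j nrm (fun y => eta y * full a B (x k) j y) <= K2.
  have strong1 : \forall k \near U, forall j, nrm (fun y => eta y * full a B (v k) j y - eta y * f j y) <= 1.
    by apply: filter_forall => j; exact: strong.
  apply: filterS strong1 => k kS; apply: ler_sum => j _.
  rewrite (_ : (fun y => _) = fun y => (eta y * full a B (v k) j y - eta y * f j y) +
      eta y * f j y - eta y * full a B w j y); last first.
    by apply/funext => y; rewrite subrK full_cut.
  have CF := Cfull (v k) j (sv k); have Cd := CcB CF (Cf j).
  apply: le_trans (nrmB (CcD Cd (Cf j)) (Cfull w j sw)) _; rewrite lerD2r.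
  by apply: le_trans (nrmD Cd (Cf j)) _; rewrite lerD2r; exact: kS.
have [k0 [k01 k02]] := filter_ex (filterI near1 near2).
have K10 : 0 <= K1 by apply: le_trans k01; apply: sumr_ge0 => i _; exact: nrm_ge0.
have K20 : 0 <= K2 by apply: le_trans k02; apply: sumr_ge0 => j _; exact: nrm_ge0.
have K30 : 0 < 2 * (K1 + K2 + 1) by rewrite mulr_gt0// ltr_wpDl// addr_ge0.
have [t t0 [s [C C0 HC]]] := local_compactness lam01 HE sa sB teta eta01 (divr_gt0 e0 K30).
have small : (fun k => \sum_(z <- s) \sum_i `|I (fun y => mk t (z - y) * eta y * x k i y)|) @ U --> (0 : R).
  rewrite [X in _ --> X](_ : 0 = \sum_(z <- s) \sum_(i : Iu) `|0 : R|); last by rewrite !(normr0, big1) // => *; rewrite big1.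
  apply: ultra_sum => z; apply: ultra_sum => i; apply: cvg_norm.
  pose psi y := mk t (z - y) * eta y.
  have Cp : Cc psi by apply: CcMl => //; exact: Cc_cont (Cc_reflect z (@Cc_mk R n t t0)).
  have := HT i (fun y => chi y * psi y) (CcMl (Cc_cont (tin_Cc tchi)) Cp).
  have [_ _ ->] := Hw i; last by [].
  move=> h; rewrite (_ : (fun k => _) = fun k => I (fun y => v k i y * (chi y * psi y)) - I (fun y => w i y * psi y)).
    by rewrite -[X in _ --> X](subrr (I (fun y => w i y * psi y))); apply: cvgB => //; exact: cvg_cst.
  apply/funext => k; rewrite -I_sub; [|apply: CcMr => //; apply: contM; [exact: Cc_cont (tin_Cc tchi)|exact: Cc_cont]|by apply: CcMr => //; exact: Cc_cont].
  by congr I; apply/funext => y; rewrite /x /psi; ring.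
have C2 : 0 < C + 1 by rewrite ltr_wpDl.
have near3 := ultra_near small (divr_gt0 (divr_gt0 e0 (ltr0n _ 2)) C2).
apply: filterS (filterI near3 (filterI near1 near2)) => k [k3 [k1 k2]].
under eq_bigr do rewrite -ex.
apply: le_trans (HC (x k) (sx k) (Cx k)) _.
rewrite subr0 in k3; have {}k3 := le_trans (ler_norm _) k3.
have S0 : 0 <= \sum_(z <- s) \sum_i `|I (fun y => mk t (z - y) * eta y * x k i y)|.
  by apply: sumr_ge0 => z _; apply: sumr_ge0.
have h1 : e / (2 * (K1 + K2 + 1)) * (\sum_i nrm (x k i) + \sum_j nrm (fun y => eta y * full a B (x k) j y)) <= e / 2.
  apply: le_trans (ler_wpM2l _ (lerD k1 k2)) _; first by rewrite divr_ge0// ltW.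
  by rewrite mulrAC ler_pdivrMr//; have := ltW e0; move: (K1 + K2) (addr_ge0 K10 K20) => z; nra.
have h2 : C * (\sum_(z <- s) \sum_i `|I (fun y => mk t (z - y) * eta y * x k i y)|) <= e / 2.
  apply: le_trans (ler_wpM2l C0 k3) _.
  by rewrite mulrA ler_pdivrMr//; have := ltW e0; nra.
have := lerD h1 h2; rewrite -splitr.
by [].
Qed.

End LocalLimit.

Lemma sum_sq_le_sq (R : realType) (T : finType) (x : T -> R) : (forall k, 0 <= x k) ->
  \sum_k x k ^+ 2 <= (\sum_k x k) ^+ 2.
Proof.
move=> x0; rewrite expr2 mulr_suml; apply: ler_sum => k _; rewrite expr2; apply: ler_wpM2l => //.
by rewrite (bigD1 k)//= lerDl; apply: sumr_ge0.
Qed.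

(** * Patches and gluing *)

Section Patches.
Variables (R : realType) (n : nat) (M : topologicalType) (A : manifold R n M).
Variables (D : cvf_distribution A) (r : nat) (E : vbundle A r) (nabla : connection E).
Local Notation V := 'rV[R]_n.
Local Notation Iu := (bool * 'I_r)%type.

Lemma sm_acoef (i : idx A) (c : V) (rho : R) (Z : cvf R n M) (j q : Iu) b : 0 < rho -> ballin i c (7 * rho) ->
  cvf_smooth A Z -> cutin c (6 * rho) (acoef i c rho Z j q b).
Proof.
move=> rho0 B7 [sL1 sL2].
have z1 := sm_zcoef b rho0 B7 sL1; have z2 := sm_zcoef b rho0 B7 sL2.
rewrite /acoef; case: ifP => _; last by split => //; exact: sm_cst.
case: ifP => // _; case: ifP => // _.
by split; [exact/sm_opp/z2.1|move=> y /z2.2 ->; rewrite oppr0].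
Qed.

Lemma sm_bcoef (i : idx A) (t : tidx E) (c : V) (rho : R) (Z : cvf R n M) (j q : Iu) : 0 < rho ->
  (forall y, `|y - c| <= 7 * rho -> tgt (ch i) y /\ tdom t (inv (ch i) y)) ->
  cvf_smooth A Z -> smooth (bcoef nabla i t c rho Z j q).
Proof.
move=> rho0 B7 sZ; have sF p := (sm_loc rho0 B7 p (cnab_smooth nabla sZ (frame_smooth rho0 B7 q.2))).1.
by rewrite /bcoef; case: ifP => // _; case: ifP => // _; exact: sm_opp.
Qed.

(** Bundled so that a finite cover of M is a finite family of records; each patch brings its own
    finite list of fields and its own lam. *)
Record spatch := SPatch {
  p_ch : idx A; p_tr : tidx E; p_c : V; p_r : R;
  p_r0 : 0 < p_r;
  p_ball : forall y, `|y - p_c| <= 7 * p_r -> tgt (ch p_ch) y /\ tdom p_tr (inv (ch p_ch) y);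
  p_m : nat; p_L : 'I_p_m -> cvf R n M; p_lam : R;
  p_D : forall l, D (p_L l);
  p_lam01 : 0 < p_lam < 1;
  p_apriori : apriori p_c (5 * p_r) (fun (j : 'I_p_m * Iu) q => acoef p_ch p_c p_r (p_L j.1) j.2 q) p_lam }.

Lemma patch_exists (g : riemannian_metric A) (P : partition_of_unity A) x : subelliptic_at g P D x ->
  exists Q : spatch, src (ch (p_ch Q)) x /\ to (ch (p_ch Q)) x = p_c Q.
Proof.
move=> Dx; have [t tx] := tdom_cover E x.
have [i [rho [m [L [lam [[sx rho0 B] [DL lam01 [C C0 HC]]]]]]]] := local_subelliptic (tdom_open t) tx Dx.
suff HE : apriori (to (ch i) x) (5 * rho) (fun (j : 'I_m * Iu) q => acoef i (to (ch i) x) rho (L j.1) j.2 q) lam.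
  by exists (SPatch rho0 B DL lam01 HE).
set c := to (ch i) x in B HC *; set a := fun (j : 'I_m * Iu) q => _.
(* The given estimate is quadratic and concerns one complex component, that is two real ones. Sums
   of squares are enlarged to squares of full sums before the root is taken. *)
exists (Num.sqrt C); first exact: sqrtr_ge0.
move=> v tv k [part b].
have cv q : cutin c (5 * rho) (v q).
  have [sv [s sr Hs]] := tv q; split => // y yr; apply: Hs; exact: lt_trans yr.
have Cv q : Cc (v q) := cutin_Cc (cv q).
have B7 : ballin i c (7 * rho) by move=> y /B[].
have sa (j : 'I_m * Iu) (q : Iu) b' := sm_acoef j.2 q b' rho0 B7 (dist_smooth (DL j.1)).
have CP j : Cc (principal a v j).
  apply: Cc_sum => q; apply: Cc_sum => b'; apply: CcMr; first exact: cutin_Cc (sa j q b').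
  exact/sm_cont/sm_partial/(cv q).1.
pose S1 := \sum_q nrm (v q); pose S2 := \sum_j nrm (principal a v j).
have S10 : 0 <= S1 by apply: sumr_ge0 => q _; exact: nrm_ge0.
have S20 : 0 <= S2 by apply: sumr_ge0 => q _; exact: nrm_ge0.
have S1le : nrm (v (true, b)) ^+ 2 + nrm (v (false, b)) ^+ 2 <= S1 ^+ 2.
  apply: le_trans (sum_sq_le_sq (fun q => nrm_ge0 (v q))).
  rewrite sum_bool_pair; apply: lerD; rewrite (bigD1 b)//= lerDl; apply: sumr_ge0 => b' _; exact: sqr_ge0.
have S2le : \sum_l (nrm (principal a v (l, (true, b))) ^+ 2 + nrm (principal a v (l, (false, b))) ^+ 2) <= S2 ^+ 2.
  apply: le_trans (sum_sq_le_sq (fun j => nrm_ge0 (principal a v j))).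
  rewrite big_pair; apply: ler_sum => l _.
  rewrite sum_bool_pair; apply: lerD; rewrite (bigD1 b)//= lerDl; apply: sumr_ge0 => b' _; exact: sqr_ge0.
have HC' := HC (v (true, b)) (v (false, b)) k (cv _) (cv _).
have Cw q : Cc (fun y => v q y - cnv (mk (tk R k)) (v q) y).
  by apply: CcB => //; apply: Cc_conv => //; apply: Cc_mk; exact: tk_gt0.
have E1 l : principal a v (l, (true, b)) = dRe (zcoef i c rho (re_vf (L l))) (zcoef i c rho (im_vf (L l))) (v (true, b)) (v (false, b)).
  by apply/funext => y; rewrite -(acoef_sum i c rho (L l) v b y).1.
have E2 l : principal a v (l, (false, b)) = dIm (zcoef i c rho (re_vf (L l))) (zcoef i c rho (im_vf (L l))) (v (true, b)) (v (false, b)).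
  by apply/funext => y; rewrite -(acoef_sum i c rho (L l) v b y).2.
lazy zeta in HC'.
rewrite -!nrm_sq// in HC'.
have HS : \sum_l (I (fun y => dRe (zcoef i c rho (re_vf (L l))) (zcoef i c rho (im_vf (L l))) (v (true, b)) (v (false, b)) y ^+ 2) +
   I (fun y => dIm (zcoef i c rho (re_vf (L l))) (zcoef i c rho (im_vf (L l))) (v (true, b)) (v (false, b)) y ^+ 2)) <= S2 ^+ 2.
  apply: le_trans S2le; apply: ler_sum => l _; rewrite -E1 -E2 !nrm_sq//; exact: CP.
have lk : 0 <= lam ^+ k by rewrite exprn_ge0// ltW//; case/andP: lam01.
have T1 : nrm (fun y => v (part, b) y - cnv (mk (tk R k)) (v (part, b)) y) ^+ 2 <= C * (lam ^+ k) ^+ 2 * (S1 + S2) ^+ 2.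
  apply: le_trans (_ : C * (lam ^+ k) ^+ 2 * (S1 ^+ 2 + S2 ^+ 2) <= _).
    apply: le_trans (le_trans _ HC') _; last first.
      by apply: ler_wpM2l; [rewrite mulr_ge0// sqr_ge0|exact: lerD].
    by case: part; rewrite ?lerDl ?lerDr sqr_ge0.
  apply: ler_wpM2l; first by rewrite mulr_ge0// sqr_ge0.
  by rewrite sqrrD -addrA lerD2l lerDr mulrn_wge0// mulr_ge0.
have R0 : 0 <= Num.sqrt C * lam ^+ k * (S1 + S2) by rewrite !mulr_ge0 ?sqrtr_ge0// addr_ge0.
rewrite -(ler_pXn2r (isT : (0 < 2)%N)) ?nnegrE ?nrm_ge0//.
apply: le_trans T1 _; rewrite -/S1 -/S2 -{1}(sqr_sqrtr C0).
by move: (Num.sqrt C) (lam ^+ k) (S1 + S2) => x1 x2 x3; rewrite -!exprMn.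
Qed.

End Patches.

Arguments p_ball {R n M A D r E} s.

Section Gluing.
Variables (R : realType) (n : nat) (M : topologicalType) (A : manifold R n M).
Hypothesis hM : compact [set: M].
Variables (D : cvf_distribution A).
Variables (r : nat) (E : vbundle A r) (h : hermitian_metric E).
Local Notation V := 'rV[R]_n.
Local Notation Iu := (bool * 'I_r)%type.

Lemma rsm_bounded (f : M -> R) : rsmooth_on A setT f -> exists2 C : R, 0 <= C & forall x, `|f x| <= C.
Proof.
move=> sf; have [[x0 _]|nM] := pselect (exists x0 : M, True); last first.
  by exists 0 => // x; case: nM; exists x.
have cf : continuous (fun x => `|f x|).
  by apply: cont_abs => x; exact: (rsm_cont openT sf (Logic.I : [set: M] x)).
have [x1 _ H] := @compact_EVT_max _ _ (fun x => `|f x|) [set: M] (ex_intro _ x0 Logic.I) hM (continuous_subspaceT cf).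
by exists `|f x1| => // x; apply: H; rewrite inE.
Qed.

Lemma hsq_family (T : finType) (F : T -> section E) : (forall p, ssmooth (F p)) ->
  exists2 C : R, 0 <= C & forall (d : T -> R) x,
    hsq h (\sum_p (d p)%:C%C *: F p x) <= C * \sum_p d p ^+ 2.
Proof.
move=> sF; have /choice[C HC] (p : T * T) : exists C : R, 0 <= C /\ forall x, `|hre h (F p.1 x) (F p.2 x)| <= C.
  by have [C C0 HC] := rsm_bounded (hform_smooth h (sF p.1) (sF p.2)).1; exists C.
exists (\sum_p C p); first by apply: sumr_ge0 => p _; case: (HC p).
move=> d x; rewrite /hsq -/(hre h _ _) hre_sum big_pair mulr_suml; apply: ler_sum => p _.
rewrite hreC hre_sum mulr_sumr mulr_suml; apply: ler_sum => q _.
rewrite hreC; apply: le_trans (ler_norm _) _; rewrite !normrM mulrA mulrC.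
apply: ler_pM => //.
    by case: (HC (p, q)) => _; exact.
have S k : `|d k| ^+ 2 <= \sum_k d k ^+ 2.
  by rewrite real_normK ?num_real// (bigD1 k)//= lerDl; apply: sumr_ge0 => l _; exact: sqr_ge0.
have := S p; have := S q; have := sqr_ge0 (`|d p| - `|d q|); move: (\sum_k _) => S0; nra.
Qed.

Lemma loc_lin i (t : tidx E) c (rho d : R) (s s' : section E) q y : 0 < rho ->
  (forall y, `|y - c| <= 7 * rho -> tgt (ch i) y /\ tdom t (inv (ch i) y)) ->
  loc i t c rho (fun x => d%:C%C *: s x + s' x) q y = d * loc i t c rho s q y + loc i t c rho s' q y.
Proof.
move=> rho0 B7; have [yr|yr] := leP `|y - c| (6 * rho); last first.
  by rewrite /loc (cutin_plat c rho0 5).2// !mul0r mulr0 addr0.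
have [Ty ty] := B7 y (le_trans yr (rho_le rho0 (isT : (6 <= 7)%N))).
rewrite /loc mulrCA -mulrDr; congr (_ * _); rewrite /rcoord trivZD// !mxE.
by case: q.1; rewrite ?cReD ?cImD ?cReM ?cImM /= ?mul0r ?subr0 ?addr0.
Qed.

Variables (N : nat) (Q : 'I_N -> spatch D E).
Local Notation qi k := (p_ch (Q k)).
Local Notation qc k := (ch (p_ch (Q k))).
Local Notation qx k := (p_c (Q k)).
Local Notation qr k := (p_r (Q k)).
Hypothesis cover : forall x, exists k, src (qc k) x /\ `|to (qc k) x - qx k| <= qr k.
Implicit Types (k l : 'I_N) (q : Iu) (s : section E).

Definition lo k : section E -> Iu -> V -> R := loc (qi k) (p_tr (Q k)) (qx k) (qr k).
Definition pla k : nat -> V -> R := plat (qx k) (qr k).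
Definition pfr k : Iu -> section E := rframe (qi k) (p_tr (Q k)) (qx k) (qr k).

Lemma pla_in k (m : nat) y : `|y - qx k| <= m%:R * qr k -> pla k m y = 1.
Proof. exact: plat_in (p_r0 (Q k)) _ _. Qed.

Lemma pla01 k (m : nat) y : 0 <= pla k m y <= 1.
Proof. exact: plat01 (p_r0 (Q k)) _ _. Qed.

Lemma cutin_pla k (m : nat) : cutin (qx k) (m.+1%:R * qr k) (pla k m).
Proof. exact: cutin_plat (p_r0 (Q k)) m. Qed.

Lemma pball_le k (m : nat) : (m <= 7)%N -> ballin (qi k) (qx k) (m%:R * qr k).
Proof. exact: ballin_plat (p_r0 (Q k)) (p_ball (Q k)) _. Qed.

Lemma sm_lo k s q : ssmooth s -> cutin (qx k) (6 * qr k) (lo k s q).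
Proof. exact: sm_loc (p_r0 (Q k)) (p_ball (Q k)) _ _. Qed.

Lemma lo_lin k (d : R) s s' q y : lo k (fun x => d%:C%C *: s x + s' x) q y = d * lo k s q y + lo k s' q y.
Proof. exact: loc_lin (p_r0 (Q k)) (p_ball (Q k)). Qed.

Lemma lo_rcoord k s q x : src (qc k) x -> `|to (qc k) x - qx k| <= 5 * qr k ->
  lo k s q (to (qc k) x) = rcoord (p_tr (Q k)) s q x.
Proof. by move=> sx xr; rewrite /lo /loc (plat_in (p_r0 (Q k)) xr) mul1r toK. Qed.

Lemma lo_out k s q y : 6 * qr k < `|y - qx k| -> lo k s q y = 0.
Proof. by move=> yr; rewrite /lo /loc (cutin_plat (qx k) (p_r0 (Q k)) 5).2// mul0r. Qed.

Lemma lo_le_rcoord k s q y : `|lo k s q y| <= `|rcoord (p_tr (Q k)) s q (inv (qc k) y)|.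
Proof.
rewrite /lo /loc normrM ler_piMl//; case/andP: (pla01 k 5 y) => p0' p1.
by rewrite ger0_norm.
Qed.

(** The denominator of a partition of unity subordinate to the patches; it is at least 1 because the
    balls of radius [qr k] cover M. *)
Definition total x : R := \sum_k mlift (qi k) (pla k 1) x.

Lemma total_ge1 x : 1 <= total x.
Proof.
have [k [sx xr]] := cover x; rewrite /total (bigD1 k)//= mlift_src// pla_in ?mul1r// lerDl.
apply: sumr_ge0 => l _; rewrite /mlift; case: asboolP => // _.
by case/andP: (pla01 l 1 (to (qc l) x)).
Qed.

Lemma total_smooth : rsmooth_on A setT (fun x => (total x)^-1).
Proof.
apply: rsm_inv => [|x _|]; [exact: openT|by rewrite gt_eqF// (lt_le_trans ltr01)// total_ge1|].
apply: rsm_sum => [|k]; first exact: openT.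
exact: (sm_mlift (@pball_le k 2 isT) (cutin_pla k 1)).
Qed.

(** Only the division by [total] is built in: the plateau weights [pla k 1] belong to f, as in
    [glue_lo]. *)
Definition gsec (f : 'I_N -> Iu -> V -> R) : section E := fun x =>
  \sum_(p : 'I_N * Iu) ((total x)^-1 * mlift (qi p.1) (f p.1 p.2) x)%:C%C *: pfr p.1 p.2 x.

Definition core (f : 'I_N -> Iu -> V -> R) := forall k q, cutin (qx k) (2 * qr k) (f k q).

Lemma pfr_smooth k q : ssmooth (pfr k q).
Proof. exact: rframe_smooth (p_r0 (Q k)) (p_ball (Q k)) q. Qed.

Lemma glue_smooth f : core f -> ssmooth (gsec f).
Proof.
move=> cf; apply: ssm_sum => p; apply: ssm_scale; last exact: pfr_smooth.
apply: csm_real; first exact: openT.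
apply: rsm_mul; [exact: openT|exact: total_smooth|].
exact: (sm_mlift (@pball_le p.1 2 isT) (cf p.1 p.2)).
Qed.

Lemma core_lo s : ssmooth s -> core (fun k q y => pla k 1 y * lo k s q y).
Proof. by move=> ss k q; apply: cutinMr; [exact: cutin_pla|case: (sm_lo k q ss)]. Qed.

Lemma glue_lo s x : gsec (fun k q y => pla k 1 y * lo k s q y) x = s x.
Proof.
have t0 : total x != 0 by rewrite gt_eqF// (lt_le_trans ltr01)// total_ge1.
have patchE k : \sum_q ((total x)^-1 * mlift (qi k) (fun y => pla k 1 y * lo k s q y) x)%:C%C *: pfr k q x =
    ((total x)^-1 * mlift (qi k) (pla k 1) x)%:C%C *: s x.
  have [kx|nk] := pselect (kball (qi k) (qx k) (2 * qr k) x); last first.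
    rewrite (mlift_out (cutin_pla k 1) nk) mulr0 scale0r big1// => q _.
    suff -> : mlift (qi k) (fun y => pla k 1 y * lo k s q y) x = 0 by rewrite mulr0 scale0r.
    rewrite /mlift; case: asboolP => // sx; rewrite (cutin_pla k 1).2 ?mul0r//.
    by rewrite ltNge; apply/negP => xr; apply: nk.
  have [sx xr] := kx; have xr6 := le_trans xr (rho_le (p_r0 (Q k)) (isT : (2 <= 6)%N)).
  have xr5 := le_trans xr (rho_le (p_r0 (Q k)) (isT : (2 <= 5)%N)).
  have /(real_combination (p_r0 (Q k)) (p_ball (Q k)) (fun q => rcoord (p_tr (Q k)) s q x) s (conj sx xr6)) -> :
    forall q, rcoord (p_tr (Q k)) s q x = rcoord (p_tr (Q k)) s q x by [].
  rewrite scaler_sumr; apply: eq_bigr => q _; rewrite scalerA; congr (_ *: _).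
  rewrite !mlift_src// lo_rcoord//.
  by apply: complex_ext; rewrite ?cReM ?cImM /= ?mul0r ?mulr0 ?subr0 ?addr0// mulrA.
rewrite /gsec (big_pair (fun p : 'I_N * Iu => ((total x)^-1 * mlift (qi p.1) (fun y => pla p.1 1 y * lo p.1 s p.2 y) x)%:C%C *: pfr p.1 p.2 x)).
under eq_bigr do rewrite patchE.
rewrite -scaler_suml -[RHS]scale1r; congr (_ *: _).
rewrite -(rmorph_sum (real_complex R)) -mulr_sumr -/(total x) mulVf//.
Qed.

Lemma glue_sub f g x : gsec (fun k q y => f k q y - g k q y) x = gsec f x - gsec g x.
Proof.
rewrite /gsec -sumrB; apply: eq_bigr => p _; rewrite -scalerBl; congr (_ *: _).
rewrite -rmorphB -mulrBr; congr (_ * _)%:C%C.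
by rewrite /mlift; case: asboolP; rewrite ?subr0.
Qed.

(** Coordinates in patch k are bounded by the fibre norm ([hsq_lower]), this by the coefficients in
    all patches l ([hsq_family]), and [chart_change] compares the integrals in l and k. *)
Lemma glue_bound : exists2 C : R, 0 <= C & forall f, core f -> forall k q,
  nrm (lo k (gsec f) q) <= C * \sum_l \sum_q' nrm (f l q').
Proof.
have [C1 C10 HC1] := hsq_family (fun p : 'I_N * Iu => pfr_smooth p.1 p.2).
have r12 l : 3 * qr l < 4 * qr l := rho_lt (p_r0 (Q l)) (isT : (3 < 4)%N).
have /choice[C2 HC2] k : exists C : R, 0 <= C /\ forall s x, kball (qi k) (qx k) (6 * qr k) x ->
    \sum_q (rcoord (p_tr (Q k)) s q x) ^+ 2 <= C * hsq h (s x).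
  by have [C C0 HC] := hsq_lower h (p_r0 (Q k)) (p_ball (Q k)); exists C.
have /choice[C3 HC3] (p : 'I_N * 'I_N) : exists C : R, 0 <= C /\ forall f : V -> R, Cc f -> (forall y, 0 <= f y) ->
    let g y := pla p.1 5 y * mlift (qi p.2) (pla p.2 2) (inv (qc p.1) y) *
      f (to (qc p.2) (inv (qc p.1) y)) in Cc g /\ I g <= C * I f.
  have [C C0 HC] := chart_change (rho_ge (p_r0 (Q p.1)) 6) (rho_lt (p_r0 (Q p.1)) (isT : (6 < 7)%N))
    (rho_ge (p_r0 (Q p.2)) 3) (r12 p.2) (@pball_le p.1 7 isT) (@pball_le p.2 4 isT)
    (cutin_pla p.1 5) (cutin_pla p.2 2) (pla01 p.1 5) (pla01 p.2 2).
  by exists C.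
have C20 k : 0 <= C2 k by case: (HC2 k).
have C30 p : 0 <= C3 p by case: (HC3 p).
pose C := C1 * (\sum_k C2 k) * \sum_p C3 p.
have C0 : 0 <= C by rewrite !mulr_ge0// sumr_ge0.
exists (Num.sqrt C); first exact: sqrtr_ge0.
move=> f cf k q; pose S := \sum_l \sum_q' nrm (f l q').
have Cf l q' : Cc (f l q') := cutin_Cc (cf l q').
have S0 : 0 <= S by apply: sumr_ge0 => l _; apply: sumr_ge0 => q' _; exact: nrm_ge0.
pose g l q' y := pla k 5 y * mlift (qi l) (pla l 2) (inv (qc k) y) *
      f l q' (to (qc l) (inv (qc k) y)) ^+ 2.
have Hg l q' : Cc (g l q') /\ I (g l q') <= C3 (k, l) * nrm (f l q') ^+ 2.
  by rewrite nrm_sq//; apply: (HC3 (k, l)).2; [exact: Cc_sq|move=> y; exact: sqr_ge0].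
have Clo : Cc (lo k (gsec f) q) := cutin_Cc (sm_lo k q (glue_smooth cf)).
have Cg : Cc (fun y => C1 * C2 k * \sum_l \sum_q' g l q' y).
  by apply: CcZ; apply: Cc_sum => l; apply: Cc_sum => q'; case: (Hg l q').
have le y : lo k (gsec f) q y ^+ 2 <= C1 * C2 k * \sum_l \sum_q' g l q' y.
  have g0 l q' : 0 <= g l q' y.
    apply: mulr_ge0; last exact: sqr_ge0.
    apply: mulr_ge0; first by case/andP: (pla01 k 5 y).
    by rewrite /mlift; case: asboolP => // _; case/andP: (pla01 l 2 (to (qc l) (inv (qc k) y))).
  have [yr|yr] := leP `|y - qx k| (6 * qr k); last first.
    rewrite (sm_lo k q (glue_smooth cf)).2// expr0n mulr_ge0// ?mulr_ge0//.
    by apply: sumr_ge0 => l _; exact: sumr_ge0.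
  have Ty := @pball_le k 6 isT _ yr.
  set x := inv (qc k) y.
  have kx : kball (qi k) (qx k) (6 * qr k) x.
    by split; [exact: Defs.inv_src|rewrite Defs.invK].
  have := (HC2 k).2 (gsec f) x kx; rewrite (bigD1 q)//= => h1.
  have {}h1 : rcoord (p_tr (Q k)) (gsec f) q x ^+ 2 <= C2 k * hsq h (gsec f x).
    by apply: le_trans h1; rewrite lerDl; apply: sumr_ge0 => q' _; exact: sqr_ge0.
  have h2 := HC1 (fun p => (total x)^-1 * mlift (qi p.1) (f p.1 p.2) x) x.
  have [p0 p1] := andP (pla01 k 5 y).
  have T1 : 0 <= (total x)^-1 <= 1.
    have := total_ge1 x => t1; rewrite invr_ge0 (le_trans ler01 t1)/= invf_le1//; exact: lt_le_trans t1.
  apply: le_trans (_ : pla k 5 y * (C2 k * (C1 * \sum_(p : 'I_N * Iu) mlift (qi p.1) (f p.1 p.2) x ^+ 2)) <= _).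
    apply: le_trans (_ : pla k 5 y * rcoord (p_tr (Q k)) (gsec f) q x ^+ 2 <= _).
      rewrite /lo /loc -/(pla k 5 y) -/x exprMn; apply: ler_wpM2r; first exact: sqr_ge0.
      by rewrite expr2 ler_piMl.
    apply: ler_wpM2l => //; apply: le_trans h1 _; apply: ler_wpM2l => //; apply: le_trans h2 _.
    apply: ler_wpM2l => //; apply: ler_sum => p _; rewrite exprMn ler_piMl ?sqr_ge0//.
    by case/andP: T1 => t0 t1; rewrite exprn_ile1.
  rewrite (big_pair (fun p : 'I_N * Iu => mlift (qi p.1) (f p.1 p.2) x ^+ 2)) /=.
  have mulE (u1 u2 u3 u4 : R) : u1 * (u2 * (u3 * u4)) = u3 * u2 * (u1 * u4) by ring.
  rewrite mulE; apply: ler_wpM2l; first exact: mulr_ge0.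
  rewrite mulr_sumr; apply: ler_sum => l _; rewrite mulr_sumr; apply: ler_sum => q' _.
  rewrite /g -mulrA; apply: ler_wpM2l => //; rewrite -/x /mlift; case: asboolP => [sx|_]; last by rewrite expr0n mul0r.
  have [xr|/(cf l q').2 ->] := leP `|to (qc l) x - qx l| (2 * qr l).
    by rewrite pla_in// mul1r.
  by rewrite expr0n mulr0.
have R0 : 0 <= Num.sqrt C * S by rewrite mulr_ge0// sqrtr_ge0.
rewrite -(ler_pXn2r (isT : (0 < 2)%N)) ?nnegrE ?nrm_ge0// nrm_sq// exprMn sqr_sqrtr//.
apply: le_trans (I_le (Cc_sq Clo) Cg le) _.
rewrite I_scal; last by apply: Cc_sum => l; apply: Cc_sum => q'; case: (Hg l q').
rewrite I_sum; last by move=> l; apply: Cc_sum => q'; case: (Hg l q').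
have Sq : \sum_l \sum_q' nrm (f l q') ^+ 2 <= S ^+ 2.
  have := sum_sq_le_sq (fun p : 'I_N * Iu => nrm_ge0 (f p.1 p.2)).
  by rewrite !big_pair.
apply: le_trans (_ : C1 * C2 k * ((\sum_p C3 p) * \sum_l \sum_q' nrm (f l q') ^+ 2) <= _).
  apply: ler_wpM2l; first exact: mulr_ge0.
  rewrite mulr_sumr; apply: ler_sum => l _; rewrite I_sum; last by move=> q'; case: (Hg l q').
  rewrite mulr_sumr; apply: ler_sum => q' _; apply: le_trans (Hg l q').2 _.
  apply: ler_wpM2r; first exact: sqr_ge0.
  by rewrite (bigD1 (k, l))//= lerDl; apply: sumr_ge0.
have C3S : 0 <= \sum_p C3 p by exact: sumr_ge0.
have C2S : C2 k <= \sum_k C2 k by rewrite (bigD1 k)//= lerDl; apply: sumr_ge0.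
rewrite /C -!mulrA; apply: ler_wpM2l => //; apply: ler_pM => //.
  by rewrite mulr_ge0//; apply: sumr_ge0 => l _; apply: sumr_ge0 => q' _; exact: sqr_ge0.
by apply: ler_wpM2l.
Qed.

End Gluing.

Section MaximalFamily.
Variables (F : fieldType) (T : Type) (d : nat) (S : T -> Prop) (ell : T -> 'rV[F]_d).

(** The rank is at most d, so a largest free family exists; a vector outside its row space would
    enlarge it. *)
Lemma maximal_free_family : exists (m : nat) (e : 'I_m -> T), [/\ forall k, S (e k),
  row_free (\matrix_k ell (e k)) & forall s, S s -> (ell s <= \matrix_k ell (e k))%MS].
Proof.
pose P m := `[< exists e : 'I_m -> T, (forall k, S (e k)) /\ row_free (\matrix_k ell (e k)) >].
have P0 : exists m, P m.
  exists 0%N; apply/asboolP; exists (fun k : 'I_0 => False_rect T (notF (ltn_ord k))); split; first by case.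
  by rewrite /row_free (flatmx0 (\matrix_k _)) mxrank0.
have Pd m : P m -> (m <= d)%N.
  by move=> /asboolP[e [_ /eqP <-]]; exact: rank_leq_col.
case: (ex_maxnP P0 Pd) => m /asboolP[e [Se fe]] max; exists m, e; split => // s Ss.
apply: contrapT => /negP ns; have : P m.+1; last by move=> /max; rewrite ltnn.
pose e' (k : 'I_(1 + m)) := match fintype.split k with inl _ => s | inr k' => e k' end.
apply/asboolP; exists e'; split.
  by move=> k; rewrite /e'; case: fintype.split.
have -> : \matrix_k ell (e' k) = col_mx (ell s) (\matrix_k ell (e k)).
  apply/matrixP => i j; rewrite !mxE /e'; case: fintype.split => k; rewrite ?mxE//.
  by rewrite ord1.
rewrite /row_free eqn_leq rank_leq_row /=.
have : (\matrix_k ell (e k) < col_mx (ell s) (\matrix_k ell (e k)))%MS.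
  rewrite ltmxE col_mx_sub negb_and ns /= andbT.
  by apply: submx_trans (addsmxSr (ell s) _) _; rewrite addsmxE.
by rewrite ltmxErank => /andP[_]; move/eqP: fe => ->.
Qed.

End MaximalFamily.

(** * Limits of global sections, parallel sections and closed range *)

Section GlobalLimit.
Variables (R : realType) (n : nat) (M : topologicalType) (A : manifold R n M).
Hypothesis hM : compact [set: M].
Variables (D : cvf_distribution A).
Variables (r : nat) (E : vbundle A r) (h : hermitian_metric E) (nabla : connection E).
Local Notation V := 'rV[R]_n.
Local Notation Iu := (bool * 'I_r)%type.
Variables (N : nat) (Q : 'I_N -> spatch D E).
Local Notation qL k := (@p_L _ _ _ _ _ _ _ (Q k)).
Local Notation qi k := (p_ch (Q k)).
Local Notation qc k := (ch (p_ch (Q k))).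
Local Notation qx k := (p_c (Q k)).
Local Notation qr k := (p_r (Q k)).
Hypothesis cover : forall x, exists k, src (qc k) x /\ `|to (qc k) x - qx k| <= qr k.
Implicit Types (q : Iu) (s : section E).
Local Notation lo := (lo Q).
Local Notation pla := (pla Q).
Local Notation gsec := (gsec Q).
Local Notation parallel := (parallel_sections nabla D).

(** A global L^2 norm built from exactly those pieces from which [gsec] recovers the section. *)
Definition Nrm s : R := \sum_k \sum_q nrm (fun y => pla k 1 y * lo k s q y).

Lemma Nrm_ge0 s : 0 <= Nrm s.
Proof. by apply: sumr_ge0 => k _; apply: sumr_ge0 => q _; exact: nrm_ge0. Qed.

Let Clo s k q (ss : ssmooth s) : Cc (lo k s q) := cutin_Cc (sm_lo Q k q ss).

Lemma Nrm_le_lo s : ssmooth s -> Nrm s <= \sum_k \sum_q nrm (lo k s q).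
Proof.
move=> ss; apply: ler_sum => k _; apply: ler_sum => q _; have C := Clo k q ss.
apply: nrm_le => //; first exact: cutin_Cc (core_lo Q ss k q).
move=> y; rewrite normrM ler_piMl//; case/andP: (pla01 Q k 1 y) => p0 p1.
by rewrite ger0_norm.
Qed.

Lemma Nrm_glue : exists2 C : R, 0 <= C & forall f, core Q f -> Nrm (gsec f) <= C * \sum_l \sum_q nrm (f l q).
Proof.
have [C C0 HC] := glue_bound hM h cover.
exists (\sum_(k < N) \sum_(q : Iu) C); first by apply: sumr_ge0 => k _; exact: sumr_ge0.
move=> f cf; apply: le_trans (Nrm_le_lo (glue_smooth cover cf)) _.
rewrite mulr_suml; apply: ler_sum => k _; rewrite mulr_suml; apply: ler_sum => q _; exact: HC.
Qed.

Lemma gsec_section s : gsec (fun k q y => pla k 1 y * lo k s q y) = s.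
Proof. by apply: section_ext => x; exact: glue_lo. Qed.

(** [lo k] reaches out to radius 6 [qr k], the weights in [Nrm] only to 2 [qr k]; the rest of a
    patch is recovered from the others by gluing. *)
Lemma lo_le_Nrm : exists2 C : R, 0 <= C & forall s, ssmooth s -> forall k q, nrm (lo k s q) <= C * Nrm s.
Proof.
have [C C0 HC] := glue_bound hM h cover; exists C => // s ss k q.
by have := HC _ (core_lo Q ss) k q; rewrite gsec_section.
Qed.

Lemma Nrm_eq0 s x : ssmooth s -> Nrm s = 0 -> s x = 0.
Proof.
move=> ss /eqP; rewrite psumr_eq0; last by move=> k _; apply: sumr_ge0 => q _; exact: nrm_ge0.
move=> /allP H.
have z k q y : pla k 1 y * lo k s q y = 0.
  have := H k (mem_index_enum k); rewrite implyTb psumr_eq0; last by move=> q' _; exact: nrm_ge0.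
  move=> /allP/(_ q (mem_index_enum q)); rewrite implyTb => /eqP.
  by move=> /(nrm_eq0 (cutin_Cc (core_lo Q ss k q))) ->.
rewrite -[s x](glue_lo cover) /gsec big1// => p _.
suff -> : mlift (qi p.1) (fun y => pla p.1 1 y * lo p.1 s p.2 y) x = 0 by rewrite mulr0 scale0r.
by rewrite /mlift; case: asboolP => // _; exact: z.
Qed.

Definition acf k (Z : cvf R n M) (j q : Iu) : 'I_n -> V -> R := acoef (qi k) (qx k) (qr k) Z j q.
Definition bcf k (Z : cvf R n M) (j q : Iu) : V -> R :=
  bcoef nabla (qi k) (p_tr (Q k)) (qx k) (qr k) Z j q.

Lemma acf_smooth k Z j q b : D Z -> smooth (acf k Z j q b) /\ Cc (acf k Z j q b).
Proof.
move=> DZ; have c := sm_acoef j q b (p_r0 (Q k)) (@pball_le _ _ _ _ _ _ _ _ Q k 7 isT) (dist_smooth DZ).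
by split; [exact: c.1|exact: cutin_Cc c].
Qed.

Lemma bcf_smooth k Z j q : D Z -> smooth (bcf k Z j q).
Proof. by move=> DZ; exact: sm_bcoef (p_r0 (Q k)) (p_ball (Q k)) (dist_smooth DZ). Qed.

Lemma full_lo k Z s j y : D Z -> ssmooth s -> `|y - qx k| < 5 * qr k ->
  full (acf k Z) (bcf k Z) (lo k s) j y = lo k (cnab nabla Z s) j y.
Proof.
by move=> DZ ss yr; rewrite [RHS](local_form nabla (p_r0 (Q k)) (p_ball (Q k)) j (dist_smooth DZ) ss yr).
Qed.

Lemma tin_pla k (m : nat) : (m.+1 < 5)%N -> tin (qx k) (5 * qr k) (pla k m).
Proof.
move=> m5; have [sp Hp] := cutin_pla Q k m; split => //.
by exists (m.+1%:R * qr k); [exact: (rho_lt (p_r0 (Q k)) m5)|exact: Hp].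
Qed.

Lemma lo_sub k s s' q y : lo k (fun x => s x - s' x) q y = lo k s q y - lo k s' q y.
Proof.
have -> : (fun x => s x - s' x) = fun x => (-1)%:C%C *: s' x + s x.
  by apply: section_ext => x; rewrite rmorphN1 scaleN1r addrC.
by rewrite lo_lin mulN1r addrC.
Qed.

Lemma ssm_sub s s' : ssmooth s -> ssmooth s' -> ssmooth (fun x => s x - s' x).
Proof.
move=> ss ss'; apply: ssm_add => //.
rewrite (_ : (fun x => _) = fun x => (-1) *: s' x); first exact: ssm_cst_scale.
by apply: section_ext => x; rewrite scaleN1r.
Qed.

Lemma cnab_sub Z s s' x : cvf_smooth A Z -> ssmooth s -> ssmooth s' ->
  cnab nabla Z (fun x => s x - s' x) x = cnab nabla Z s x - cnab nabla Z s' x.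
Proof.
move=> sZ ss ss'; rewrite -[RHS]addrC -scaleN1r -cnab_lin//; congr (cnab nabla Z _ x).
by apply: section_ext => z; rewrite scaleN1r addrC.
Qed.

Section UltraLimit.
Variables (U : set_system nat) (UU : UltraFilter U).

(** The derivatives are moved onto psi by [full_weak], and the pairing is then bounded by [Nrm]. *)
Lemma weak_null k Z j psi (u : nat -> section E) : D Z -> (forall m, ssmooth (u m)) ->
  (forall e, 0 < e -> \forall m \near U, Nrm (u m) <= e) -> tin (qx k) (5 * qr k) psi ->
  (fun m => I (fun y => lo k (cnab nabla Z (u m)) j y * psi y)) @ U --> (0 : R).
Proof.
move=> DZ su uN tp; have [C C0 HC] := lo_le_Nrm.
have sa j' q b := acf_smooth k j' q b DZ; have sB j' q := bcf_smooth k j' q DZ.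
pose W q y := bcf k Z j q y * psi y - \sum_b partial b (fun z => acf k Z j q b z * psi z) y.
have Cp := tin_Cc tp; have sp := tin_smooth tp.
have CW q : Cc (W q).
  apply: CcB; first by apply: CcMl => //; exact/sm_cont/sB.
  apply: Cc_sum => b; have [s1 c1] := sa j q b; apply: Cc_partial; first exact: sm_mul.
  by apply: CcMl => //; exact: sm_cont.
pose K := \sum_q C * nrm (W q).
have K0 : 0 <= K by apply: sumr_ge0 => q _; rewrite mulr_ge0// nrm_ge0.
have bd m : `|I (fun y => lo k (cnab nabla Z (u m)) j y * psi y)| <= K * Nrm (u m).
  have -> : I (fun y => lo k (cnab nabla Z (u m)) j y * psi y) = \sum_q I (fun y => lo k (u m) q y * W q y).
    rewrite (full_weak sa sB j (fun q => (sm_lo Q k q (su m)).1) (fun q => Clo k q (su m)) tp).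
    have [r' r'5 Hr'] := tp.2.
    congr I; apply/funext => y; have [yr|/Hr' ->] := leP `|y - qx k| r'; last by rewrite !mulr0.
    by rewrite full_lo//; exact: le_lt_trans r'5.
  apply: le_trans (ler_norm_sum _ _ _) _; rewrite mulr_suml; apply: ler_sum => q _.
  apply: le_trans (cauchy_schwarz_I (Clo k q (su m)) (CW q)) _.
  by rewrite mulrAC; apply: ler_wpM2r; [exact: nrm_ge0|exact: HC].
apply/cvgrPdist_le => e e0; have K1 : 0 < K + 1 by rewrite ltr_wpDl.
have := uN _ (divr_gt0 e0 K1); apply: filterS => m Hm; rewrite sub0r normrN.
apply: le_trans (bd m) _; apply: le_trans (ler_wpM2l K0 Hm) _.
by rewrite mulrA ler_pdivrMr// mulrC ler_wpM2l ?(ltW e0)// lerDl.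
Qed.

(** Only the finitely many fields of the patches are used to produce the limit; the equation for an
    arbitrary Z is then obtained by testing, from the convergence in [Nrm]. *)
Theorem global_limit (s : nat -> section E) (f : cvf R n M -> section E) (K : R) :
  (forall m, ssmooth (s m)) -> (\forall m \near U, Nrm (s m) <= K) ->
  (forall Z, D Z -> ssmooth (f Z)) ->
  (forall Z k q e, D Z -> 0 < e -> \forall m \near U, forall y,
     `|lo k (cnab nabla Z (s m)) q y - lo k (f Z) q y| <= e) ->
  exists sigma, [/\ ssmooth sigma, forall Z, D Z -> forall x, cnab nabla Z sigma x = f Z x &
    forall e, 0 < e -> \forall m \near U, Nrm (fun x => s m x - sigma x) <= e].
Proof.
move=> ss sK sf conv; have [C C0 HC] := lo_le_Nrm; have [C1 C10 HC1] := Nrm_glue.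
have sZ Z : D Z -> cvf_smooth A Z by exact: dist_smooth.
have sn Z m : D Z -> ssmooth (cnab nabla Z (s m)) by move=> DZ; apply: cnab_smooth => //; exact: sZ.
pose d k Z m q y := lo k (cnab nabla Z (s m)) q y - lo k (f Z) q y.
have Cd k Z m q : D Z -> Cc (d k Z m q) by move=> DZ; apply: CcB; apply: Clo; [exact: sn|exact: sf].
have nd k Z q e : D Z -> 0 < e -> \forall m \near U, nrm (d k Z m q) <= e.
  move=> DZ e0; pose B := `|qx k| + 6 * qr k.
  have B0 : 0 <= B by rewrite addr_ge0// rho_ge// p_r0.
  pose w := Num.sqrt ((2 * B) ^+ n); have w1 : 0 < w + 1 by rewrite ltr_wpDl// sqrtr_ge0.
  have := conv Z k q _ DZ (divr_gt0 e0 w1); apply: filterS => m Hm.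
  have e1 : 0 <= e / (w + 1) by rewrite divr_ge0// ltW.
  apply: le_trans (nrm_bound B0 e1 (Cc_cont (Cd k Z m q DZ)) _ (fun y _ => Hm y)) _.
    move=> y yB; rewrite /d (sm_lo Q k q (sn Z m DZ)).2 ?(sm_lo Q k q (sf Z DZ)).2 ?subr0//;
      by have := ler_normD (y - qx k) (qx k); rewrite subrK; move: yB; rewrite /B; lra.
  by rewrite -/w mulrA ler_pdivrMr// mulrC ler_wpM2l ?(ltW e0)// lerDl.
have weak k Z q psi : D Z -> Cc psi -> (fun m => I (fun y => d k Z m q y * psi y)) @ U --> (0 : R).
  move=> DZ Cp; apply/cvgrPdist_le => e e0.
  have P1 : 0 < nrm psi + 1 by rewrite ltr_wpDl// nrm_ge0.
  have := nd k Z q _ DZ (divr_gt0 e0 P1); apply: filterS => m Hm; rewrite sub0r normrN.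
  apply: le_trans (cauchy_schwarz_I (Cd k Z m q DZ) Cp) _.
  apply: le_trans (ler_wpM2r (nrm_ge0 _) Hm) _.
  by rewrite mulrAC ler_pdivrMr// ler_wpM2l ?(ltW e0)// lerDl.
have loc k : exists w : Iu -> V -> R, [/\ forall q, smooth (w q), forall q, Cc (w q) &
    forall e, 0 < e -> \forall m \near U, \sum_q nrm (fun y => pla k 1 y * lo k (s m) q y - pla k 1 y * w q y) <= e].
  pose a (j : 'I_(p_m (Q k)) * Iu) := acf k (qL k j.1) j.2.
  pose B (j : 'I_(p_m (Q k)) * Iu) := bcf k (qL k j.1) j.2.
  have fE v j y : full a B v j y = full (acf k (qL k j.1)) (bcf k (qL k j.1)) v j.2 y by [].
  (* Radii in units of [qr k]: eta = [pla k 1] lives in 2, chi = [pla k 3] is 1 up to 3 and lives in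
     4, below the radius 5 of the a priori estimate. *)
  have eta5 := tin_pla k (isT : (2 < 5)%N).
  apply: (@local_limit R n (qx k) (5 * qr k) (p_lam (Q k)) Iu _ a B _ (p_lam01 (Q k)) (@p_apriori _ _ _ _ _ _ _ (Q k))
    (fun j q b => acf_smooth k j.2 q b (p_D j.1)) (fun j q => bcf_smooth k j.2 q (p_D j.1)) (pla k 1) (pla k 3)
    (2 * qr k) (3 * qr k) eta5 (pla01 Q k 1) (tin_pla k (isT : (4 < 5)%N))
    (rho_lt (p_r0 (Q k)) (isT : (2 < 3)%N)) (cutin_pla Q k 1).2 (fun y => @pla_in _ _ _ _ _ _ _ _ Q k 3 y) U UU
    (fun m => lo k (s m)) (fun j => lo k (f (qL k j.1)) j.2) (C * K)).
  - by rewrite mulr_gt0// p_r0.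
  - by move=> m q; case: (sm_lo Q k q (ss m)).
  - by move=> m q; exact: Clo.
  - by apply: filterS sK => m Hm q; apply: le_trans (HC _ (ss m) k q) _; exact: ler_wpM2l.
  - by move=> j; case: (sm_lo Q k j.2 (sf _ (p_D j.1))).
  - move=> j psi tp; have Cp := tin_Cc tp; have [r' r'5 Hr'] := tp.2.
    have := weak k _ j.2 psi (p_D j.1) Cp; have Cf := Clo k j.2 (sf _ (p_D j.1)).
    move=> /(cvgD (cvg_cst (I (fun y => lo k (f (qL k j.1)) j.2 y * psi y)))); rewrite addr0.
    apply: cvg_trans; rewrite (_ : (fun m => I _) = (cst (I (fun y => lo k (f (qL k j.1)) j.2 y * psi y)) : nat -> R) +
      (fun m => I (fun y => d k (qL k j.1) m j.2 y * psi y))) //.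
    apply/funext => m; rewrite fctE /= -I_add; [|exact: CcMr Cf (Cc_cont Cp)|exact: CcMr (Cd k _ m j.2 (p_D j.1)) (Cc_cont Cp)].
    congr I; apply/funext => y; have [yr|/Hr' ->] := leP `|y - qx k| r'; last by rewrite !mulr0 addr0.
    rewrite fE full_lo//; [|exact: p_D|exact: le_lt_trans r'5].
    by rewrite /d; ring.
  move=> j e e0; have := nd k _ j.2 _ (p_D j.1) e0; apply: filterS => m; apply: le_trans.
  have CD := Cd k _ m j.2 (p_D j.1).
  have E1 y : pla k 1 y * full a B (lo k (s m)) j y - pla k 1 y * lo k (f (qL k j.1)) j.2 y =
      pla k 1 y * d k (qL k j.1) m j.2 y.
    have [yr|/(cutin_pla Q k 1).2 ->] := leP `|y - qx k| (2 * qr k); last by rewrite !mul0r subr0.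
    rewrite fE full_lo//; [by rewrite /d mulrBr|exact: p_D|].
    by apply: le_lt_trans yr _; exact: (rho_lt (p_r0 (Q k)) (isT : (2 < 5)%N)).
  under eq_fun do rewrite E1.
  apply: nrm_le => //; first by apply: CcMl => //; exact: sm_cont (cutin_pla Q k 1).1.
  move=> y; rewrite normrM ler_piMl//; case/andP: (pla01 Q k 1 y) => p0 p1.
  by rewrite ger0_norm.
have /choice[w Hw] := loc.
pose fw k q y := pla k 1 y * w k q y.
have cw : core Q fw by move=> k q; apply: cutinMr; [exact: cutin_pla|case: (Hw k)].
pose sigma := gsec fw; have ssig : ssmooth sigma by exact: glue_smooth.
have close e : 0 < e -> \forall m \near U, Nrm (fun x => s m x - sigma x) <= e.
  move=> e0; have D0 : 0 < C1 * N%:R + 1 by rewrite ltr_wpDl// mulr_ge0.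
  have near1 : \forall m \near U, forall k, \sum_q nrm (fun y => pla k 1 y * lo k (s m) q y - pla k 1 y * w k q y) <= e / (C1 * N%:R + 1).
    by apply: filter_forall => k; case: (Hw k) => _ _; apply; exact: divr_gt0.
  apply: filterS near1 => m Hm.
  have -> : (fun x => s m x - sigma x) = gsec (fun k q y => pla k 1 y * lo k (s m) q y - fw k q y).
    by apply: section_ext => x; rewrite glue_sub glue_lo.
  have cd : core Q (fun k q y => pla k 1 y * lo k (s m) q y - fw k q y).
    move=> k q; have c1 := core_lo Q (ss m) k q; have c2 := cw k q; split; first exact: sm_sub c1.1 c2.1.
    by move=> y yr; rewrite (c1.2 y yr) (c2.2 y yr) subr0.
  apply: le_trans (HC1 _ cd) _.
  apply: le_trans (_ : C1 * (\sum_(k < N) e / (C1 * N%:R + 1)) <= _).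
    by apply: ler_wpM2l => //; apply: ler_sum => k _; exact: Hm.
  rewrite sumr_const card_ord -[X in C1 * X]mulr_natr.
  have -> : C1 * (e / (C1 * N%:R + 1) * N%:R) = e * (C1 * N%:R) / (C1 * N%:R + 1) by ring.
  by rewrite ler_pdivrMr// ler_wpM2l ?(ltW e0)// lerDl.
exists sigma; split => // Z DZ x.
have sns := cnab_smooth nabla (sZ Z DZ) ssig.
have [k [sx xr]] := cover x.
have test psi j : tin (qx k) (5 * qr k) psi ->
    I (fun y => (lo k (cnab nabla Z sigma) j y - lo k (f Z) j y) * psi y) = 0.
  move=> tp; have Cp := tin_Cc tp.
  have h1 := weak k Z j psi DZ Cp.
  have h2 := weak_null j DZ (fun m => ssm_sub (ss m) ssig) close tp.
  have h3 : (fun m => I (fun y => d k Z m j y * psi y) -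
      I (fun y => lo k (cnab nabla Z (fun x => s m x - sigma x)) j y * psi y)) @ U --> (0 : R).
    by rewrite -[X in _ --> X](subr0 (0 : R)); apply: cvgB.
  apply: (filter_cvg_unique _ _ h3).
  rewrite (_ : (fun m => _) = fun=> I (fun y => (lo k (cnab nabla Z sigma) j y - lo k (f Z) j y) * psi y));
    first exact: cvg_cst.
  apply/funext => m; have sm1 := cnab_smooth nabla (sZ Z DZ) (ssm_sub (ss m) ssig).
  rewrite -I_sub; [|exact: CcMr (Cd k Z m j DZ) (Cc_cont Cp)|exact: CcMr (Clo k j sm1) (Cc_cont Cp)].
  congr I; apply/funext => y; rewrite -mulrBl; congr (_ * _).
  have -> : cnab nabla Z (fun x => s m x - sigma x) = fun x => cnab nabla Z (s m) x - cnab nabla Z sigma x.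
    by apply: section_ext => z; exact: cnab_sub (sZ Z DZ) (ss m) ssig.
  by rewrite lo_sub /d; ring.
have xr5 : `|to (qc k) x - qx k| <= 5 * qr k.
  by apply: le_trans xr _; rewrite ler_peMl ?ler1n// ltW// p_r0.
have xr1 : `|to (qc k) x - qx k| <= 1%:R * qr k by rewrite mul1r.
have eqlo j : lo k (cnab nabla Z sigma) j (to (qc k) x) = lo k (f Z) j (to (qc k) x).
  pose G y := lo k (cnab nabla Z sigma) j y - lo k (f Z) j y.
  have sG : smooth G by apply: sm_sub; [exact: (sm_lo Q k j sns).1|exact: (sm_lo Q k j (sf Z DZ)).1].
  (* G is tested against a cut-off of itself, which gives a nonnegative integrand of integral 0. *)
  have tG : tin (qx k) (5 * qr k) (fun y => pla k 1 y * G y) by apply: tinMr => //; exact: tin_pla.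
  have CG : Cc (fun y => G y * (pla k 1 y * G y)) by apply: CcMl; [exact: sm_cont|exact: tin_Cc tG].
  have := I_eq0 CG _ (test _ j tG) (to (qc k) x).
  rewrite pla_in// mul1r => H; apply/eqP; rewrite -subr_eq0 -/(G _) -[_ == 0]orbb -mulf_eq0; apply/eqP; apply: H.
  move=> y; rewrite mulrCA mulr_ge0//; first by case/andP: (pla01 Q k 1 y).
  by rewrite -expr2 sqr_ge0.
have tx := kball_tdom (p_r0 (Q k)) (p_ball (Q k)) (isT : (5 <= 7)%N) (conj sx xr5).
have rc s' q := lo_rcoord s' q sx xr5.
apply: (triv_inj tx); apply/rowP => b; apply: complex_ext.
  by have := eqlo (true, b); rewrite !rc.
by have := eqlo (false, b); rewrite !rc.
Qed.

End UltraLimit.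

Lemma lo0 k q y : lo k (fun x => 0 : E x) q y = 0.
Proof.
have := lo_lin Q k (-1) (fun x => 0 : E x) (fun x => 0 : E x) q y; rewrite mulN1r addNr.
by under [fun x => _]section_ext do rewrite scaler0 addr0.
Qed.

Lemma lo_scale k (d : R) s q y : lo k (fun x => d%:C%C *: s x) q y = d * lo k s q y.
Proof.
have -> : (fun x => d%:C%C *: s x) = fun x => d%:C%C *: s x + 0.
  by apply: section_ext => x; rewrite addr0.
by rewrite lo_lin lo0 addr0.
Qed.

Lemma lo_sum k (T : Type) (l : seq T) (d : T -> R) (F : T -> section E) q y :
  lo k (fun x => \sum_(i <- l) (d i)%:C%C *: F i x) q y = \sum_(i <- l) d i * lo k (F i) q y.
Proof.
elim: l => [|i l IH].
  rewrite big_nil -[RHS](lo0 k q y); congr (lo k _ q y).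
  by apply: section_ext => x; rewrite big_nil.
rewrite big_cons -IH -lo_lin; congr (lo k _ q y).
by apply: section_ext => x; rewrite big_cons.
Qed.

Lemma Nrm_scale (d : R) s : ssmooth s -> Nrm (fun x => d%:C%C *: s x) = `|d| * Nrm s.
Proof.
move=> ss; rewrite /Nrm mulr_sumr; apply: eq_bigr => k _; rewrite mulr_sumr; apply: eq_bigr => q _.
rewrite -nrmZ; last exact: cutin_Cc (core_lo Q ss k q).
by congr nrm; apply/funext => y; rewrite lo_scale mulrCA.
Qed.

Lemma parallel0 : parallel (fun x => 0 : E x).
Proof.
split; first exact: ssm0.
move=> Z DZ x; have := cnab_lin nabla (-1) x (dist_smooth DZ) (@ssm0 _ _ _ _ _ E) (@ssm0 _ _ _ _ _ E).
rewrite scaleN1r addNr => e; rewrite -[RHS]e; congr (cnab nabla Z _ x).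
by apply: section_ext => z; rewrite scaler0 addr0.
Qed.

Lemma parallel_lin (d : R[i]) s s' : parallel s -> parallel s' -> parallel (fun x => d *: s x + s' x).
Proof.
move=> [ss Hs] [ss' Hs']; split; first by apply: ssm_add => //; exact: ssm_cst_scale.
by move=> Z DZ x; rewrite (cnab_lin nabla d x (dist_smooth DZ) ss ss') Hs// Hs'// scaler0 addr0.
Qed.

Lemma parallel_sum (T : Type) (l : seq T) (d : T -> R[i]) (F : T -> section E) : (forall i, parallel (F i)) ->
  parallel (fun x => \sum_(i <- l) d i *: F i x).
Proof.
move=> H; elim: l => [|i l IH].
  rewrite (_ : (fun x => _) = fun x => 0 : E x); first exact: parallel0.
  by apply: section_ext => x; rewrite big_nil.
rewrite (_ : (fun x => _) = fun x => d i *: F i x + \sum_(i <- l) d i *: F i x); first exact: parallel_lin.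
by apply: section_ext => x; rewrite big_cons.
Qed.

(** The functionals are the net values of [local_compactness] in all patches. If they vanish on a
    parallel section s, that estimate leaves Nrm s <= e W Nrm s, where W comes from [lo_le_Nrm], and
    e is chosen with e W <= 1/2. *)
Lemma separating : exists (T : finType) (K : T -> 'I_N) (q : T -> Iu) (psi : T -> V -> R), (forall p, Cc (psi p)) /\
  forall s, parallel s -> (forall p, I (fun y => psi p y * lo (K p) s (q p) y) = 0) -> forall x, s x = 0.
Proof.
have [C C0 HC] := lo_le_Nrm.
pose W := N%:R * (#|{: Iu}|%:R * C); have W0 : 0 <= W by rewrite !mulr_ge0.
pose e := (2 * (W + 1))^-1; have e0 : 0 < e by rewrite invr_gt0 mulr_gt0// ltr_wpDl.
have /choice[ts Hts] k : exists p : R * seq V, 0 < p.1 /\ exists C' : R, forall s, parallel s ->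
   \sum_q nrm (fun y => pla k 1 y * lo k s q y) <=
     e * (\sum_q nrm (lo k s q)) + C' * \sum_(x <- p.2) \sum_q `|I (fun y => mk p.1 (x - y) * pla k 1 y * lo k s q y)|.
  pose a (j : 'I_(p_m (Q k)) * Iu) := acf k (qL k j.1) j.2.
  pose B (j : 'I_(p_m (Q k)) * Iu) := bcf k (qL k j.1) j.2.
  have [t t0 [l [C' _ HC']]] := @local_compactness R n (qx k) (5 * qr k) (p_lam (Q k)) Iu _ a B
    (p_lam01 (Q k)) (@p_apriori _ _ _ _ _ _ _ (Q k))
    (fun j q b => acf_smooth k j.2 q b (p_D j.1)) (fun j q => bcf_smooth k j.2 q (p_D j.1)) (pla k 1)
    (tin_pla k (isT : (2 < 5)%N)) (pla01 Q k 1) e e0.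
  exists (t, l); split => //; exists C' => s [ss Hs].
  apply: le_trans (HC' (lo k s) (fun q => (sm_lo Q k q ss).1) (fun q => Clo k q ss)) _.
  rewrite [X in e * (_ + X)]big1 ?addr0// => j _.
  rewrite (_ : (fun y => _) = fun=> 0) ?nrm0//; apply/funext => y.
  have [yr|/(cutin_pla Q k 1).2 ->] := leP `|y - qx k| (2 * qr k); last by rewrite mul0r.
  have y5 : `|y - qx k| < 5 * qr k.
    by apply: le_lt_trans yr _; exact: (rho_lt (p_r0 (Q k)) (isT : (2 < 5)%N)).
  rewrite [full _ _ _ _ _](full_lo j.2 (p_D j.1) ss y5).
  have -> : cnab nabla (p_L j.1) s = fun x => 0 : E x.
    by apply: section_ext => x; apply: Hs; exact: p_D.
  by rewrite lo0 mulr0.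
exists ({k : 'I_N & 'I_(size (ts k).2)} * Iu)%type, (fun p => tag p.1), (fun p => p.2),
  (fun p y => mk (ts (tag p.1)).1 (nth 0 (ts (tag p.1)).2 (nat_of_ord (tagged p.1)) - y) * pla (tag p.1) 1 y); split.
  move=> [[k i] q] /=; apply: CcMl; last exact: cutin_Cc (cutin_pla Q k 1).
  apply: Cc_cont; apply: Cc_reflect; apply: Cc_mk; case: (Hts k) => t0 _; exact: t0.
move=> s ps H x; have ss := ps.1; apply: (Nrm_eq0) => //; apply: le_anti; rewrite Nrm_ge0 andbT.
have Nle : Nrm s <= e * W * Nrm s.
  rewrite {1}/Nrm; apply: le_trans (_ : \sum_(k < N) e * (#|{: Iu}|%:R * C * Nrm s) <= _); last first.
    rewrite sumr_const card_ord -[X in X <= _]mulr_natl /W.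
    by rewrite (_ : N%:R * _ = e * (N%:R * (#|{: Iu}|%:R * C)) * Nrm s)//; ring.
  apply: ler_sum => k _; have [_ [C' HC']] := Hts k; apply: le_trans (HC' s ps) _.
  rewrite [X in _ + C' * X]big1_seq ?mulr0 ?addr0.
    apply: ler_wpM2l; first exact: ltW.
    apply: le_trans (_ : \sum_(q : Iu) C * Nrm s <= _); first by apply: ler_sum => q _; exact: HC.
    by rewrite sumr_const -[X in X <= _]mulr_natl mulrA.
  move=> z /andP[_ zs]; apply: big1 => q _; apply/normr0P/eqP.
  have zi : (index z (ts k).2 < size (ts k).2)%N by rewrite index_mem.
  have := H (Tagged (fun k => 'I_(size (ts k).2)) (Ordinal zi), q).
  by rewrite /= nth_index.
have eW : e * W <= 2^-1.
  by rewrite /e mulrC ler_pdivrMr ?mulr_gt0 ?ltr_wpDl//; lra.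
have := Nrm_ge0 s; move: Nle eW; move: (e * W) (Nrm s) => u v; nra.
Qed.

Definition combination m (e : 'I_m -> section E) (u : 'rV[R]_m) : section E :=
  fun x => \sum_k (u 0 k)%:C%C *: e k x.

Lemma parallel_combination m (e : 'I_m -> section E) u : (forall k, parallel (e k)) -> parallel (combination e u).
Proof. exact: parallel_sum. Qed.

(** A maximal family of parallel sections with independent vectors of functionals spans, because the
    functionals separate. Composing them with the pseudo-inverse of the matrix of this family makes
    [co] linear and bounded on all smooth sections, not only on parallel ones, hence a
    projection. *)
Lemma parallel_coordinates : exists (m : nat) (e : 'I_m -> section E) (co : section E -> 'rV[R]_m),
  [/\ forall k, parallel (e k), forall s, parallel s -> s = combination e (co s),
    forall (d : R) s s', ssmooth s -> ssmooth s' ->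
      co (fun x => d%:C%C *: s x + s' x) = d *: co s + co s',
    forall u, co (combination e u) = u &
    exists2 C : R, 0 <= C & forall s i, ssmooth s -> `|co s 0 i| <= C * Nrm s].
Proof.
have [T [K [q [psi [Cpsi sep]]]]] := separating.
have [C C0 HC] := lo_le_Nrm.
pose ell s : 'rV[R]_#|T| := \row_i I (fun y => psi (enum_val i) y * lo (K (enum_val i)) s (q (enum_val i)) y).
have Cp p s : ssmooth s -> Cc (fun y => psi p y * lo (K p) s (q p) y).
  by move=> ss; apply: CcMr => //; exact: Cc_cont (Clo _ _ ss).
have ell_lin (d : R) s s' : ssmooth s -> ssmooth s' ->
    ell (fun x => d%:C%C *: s x + s' x) = d *: ell s + ell s'.
  move=> ss ss'; apply/rowP => i; rewrite !mxE -I_lin; [|exact: Cp|exact: Cp].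
  by congr I; apply/funext => y; rewrite lo_lin; ring.
have [m [e [Se fe He]]] := maximal_free_family parallel ell.
set G := \matrix_k ell (e k) in fe He.
have ell_comb u : ell (combination e u) = u *m G.
  apply/rowP => i; rewrite !mxE.
  under eq_fun do rewrite /combination lo_sum mulr_sumr.
  rewrite I_sum; last first.
    move=> k; under eq_fun do rewrite mulrCA; apply: CcZ; apply: Cp; exact: (Se k).1.
  apply: eq_bigr => k _; under eq_fun do rewrite mulrCA.
  by rewrite I_scal ?mxE//; apply: Cp; exact: (Se k).1.
pose co s := ell s *m pinvmx G; exists m, e, co.
have co_lin (d : R) s s' : ssmooth s -> ssmooth s' ->
    co (fun x => d%:C%C *: s x + s' x) = d *: co s + co s'.
  by move=> ss ss'; rewrite /co ell_lin// mulmxDl scalemxAl.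
split => //.
- move=> s ps; apply: section_ext => x; apply/eqP; rewrite -subr_eq0; apply/eqP.
  have pc := parallel_combination (co s) Se.
  have pd := parallel_lin (-1)%:C%C pc ps.
  have := sep _ pd _ x; rewrite rmorphN1 scaleN1r addrC; apply => p.
  have : ell (fun x => (-1)%:C%C *: combination e (co s) x + s x) = 0.
    rewrite ell_lin; [|exact: pc.1|exact: ps.1].
    by rewrite ell_comb /co mulmxKpV ?He// scaleN1r addNr.
  move=> /rowP/(_ (enum_rank p)); rewrite !mxE enum_rankK.
  by rewrite rmorphN1.
- by move=> u; rewrite /co ell_comb -mulmxA mulmxVp// mulmx1.
pose B := \sum_p nrm (psi p) * C; pose B' := \sum_i \sum_j `|pinvmx G j i|.
have B0 : 0 <= B by apply: sumr_ge0 => p _; rewrite mulr_ge0// nrm_ge0.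
have B'0 : 0 <= B' by apply: sumr_ge0 => i _; exact: sumr_ge0.
exists (B * B'); first exact: mulr_ge0.
move=> s i ss; have ellb j : `|ell s 0 j| <= B * Nrm s.
  rewrite mxE; apply: le_trans (cauchy_schwarz_I (Cpsi _) (Clo _ _ ss)) _.
  apply: le_trans (ler_wpM2l (nrm_ge0 _) (HC s ss _ _)) _.
  rewrite mulrA; apply: ler_wpM2r; first exact: Nrm_ge0.
  by rewrite /B (bigD1 (enum_val j))//= lerDl; apply: sumr_ge0 => p _; rewrite mulr_ge0// nrm_ge0.
rewrite mxE; apply: le_trans (ler_norm_sum _ _ _) _.
apply: le_trans (_ : \sum_j B * Nrm s * `|pinvmx G j i| <= _).
  by apply: ler_sum => j _; rewrite normrM; apply: ler_wpM2r.
rewrite -mulr_sumr mulrAC; apply: ler_wpM2r; first exact: Nrm_ge0.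
apply: ler_wpM2l => //; rewrite /B' (bigD1 i)//= lerDl.
by apply: sumr_ge0 => i' _; exact: sumr_ge0.
Qed.

Lemma uniform_lo (U : set_system nat) (FU : Filter U) (s : nat -> section E) (f : section E) k q (e : R) :
  (\oo `<=` U) -> uniform_cvg h s f -> 0 < e ->
  \forall m \near U, forall y, `|lo k (s m) q y - lo k f q y| <= e.
Proof.
move=> oU sf e0; have [C C0 HC] := hsq_lower h (p_r0 (Q k)) (p_ball (Q k)).
have C1 : 0 < Num.sqrt C + 1 by rewrite ltr_wpDl// sqrtr_ge0.
have [m0 Hm] := sf _ (divr_gt0 e0 C1).
have : U [set m | (m0 <= m)%N] by apply: oU; exists m0.
apply: filterS => m /= /Hm {}Hm y; rewrite -lo_sub.
have [yr|yr] := leP `|y - qx k| (6 * qr k); last first.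
  by rewrite lo_out// normr0 ltW.
set x := inv (qc k) y.
have Ty := @pball_le _ _ _ _ _ _ _ _ Q k 6 isT y yr.
have kx : kball (qi k) (qx k) (6 * qr k) x.
  by split; [exact: Defs.inv_src|rewrite Defs.invK].
have H := HC (fun x => s m x - f x) x kx.
have h0 := hsq_ge0 h (s m x - f x).
have : `|rcoord (p_tr (Q k)) (fun x => s m x - f x) q x| <= e.
  rewrite -(ler_pXn2r (isT : (0 < 2)%N)) ?nnegrE ?(ltW e0)// real_normK ?num_real//.
  apply: le_trans (le_trans _ H) _.
    by rewrite (bigD1 q)//= lerDl; apply: sumr_ge0 => q' _; exact: sqr_ge0.
  have := ltW (Hm x); rewrite ler_pdivlMr// => h1.
  rewrite -(sqr_sqrtr C0) -(sqr_sqrtr h0) -exprMn.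
  have S0 := sqrtr_ge0 C; have S1 := sqrtr_ge0 (hsq h (s m x - f x)).
  rewrite ler_pXn2r ?nnegrE ?mulr_ge0 ?(ltW e0)//; apply: le_trans h1.
  by rewrite mulrC -/(hsq h _); apply: ler_wpM2l => //; rewrite lerDl.
by apply: le_trans; exact: lo_le_rcoord.
Qed.

Lemma lo_bounded s : ssmooth s -> exists2 C : R, 0 <= C & forall k q y, `|lo k s q y| <= C.
Proof.
move=> ss; have /choice[C HC] (p : 'I_N * Iu) : exists C : R, 0 <= C /\ forall y, `|lo p.1 s p.2 y| <= C.
  by have [C C0 HC] := Cc_bounded (Clo p.1 p.2 ss); exists C.
exists (\sum_p C p); first by apply: sumr_ge0 => p _; case: (HC p).
move=> k q y; apply: le_trans ((HC (k, q)).2 y) _.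
by rewrite (bigD1 (k, q))//= lerDl; apply: sumr_ge0 => p _; case: (HC p).
Qed.

Theorem closed_range (s : nat -> section E) (f : cvf R n M -> section E) : (forall m, ssmooth (s m)) ->
  (forall Z, D Z -> ssmooth (f Z) /\ uniform_cvg h (fun m => cnab nabla Z (s m)) (f Z)) ->
  exists sigma, ssmooth sigma /\ forall Z, D Z -> forall x, cnab nabla Z sigma x = f Z x.
Proof.
move=> ss Hf; have [m [e [co [Pe coE co_lin coK [C C0 HC]]]]] := parallel_coordinates.
have [U [UU oU]] := ultraFilterLemma (_ : ProperFilter (\oo : set_system nat)).
pose t k : section E := fun x => (-1)%:C%C *: combination e (co (s k)) x + s k x.
have pc k := parallel_combination (co (s k)) Pe.
have st k : ssmooth (t k) by apply: ssm_add => //; apply: ssm_cst_scale; exact: (pc k).1.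
have cot k : co (t k) = 0 by rewrite co_lin ?coK ?scaleN1r ?addNr//; exact: (pc k).1.
have nt Z k : D Z -> cnab nabla Z (t k) = cnab nabla Z (s k).
  move=> DZ; apply: section_ext => x.
  by rewrite (cnab_lin nabla _ x (dist_smooth DZ) (pc k).1 (ss k)) (pc k).2// scaler0 add0r.
have sf Z : D Z -> ssmooth (f Z) by move=> /Hf[].
have conv Z k q eps : D Z -> 0 < eps -> \forall i \near U, forall y, `|lo k (cnab nabla Z (t i)) q y - lo k (f Z) q y| <= eps.
  move=> DZ e0; apply: filterS (uniform_lo _ k q oU (Hf Z DZ).2 e0) => i.
  by rewrite nt.
have [[K HK]|nK] := pselect (exists K, \forall i \near U, Nrm (t i) <= K).
  by have [sg [s1 s2 _]] := global_limit UU st HK sf conv; exists sg.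
have big K : \forall i \near U, K < Nrm (t i).
  have [h1|h1] := in_ultra_setVsetC [set i | Nrm (t i) <= K] UU; first by case: nK; exists K.
  by apply: filterS h1 => i /negP; rewrite -ltNge.
pose t' k : section E := fun x => ((Nrm (t k))^-1)%:C%C *: t k x.
have st' k : ssmooth (t' k) by exact: ssm_cst_scale.
have nt' Z k x : D Z -> cnab nabla Z (t' k) x = ((Nrm (t k))^-1)%:C%C *: cnab nabla Z (s k) x.
  move=> DZ; rewrite -(nt Z k DZ) -[RHS]addr0 -((parallel0).2 Z DZ x).
  rewrite -(cnab_lin nabla _ x (dist_smooth DZ) (st k) (@ssm0 _ _ _ _ _ E)); congr (cnab nabla Z _ x).
  by apply: section_ext => z; rewrite addr0.
have N1 : \forall i \near U, Nrm (t' i) = 1.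
  apply: filterS (big 0) => i Ni.
  by rewrite (Nrm_scale _ (st i)) gtr0_norm ?invr_gt0// mulVf// gt_eqF.
have N1' : \forall i \near U, Nrm (t' i) <= 1 by apply: filterS N1 => i ->.
(* The right-hand sides, eventually at most B + 1, are divided by norms that exceed every bound
   along U, so the normalised limit solves the homogeneous equation. *)
have conv' Z k q eps : D Z -> 0 < eps -> \forall i \near U, forall y,
    `|lo k (cnab nabla Z (t' i)) q y - lo k ((fun _ x => 0 : E x) Z) q y| <= eps.
  move=> DZ e0; have [B B0 HB] := lo_bounded (sf Z DZ).
  apply: filterS (filterI (big ((B + 1) / eps)) (conv Z k q 1 DZ ltr01)) => i [Ni Hi] y.
  have B1 : 0 < B + 1 by rewrite ltr_wpDl.
  have Ni0 : 0 < Nrm (t i) by apply: lt_trans Ni; exact: divr_gt0.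
  have -> : cnab nabla Z (t' i) = fun x => ((Nrm (t i))^-1)%:C%C *: cnab nabla Z (t i) x.
    by apply: section_ext => x; rewrite nt'// nt.
  rewrite lo_scale lo0 subr0 normrM gtr0_norm ?invr_gt0// mulrC ler_pdivrMr//.
  apply: le_trans (_ : B + 1 <= _); last by rewrite mulrC -ler_pdivrMr// ltW.
  have := HB k q y; have := Hi y; have := ler_normD (lo k (cnab nabla Z (t i)) q y - lo k (f Z) q y) (lo k (f Z) q y).
  by rewrite subrK; lra.
have [sg [s1 s2 s3]] := global_limit UU st' N1' (fun Z _ => @ssm0 _ _ _ _ _ E) conv'.
have psg : parallel sg by split.
have cot' k : co (t' k) = 0.
  have -> : t' k = fun x => ((Nrm (t k))^-1)%:C%C *: t k x + 0 by apply: section_ext => x; rewrite addr0.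
  rewrite co_lin//; last exact: ssm0.
  have -> : co (fun x => 0 : E x) = 0.
    rewrite -[RHS](coK 0); congr co; apply: section_ext => x.
    by rewrite /combination big1// => i _; rewrite mxE scale0r.
  by rewrite cot scaler0 addr0.
have cosg : co sg = 0.
  apply/rowP => i; rewrite mxE; apply/eqP; rewrite -normr_le0; apply/ler_addgt0Pr => eps e0; rewrite add0r.
  have C1 : 0 < C + 1 by rewrite ltr_wpDl.
  have [k Hk] := filter_ex (s3 _ (divr_gt0 e0 C1)).
  have sd : ssmooth (fun x => (-1)%:C%C *: sg x + t' k x) by apply: ssm_add => //; exact: ssm_cst_scale.
  have E1 : (fun x => (-1)%:C%C *: sg x + t' k x) = fun x => t' k x - sg x.
    by apply: section_ext => x; rewrite rmorphN1 scaleN1r addrC.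
  have := HC _ i sd; rewrite co_lin// cot' addr0 scaleN1r mxE normrN E1 => h1.
  apply: le_trans h1 _; apply: le_trans (ler_wpM2l C0 Hk) _.
  by rewrite mulrA ler_pdivrMr// mulrC ler_wpM2l ?(ltW e0)// lerDl.
have sg0 : sg = fun x => 0 : E x.
  rewrite (coE sg psg) cosg; apply: section_ext => x.
  by rewrite /combination big1// => i _; rewrite mxE scale0r.
have h2 : 0 < 2^-1 :> R by rewrite invr_gt0.
have [k [k1 k2]] := filter_ex (filterI N1 (s3 _ h2)).
move: k2; rewrite sg0; under [fun x => _]section_ext do rewrite subr0.
by rewrite k1; lra.
Qed.

End GlobalLimit.

Theorem corollary4p2 (R : realType) (n : nat) (M : topologicalType)
    (A : manifold R n M) (hM : compact [set: M])
    (g : riemannian_metric A) (P : partition_of_unity A)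
    (D : cvf_distribution A)
    (r : nat) (E : vbundle A r) (h : hermitian_metric E)
    (nabla : connection E)
    (hD : forall p : M, subelliptic_at g P D p) :
  finite_dimensional (parallel_sections nabla D) /\
  (forall (s : nat -> section E) (f : cvf R n M -> section E),
     (forall nu, section_smooth (s nu)) ->
     (forall Z, D Z -> section_smooth (f Z) /\
        uniform_cvg h (fun nu => cnab nabla Z (s nu)) (f Z)) ->
     exists sigma : section E, section_smooth sigma /\
       forall Z, D Z -> forall x, cnab nabla Z sigma x = f Z x).
Proof.
have /choice[F HF] x : exists Q : spatch D E, src (ch (p_ch Q)) x /\ to (ch (p_ch Q)) x = p_c Q.
  exact: patch_exists (hD x).
pose W x := src (ch (p_ch (F x))) `&` to (ch (p_ch (F x))) @^-1` ball (p_c (F x)) (p_r (F x)).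
have [l [_ Hl]] : exists l : seq M, (forall x, x \in l -> [set: M] x) /\ forall y, [set: M] y -> exists2 x, x \in l & W x y.
  apply: compact_seq_cover hM _ => x _; have [sx ex] := HF x; split; first by apply: open_src; exact: ball_open.
  by split => //=; rewrite ex; apply: ballxx; exact: p_r0.
pose Q (k : 'I_(size l)) := F (tnth (in_tuple l) k).
have cover y : exists k, src (ch (p_ch (Q k))) y /\ `|to (ch (p_ch (Q k))) y - p_c (Q k)| <= p_r (Q k).
  have [x xl [sy yr]] := Hl y Logic.I; have /tnthP[k xk] : x \in in_tuple l by [].
  exists k; rewrite /Q -xk; split => //.
  by move: yr; rewrite /= -ball_normE /= distrC => /ltW.
split; last by move=> s f ss Hf; exact: (closed_range hM cover ss Hf).
have [m [e [co [Pe coE _ _ _]]]] := parallel_coordinates hM h nabla cover.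
exists m, e; split => // s /coE sE; exists (fun k => (co s 0 k)%:C%C) => x.
by rewrite {1}sE.
Qed.
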